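(* Let $\gamma>0$, let $$X=\Big\{u:\mathbb{R}^2\to\mathbb{C}:\ \int_{\mathbb{R}^2}\big(|\nabla u|^2+|u|^2+\ln(1+|x|)\,|u|^2\big)\,dx<\infty\Big\},$$ $$E(u)=\int_{\mathbb{R}^2}|\nabla u|^2\,dx+\frac{\gamma}{4\pi}\int_{\mathbb{R}^2}\int_{\mathbb{R}^2}\ln(|x-y|)\,|u(x)|^2|u(y)|^2\,dx\,dy,\qquad N(u)=\int_{\mathbb{R}^2}|u|^2\,dx,$$ and $e_0(\lambda)=\inf\{E(u):u\in X,\ N(u)=\lambda\}$. Let $\lambda>0$ and let $u^*\in X$ be a spherically symmetric decreasing function with $N(u^* )=\lambda$ and $E(u^* )=e_0(\lambda)$. If $v\in X$ satisfies $N(v)=\lambda$ and $E(v)=e_0(\lambda)$, then there exist $\theta\in\mathbb{R}$ and $x_0\in\mathbb{R}^2$ such that $v(x)=e^{i\theta}u^*(x-x_0)$ for all $x\in\mathbb{R}^2$.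
   Context: $\gamma>0$ is a fixed coupling constant.
   Formalization: The identity v(x) = e^{iθ}u*(x − x0) is stated for almost every x instead of all x, since v may be altered on a null set without affecting any hypothesis; functions in X are taken Borel measurable with weak gradients. *)

(* Defs.v *)
From HB Require Import structures.
From mathcomp Require Import all_boot all_order all_algebra.
From mathcomp Require Import all_classical all_reals all_analysis.
From mathcomp Require Import complex.
Set Implicit Arguments. Unset Strict Implicit. Unset Printing Implicit Defensive.
Import Order.TTheory GRing.Theory Num.Theory.
Import numFieldNormedType.Exports.
Local Open Scope classical_set_scope.
Local Open Scope ring_scope.

Section Defs.
Variable R : realType.

Definition leb2 := ((@lebesgue_measure R) \x (@lebesgue_measure R))%E.

Definition eucl (x : R * R) : R := Num.sqrt (x.1 ^+ 2 + x.2 ^+ 2).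
Definition cabs2 (z : R[i]) : R := (complex.Re z) ^+ 2 + (complex.Im z) ^+ 2.
Definition e1 : R * R := (1, 0).
Definition e2 : R * R := (0, 1).

Fixpoint iterD (ds : seq (R * R)) (f : R * R -> R) : R * R -> R :=
  match ds with
  | [::] => f
  | d :: ds' => 'D_d (iterD ds' f)
  end.

Definition smooth (f : R * R -> R) : Prop :=
  forall (ds : seq (R * R)) (x : R * R), differentiable (iterD ds f) x.

Definition test_fun (phi : R * R -> R) : Prop :=
  smooth phi /\ exists r : R, forall x, r < eucl x -> phi x = 0.

Definition weak_partial (f g : R * R -> R) (d : R * R) : Prop :=
  measurable_fun setT g /\
  forall phi, test_fun phi ->
    (\int[leb2]_x (f x * 'D_d phi x)%:E = - \int[leb2]_x (g x * phi x)%:E)%E.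

(* int |grad u|^2 dx, where grad u is the weak gradient of u = Re u + i Im u
   (+oo if u has no weak gradient). Weak gradients are unique a.e., so
   the infimum is over a set of identical values. *)
Definition dirichlet (u : R * R -> R[i]) : \bar R :=
  ereal_inf [set z | exists g1 g2 h1 h2 : R * R -> R,
    [/\ weak_partial (fun x => complex.Re (u x)) g1 e1,
        weak_partial (fun x => complex.Re (u x)) g2 e2,
        weak_partial (fun x => complex.Im (u x)) h1 e1,
        weak_partial (fun x => complex.Im (u x)) h2 e2 &
        z = (\int[leb2]_x (g1 x ^+ 2 + g2 x ^+ 2 + h1 x ^+ 2 + h2 x ^+ 2)%:E)%E]].

Definition mass (u : R * R -> R[i]) : \bar R :=
  (\int[leb2]_x (cabs2 (u x))%:E)%E.

Definition inX (u : R * R -> R[i]) : Prop :=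
  [/\ measurable_fun setT (fun x => complex.Re (u x)),
      measurable_fun setT (fun x => complex.Im (u x)),
      (dirichlet u < +oo)%E,
      (mass u < +oo)%E &
      (\int[leb2]_x (ln (1 + eucl x) * cabs2 (u x))%:E < +oo)%E].

Definition energy (gamma : R) (u : R * R -> R[i]) : \bar R :=
  (dirichlet u +
   (gamma / (4 * pi))%:E *
     \int[leb2]_x \int[leb2]_y
        (ln (eucl (x - y)) * cabs2 (u x) * cabs2 (u y))%:E)%E.

Definition e0 (gamma lam : R) : \bar R :=
  ereal_inf [set energy gamma u | u in [set u | inX u /\ mass u = lam%:E]].

Definition sym_decreasing (f : R * R -> R) : Prop :=
  forall x y : R * R, eucl x <= eucl y -> f y <= f x.

End Defs.

(* Main.v *)
(* A weak derivative is controlled by difference quotients, so the Dirichlet energy of a real function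
   is the limit of the squared L2 norms of its difference quotients along the two axes, and Dirichlet
   energies can be compared quotient by quotient.

   Replacing v by |v| does not increase the energy, so |v| is a minimiser as well. Polarising |v| with
   respect to a line does not increase the energy either, and the logarithmic term decreases strictly
   unless |v| is ordered across the line. Applied to all lines through a point where two perpendicular mass-halving lines meet,
   and to their translates, this makes |v| radially decreasing up to a translation.

   For radial densities Newton's theorem replaces ln |x - y| by ln max(|x|, |y|), so the logarithmic
   term is a decreasing function of the disc masses m(r). Dilations give the virial identity: all
   minimisers have the same Dirichlet energy, hence the same logarithmic energy. Given two radial
   minimisers, dilate the second one by the least factor t >= 1 for which its disc masses dominate those
   of the first. If t = 1, equality of the logarithmic energies forces equal disc masses. If t > 1, either
   the supremum of the second is smaller by the factor t^2, or the disc masses touch at some radius r0;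
   exchanging the two profiles inside the disc of radius r0 then preserves the total logarithmic energy
   and does not increase the total Dirichlet energy, so the exchanged profiles are minimal too, which
   forces equal masses inside and contradicts the situation near the origin. Using this twice, with the
   roles exchanged, excludes the case of the suprema.

   Finally v and |v| have the same Dirichlet energy, so the difference quotients of the phase v / |v|
   are o(h), and the phase is constant on discs. *)

(* Taking the modulus, polarising and exchanging two profiles inside a disc act on values in a
   non-smooth way, and weak gradients of the results would require chain rules and traces.
   Difference quotients only require a pointwise inequality between the values at [x] and [x + c].
   They carry as much information as the gradient because a quadratic bound for some arbitrarily
   small shifts already produces a weak derivative by Riesz, and this gives back the bound for every
   shift; hence limit and supremum of the normalised quotients coincide.

   The uniqueness argument uses no Euler-Lagrange equation. The dilation [t ^ 2 v (t x)] has mass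
   [t ^ 2 lam], so it does not compete at mass [lam], but its energy and the lower bound at its own
   mass both follow exactly by scaling, and an exchange between profiles of different masses can
   still be compared with the minimum. Contact of the disc masses also provides a level that
   separates inner from outer values of both profiles; it makes the energy created by pasting
   negligible.

   Elements of the energy space are given up to null sets, hence the almost everywhere identities,
   including the final one. *)
Require Import Defs.
From HB Require Import structures.
From mathcomp Require Import all_boot all_order all_algebra.
From mathcomp Require Import all_classical all_reals all_analysis.
From mathcomp Require Import measurable_realfun complex ring lra.
Set Implicit Arguments. Unset Strict Implicit. Unset Printing Implicit Defensive.
Import Order.TTheory GRing.Theory Num.Theory.
Import numFieldNormedType.Exports.
Local Open Scope classical_set_scope.
Local Open Scope ring_scope.

(** * Measure preserving maps of the plane *)

HB.instance Definition _ (R : realType) := Measure.on (@leb2 R).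

Lemma leb2_sigma_finite (R : realType) : sigma_finite setT (@leb2 R).
Proof.
have /sigma_finiteP[F [TF ndF Foo]] := sigma_finiteT (@lebesgue_measure R).
exists (fun n => F n `*` F n).
  rewrite -setXTT TF predeqE => -[x y]; split.
    move=> [/= [n _ Fnx] [k _ Gky]]; exists (maxn n k) => //; split.
    - by move: x Fnx; exact/subsetPset/ndF/leq_maxl.
    - by move: y Gky; exact/subsetPset/ndF/leq_maxr.
  by move=> [n _ []/= ? ?]; split; exists n.
move=> k; have [? ?] := Foo k.
split; first exact: measurableX.
by rewrite /leb2 product_measure1E// lte_mul_pinfty// ge0_fin_numE.
Qed.

HB.instance Definition _ (R : realType) :=
  Measure_isSigmaFinite.Build _ _ _ (@leb2 R) (@leb2_sigma_finite R).

Lemma measurable_sqrtr (R : realType) :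
  measurable_fun [set: R] (@Num.sqrt R : R -> R).
Proof. by apply: continuous_measurable_fun; exact: sqrt_continuous. Qed.

Lemma measurable_funDp (R : realType) d (X : measurableType d)
    (f g : X -> measurableTypeR R * measurableTypeR R) :
  measurable_fun setT f -> measurable_fun setT g ->
  measurable_fun setT (fun x => (f x + g x)%R : measurableTypeR R * measurableTypeR R).
Proof.
move=> mf mg.
have h1 : measurable_fun setT (fun x => (f x).1 + (g x).1 : measurableTypeR R).
  by apply: measurable_funD; apply: (measurableT_comp measurable_fst).
have h2 : measurable_fun setT (fun x => (f x).2 + (g x).2 : measurableTypeR R).
  by apply: measurable_funD; apply: (measurableT_comp measurable_snd).
exact: measurable_fun_pair h1 h2.
Qed.

Lemma measurable_funNp (R : realType) d (X : measurableType d)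
    (f : X -> measurableTypeR R * measurableTypeR R) :
  measurable_fun setT f ->
  measurable_fun setT (fun x => (- f x)%R : measurableTypeR R * measurableTypeR R).
Proof.
move=> mf.
have h1 : measurable_fun setT (fun x => - (f x).1 : measurableTypeR R).
  by apply: measurable_funN; apply: (measurableT_comp measurable_fst).
have h2 : measurable_fun setT (fun x => - (f x).2 : measurableTypeR R).
  by apply: measurable_funN; apply: (measurableT_comp measurable_snd).
exact: measurable_fun_pair h1 h2.
Qed.

(** Measurability is derived from the syntax of the function. Leaves are closed by hypotheses
    [measurable_fun setT f] of the context, which is why such facts are put into the context before
    [mf] is called. *)
Ltac mfstep :=
  match goal with
  | |- measurable_fun _ (fun x => (_ + _)%E) => first [apply: emeasurable_funD | apply: measurable_funD | apply: measurable_funDp]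
  | |- measurable_fun _ (fun x => (_ * _)%E) => apply: emeasurable_funM
  | |- measurable_fun _ (fun x => (- _)%E) => apply: measurableT_comp (oppe_measurable _) _
  | |- measurable_fun _ (fun x => (`| _ |)%E) => apply: (measurableT_comp (@abse_measurable _ _))
  | |- measurable_fun _ (fun x => (_ %:E)%E) => apply/measurable_EFinP; rewrite /=
  | |- measurable_fun _ (EFin \o _) => apply/measurable_EFinP; rewrite /=
  | |- measurable_fun _ (fun x => x) => exact: measurable_id
  | |- measurable_fun _ fst => exact: measurable_fst
  | |- measurable_fun _ snd => exact: measurable_snd
  | |- measurable_fun _ (fun x => x.1) => exact: measurable_fst
  | |- measurable_fun _ (fun x => x.2) => exact: measurable_snd
  | |- measurable_fun _ (fun _ => ?c) => exact: measurable_cst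
  | H : measurable_fun setT ?f |- measurable_fun _ ?f => exact: H
  | |- measurable_fun _ (fun x => (_ , _)) => apply: measurable_fun_pair
  | |- measurable_fun _ (fun x => (@fst _ _ (_ x))) => apply: (measurableT_comp measurable_fst)
  | |- measurable_fun _ (fun x => (@snd _ _ (_ x))) => apply: (measurableT_comp measurable_snd)
  | |- measurable_fun _ (fun x => (_ - _)%R) => first [apply: measurable_funB | apply: measurable_funDp]
  | |- measurable_fun _ (fun x => (_ + _)%R) => first [apply: measurable_funD | apply: measurable_funDp | apply: emeasurable_funD]
  | |- measurable_fun _ (+%R ?c) => first [apply: (@measurable_funD _ _ _ _ (fun=> c) (fun x => x)) | apply: (@measurable_funDp _ _ _ (fun=> c) (fun x => x))]
  | |- measurable_fun _ ( *%R ?c) => apply: (@measurable_funM _ _ _ _ (fun=> c) (fun x => x))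
  | |- measurable_fun _ (fun x => (- _)%R) => first [apply: measurable_funN | apply: measurable_funNp]
  | |- measurable_fun _ (fun x => (_ * _)%R) => apply: measurable_funM
  | |- measurable_fun _ (fun x => (_ ^+ _)%R) => apply: measurable_funX
  | |- measurable_fun _ (fun x => Num.max _ _) => apply: measurable_maxr
  | |- measurable_fun _ (fun x => Num.min _ _) => apply: measurable_minr
  | |- measurable_fun _ (fun x => `| _ |%R) => apply: (measurableT_comp (@normr_measurable _ _))
  | |- measurable_fun _ (fun x => Num.sqrt _) => apply: (measurableT_comp (@measurable_sqrtr _))
  | |- measurable_fun _ (fun x => ln _) => apply: (measurableT_comp (@measurable_ln _))
  | |- measurable_fun _ (fun x => expR _) => apply: (measurableT_comp (@measurable_expR _))
  | |- measurable_fun _ (fun x => if _ then _ else _) => apply: measurable_fun_ifT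
  | |- measurable_fun _ (fun x => (_ < _)%R) => apply: measurable_fun_ltr
  | |- measurable_fun _ (fun x => (_ <= _)%R) => apply: measurable_fun_ler
  | |- measurable_fun _ (fun x => (_ && _)) => apply: measurable_and
  | |- measurable_fun _ (fun x => (_ || _)) => apply: measurable_or
  | |- measurable_fun _ (fun x => ~~ _) => apply: measurable_neg
  | |- measurable_fun _ (fun x => (\1_?A _)%R) => apply: measurableT_comp
  | |- measurable_fun _ (\1_?A) => apply: measurable_indic
  | H : measurable_fun setT ?f |- measurable_fun _ (fun x => ?f _) => apply: (measurableT_comp H)
  end.
Ltac mf := do ?mfstep; try done.

Section leb.
Variable R : realType.
Local Notation mu := (@lebesgue_measure R).
Local Notation L := (@leb2 R).
Local Notation R1 := (measurableTypeR R).
Local Notation T2 := (R1 * R1)%type.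
Implicit Types (F : T2 -> \bar R) (f : R1 -> \bar R).
Local Open Scope ereal_scope.

Lemma ge0_integral_pushforward_eq d1 (X : measurableType d1)
    (m : {measure set X -> \bar R}) (phi : X -> X) (F : X -> \bar R) :
  measurable_fun setT phi ->
  (forall A, measurable A -> pushforward m phi A = m A) ->
  measurable_fun setT F -> (forall x, 0 <= F x) ->
  \int[m]_x F (phi x) = \int[m]_x F x.
Proof.
move=> mphi H mF F0.
rewrite -[RHS](@eq_measure_integral _ _ _ _ m (pushforward m phi)); last first.
  by move=> A mA _; exact: H.
by rewrite (ge0_integral_pushforward mphi).
Qed.

Lemma lebesgue_measure_shift (c : R) (A : set R) : measurable A ->
  pushforward mu (fun x : R1 => (x + c)%R : R1) A = mu A.
Proof.
have mphi : measurable_fun setT (fun x : R1 => (x + c)%R : R1) by mf.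
move=> mA; apply/esym.
apply: (@lebesgue_measure_unique _ (measure_function_pushforward__canonical__measure_function_Measure mu mphi)) => //.
move=> _ [[a b]] _ <-; rewrite /= /pushforward.
have -> : (fun x : R => (x + c)%R) @^-1` `]a, b] = `](a - c)%R, (b - c)%R]%classic.
  apply/seteqP; split=> x /=; rewrite !in_itv/=; lra.
rewrite !lebesgue_measure_itv/= !lte_fin ltrD2r.
by case: ifP => // _; congr (_%:E); ring.
Qed.

Lemma integral_shift (c : R) f : measurable_fun setT f -> (forall x, 0 <= f x) ->
  \int[mu]_x f (x + c)%R = \int[mu]_x f x.
Proof.
move=> mF f0; apply: (ge0_integral_pushforward_eq (phi := fun x : R1 => (x + c)%R)) => //.
  by mf.
exact: lebesgue_measure_shift.
Qed.

Lemma integral_oppr f : measurable_fun setT f -> (forall x, 0 <= f x) ->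
  \int[mu]_x f (- x)%R = \int[mu]_x f x.
Proof.
move=> mF f0; apply: (ge0_integral_pushforward_eq (phi := fun x : R1 => (- x)%R)) => //.
  by mf.
exact: lebesgue_measureN.
Qed.

Lemma integral_scale (k : R) f : (0 < k)%R -> measurable_fun setT f -> (forall x, 0 <= f x) ->
  k%:E * \int[mu]_x f (k * x)%R = \int[mu]_x f x.
Proof.
move=> k0 mF f0.
have mphi : measurable_fun setT (fun x : R1 => (k * x)%R : R1) by mf.
pose m' := measure_function_pushforward__canonical__measure_function_Measure mu mphi.
(* The pushforward under [x |-> k x] shrinks lengths by the factor [k]; the compensated measure
   [m''] agrees with [mu] on half-open intervals, which determine it. *)
pose m'' := [the {measure set _ -> \bar R} of mscale (NngNum (ltW k0)) m'].
rewrite -[RHS](@eq_measure_integral _ _ _ _ mu m''); last first.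
  move=> A mA _; apply/esym; apply: lebesgue_measure_unique => //.
  move=> _ [[a b]] _ <-; rewrite /= /mscale /= /pushforward.
  have -> : (fun x : R => (k * x)%R) @^-1` `]a, b] = `](a / k)%R, (b / k)%R]%classic.
    apply/seteqP; split=> x /=; rewrite !in_itv/= => /andP[h1 h2]; apply/andP; split.
    - by rewrite ltr_pdivrMr// mulrC.
    - by rewrite ler_pdivlMr// mulrC.
    - by move: h1; rewrite ltr_pdivrMr// mulrC.
    - by move: h2; rewrite ler_pdivlMr// mulrC.
  rewrite !lebesgue_measure_itv/= !lte_fin ltr_pM2r ?invr_gt0//.
  case: ifP => ab; last by rewrite mule0.
  by rewrite -!EFinB -EFinM -mulrBl mulrCA mulfV ?mulr1// gt_eqF.
rewrite ge0_integral_mscale//=; congr (_ * _).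
by rewrite (ge0_integral_pushforward mphi).
Qed.

(* Maps preserving [leb2], stated on integrals rather than on sets. *)
Definition mpres (phi : T2 -> T2) := measurable_fun setT phi /\
  forall F, measurable_fun setT F -> (forall x, 0 <= F x) ->
    \int[L]_x F (phi x) = \int[L]_x F x.

Lemma mpres_comp phi psi : mpres phi -> mpres psi -> mpres (phi \o psi).
Proof.
move=> [mphi phiP] [mpsi psiP]; split; first exact: measurableT_comp.
move=> F mF F0; rewrite -(phiP F)// -(psiP (F \o phi))//.
  exact: measurableT_comp.
by move=> x; exact: F0.
Qed.

Lemma mpres_integral phi F : mpres phi -> measurable_fun setT F ->
  \int[L]_x F (phi x) = \int[L]_x F x.
Proof.
move=> [mphi phiP] mF.
have h1 : \int[L]_x (F^\+ (phi x)) = \int[L]_x (F^\+ x).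
  by apply: phiP => //; exact: measurable_funepos.
have h2 : \int[L]_x (F^\- (phi x)) = \int[L]_x (F^\- x).
  by apply: phiP => //; exact: measurable_funeneg.
have e1 : (fun x => F (phi x))^\+ = (fun x => F^\+ (phi x)).
  by rewrite -[RHS]/(F^\+ \o phi) -funepos_comp.
have e2 : (fun x => F (phi x))^\- = (fun x => F^\- (phi x)).
  by rewrite -[RHS]/(F^\- \o phi) -funeneg_comp.
by rewrite integralE e1 e2 h1 h2 -integralE.
Qed.

Lemma leb2_tonelli1 F : measurable_fun setT F -> (forall x, 0 <= F x) ->
  \int[L]_x F x = \int[mu]_x \int[mu]_y F (x, y).
Proof. by move=> mF F0; rewrite /leb2 fubini_tonelli1. Qed.

Lemma leb2_tonelli2 F : measurable_fun setT F -> (forall x, 0 <= F x) ->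
  \int[L]_x F x = \int[mu]_y \int[mu]_x F (x, y).
Proof. by move=> mF F0; rewrite /leb2 fubini_tonelli2. Qed.

Lemma mpres_swap : mpres (fun x : T2 => (x.2, x.1)).
Proof.
split; first by mf.
by move=> F mF F0; rewrite leb2_tonelli1 ?leb2_tonelli2//; mf.
Qed.

(** On each horizontal line the map is a translation, so Tonelli reduces the claim to the line.
    Conjugated with the swap of coordinates, shears generate the translations and rotations
    below. *)
Lemma mpres_shear (a : R1 -> R1) : measurable_fun setT a ->
  mpres (fun x : T2 => (x.1 + a x.2, x.2)%R).
Proof.
move=> ma; split; first by mf.
move=> F mF F0; rewrite [LHS]leb2_tonelli2; [|by mf|by []].
rewrite [RHS]leb2_tonelli2; [|exact: mF|exact: F0]; apply: eq_integral => y _ /=.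
by rewrite (@integral_shift (a y) (fun x => F (x, y)))//; mf.
Qed.

Lemma mpres_refl1 : mpres (fun x : T2 => (- x.1, x.2)%R).
Proof.
split; first by mf.
move=> F mF F0; rewrite [LHS]leb2_tonelli2; [|by mf|by []].
rewrite [RHS]leb2_tonelli2; [|exact: mF|exact: F0]; apply: eq_integral => y _ /=.
by rewrite (@integral_oppr (fun x => F (x, y)))//; mf.
Qed.

Lemma mpres_eq phi psi : mpres phi -> phi =1 psi -> mpres psi.
Proof. by move=> + /funext <-. Qed.

Lemma mpres_shift (c : T2) : mpres (fun x : T2 => (x + c)%R).
Proof.
have h1 := @mpres_shear (fun=> c.1) (measurable_cst _).
have h2 := mpres_comp mpres_swap (mpres_comp (@mpres_shear (fun=> c.2) (measurable_cst _)) mpres_swap).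
by apply: mpres_eq (mpres_comp h1 h2) _ => -[x y].
Qed.

Lemma mpres_refl2 : mpres (fun x : T2 => (x.1, - x.2)%R).
Proof. exact: mpres_eq (mpres_comp mpres_swap (mpres_comp mpres_refl1 mpres_swap)) _. Qed.

Lemma mpres_opp : mpres (fun x : T2 => (- x)%R).
Proof. by apply: mpres_eq (mpres_comp mpres_refl1 mpres_refl2) _ => -[]. Qed.

Definition plane_rot (c s : R) (x : T2) : T2 := (c * x.1 - s * x.2, s * x.1 + c * x.2)%R.

(** A rotation is a product of three shears, horizontal, vertical, horizontal, the outer ones with
    slope [- s / (1 + c)], that is, minus the tangent of the half angle. This breaks down only for
    the half turn [c = -1], which is [- id]. *)
Lemma mpres_rot (c s : R) : (c ^+ 2 + s ^+ 2 = 1)%R -> mpres (plane_rot c s).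
Proof.
move=> cs; have [c1|c1] := eqVneq c (-1)%R.
  have s0 : (s = 0)%R.
    by move: cs; rewrite c1 sqrrN expr1n => h; apply/eqP; rewrite -(sqrf_eq0 s) ; apply/eqP; lra.
  apply: mpres_eq mpres_opp _ => -[x y]; rewrite /plane_rot c1 s0/=.
  by congr pair; rewrite /=; ring.
pose a : R := (- s / (1 + c))%R.
have c10 : (1 + c != 0)%R by apply: contra c1 => /eqP h; apply/eqP; lra.
have ml (k : R) : measurable_fun setT (fun x : R1 => (k * x)%R : R1) by mf.
have h1 := mpres_shear (ml a).
have h2 := mpres_comp mpres_swap (mpres_comp (mpres_shear (ml s)) mpres_swap).
apply: mpres_eq (mpres_comp h1 (mpres_comp h2 h1)) _ => -[x y]; rewrite /plane_rot/=.
have e : (s * a = c - 1)%R.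
  by rewrite /a mulrA mulrN -expr2 (_ : s ^+ 2 = 1 - c ^+ 2)%R; [field|lra].
have e2 : (a * (1 + c) = - s)%R by rewrite /a; field.
congr pair; last first.
  by rewrite mulrDr mulrA e; ring.
have -> : (s * y = - (a * (1 + c)) * y)%R by rewrite e2 opprK.
transitivity (x + a * y + a * y + (s * a) * (x + a * y))%R; first ring.
by rewrite e; ring.
Qed.

Lemma leb2_scale (k : R) F : (0 < k)%R -> measurable_fun setT F -> (forall x, 0 <= F x) ->
  (k ^+ 2)%:E * \int[L]_x F (k * x.1, k * x.2)%R = \int[L]_x F x.
Proof.
move=> k0 mF F0; rewrite !leb2_tonelli1//; last by mf.
have mG : measurable_fun setT (fun x : R1 => \int[mu]_y F (x, y)).
  exact: (measurable_fun_fubini_tonelli_F F).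
have mH : measurable_fun setT (fun x : R1 => \int[mu]_y F (k * x, k * y)%R).
  by apply: (measurable_fun_fubini_tonelli_F (fun x : T2 => F (k * x.1, k * x.2)%R)) => //; mf.
rewrite -[RHS](integral_scale k0 mG); last by move=> x; exact: integral_ge0.
rewrite expr2 EFinM -muleA; congr (_ * _).
rewrite -ge0_integralZl_EFin//; [|by move=> x _; exact: integral_ge0|exact: ltW].
apply: eq_integral => x _.
by rewrite (@integral_scale k (fun y => F (k * x, y)%R))//; mf.
Qed.

(* Fubini after the shear [(x, t) |-> (x, x + t)]. *)
Lemma ae_pair (P : T2 -> T2 -> bool) : measurable_fun setT (fun z : T2 * T2 => P z.1 z.2) ->
  (forall t, {ae L, forall x, P x (x + t)%R}) ->
  {ae L, forall x, {ae L, forall y, P x y}}.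
Proof.
move=> mP H.
pose N := fun x y => (~~ P x y)%:R%:E : \bar R.
have N0 x y : 0 <= N x y by rewrite lee_fin.
have mN : measurable_fun setT (fun z : T2 * T2 => N z.1 z.2).
  rewrite (_ : (fun z => _) = (fun z : T2 * T2 => (if P z.1 z.2 then 0 else 1)%R%:E)); last first.
    by apply/funext => z; rewrite /N; case: (P _ _).
  by mf.
have aeP (Q : T2 -> bool) : measurable_fun setT Q ->
    {ae L, forall x, Q x} <-> \int[L]_x (~~ Q x)%:R%:E = 0.
  move=> mQ.
  have mq : measurable_fun setT (fun x => (~~ Q x)%:R%:E : \bar R).
    rewrite (_ : (fun x => _) = (fun x => (if Q x then 0 else 1)%R%:E)); last first.
      by apply/funext => z; case: (Q _).
    by mf.
  have := ae_eq_integral_abs L measurableT mq.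
  rewrite (eq_integral (fun x => (~~ Q x)%:R%:E)); last by move=> x _; rewrite gee0_abs.
  move=> ->; split; apply: filterS => x.
    by move=> -> _.
  by move=> /(_ I)/= []; case: (Q x) => //= /eqP; rewrite oner_eq0.
have mS x : measurable_fun setT (P x).
  exact: (measurableT_comp mP (measurable_fun_pair (measurable_cst x) (@measurable_id _ _ _))).
have mPt t : measurable_fun setT (fun x => P x (x + t)%R).
  apply: (measurableT_comp mP (g := fun x : T2 => (x, (x + t)%R : T2))).
  apply: measurable_fun_pair; first exact: measurable_id.
  exact: (mpres_shift t).1.
have z : \int[L]_x \int[L]_y N x y = 0.
  have e x : \int[L]_y N x y = \int[L]_t N x (x + t)%R.
    rewrite -(mpres_integral (mpres_shift x)); last first.
      exact: (measurableT_comp mN (measurable_fun_pair (measurable_cst x) (@measurable_id _ _ _))).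
    by apply: eq_integral => t _; rewrite addrC.
  rewrite (eq_integral (fun x => \int[L]_t N x (x + t)%R)) //.
  rewrite (@fubini_tonelli _ _ _ _ R L L (fun z => N z.1 (z.1 + z.2)%R))//; last first.
    apply: (measurableT_comp mN (g := fun z : T2 * T2 => (z.1, (z.1 + z.2)%R : T2))).
    apply: measurable_fun_pair; first exact: measurable_fst.
    by apply: measurable_funDp.
  by apply: integral0_eq => t _; exact: (iffLR (aeP _ (mPt t)) (H t)).
have mI : measurable_fun setT (fun x => \int[L]_y N x y).
  exact: (measurable_fun_fubini_tonelli_F (fun z => N z.1 z.2)).
have := ae_eq_integral_abs L measurableT mI.
rewrite (eq_integral (fun x => \int[L]_y N x y)); last first.
  by move=> x _; rewrite gee0_abs//; exact: integral_ge0.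
move=> /iffLR/(_ z); apply: filterS => x /(_ I) h.
exact: (iffRL (aeP _ (mS x)) h).
Qed.

End leb.

(** * Square integrable functions *)

Section L2.
Context d (T : measurableType d) (R : realType) (mu : {measure set T -> \bar R}).
Implicit Types f g h : T -> R.

Definition N2 f : \bar R := (\int[mu]_x (f x ^+ 2)%:E)%E.
Definition L2 f := measurable_fun setT f /\ (N2 f < +oo)%E.
(** [fine] hides an infinite integral, so this is an inner product only for arguments in [L2], where
    [ip_fin] identifies it with the integral. *)
Definition ip f g : R := fine (\int[mu]_x (f x * g x)%:E)%E.

Lemma N2_ge0 f : (0 <= N2 f)%E.
Proof. by apply: integral_ge0 => x _; rewrite lee_fin sqr_ge0. Qed.

Lemma le_N2 f g : measurable_fun setT f -> measurable_fun setT g ->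
  (forall x, f x ^+ 2 <= g x ^+ 2) -> (N2 f <= N2 g)%E.
Proof.
move=> mf mg fg; apply: ge0_le_integral => //.
- by move=> x _; rewrite lee_fin sqr_ge0.
- by mf.
- by mf.
- by move=> x _; rewrite lee_fin.
Qed.

Lemma L2_sqr_int f : L2 f -> mu.-integrable setT (fun x => (f x ^+ 2)%:E).
Proof.
move=> [mf lf]; apply/integrableP; split; first by mf.
rewrite (eq_integral (fun x => (f x ^+ 2)%:E)) // => x _.
by rewrite gee0_abs// lee_fin sqr_ge0.
Qed.

Lemma L2_mul f g : L2 f -> L2 g -> mu.-integrable setT (fun x => (f x * g x)%:E).
Proof.
move=> Lf Lg; have [mf lf] := Lf; have [mg lg] := Lg.
apply: (@le_integrable _ _ _ _ _ measurableT _ (fun x => (f x ^+ 2)%:E + (g x ^+ 2)%:E)%E).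
- by mf.
- move=> x _; rewrite -EFinD !abse_EFin lee_fin [leRHS]ger0_norm ?addr_ge0 ?sqr_ge0//.
  by rewrite ler_norml; apply/andP; split; nra.
- by apply: integrableD => //; exact: L2_sqr_int.
Qed.

Lemma ip_fin f g : L2 f -> L2 g -> (\int[mu]_x (f x * g x)%:E)%E = (ip f g)%:E.
Proof.
by move=> Lf Lg; rewrite fineK//; apply: integrable_fin_num => //; exact: L2_mul.
Qed.

Lemma N2_ip f : L2 f -> N2 f = (ip f f)%:E.
Proof. by move=> Lf; rewrite -ip_fin//; apply: eq_integral => x _; rewrite expr2. Qed.

Lemma ip_ge0 f : 0 <= ip f f.
Proof.
apply: fine_ge0; apply: integral_ge0 => x _; by rewrite lee_fin -expr2 sqr_ge0.
Qed.

Lemma ipC f g : ip f g = ip g f.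
Proof. by rewrite /ip; congr fine; apply: eq_integral => x _; rewrite mulrC. Qed.

Lemma L2Z k f : L2 f -> L2 (fun x => k * f x).
Proof.
move=> Lf; have [mf lf] := Lf; split; first by mf.
rewrite /N2 (eq_integral (fun x => (k ^+ 2)%:E * (f x ^+ 2)%:E)%E); last first.
  by move=> x _; rewrite -EFinM exprMn.
rewrite ge0_integralZl_EFin//; [|by move=> x _; rewrite lee_fin sqr_ge0|by mf|exact: sqr_ge0].
by rewrite lte_mul_pinfty ?lee_fin ?sqr_ge0.
Qed.

Lemma N2_le_add f g h : measurable_fun setT f -> measurable_fun setT g -> measurable_fun setT h ->
  (forall x, f x ^+ 2 <= g x ^+ 2 + h x ^+ 2) -> (N2 f <= N2 g + N2 h)%E.
Proof.
move=> mf mg mh fgh; rewrite -ge0_integralD//.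
- apply: ge0_le_integral => //.
  + by move=> x _; rewrite lee_fin sqr_ge0.
  + by mf.
  + by mf.
  + by move=> x _; rewrite -EFinD lee_fin.
- by move=> x _; rewrite lee_fin sqr_ge0.
- by mf.
- by move=> x _; rewrite lee_fin sqr_ge0.
- by mf.
Qed.

Lemma L2D f g : L2 f -> L2 g -> L2 (fun x => f x + g x).
Proof.
move=> Lf Lg; have [mf lf] := Lf; have [mg lg] := Lg; split; first by mf.
apply: (@le_lt_trans _ _ (N2 (fun x => 2 * f x)%R + N2 (fun x => 2 * g x)%R)%E).
  by apply: N2_le_add; [mf..|move=> x; nra].
by apply: lte_add_pinfty; [exact: (L2Z 2 Lf).2|exact: (L2Z 2 Lg).2].
Qed.

Lemma L2N f : L2 f -> L2 (fun x => - f x).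
Proof. by move=> Lf; rewrite (_ : (fun x => _) = (fun x => -1 * f x)); [exact: L2Z|apply/funext => x; rewrite mulN1r]. Qed.

Lemma L2B f g : L2 f -> L2 g -> L2 (fun x => f x - g x).
Proof. by move=> Lf Lg; apply: L2D => //; exact: L2N. Qed.

Lemma L2_le f g : measurable_fun setT f -> L2 g -> (forall x, f x ^+ 2 <= g x ^+ 2) -> L2 f.
Proof. by move=> mf [mg lg] h; split => //; apply: le_lt_trans lg; exact: le_N2. Qed.

Lemma ipZl k f g : L2 f -> L2 g -> ip (fun x => k * f x) g = k * ip f g.
Proof.
move=> Lf Lg; apply: EFin_inj; rewrite EFinM -!ip_fin//; last exact: L2Z.
rewrite -integralZl//; last exact: L2_mul.
by apply: eq_integral => x _; rewrite -EFinM mulrA.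
Qed.

Lemma ipDl f g h : L2 f -> L2 g -> L2 h -> ip (fun x => f x + g x) h = ip f h + ip g h.
Proof.
move=> Lf Lg Lh; apply: EFin_inj; rewrite EFinD -!ip_fin//; last exact: L2D.
rewrite -integralD//; [|exact: L2_mul..].
by apply: eq_integral => x _; rewrite -EFinD mulrDl.
Qed.

Lemma ipBl f g h : L2 f -> L2 g -> L2 h -> ip (fun x => f x - g x) h = ip f h - ip g h.
Proof.
move=> Lf Lg Lh; rewrite ipDl//; last exact: L2N.
congr (_ + _); rewrite -mulN1r -ipZl//; congr (ip _ _).
by apply/funext => x; rewrite mulN1r.
Qed.

Lemma ipDr f g h : L2 f -> L2 g -> L2 h -> ip h (fun x => f x + g x) = ip h f + ip h g.
Proof. by move=> *; rewrite ipC ipDl// ipC (ipC g). Qed.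
Lemma ipBr f g h : L2 f -> L2 g -> L2 h -> ip h (fun x => f x - g x) = ip h f - ip h g.
Proof. by move=> *; rewrite ipC ipBl// ipC (ipC g). Qed.
Lemma ipZr k f g : L2 f -> L2 g -> ip g (fun x => k * f x) = k * ip g f.
Proof. by move=> *; rewrite ipC ipZl// ipC. Qed.

Lemma ip_sqrD f g : L2 f -> L2 g ->
  ip (fun x => f x + g x) (fun x => f x + g x) = ip f f + 2 * ip f g + ip g g.
Proof.
move=> Lf Lg; have Ls := L2D Lf Lg.
by rewrite (ipDl Lf Lg Ls) (ipDr Lf Lg Lf) (ipDr Lf Lg Lg) (ipC g f); ring.
Qed.

Lemma ip_sqrB f g : L2 f -> L2 g ->
  ip (fun x => f x - g x) (fun x => f x - g x) = ip f f - 2 * ip f g + ip g g.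
Proof.
move=> Lf Lg; have Ls := L2B Lf Lg.
by rewrite (ipBl Lf Lg Ls) (ipBr Lf Lg Lf) (ipBr Lf Lg Lg) (ipC g f); ring.
Qed.

(** The quadratic polynomial [q t], the squared norm of [f + t g], is nonnegative; it is evaluated
    at its minimiser. If [ip g g = 0] it is affine in [t], and a nonzero slope would make it
    negative somewhere. *)
Lemma ip_CS f g : L2 f -> L2 g -> ip f g ^+ 2 <= ip f f * ip g g.
Proof.
move=> Lf Lg.
have q t : 0 <= ip f f + 2 * t * ip f g + t ^+ 2 * ip g g.
  have := ip_ge0 (fun x => f x + t * g x).
  have Ltg : L2 (fun x => t * g x) by exact: L2Z.
  rewrite ipDl// ?ipDr// ?ipZl// ?ipZr//; last exact: L2D.
  by rewrite (ipC g f); lra.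
have [g0|g0] := eqVneq (ip g g) 0.
  have := q (- (ip f f + 1) / 2 * ip f g); rewrite g0 mulr0 addr0.
  have := ip_ge0 f; set a := ip f f; set b := ip f g => a0 h.
  rewrite mulr0; have [->|b0] := eqVneq b 0; first by rewrite expr0n.
  have {}q2 := q (- (a + 1) / (2 * b)); move: q2; rewrite g0 -/a -/b mulr0 addr0.
  by rewrite (_ : 2 * _ * b = - (a + 1)); [lra|field].
have gp : 0 < ip g g by rewrite lt_neqAle eq_sym g0 ip_ge0.
have := q (- ip f g / ip g g).
rewrite (_ : _ + _ + _ = ip f f - ip f g ^+ 2 / ip g g); last by field.
by rewrite subr_ge0 ler_pdivrMr.
Qed.

End L2.

Lemma le0_geometric (R : realType) (x K : R) : (forall n, x <= K * 8^-1 ^+ n) -> x <= 0.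
Proof.
move=> h.
have c : (fun n => K * 8^-1 ^+ n : R) @ \oo --> (K * 0 : R).
  apply: cvgMr; apply: cvg_expr; rewrite ger0_norm; lra.
rewrite -[leRHS](mulr0 K) -(cvg_lim _ c)//.
by apply: limr_ge; [exact: cvgP c|apply: nearW => n; exact: h].
Qed.

(** * Completeness and the Riesz representation theorem *)

Section completeness.
Context d (T : measurableType d) (R : realType) (mu : {measure set T -> \bar R}).
Implicit Types f g h : T -> R.

(** The rate [8 ^ - n] leaves room for a weight: multiplied by [4 ^ k], the squared increments still
    have summable integrals. So at almost every point the increments are dominated by a geometric
    series of ratio 1/2, the sequence converges there, and Fatou transfers the distance bounds to
    the limit. *)
Lemma L2_complete (u : nat -> T -> R) : (forall n, L2 mu (u n)) ->
  (forall n m, (n <= m)%N ->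
     ip mu (fun x => u m x - u n x) (fun x => u m x - u n x) <= 8^-1 ^+ n / 2) ->
  exists2 f, L2 mu f & forall n, (N2 mu (fun x => f x - u n x)%R <= (8^-1 ^+ n / 2)%:E)%E.
Proof.
move=> Lu uC.
have mu_ n : measurable_fun setT (u n) := (Lu n).1.
pose D k x : R := u k.+1 x - u k x.
have LD k : L2 mu (D k) by exact: L2B.
have mD k : measurable_fun setT (D k) := (LD k).1.
(* Finiteness of [G x] gives [|D k x| <= sqrt (G x) / 2 ^ k] for all [k]. *)
pose G x := (\sum_(k <oo) (4 ^+ k * D k x ^+ 2)%:E)%E.
have G0 x : (0 <= G x)%E by apply: nneseries_ge0 => n _ _; rewrite lee_fin mulr_ge0 ?sqr_ge0 ?exprn_ge0.
have mG : measurable_fun setT G.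
  apply: ge0_emeasurable_sum => [k x _ _|k _]; last by mf.
  by rewrite lee_fin mulr_ge0 ?sqr_ge0 ?exprn_ge0.
have iG : (\int[mu]_x G x <= 1)%E.
  rewrite integral_nneseries//; last 2 first.
  - by move=> n; mf.
  - by move=> n x _; rewrite lee_fin mulr_ge0 ?sqr_ge0 ?exprn_ge0.
  apply: le_trans (epsilon_trick0 xpredT (ler01 : 0 <= 1 :> R)).
  apply: lee_nneseries => [k _ _|k _].
    by apply: integral_ge0 => x _; rewrite lee_fin mulr_ge0 ?sqr_ge0 ?exprn_ge0.
  rewrite (eq_integral (fun x => (4 ^+ k)%:E * (D k x ^+ 2)%:E)%E); last by move=> x _; rewrite -EFinM.
  rewrite ge0_integralZl_EFin//; [|by move=> x _; rewrite lee_fin sqr_ge0|by have hm := mD k; mf].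
  have -> : (\int[mu]_x (D k x ^+ 2)%:E)%E = N2 mu (D k) by [].
  rewrite N2_ip// -EFinM lee_fin.
  apply: (@le_trans _ _ (4 ^+ k * (8^-1 ^+ k / 2))).
    by rewrite ler_wpM2l ?exprn_ge0//; apply: uC.
  rewrite mulrA -exprMn (_ : 4 * 8^-1 = 2^-1 :> R); last by field.
  by rewrite exprVn -invfM -exprSr div1r natrX.
have Gfin : {ae mu, forall x, G x \is a fin_num}.
  have : mu.-integrable setT G.
    apply/integrableP; split => //.
    rewrite (eq_integral G) => [|x _]; last by rewrite gee0_abs.
    by apply: le_lt_trans iG _; rewrite ltry.
  by move=> /(integrable_ae measurableT); apply: filterS => x; apply.
(* An upper limit is measurable whether or not the sequence converges at the point; it equals the
   limit wherever the latter exists. *)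
pose f x := fine (limn_esup (fun n => (u n x)%:E)).
have mfe : measurable_fun setT f.
  apply: measurableT_comp; first exact: fine_measurable.
  by apply: measurable_fun_limn_esup => n; mf.
have ucvg : {ae mu, forall x, u ^~ x @ \oo --> f x}.
  apply: filterS Gfin => x Gx.
  have c : cvgn (u ^~ x).
    have -> : u ^~ x = (fun n => u 0%N x + series (telescope (u ^~ x)) n).
      by apply/funext => n; rewrite -eq_sum_telescope.
    apply: is_cvgD; first exact: is_cvg_cst.
    apply: normed_cvg.
    pose C := Num.sqrt (fine (G x)).
    apply: (@series_le_cvg _ _ (geometric C 2^-1)).
    - by move=> n; exact: normr_ge0.
    - by move=> n; rewrite /geometric/= mulr_ge0 ?sqrtr_ge0 ?exprn_ge0.
    - move=> n; rewrite /geometric/= -[leLHS]ger0_norm ?normr_ge0//.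
      have C0 : 0 <= C * 2^-1 ^+ n by rewrite mulr_ge0 ?sqrtr_ge0 ?exprn_ge0.
      rewrite normr_id -(ler_pXn2r (ltn0Sn 1)) ?nnegrE ?normr_ge0//.
      have h : 4 ^+ n * D n x ^+ 2 <= fine (G x).
        rewrite -lee_fin fineK// /G.
        apply: le_trans (nneseries_lim_ge (m := 0) n.+1 _); last first.
          by move=> k _ _; rewrite lee_fin mulr_ge0 ?sqr_ge0 ?exprn_ge0.
        rewrite big_nat_recr//= leeDr// sume_ge0// => k _.
        by rewrite lee_fin mulr_ge0 ?sqr_ge0 ?exprn_ge0.
      rewrite exprMn sqr_sqrtr ?fine_ge0//.
      rewrite -[leLHS](_ : D n x ^+ 2 = _); last by rewrite /D /telescope/= real_normK ?num_real.
      rewrite -exprM mulnC exprM exprVn (_ : 2 ^+ 2 = 4 :> R); last by rewrite expr2; ring.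
      by rewrite exprVn ler_pdivlMr ?exprn_gt0// mulrC.
    - by apply: is_cvg_geometric_series; rewrite ger0_norm; lra.
  have /cvg_ex[l ul] := c.
  rewrite /f.
  have ul' : (fun n => (u n x)%:E) @ \oo --> l%:E by apply: cvg_EFin => //; exact: nearW.
  by have [_ ->] := cvg_limn_einf_sup ul'.
(* Fatou in [m] for the functions [(u m - u n) ^ 2]; the indices [maxn k n] ensure that only
   [m >= n] enters the Cauchy bound. *)
have bound n : (N2 mu (fun x => f x - u n x)%R <= (8^-1 ^+ n / 2)%:E)%E.
  have mh m : measurable_fun setT (fun x => ((u m x - u n x) ^+ 2)%:E).
    by have h1 := mu_ m; have h2 := mu_ n; mf.
  have h2 := mu_ n.
  apply: (@le_trans _ _ (\int[mu]_x limn_einf (fun m => ((u m x - u n x) ^+ 2)%:E))%E).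
    rewrite le_eqVlt; apply/orP; left; apply/eqP; apply: ae_eq_integral => //.
    - by mf.
    - rewrite /limn_einf; apply: (measurableT_comp (f := -%E)) => //.
      apply: (measurable_fun_limn_esup (f := fun m x => - ((u m x - u n x) ^+ 2)%:E)%E) => m.
      exact: (measurableT_comp (f := -%E)).
    - apply: filterS ucvg => x ux _.
      have c : (fun m => ((u m x - u n x) ^+ 2)%:E) @ \oo --> ((f x - u n x) ^+ 2)%:E.
        apply: cvg_EFin; first exact: nearW.
        have cd : (fun m => u m x - u n x) @ \oo --> f x - u n x by apply: cvgB => //; exact: cvg_cst.
        by apply: cvgM.
      by have [-> _] := cvg_limn_einf_sup c.
  apply: le_trans (fatou mu measurableT mh _) _.
    by move=> m x _; rewrite lee_fin sqr_ge0.
  rewrite limn_einf_lim.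
  apply: lime_le; first exact: is_cvg_einfs.
  apply: nearW => k; apply: ereal_inf_le.
  exists (\int[mu]_x ((u (maxn k n) x - u n x) ^+ 2)%:E)%E.
    by exists (maxn k n) => //=; exact: leq_maxl.
  have -> : (\int[mu]_x ((u (maxn k n) x - u n x) ^+ 2)%:E)%E = N2 mu (fun x => u (maxn k n) x - u n x) by [].
  by rewrite N2_ip; [rewrite lee_fin; apply: uC; exact: leq_maxr|exact: L2B].
exists f => //; split => //.
have h0 := mu_ 0%N.
have L' : L2 mu (fun x => f x - u 0%N x).
  by split; [mf|apply: le_lt_trans (bound 0%N) _; rewrite ltry].
have := (L2D L' (Lu 0%N)).2.
by rewrite (_ : (fun x => _) = f)//; apply/funext => x; rewrite subrK.
Qed.

(** [V] is a linear subspace that need not be closed; it will be the space of test functions. The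
    representing [g] is the limit of a minimising sequence in [V] of the functional
    [|f| ^ 2 / 2 - l f], and it may lie outside [V]. *)
Lemma L2_riesz (V : (T -> R) -> Prop) (l : (T -> R) -> R) (M : R) :
  V (fun=> 0) ->
  (forall f, V f -> L2 mu f) ->
  (forall f g, V f -> V g -> V (fun x => f x + g x)) ->
  (forall k f, V f -> V (fun x => k * f x)) ->
  (forall f g, V f -> V g -> l (fun x => f x + g x) = l f + l g) ->
  (forall k f, V f -> l (fun x => k * f x) = k * l f) ->
  0 <= M ->
  (forall f, V f -> l f ^+ 2 <= M * ip mu f f) ->
  exists g, [/\ L2 mu g, (N2 mu g <= M%:E)%E & forall f, V f -> ip mu g f = l f].
Proof.
move=> V0 VL VD VZ lD lZ M0 lM.
pose J f := ip mu f f / 2 - l f.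
(* With [p] the squared norm of [f], this is [l f <= sqrt (M p) <= (p + M) / 2], written without the
   root. *)
have Jge f : V f -> - (M / 2) <= J f.
  move=> Vf; have := lM _ Vf; have := ip_ge0 mu f; rewrite /J.
  set p := ip mu f f; set q := l f => p0 qM.
  suff : q <= (p + M) / 2 by lra.
  have [q0|q0] := leP q 0; first lra.
  rewrite leNgt; apply/negP => h.
  have h2 : 0 < (q - (p + M) / 2) * (q + (p + M) / 2) by apply: mulr_gt0; lra.
  have := sqr_ge0 ((p - M) / 2); nra.
pose S := [set J f | f in V].
have Si : has_inf S.
  by split; [exists (J (fun=> 0)), (fun=> 0)|exists (- (M / 2)) => _ [f Vf <-]; exact: Jge].
pose J0 := inf S.
have J0le f : V f -> J0 <= J f by move=> Vf; apply: ge_inf; [exact: Si.2|exists f].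
have J0ge : - (M / 2) <= J0.
  by apply: lb_le_inf; [exact: Si.1|move=> _ [f Vf <-]; exact: Jge].
have /choice[phi phiP] : forall n : nat, exists f, V f /\ J f < J0 + 8^-1 ^+ n / 16.
  move=> n; have e0 : 0 < (8^-1 : R) ^+ n / 16 by rewrite divr_gt0 ?exprn_gt0.
  by have [_ [f Vf <-] h] := inf_adherent e0 Si; exists f.
have Vphi n : V (phi n) := (phiP n).1.
have Lphi n : L2 mu (phi n) := VL _ (Vphi n).
have C8 n m : (n <= m)%N -> (8^-1 : R) ^+ m <= 8^-1 ^+ n.
  by move=> nm; apply: ler_wiXn2l => //; lra.
have [g Lg gP] : exists2 g, L2 mu g &
    forall n, (N2 mu (fun x => g x - phi n x)%R <= (8^-1 ^+ n / 2)%:E)%E.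
  apply: L2_complete => // n m nm.
  have h1 := (phiP n).2; have h2 := (phiP m).2; have h3 := C8 _ _ nm.
  (* Parallelogram identity: the midpoint of two near-minimisers does not lie below [J0], so their
     squared distance is at most four times the sum of their excesses. This fixes the constant 16 in
     the choice of [phi]. *)
  have Vs : V (fun x => phi m x + phi n x) by exact: VD.
  have h4 := J0le _ (VZ 2^-1 _ Vs); move: h4 h1 h2.
  rewrite /J lZ// lD// ipZl ?ipZr//; [|exact: VL..|by apply: L2Z; exact: VL].
  rewrite (ip_sqrD (Lphi m) (Lphi n)) (ip_sqrB (Lphi m) (Lphi n)); lra.
have gphi n : ip mu (fun x => g x - phi n x) (fun x => g x - phi n x) <= 8^-1 ^+ n / 2.
  by rewrite -lee_fin -N2_ip//; exact: L2B.
have key f : V f -> ip mu g f = l f.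
  move=> Vf; have Lf := VL _ Vf.
  pose a := ip mu f f; pose b := ip mu g f - l f.
  have a0 : 0 <= a := ip_ge0 mu f.
  suff : b ^+ 2 <= 0.
    by move=> b0; apply/eqP; rewrite -subr_eq0 -sqrf_eq0 eq_le b0 sqr_ge0.
  apply: (@le0_geometric _ _ (5 * a + 2)) => n.
  pose c := ip mu (phi n) f - l f.
  pose e : R := 8^-1 ^+ n; have e0 : 0 < e by rewrite /e exprn_gt0.
  (* First variation: moving from [phi n] in the direction [f] lowers [J] by at most the excess of
     [phi n]. Optimising in [t] makes [c] of order the root of [e]. *)
  have cq t : - (e / 16) <= t ^+ 2 / 2 * a + t * c.
    have Vt : V (fun x => phi n x + t * f x) by apply: VD => //; exact: VZ.
    have h1 := (phiP n).2; have := J0le _ Vt; move: h1.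
    have Ltf : L2 mu (fun x => t * f x) by exact: L2Z.
    rewrite /J lD// ?lZ//; last exact: VZ.
    rewrite (ip_sqrD (Lphi n) Ltf) (ipZr _ Lf (Lphi n)) (ipZl _ Lf Ltf) (ipZr _ Lf Lf).
    by rewrite /c /a -/e; lra.
  have c2 : c ^+ 2 <= (2 * a + 1) * e.
    have [a1|a1] := eqVneq a 0.
      have [->|c0] := eqVneq c 0; first by rewrite expr0n/= mulr_ge0 ?ltW//; lra.
      have := cq (- e / c); rewrite a1 mulr0 add0r divfK//; lra.
    have ap : 0 < a by rewrite lt_neqAle eq_sym a1.
    have := cq (- c / a).
    rewrite (_ : _ + _ = - (c ^+ 2 / (2 * a))); last by field.
    rewrite lerN2 ler_pdivrMr ?mulr_gt0//; nra.
  have bc : (b - c) ^+ 2 <= a * (e / 2).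
    rewrite (_ : b - c = ip mu (fun x => g x - phi n x) f); last by rewrite ipBl// /b /c; ring.
    apply: le_trans (ip_CS _ Lf) _; first exact: L2B.
    by rewrite mulrC ler_wpM2l// /e.
  have : b ^+ 2 <= 2 * c ^+ 2 + 2 * (b - c) ^+ 2 by have := sqr_ge0 (b - 2 * c); nra.
  rewrite -/e (_ : (5 * a + 2) * e = 2 * ((2 * a + 1) * e) + 2 * (a * (e / 2))); last by field.
  by lra.
exists g; split => //.
(* By [key], the squared distance of [g] to [phi n] is the squared norm of [g] plus [2 * J (phi n)],
   and [J] is bounded below by [- M / 2]. *)
rewrite N2_ip// lee_fin -subr_le0; apply: (@le0_geometric _ _ 2^-1) => n.
have := J0le _ (Vphi n); have := gphi n; have := key _ (Vphi n).
rewrite /J (ip_sqrB Lg (Lphi n)) mulrC => ->; lra.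
Qed.

End completeness.

(** * Test functions and weak derivatives *)

Section density.
Context d (T : measurableType d) (R : realType) (mu : {measure set T -> \bar R}).
Variables (f : T -> \bar R) (mf : measurable_fun setT f) (f0 : forall x, (0 <= f x)%E).
Local Open Scope ereal_scope.

Definition densm (A : set T) : \bar R := \int[mu]_(x in A) f x.

Let densm0 : densm set0 = 0.
Proof. exact: integral_set0. Qed.

Let densm_ge0 A : 0 <= densm A.
Proof. exact: integral_ge0. Qed.

Let densm_sigma_additive : semi_sigma_additive densm.
Proof.
move=> F mF tF mUF; rewrite /densm ge0_integral_bigcup//; last exact: measurable_funTS.
by apply: is_cvg_nneseries => n _ _; exact: integral_ge0.
Qed.

HB.instance Definition _ := isMeasure.Build _ _ _ densm densm0 densm_ge0 densm_sigma_additive.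

Definition dens_measure : {measure set T -> \bar R} := [the measure _ _ of densm].

End density.

Lemma measurable_bool d (T : measurableType d) (b : T -> bool) :
  measurable_fun setT b -> measurable [set x | b x].
Proof. by move=> mb; rewrite -[X in measurable X]setTI; exact: (mb measurableT [set true]). Qed.

(** * Functions whose integrals over rectangles vanish *)

Section fundamental.
Variable R : realType.
Local Notation mu := (@lebesgue_measure R).
Local Notation L := (@leb2 R).
Local Notation R1 := (measurableTypeR R).
Local Notation T2 := (R1 * R1)%type.

(** Half-open rectangles are stable under intersection and generate the product sigma-algebra, so a
    sigma-finite measure is determined by them. *)
Definition rects : set (set T2) := [set A `*` B | A in @ocitv R & B in @ocitv R].

Lemma rects_itv p q r s : rects (`]p, q]%classic `*` `]r, s]%classic).
Proof.
by exists `]p, q]%classic; [exact: is_ocitv|exists `]r, s]%classic; [exact: is_ocitv|]].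
Qed.

Lemma measurable_rects : @measurable _ T2 = <<s rects >>.
Proof.
have bigU : setT = \bigcup_n `]- n%:R, n%:R]%classic :> set R.
  apply/seteqP; split => // x _.
  exists (Num.truncn `|x|).+1 => //=; rewrite in_itv/=.
  have h := Num.Theory.truncnS_gt `|x|.
  by have := ler_norm x; have := ler_norm (- x); rewrite normrN; lra.
apply/seteqP; split; last first.
  apply: smallest_sub; first exact: sigma_algebra_measurable.
  move=> _ [A [a _ <-] [B [b _ <-] <-]]; exact: measurableX.
rewrite measurable_prod_measurableType; apply: smallest_sub; first exact: smallest_sigma_algebra.
move=> _ [A mA [B mB <-]].
pose S := g_sigma_algebraType rects.
have mfst : measurable_fun setT (fst : S -> R1).
  apply: (@measurability _ _ S R1 setT _ (@ocitv R)) => // _ [_ [a _ <-] <-].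
  rewrite setTI.
  rewrite (_ : _ @^-1` _ = \bigcup_n (`]a.1, a.2]%classic `*` `]- n%:R, n%:R]%classic)); last first.
    by rewrite -setX_bigcupr -bigU; apply/seteqP; split => [x ?|x []].
  apply: bigcup_measurable => n _; apply: sub_sigma_algebra; exact: rects_itv.
have msnd : measurable_fun setT (snd : S -> R1).
  apply: (@measurability _ _ S R1 setT _ (@ocitv R)) => // _ [_ [a _ <-] <-].
  rewrite setTI.
  rewrite (_ : _ @^-1` _ = \bigcup_n (`]- n%:R, n%:R]%classic `*` `]a.1, a.2]%classic)); last first.
    by rewrite -setX_bigcupl -bigU; apply/seteqP; split => [x ?|x []].
  apply: bigcup_measurable => n _; apply: sub_sigma_algebra; exact: rects_itv.
have -> : A `*` B = (setT `&` fst @^-1` A) `&` (setT `&` snd @^-1` B) by rewrite !setTI.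
apply: (@measurableI _ S); [exact: mfst|exact: msnd].
Qed.

(** The positive and the negative part of [F], taken as densities, define two measures that agree on
    rectangles, hence everywhere. On the set where [F] is positive the second one vanishes, so the
    first does too; likewise where [F] is negative. *)
Lemma ae0_rects (F : T2 -> R) : measurable_fun setT F ->
  (forall p q r s, p < q -> r < s ->
    L.-integrable (`]p, q]%classic `*` `]r, s]%classic) (EFin \o F) /\
    (\int[L]_(x in `]p, q]%classic `*` `]r, s]%classic) (F x)%:E = 0)%E) ->
  {ae L, forall x, F x = 0}.
Proof.
move=> mF H; pose f := EFin \o F.
have mf : measurable_fun setT f by rewrite /f; mf.
have mfp : measurable_fun setT (f^\+)%E by exact: measurable_funepos.
have mfn : measurable_fun setT (f^\-)%E by exact: measurable_funeneg.
have fp0 x : (0 <= f^\+ x)%E by [].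
have fn0 x : (0 <= f^\- x)%E by [].
pose m1 := dens_measure L mfp fp0; pose m2 := dens_measure L mfn fn0.
have HR A : rects A -> (\int[L]_(x in A) f^\+ x < +oo)%E /\
   (\int[L]_(x in A) f^\+ x = \int[L]_(x in A) f^\- x)%E.
  move=> [_ [[p q] _ <-] [_ [[r s] _ <-] <-]]/=.
  have [pq|pq] := ltP p q; last first.
    have -> : `]p, q]%classic = set0 :> set R by rewrite set_itv_ge ?bnd_simp -?leNgt.
    by rewrite set0X !integral_set0.
  have [rs|rs] := ltP r s; last first.
    have -> : `]r, s]%classic = set0 :> set R by rewrite set_itv_ge ?bnd_simp -?leNgt.
    by rewrite setX0 !integral_set0.
  have [h1 h2] := H _ _ _ _ pq rs.
  have mD : measurable (`]p, q]%classic `*` `]r, s]%classic : set T2) by exact: measurableX.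
  split; first exact: (integral_funepos_lt_pinfty mD h1).
  move: h2; rewrite integralE => /eqP; rewrite sube_eq ?add0e; first by move/eqP.
    exact: (integrable_pos_fin_num mD h1).
  by rewrite fin_num_adde_defl//; exact: (integrable_neg_fin_num mD h1).
have bigU : \bigcup_n (`]- n%:R, n%:R]%classic `*` `]- n%:R, n%:R]%classic) = setT :> set T2.
  apply/seteqP; split => // x _.
  exists (Num.truncn (`|x.1| + `|x.2|)).+1 => //=; rewrite !in_itv/=.
  have h := Num.Theory.truncnS_gt (`|x.1| + `|x.2|).
  have := ler_norm x.1; have := ler_norm (- x.1); have := ler_norm x.2; have := ler_norm (- x.2).
  by rewrite !normrN => *; split; lra.
have E A : measurable A -> m1 A = m2 A.
  apply: (@measure_unique _ R T2 rects (fun n => `]- n%:R, n%:R]%classic `*` `]- n%:R, n%:R]%classic)).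
  - exact: measurable_rects.
  - move=> _ _ [A1 a1 [B1 b1 <-]] [A2 a2 [B2 b2 <-]].
    by rewrite -setXI; exists (A1 `&` A2); [exact: ocitvI|exists (B1 `&` B2) => //; exact: ocitvI].
  - by move=> n; exact: rects_itv.
  - exact: bigU.
  - by move=> B /HR[].
  - by move=> n; apply: (HR _ _).1; exact: rects_itv.
pose P := [set x | 0 < F x]; pose Q := [set x | F x < 0].
have mP : measurable P.
  by apply: measurable_bool; mf.
have mN : measurable Q.
  by apply: measurable_bool; mf.
have z1 : (\int[L]_(x in P) f^\+ x = 0)%E.
  rewrite -[LHS]/(m1 _) E// /m2 /= /densm; apply: integral0_eq => x /= Fx.
  by rewrite funenegE /f/=; apply/max_idPr; rewrite lee_fin oppr_le0 ltW.
have z2 : (\int[L]_(x in Q) f^\- x = 0)%E.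
  rewrite -[LHS]/(m2 _) -E// /m1 /= /densm; apply: integral0_eq => x /= Fx.
  by rewrite funeposE /f/=; apply/max_idPr; rewrite lee_fin ltW.
have a1 : {ae L, forall x, 0 < F x -> F x = 0}.
  have : (\int[L]_(x in P) `|f x| = 0)%E.
    rewrite -[RHS]z1; apply: eq_integral => x; rewrite inE/= => Fx.
    by rewrite funeposE /f/= ger0_norm ?ltW//; apply/esym/max_idPl; rewrite lee_fin ltW.
  move=> /(ae_eq_integral_abs L mP (measurable_funTS mf)).
  by apply: filterS => x /= h Fx; have [] := h Fx.
have a2 : {ae L, forall x, F x < 0 -> F x = 0}.
  have : (\int[L]_(x in Q) `|f x| = 0)%E.
    rewrite -[RHS]z2; apply: eq_integral => x; rewrite inE/= => Fx.
    by rewrite funenegE /f/= ltr0_norm//; apply/esym/max_idPl; rewrite lee_fin oppr_ge0 ltW.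
  move=> /(ae_eq_integral_abs L mN (measurable_funTS mf)).
  by apply: filterS => x /= h Fx; have [] := h Fx.
apply: filterS2 a1 a2 => x h1 h2.
by have [/h2|/h1|] := ltgtP (F x) 0.
Qed.

End fundamental.

(** * Smooth bump functions *)

Section bump.
Variable R : realType.
Implicit Types a b f g : R -> R.

(** The powers of [1 / x] make the family closed under differentiation up to linear combinations, so
    that smoothness of [exp (- 1 / x)] at 0 becomes a statement about first derivatives only. *)
Definition ebump (k : nat) (x : R) : R := if x <= 0 then 0 else x^-1 ^+ k * expR (- x^-1).

Lemma ebump_ge0 k x : 0 <= ebump k x.
Proof. by rewrite /ebump; case: (leP x 0) => // x0; rewrite mulr_ge0 ?expR_ge0// exprn_ge0// invr_ge0 ltW. Qed.

Lemma ebump0_le1 x : ebump 0 x <= 1.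
Proof.
rewrite /ebump; case: (leP x 0) => // x0; rewrite expr0 mul1r -expR0 ler_expR.
by rewrite oppr_le0 invr_ge0 ltW.
Qed.

(** From [(y / n) ^ n <= exp y] with [y = 1 / x] and [n = k + 2]; the two surplus powers of [x]
    force the function and its slope to vanish at 0. *)
Lemma ebump_le k x : ebump k x <= (k.+2%:R ^+ k.+2) * x ^+ 2.
Proof.
rewrite /ebump; case: (leP x 0) => x0; first by apply: mulr_ge0; [exact: exprn_ge0|exact: sqr_ge0].
have h : (x^-1 / k.+2%:R) ^+ k.+2 <= expR x^-1.
  rewrite -{2}(@divfK _ k.+2%:R _ x^-1) ?pnatr_eq0// expRM_natr.
  apply: lerXn2r; rewrite ?nnegrE ?expR_ge0//; first by rewrite divr_ge0// invr_ge0 ltW.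
  by apply: le_trans (expR_ge1Dx _); rewrite lerDr.
have y0 : 0 < x^-1 by rewrite invr_gt0.
rewrite expRN ler_pdivrMr ?expR_gt0//.
apply: le_trans (ler_wpM2l _ h); last by apply: mulr_ge0; [exact: exprn_ge0|exact: sqr_ge0].
rewrite exprMn [X in _ * X]mulrC mulrACA -exprMn mulfV ?pnatr_eq0// expr1n mul1r.
by rewrite -(addn2 k) exprD mulrCA -exprMn mulfV ?gt_eqF// expr1n mulr1.
Qed.

Lemma is_derive_ebump k (x : R) :
  is_derive x 1 (ebump k) (ebump k.+2 x - k%:R * ebump k.+1 x).
Proof.
have [x0|x0|->] := ltgtP x 0.
- rewrite {2 3}/ebump (ltW x0) mulr0 subr0.
  apply: (near_eq_is_derive (f := cst 0)).
  near=> y; have y0 : y < 0 by near: y; exact: lt_nbhsl.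
  by rewrite /cst /ebump (ltW y0).
- apply: (near_eq_is_derive (f := (fun y : R => y^-1 ^+ k * expR (- y^-1)) : R -> R)).
    near=> y; have y0 : 0 < y by near: y; exact: lt_nbhsr.
    by rewrite /ebump leNgt y0.
  have xN : x != 0 by rewrite gt_eqF.
  have dI : is_derive x 1 (fun y : R => y^-1) (- x ^- 2).
    have := @is_deriveV R id x 1 1 xN (is_derive_id _ _).
    by rewrite [_ *: _]mulr1.
  have dE : is_derive x 1 (fun y : R => expR (- y^-1)) (expR (- x^-1) * x ^- 2).
    have h1 : is_derive (- x^-1) 1 expR (expR (- x^-1)) by exact: is_derive_expR.
    have := @is_derive1_comp R expR (fun y => - y^-1) x _ _ h1 (is_deriveN dI).
    by rewrite opprK.
  have dX : is_derive x 1 (fun y : R => y^-1 ^+ k) (k%:R * x^-1 ^+ k.-1 * (- x ^- 2)).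
    have := @is_deriveX _ _ (fun y : R => y^-1) k x 1 _ dI.
    rewrite (_ : (fun y : R => y^-1 ^+ k) = (fun y : R => y^-1) ^+ k)//.
    by apply/funext => y; rewrite exprfctE.
  apply: (@is_derive_eq _ _ _ _ _ _ _ _ (is_deriveM dX dE)).
  rewrite /ebump leNgt x0/=.
  have -> : x ^- 2 = x^-1 ^+ 2 by rewrite exprVn.
  rewrite -![_ *: _]/(_ * _).
  case: k {dX} => [|k] /=.
    by rewrite !mul0r mulr0 addr0 subr0 expr0 !mul1r mulrC.
  by rewrite !exprS; ring.
- have e0 j : ebump j 0 = 0 by rewrite /ebump lexx.
  rewrite !e0 mulr0 subr0.
  (* The slope at 0 is [ebump k z / z], of size at most [C |z|] by [ebump_le]; the default
     [0^-1 = 0] gives it the right value 0 at [z = 0]. *)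
  apply/is_derive1_caratheodory; exists (fun z => ebump k z / z); split.
  + move=> z; rewrite e0 !subr0; have [->|z0] := eqVneq z 0; first by rewrite e0 mulr0.
    by rewrite divfK.
  + rewrite /prop_for /continuous_at invr0 mulr0.
    pose C : R := k.+2%:R ^+ k.+2.
    have C0 : 0 < C by rewrite /C exprn_gt0.
    have q (z : R) : `|ebump k z / z| <= C * `|z|.
      rewrite normrM ger0_norm ?ebump_ge0//.
      have [->|z0] := eqVneq z 0; first by rewrite e0 mul0r normr0 mulr0.
      rewrite normfV ler_pdivrMr ?normr_gt0// -mulrA -normrM -expr2 ger0_norm ?sqr_ge0//.
      exact: ebump_le.
    apply/cvgr0Pnorm_le => e ep; apply/nbhs_ballP; exists (e / C); first exact: divr_gt0.
    move=> z /=; rewrite /ball/= sub0r normrN ltr_pdivlMr// mulrC => hz.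
    by apply: (le_trans (q z)); exact: ltW.
  + by rewrite invr0 mulr0.
Unshelve. all: by end_near. Qed.

(** A class of functions closed under differentiation by construction: infinitely many derivatives
    are obtained from one induction, without formulas for them. The clause [sm_prim] admits
    antiderivatives, which are required when bumps are averaged over segments. *)
Inductive sm : (R -> R) -> Prop :=
| sm_ebump k : sm (ebump k)
| sm_add f g : sm f -> sm g -> sm (fun x => f x + g x)
| sm_mul f g : sm f -> sm g -> sm (fun x => f x * g x)
| sm_scale k f : sm f -> sm (fun x => k * f x)
| sm_aff c d f : sm f -> sm (fun x => f (c * x + d))
| sm_prim a f : sm a -> (forall x : R, is_derive x 1 f (a x)) -> sm f.

Lemma sm_derive f : sm f -> exists2 g, sm g & forall x : R, is_derive x 1 f (g x).
Proof.
elim=> {f} [k|f g sf [f' sf' df] sg [g' sg' dg]|f g sf [f' sf' df] sg [g' sg' dg]|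
  k f sf [f' sf' df]|c d f sf [f' sf' df]|a f sa _ df].
- exists (fun x => ebump k.+2 x + - k%:R * ebump k.+1 x).
    by apply: sm_add; [exact: sm_ebump|apply: sm_scale; exact: sm_ebump].
  by move=> x; rewrite mulNr; exact: is_derive_ebump.
- exists (fun x => f' x + g' x); first exact: sm_add.
  by move=> x; apply: is_deriveD.
- exists (fun x => f x * g' x + g x * f' x); first by apply: sm_add; apply: sm_mul.
  by move=> x; apply: is_deriveM.
- exists (fun x => k * f' x); first exact: sm_scale.
  by move=> x; apply: is_deriveZ.
- exists (fun x => c * f' (c * x + d)); first by apply: sm_scale; exact: sm_aff.
  move=> x.
  have h : is_derive x 1 (fun y : R => c * y + d) c.
    have h1 : is_derive x 1 (fun y : R => c * y) (c * 1) by apply: is_deriveZ.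
    by have := is_deriveD h1 (is_derive_cst d x 1); rewrite mulr1 addr0.
  have := @is_derive1_comp R f (fun y => c * y + d) x _ _ (df _) h.
  by rewrite mulrC.
- by exists a.
Qed.

Lemma sm_continuous f : sm f -> continuous f.
Proof.
move=> /sm_derive[g _ df] x; apply: differentiable_continuous.
by apply/derivable1_diffP; have [] := df x.
Qed.

(** The planar counterpart of [sm]: every directional derivative stays in the class, hence so does
    every [iterD ds f]. *)
Inductive sm2 : (R * R -> R) -> Prop :=
| sm2_fst f : sm f -> sm2 (fun x => f x.1)
| sm2_snd f : sm f -> sm2 (fun x => f x.2)
| sm2_add (f g : R * R -> R) : sm2 f -> sm2 g -> sm2 (fun x => f x + g x)
| sm2_mul (f g : R * R -> R) : sm2 f -> sm2 g -> sm2 (fun x => f x * g x)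
| sm2_scale k (f : R * R -> R) : sm2 f -> sm2 (fun x => k * f x).

Lemma is_diff_fst (x : R * R) : is_diff x (fst : R * R -> R) (fst : R * R -> R).
Proof.
have lf : linear (fst : R * R -> R) by [].
pose l := GRing.isLinear.Build R (R * R)%type R _ (fst : R * R -> R) lf.
pose f : {linear (R * R)%type -> R} := HB.pack (fst : R * R -> R) l.
have cf : continuous f by move=> y; exact: cvg_fst.
apply: DiffDef; first exact: (linear_differentiable (f := f)).
exact: (diff_lin x (f := f)).
Qed.

Lemma is_diff_snd (x : R * R) : is_diff x (snd : R * R -> R) (snd : R * R -> R).
Proof.
have lf : linear (snd : R * R -> R) by [].
pose l := GRing.isLinear.Build R (R * R)%type R _ (snd : R * R -> R) lf.
pose f : {linear (R * R)%type -> R} := HB.pack (snd : R * R -> R) l.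
have cf : continuous f by move=> y; exact: cvg_snd.
apply: DiffDef; first exact: (linear_differentiable (f := f)).
exact: (diff_lin x (f := f)).
Qed.

Lemma is_diff_comp_fst (f : R -> R) (x : R * R) df : is_derive x.1 1 f df ->
  is_diff x (fun y : R * R => f y.1) (fun v : R * R => v.1 * df).
Proof.
move=> [d1 d2].
have h : is_diff (x.1) f (fun v => v * df).
  apply: DiffDef; first exact/derivable1_diffP.
  by rewrite deriv1E// derive1E d2.
exact: is_diff_comp (is_diff_fst x) h.
Qed.

Lemma is_diff_comp_snd (f : R -> R) (x : R * R) df : is_derive x.2 1 f df ->
  is_diff x (fun y : R * R => f y.2) (fun v : R * R => v.2 * df).
Proof.
move=> [d1 d2].
have h : is_diff (x.2) f (fun v => v * df).
  apply: DiffDef; first exact/derivable1_diffP.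
  by rewrite deriv1E// derive1E d2.
exact: is_diff_comp (is_diff_snd x) h.
Qed.

Lemma sm2_diff (f : R * R -> R) : sm2 f ->
  (forall x, differentiable f x) /\ forall d, sm2 ('D_d f).
Proof.
have DE (g g' : R * R -> R) (d : R * R) (dg : R * R -> R * R -> R) :
    (forall x, is_diff x g (dg x)) -> (forall x, dg x d = g' x) -> 'D_d g = g'.
  move=> h e; apply/funext => x; have [d1 d2] := h x.
  by rewrite deriveE// d2 e.
have is_diffP (g : R * R -> R) : (forall x, differentiable g x) ->
    forall x, is_diff x g ('d g x) by move=> h x; exact: DiffDef.
elim=> {f} [f /sm_derive[g sg df]|f /sm_derive[g sg df]|f g sf [df Df] sg [dg Dg]|
  f g sf [df Df] sg [dg Dg]|k f sf [df Df]].
- have h x := is_diff_comp_fst (df x.1); split; first by move=> x; have [] := h x.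
  move=> d; rewrite (DE _ (fun x : R * R => d.1 * g x.1) _ _ h)//.
  by apply: sm2_scale; exact: sm2_fst.
- have h x := is_diff_comp_snd (df x.2); split; first by move=> x; have [] := h x.
  move=> d; rewrite (DE _ (fun x : R * R => d.2 * g x.2) _ _ h)//.
  by apply: sm2_scale; exact: sm2_snd.
- have h x := is_diffD (is_diffP _ df x) (is_diffP _ dg x).
  split; first by move=> x; have [] := h x.
  move=> d; rewrite (DE _ (fun x => 'D_d f x + 'D_d g x) _ _ h).
    by apply: sm2_add.
  by move=> x; rewrite !deriveE.
- have h x := is_diffM (is_diffP _ df x) (is_diffP _ dg x).
  split; first by move=> x; have [] := h x.
  move=> d; rewrite (DE _ (fun x => f x * 'D_d g x + g x * 'D_d f x) _ _ h).
    by apply: sm2_add; apply: sm2_mul.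
  by move=> x; rewrite !deriveE.
- have h x := is_diffZ k (is_diffP _ df x).
  split; first by move=> x; have [] := h x.
  move=> d; rewrite (DE _ (fun x => k * 'D_d f x) _ _ h).
    by apply: sm2_scale.
  by move=> x; rewrite !deriveE.
Qed.

Lemma sm2_smooth (f : R * R -> R) : sm2 f -> smooth f.
Proof.
move=> sf ds x; suff h : sm2 (Defs.iterD ds f) by exact: (sm2_diff h).1.
by elim: ds => //= d ds ih; exact: (sm2_diff ih).2.
Qed.

End bump.

(** * Test functions and linear changes of variables *)

Section plane.
Variable R : realType.
Local Notation mu := (@lebesgue_measure R).
Local Notation L := (@leb2 R).
Local Notation R1 := (measurableTypeR R).
Local Notation T2 := (R1 * R1)%type.

Lemma eucl_ge0 (x : R * R) : 0 <= eucl x. Proof. exact: sqrtr_ge0. Qed.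

Lemma eucl_sqr (x : R * R) : eucl x ^+ 2 = x.1 ^+ 2 + x.2 ^+ 2.
Proof. by rewrite sqr_sqrtr// addr_ge0 ?sqr_ge0. Qed.

Lemma le_eucl (x : R * R) r : 0 <= r -> (eucl x <= r) = (x.1 ^+ 2 + x.2 ^+ 2 <= r ^+ 2).
Proof. by move=> r0; rewrite -eucl_sqr ler_sqr ?nnegrE ?eucl_ge0. Qed.

Lemma eucl_le_add (x : R * R) : eucl x <= `|x.1| + `|x.2|.
Proof.
rewrite le_eucl ?addr_ge0// -(real_normK (num_real x.1)) -(real_normK (num_real x.2)).
by have := normr_ge0 x.1; have := normr_ge0 x.2; nra.
Qed.

Lemma normr1_le_eucl (x : R * R) : `|x.1| <= eucl x.
Proof.
by rewrite -[leLHS]sqrtr_sqr; apply: ler_wsqrtr; rewrite lerDl sqr_ge0.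
Qed.

Lemma normr2_le_eucl (x : R * R) : `|x.2| <= eucl x.
Proof.
by rewrite -[leLHS]sqrtr_sqr; apply: ler_wsqrtr; rewrite lerDr sqr_ge0.
Qed.

Lemma measurable_eucl : measurable_fun setT (fun x : T2 => eucl x).
Proof. by rewrite /eucl; mf. Qed.

(** Links the topology of the plane with the product sigma-algebra: an open set is a countable union
    of open boxes with rational corners. *)
Lemma open_measurable2 (U : set (R * R)) : open U -> measurable (U : set T2).
Proof.
move=> oU.
pose Q (k : rat * rat * (rat * rat)) : set T2 :=
  `](ratr k.1.1 : R), (ratr k.1.2 : R)[%classic `*` `](ratr k.2.1 : R), (ratr k.2.2 : R)[%classic.
have -> : U = \bigcup_(k in [set k | Q k `<=` U]) Q k.
  apply/seteqP; split => [x Ux|x [k /= kU Qx]]; last exact: kU.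
  have /nbhs_ballP[e /= e0 eU] : nbhs x U by exact: open_nbhs_nbhs.
  have /rat_in_itvoo[a a1] : x.1 - e < x.1 by rewrite ltrBlDr ltrDl.
  have /rat_in_itvoo[b b1] : x.1 < x.1 + e by rewrite ltrDl.
  have /rat_in_itvoo[c c1] : x.2 - e < x.2 by rewrite ltrBlDr ltrDl.
  have /rat_in_itvoo[d d1] : x.2 < x.2 + e by rewrite ltrDl.
  move: a1 b1 c1 d1; rewrite !in_itv/= => /andP[? ?] /andP[? ?] /andP[? ?] /andP[? ?].
  exists ((a, b), (c, d)); last by split; rewrite /= in_itv/=; apply/andP.
  move=> y [/=]; rewrite !in_itv/= => /andP[? ?] /andP[? ?]; apply: eU.
  by split; rewrite /ball/= ltr_norml; apply/andP; split; lra.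
rewrite bigcup_mkcond; apply: countable_bigcupT_measurable; first exact: countableP.
move=> k.
by case: ifPn => // _; exact: measurableX.
Qed.

Lemma continuous_measurable2 (f : R * R -> R) : continuous f ->
  measurable_fun setT (f : T2 -> R).
Proof.
move=> /continuousP cf.
apply: (@measurability _ _ T2 R setT f _ (RGenOInfty.measurableE R)) => // _ [_ [a ->] <-].
rewrite setTI; apply: open_measurable2; apply: cf.
rewrite (_ : `]a, +oo[%classic = [set y | a < y]); first exact: open_gt.
by apply/seteqP; split=> y /=; rewrite in_itv/= andbT.
Qed.

Lemma smooth_iterD (f : R * R -> R) ds : smooth f -> smooth (Defs.iterD ds f).
Proof.
move=> sf ds' x.
have -> : Defs.iterD ds' (Defs.iterD ds f) = Defs.iterD (ds' ++ ds) f.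
  by elim: ds' => //= d ds' ->.
exact: sf.
Qed.

Lemma smooth_differentiable (f : R * R -> R) x : smooth f -> differentiable f x.
Proof. by move=> /(_ [::] x). Qed.

Lemma smooth_continuous (f : R * R -> R) : smooth f -> continuous f.
Proof. by move=> sf x; apply: differentiable_continuous; exact: smooth_differentiable. Qed.

Lemma smooth_derive (f : R * R -> R) d : smooth f -> smooth ('D_d f).
Proof. exact: (@smooth_iterD f [:: d]). Qed.

Lemma smoothD (f g : R * R -> R) : smooth f -> smooth g -> smooth (fun x => f x + g x).
Proof.
move=> sf sg ds.
suff -> : Defs.iterD ds (fun x => f x + g x) = (fun x => Defs.iterD ds f x + Defs.iterD ds g x).
  by move=> x; exact: differentiableD.
elim: ds => //= d ds ->; apply/funext => x.
by rewrite deriveD//; apply: diff_derivable; [exact: sf|exact: sg].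
Qed.

Lemma smoothZ (k : R) (f : R * R -> R) : smooth f -> smooth (fun x => k * f x).
Proof.
move=> sf ds.
suff -> : Defs.iterD ds (fun x => k * f x) = (fun x => k * Defs.iterD ds f x).
  by move=> x; apply: differentiableZ; exact: sf.
elim: ds => //= d ds ->; apply/funext => x.
by rewrite deriveZ//; apply: diff_derivable; exact: sf.
Qed.

Lemma derive_comp_lin (B : R * R -> R * R) (f : R * R -> R) d x :
  (forall x, is_diff x B B) -> differentiable f (B x) ->
  'D_d (fun y => f (B y)) x = 'D_(B d) f (B x).
Proof.
move=> dB df; have [h1 h2] := dB x.
rewrite deriveE; last exact: differentiable_comp.
by rewrite diff_comp// h2 /= deriveE.
Qed.

Lemma smooth_comp_lin (B : R * R -> R * R) (f : R * R -> R) :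
  (forall x, is_diff x B B) -> smooth f -> smooth (fun x => f (B x)).
Proof.
move=> dB sf ds x.
have -> : Defs.iterD ds (fun x => f (B x)) = (fun x => Defs.iterD (map B ds) f (B x)).
  elim: ds => //= d ds ->; apply/funext => y.
  by rewrite (derive_comp_lin _ dB (sf _ _)).
by apply: differentiable_comp; [have [] := dB x|exact: sf].
Qed.

Lemma is_diff_lin (a b c d : R) (x : R * R) :
  is_diff x (fun y : R * R => (a * y.1 + b * y.2, c * y.1 + d * y.2))
            (fun y : R * R => (a * y.1 + b * y.2, c * y.1 + d * y.2)).
Proof.
have h1 := is_diffD (is_diffZ a (is_diff_fst x)) (is_diffZ b (is_diff_snd x)).
have h2 := is_diffD (is_diffZ c (is_diff_fst x)) (is_diffZ d (is_diff_snd x)).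
exact: is_diff_pair h1 h2.
Qed.

Lemma test_compact_bound (f : R * R -> R) : continuous f ->
  (exists r, forall x, r < eucl x -> f x = 0) ->
  exists M P : R, [/\ 0 <= M, 0 <= P, forall x, `|f x| <= M & forall x, f x != 0 -> `|x.1| <= P /\ `|x.2| <= P].
Proof.
move=> cf [r hr]; pose P := `|r|.
have sup x : f x != 0 -> `|x.1| <= P /\ `|x.2| <= P.
  move=> fx; have [rx|rx] := ltP r (eucl x); first by rewrite hr ?eqxx in fx.
  have h := le_trans rx (ler_norm r).
  by split; apply: le_trans h; [exact: normr1_le_eucl|exact: normr2_le_eucl].
have cB : compact (`[- P, P]%classic `*` `[- P, P]%classic : set (R * R)).
  by apply: compact_setX; exact: segment_compact.
have := continuous_compact (continuous_subspaceT cf) cB.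
move=> /compact_bounded[M [Mr HM]].
exists (`|M| + 1), P; split; [by rewrite addr_ge0|exact: normr_ge0| |exact: sup].
move=> x; have [->|fx] := eqVneq (f x) 0; first by rewrite normr0 addr_ge0.
have [h1 h2] := sup x fx.
apply: (HM (`|M| + 1)); first by have := ler_norm M; lra.
by exists x => //; split; rewrite /= in_itv/= -ler_norml.
Qed.

Lemma leb2_box_fin (P : R) : (L (`[(- P)%R, P]%classic `*` `[(- P)%R, P]%classic) < +oo)%E.
Proof.
rewrite /leb2 product_measure1E//= !lebesgue_measure_itv/=.
by case: ifP => _; rewrite ?mule0 ?ltry// -!EFinB -EFinM ltry.
Qed.

Lemma L2_bounded_support (f : T2 -> R) (M P : R) : measurable_fun setT f -> 0 <= M ->
  (forall x, `|f x| <= M) -> (forall x, f x != 0 -> `|x.1| <= P /\ `|x.2| <= P) -> L2 L f.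
Proof.
move=> mf M0 fM fP; split => //.
pose B : set T2 := `[- P, P]%classic `*` `[- P, P]%classic.
have mB : measurable B by exact: measurableX.
apply: (@le_lt_trans _ _ (\int[L]_x ((M ^+ 2)%:E * (\1_B x)%:E))%E).
  apply: ge0_le_integral => //.
  - by move=> x _; rewrite lee_fin sqr_ge0.
  - by mf.
  - by mf.
  - move=> x _; rewrite -EFinM lee_fin.
    have [->|fx] := eqVneq (f x) 0; first by rewrite expr0n mulr_ge0 ?sqr_ge0.
    have [h1 h2] := fP x fx.
    have -> : \1_B x = 1 :> R.
      by rewrite indicE mem_set//; split; rewrite /= in_itv/= -ler_norml.
    by rewrite mulr1 -real_normK ?num_real// ler_sqr ?nnegrE.
rewrite ge0_integralZl_EFin ?sqr_ge0//; last by mf.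
rewrite integral_indic// setIT lte_mul_pinfty ?lee_fin ?sqr_ge0//.
exact: leb2_box_fin.
Qed.

Lemma test_L2 (f : R * R -> R) : continuous f ->
  (exists r, forall x, r < eucl x -> f x = 0) -> L2 L (f : T2 -> R).
Proof.
move=> cf hr; have [M [P [M0 P0 fM fP]]] := test_compact_bound cf hr.
exact: (L2_bounded_support (continuous_measurable2 cf) M0 fM fP).
Qed.

Lemma test_fun_L2 (phi : R * R -> R) : test_fun phi -> L2 L (phi : T2 -> R).
Proof. by move=> [sp hr]; apply: test_L2 => //; exact: smooth_continuous. Qed.

Lemma test_fun_derive (phi : R * R -> R) d : test_fun phi -> test_fun ('D_d phi).
Proof.
move=> [sp [r0 hr0]]; split; first exact: smooth_derive.
(* With a nonnegative radius the outside of the disc is the open set [r ^ 2 < x.1 ^ 2 + x.2 ^ 2];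
   there [phi] vanishes in a neighbourhood of each point, so its derivative does too. *)
pose r := Num.max r0 0; have r0' : 0 <= r by rewrite le_max lexx orbT.
have hr x : r < eucl x -> phi x = 0 by rewrite gt_max => /andP[/hr0].
exists r => x rx.
have ce : continuous (fun x : R * R => x.1 ^+ 2 + x.2 ^+ 2).
  move=> y; apply: cvgD; apply: cvgM; by [exact: cvg_fst|exact: cvg_snd].
rewrite (near_eq_derive (g := cst 0)) ?derive_cst//.
have : nbhs x [set y : R * R | r ^+ 2 < y.1 ^+ 2 + y.2 ^+ 2].
  apply: (ce x [set z | r ^+ 2 < z]); apply: lt_nbhsr.
  by rewrite -eucl_sqr ltr_sqr ?nnegrE// eucl_ge0.
apply: filterS => y /= ry; rewrite hr//.
by rewrite -ltr_sqr ?nnegrE ?eucl_ge0// eucl_sqr.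
Qed.

Lemma test_funD (f g : R * R -> R) : test_fun f -> test_fun g -> test_fun (fun x => f x + g x).
Proof.
move=> [sf [r hr]] [sg [s hs]]; split; first exact: smoothD.
by exists (Num.max r s) => x; rewrite gt_max => /andP[? ?]; rewrite hr// hs// addr0.
Qed.

Lemma test_funZ (k : R) (f : R * R -> R) : test_fun f -> test_fun (fun x => k * f x).
Proof.
move=> [sf [r hr]]; split; first exact: smoothZ.
by exists r => x rx; rewrite hr// mulr0.
Qed.

(** The weak derivative of [f] is tested with [phi \o B], whose derivative along [A d] at [A x] is
    that of [phi] along [B (A d) = d]; the integrals are then pulled back by [A]. Isometry of [B]
    keeps the support bounded. *)
Lemma weak_partial_lin (A B : R * R -> R * R) (f g : R * R -> R) d :
  (forall x, is_diff x B B) -> mpres (A : T2 -> T2) -> mpres (B : T2 -> T2) ->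
  cancel A B -> (forall x, eucl (B x) = eucl x) ->
  measurable_fun setT (f : T2 -> R) ->
  weak_partial f g (A d) -> weak_partial (fun x => f (A x)) (fun x => g (A x)) d.
Proof.
move=> dB pA pB AB eB mf [mg H]; split.
  exact: (measurableT_comp mg pA.1).
move=> phi tphi; have [sphi [r hr]] := tphi.
have sB : smooth (fun x => phi (B x)) by exact: smooth_comp_lin.
have tB : test_fun (fun x => phi (B x)).
  by split => //; exists r => x rx; apply: hr; rewrite eB.
have mphi : measurable_fun setT (phi : T2 -> R).
  by apply: continuous_measurable2; exact: smooth_continuous.
have mD : measurable_fun setT ('D_d phi : T2 -> R).
  by apply: continuous_measurable2; apply: smooth_continuous; exact: smooth_derive.
have mB := pB.1.
have := H _ tB.
rewrite -(mpres_integral pA (F := fun x => (f x * 'D_(A d) (fun x => phi (B x)) x)%:E)); last first.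
  mf; apply: continuous_measurable2; apply: smooth_continuous; exact: smooth_derive.
rewrite -(mpres_integral pA (F := fun x => (g x * phi (B x))%:E)); last first.
  by mf.
move=> h; apply: etrans _ (etrans h _).
  apply: eq_integral => x _.
  rewrite (derive_comp_lin (A d) dB (smooth_differentiable _ sphi)) ?AB//.
by congr (- _)%E; apply: eq_integral => x _; rewrite AB.
Qed.

End plane.

Lemma ge0_integral_EFinZ (R : realType) d (X : measurableType d)
    (m : {measure set X -> \bar R}) (c : R) (f : X -> R) :
  0 <= c -> measurable_fun setT f -> (forall x, 0 <= f x) ->
  (\int[m]_x (c * f x)%:E = c%:E * \int[m]_x (f x)%:E)%E.
Proof.
move=> c0 mf f0; rewrite -ge0_integralZl//; first by apply/measurable_EFinP.
by move=> x _; rewrite lee_fin.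
Qed.

Lemma addrpE (R : realType) (x y : R * R) : x + y = (x.1 + y.1, x.2 + y.2).
Proof. by []. Qed.

Lemma oppr_pairE (R : realType) (x : R * R) : - x = (- x.1, - x.2).
Proof. by []. Qed.

(** * Bumps converging to indicators of half-open intervals *)

Section bumps.
Variable R : realType.
Implicit Types p q x : R.

(** The first factor vanishes up to [p]; the second vanishes from [q + 1 / (n + 1)] on. Its
    quadratic scale makes the argument equal to [n + 1] at [x = q], so the bumps tend to 1 at [q]
    and to 0 at [p]: the limit is the indicator of the interval open at [p] and closed at [q]. *)
Definition abump p q (n : nat) x : R :=
  ebump 0 (n.+1%:R * x + - (n.+1%:R * p)) *
  ebump 0 (- n.+1%:R ^+ 2 * x + (n.+1%:R ^+ 2 * q + n.+1%:R)).

Lemma sm_abump p q n : sm (abump p q n).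
Proof. by apply: sm_mul; apply: sm_aff; exact: sm_ebump. Qed.

Lemma abump_ge0 p q n x : 0 <= abump p q n x.
Proof. by rewrite mulr_ge0 ?ebump_ge0. Qed.

Lemma abump_le1 p q n x : abump p q n x <= 1.
Proof.
rewrite -[leRHS]mulr1; apply: ler_pM; rewrite ?ebump_ge0//; exact: ebump0_le1.
Qed.

Lemma abump_supp p q n x : abump p q n x != 0 -> p < x /\ x < q + 1.
Proof.
have n1 : 1 <= n.+1%:R :> R by rewrite ler1n.
have n0 : 0 < n.+1%:R :> R by [].
move=> h; split; rewrite ltNge; apply: contra h => h; rewrite /abump.
- rewrite {1}/ebump ifT ?mul0r//; nra.
- rewrite mulrC {1}/ebump ifT ?mul0r//; nra.
Qed.

Lemma ebump_cvg1 (y : nat -> R) (c : R) : 0 < c -> (forall n, c * n.+1%:R <= y n) ->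
  ebump 0 (y n) @[n --> \oo] --> (1 : R).
Proof.
move=> c0 cy.
have y0 n : 0 < y n by apply: lt_le_trans (cy n); rewrite mulr_gt0.
have c1 : (fun n => 1 - c^-1 * n.+1%:R^-1) @ \oo --> (1 : R).
  rewrite -[X in _ --> X]subr0 -[X in _ - X](mulr0 c^-1).
  by apply: cvgB; [exact: cvg_cst|apply: cvgMl_tmp; exact: cvg_harmonic].
apply: (squeeze_cvgr _ c1 (h := cst 1)); last exact: cvg_cst.
apply: nearW => n; rewrite ebump0_le1 andbT.
rewrite /ebump ifF ?expr0 ?mul1r; last by apply/negbTE; rewrite -ltNge.
apply: le_trans (expR_ge1Dx _); rewrite lerD2l lerN2 -invfM lef_pV2 ?posrE ?mulr_gt0//.
Qed.

Lemma abump_cvg p q x :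
  abump p q n x @[n --> \oo] --> (\1_(`]p, q]%classic) x : R).
Proof.
rewrite indicE; have [px|px] := ltP p x; last first.
  have -> : x \in `]p, q]%classic = false.
    by apply/negbTE; rewrite notin_setE/= in_itv/=; apply/negP; rewrite ltNge px.
  have -> : (fun n => abump p q n x) = cst 0.
    apply/funext => n; apply/eqP; apply: contraT => /abump_supp[].
    by rewrite ltNge px.
  exact: cvg_cst.
have [xq|xq] := leP x q.
  have -> : x \in `]p, q]%classic by rewrite mem_set//= in_itv/= px.
  rewrite -[X in _ --> X](mulr1 1); apply: cvgM.
  - apply: (@ebump_cvg1 _ (x - p)); first by rewrite subr_gt0.
    by move=> n; rewrite mulrBl; lra.
  - apply: (@ebump_cvg1 _ 1) => // n.
    have n0 : 0 <= n.+1%:R ^+ 2 * (q - x) :> R by rewrite mulr_ge0 ?sqr_ge0 ?subr_ge0.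
    by lra.
have -> : x \in `]p, q]%classic = false.
  by apply/negbTE; rewrite notin_setE/= in_itv/=; apply/negP; rewrite px/= leNgt xq.
apply: cvg_near_cst.
have [N hN] : exists N : nat, (x - q)^-1 <= N%:R.
  by exists (Num.truncn (x - q)^-1).+1; apply/ltW; exact: Num.Theory.truncnS_gt.
exists N => // n /= Nn.
apply/eqP; rewrite mulf_eq0; apply/orP; right.
rewrite {1}/ebump ifT// .
have n0 : 0 < n.+1%:R :> R by [].
have h : 1 <= (x - q) * n.+1%:R.
  rewrite -ler_pdivrMl ?subr_gt0// mulr1; apply: le_trans hN _.
  by rewrite ler_nat; apply: leq_trans Nn _.
rewrite -subr_ge0 (_ : 0 - _ = n.+1%:R * ((x - q) * n.+1%:R - 1)); last by ring.
by rewrite mulr_ge0 ?subr_ge0// ltW.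
Qed.

End bumps.

Section primitive.
Variable R : realType.
Local Notation mu := (@lebesgue_measure R).

(** Bounded support allows integration from minus infinity, and the clause [sm_prim] puts the
    primitive back into the class. *)
Lemma sm_primitive (a : R -> R) (p q : R) : sm a -> (forall x, `|a x| <= 1) ->
  (forall x, a x != 0 -> p <= x /\ x <= q) ->
  exists2 A, sm A & forall x : R, is_derive x 1 A (a x).
Proof.
move=> sa a1 aS; pose A x := (\int[mu]_(t in [set` `]-oo, x]]) a t)%R.
have ia u : mu.-integrable `]-oo, u] (EFin \o a).
  have ca := sm_continuous sa.
  have ma : measurable_fun setT a by exact: continuous_measurable_fun.
  apply: (@integrableS _ _ _ mu setT) => //.
  apply: (@le_integrable _ _ _ mu _ measurableT _ (EFin \o \1_(`[p, q]%classic))).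
  - by mf.
  - move=> x _ /=; rewrite lee_fin indicE.
    have [->|ax] := eqVneq (a x) 0; first by rewrite normr0.
    have [h1 h2] := aS x ax.
    by rewrite mem_set/= ?normr1 ?in_itv/= ?h1.
  - exact: integrable_indic_itv.
have dA (x : R) : is_derive x 1 A (a x).
  have x1 : x < x + 1 by rewrite ltrDl.
  have ca : {for x, continuous a} by apply: sm_continuous.
  have [|h1 h2] := @continuous_FTC1 R a -oo%O x (x + 1) x1 (ia _) _ ca.
    by first [rewrite ltNyr| exact: isT|rewrite bnd_simp].
  by apply: DeriveDef; [exact: h1|rewrite -derive1E; exact: h2].
by exists A => //; exact: sm_prim dA.
Qed.

Lemma int_primitive (a A : R -> R) (x h : R) : continuous a -> 0 < h ->
  (forall x : R, is_derive x 1 A (a x)) ->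
  (\int[mu]_(s in `[0%R, h]) (a (x - s))%:E = (A x - A (x - h))%:E)%E.
Proof.
move=> ca h0 dA.
have dF (s : R) : is_derive s 1 (fun s => - A (x - s)) (a (x - s)).
  have d1 : is_derive s 1 (fun s : R => x - s) (- 1).
    by have := is_deriveB (is_derive_cst x s 1) (is_derive_id s 1); rewrite sub0r.
  have := is_deriveN (@is_derive1_comp R A (fun s => x - s) s _ _ (dA _) d1).
  by rewrite mulrN1 opprK.
have cF : continuous (fun s => - A (x - s)).
  by move=> s; apply: differentiable_continuous; apply/derivable1_diffP; have [] := dF s.
rewrite (@continuous_FTC2 R (fun s => a (x - s)) (fun s => - A (x - s)) 0 h h0).
- by rewrite subr0 -EFinB opprK addrC.
- apply: continuous_subspaceT => s; apply: continuous_comp; last exact: ca.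
  by apply: cvgB; [exact: cvg_cst|exact: cvg_id].
- split.
  + by move=> s _; have [] := dF s.
  + by apply: cvg_at_right_filter; exact: cF.
  + by apply: cvg_at_left_filter; exact: cF.
- by move=> s _; rewrite derive1E; have [] := dF s.
Qed.

Lemma derive_tensor (A a b b' : R -> R) (x : R * R) :
  (forall x : R, is_derive x 1 A (a x)) -> (forall x : R, is_derive x 1 b (b' x)) ->
  'D_(@e1 R) (fun x : R * R => A x.1 * b x.2) x = a x.1 * b x.2.
Proof.
move=> dA db.
have [h1 h2] := is_diffM (is_diff_comp_fst (dA x.1)) (is_diff_comp_snd (db x.2)).
rewrite deriveE; last exact: h1.
by rewrite h2 /= !fctE /= /e1 /=; rewrite -![_ *: _]/(_ * _); ring.
Qed.

End primitive.

(** * Increments as segment integrals of the weak derivative *)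

Section difference_quotient_formula.
Variable R : realType.
Local Notation mu := (@lebesgue_measure R).
Local Notation L := (@leb2 R).
Local Notation R1 := (measurableTypeR R).
Local Notation T2 := (R1 * R1)%type.
Implicit Types (f g k : T2 -> R) (h : R).

Definition box_bump p q r s n : T2 -> R := fun x => abump p q n x.1 * abump r s n x.2.

Lemma measurable_sm (a : R -> R) : sm a -> measurable_fun setT (a : R1 -> R).
Proof. by move=> sa; apply: continuous_measurable_fun; exact: sm_continuous sa. Qed.

Lemma measurable_box_bump p q r s n : measurable_fun setT (box_bump p q r s n).
Proof.
rewrite /box_bump; have ma := measurable_sm (sm_abump p q n).
by have mb := measurable_sm (sm_abump r s n); mf.
Qed.

Lemma box_bump_ge0 p q r s n x : 0 <= box_bump p q r s n x.
Proof. by rewrite mulr_ge0 ?abump_ge0. Qed.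

Lemma box_bump_le p q r s n (x : T2) :
  box_bump p q r s n x <= \1_(`]p, (q + 1)%R]%classic `*` `]r, (s + 1)%R]%classic) x.
Proof.
rewrite indicE; case: (boolP (x \in _)) => [_|/negP hx].
  by rewrite -[leRHS]mulr1; apply: ler_pM; rewrite ?abump_ge0 ?abump_le1.
rewrite /box_bump.
have [->|h1] := eqVneq (abump p q n x.1) 0; first by rewrite mul0r.
have [->|h2] := eqVneq (abump r s n x.2) 0; first by rewrite mulr0.
exfalso; apply: hx; rewrite inE/= !in_itv/=.
have [-> /ltW ->] := abump_supp h1; have [-> /ltW ->] := abump_supp h2.
by [].
Qed.

Lemma L2_box (p q r s : R) :
  L2 L (\1_(`]p, q]%classic `*` `]r, s]%classic) : T2 -> R).
Proof.
pose P := `|p| + `|q| + `|r| + `|s|.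
apply: (@L2_bounded_support _ _ 1 P) => //.
- by apply: measurable_indic; apply: measurableX.
- by move=> x; rewrite indicE; case: (_ \in _); rewrite ?normr1 ?normr0.
- move=> x; rewrite indicE; case: (boolP (x \in _)); last by rewrite eqxx.
  rewrite inE/= !in_itv/= => -[/andP[h1 h2] /andP[h3 h4]] _.
  have := ler_norm p; have := ler_norm q; have := ler_norm r; have := ler_norm s.
  have := lerNnormlW (lexx `|p|); have := lerNnormlW (lexx `|r|).
  have := normr_ge0 p; have := normr_ge0 q; have := normr_ge0 r; have := normr_ge0 s.
  rewrite /P !ler_norml => *; split; apply/andP; split; lra.
Qed.

Lemma L2_box_bump p q r s n : L2 L (box_bump p q r s n).
Proof.
apply: L2_le (measurable_box_bump _ _ _ _ _) (L2_box p (q + 1) r (s + 1)) _ => x.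
by rewrite lerXn2r ?nnegrE ?box_bump_ge0 ?box_bump_le// indicE.
Qed.

Lemma cvg_ip_dominated d (X : measurableType d) (m : {measure set X -> \bar R})
    (F B Phi : X -> R) (Phin : nat -> X -> R) :
  L2 m F -> L2 m B -> (forall n, measurable_fun setT (Phin n)) -> measurable_fun setT Phi ->
  (forall n x, `|Phin n x| <= B x) -> (forall x, Phin n x @[n --> \oo] --> Phi x) ->
  ip m F (Phin n) @[n --> \oo] --> ip m F Phi.
Proof.
move=> lF lB mP mPhi PB PP; have [mF _] := lF; have [mB _] := lB.
have B0 x : 0 <= B x by apply: le_trans (PB 0%N x).
have lPhin n : L2 m (Phin n).
  by apply: L2_le (mP n) lB _ => x; rewrite -(real_normK (num_real (Phin n x))) lerXn2r ?nnegrE.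
have PhiB x : `|Phi x| <= B x.
  have c : `|Phin n x| @[n --> \oo] --> `|Phi x| by apply: cvg_norm; exact: PP.
  by rewrite -(cvg_lim _ c)//; apply: limr_le; [apply/cvg_ex; exists (`|Phi x|)|apply: nearW].
have lPhi : L2 m Phi.
  by apply: L2_le mPhi lB _ => x; rewrite -(real_normK (num_real (Phi x))) lerXn2r ?nnegrE.
have lF' : L2 m (fun x => `|F x|).
  by apply: L2_le lF _ => [|x]; [mf|rewrite real_normK ?num_real].
have [||||| _ _] := @dominated_convergence _ _ _ m setT measurableT
  (fun n x => (F x * Phin n x)%:E) (fun x => (F x * Phi x)%:E) (fun x => (`|F x| * B x)%:E).
- by move=> n; have mPn := mP n; mf.
- by mf.
- by apply: aeW => x _; apply: cvg_EFin; [exact: nearW|apply: cvgMl_tmp; exact: PP].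
- exact: L2_mul.
- by apply: aeW => x n _; rewrite /= lee_fin normrM ler_wpM2l.
rewrite ip_fin// => /fine_cvgP[_].
by apply: cvg_trans; apply: near_eq_cvg; apply: nearW => n /=; rewrite ip_fin.
Qed.

Lemma box_bump_cvg p q r s (x : T2) :
  box_bump p q r s n x @[n --> \oo] --> (\1_(`]p, q]%classic `*` `]r, s]%classic) x : R).
Proof.
have -> : \1_(`]p, q]%classic `*` `]r, s]%classic) x = \1_(`]p, q]%classic) x.1 * \1_(`]r, s]%classic) x.2 :> R.
  rewrite !indicE -natrM mulnb; congr (_%:R); congr nat_of_bool.
  by apply/idP/andP; rewrite !inE.
by apply: cvgM; exact: abump_cvg.
Qed.

(** Dominated convergence turns orthogonality to all bumps into vanishing integrals over half-open
    rectangles. *)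
Lemma L2_ae0_box_bump F : L2 L F ->
  (forall p q r s n, ip L F (box_bump p q r s n) = 0) -> {ae L, forall x, F x = 0}.
Proof.
move=> lF h; have [mF _] := lF.
apply: ae0_rects => // p q r s pq rs.
have lB := L2_box p q r s; have iFB := L2_mul lF lB.
have E : (fun x => (F x * \1_(`]p, q]%classic `*` `]r, s]%classic) x)%:E) =
   (EFin \o F) \_ (`]p, q]%classic `*` `]r, s]%classic).
  apply/funext => x; rewrite patchE indicE/=.
  by case: (x \in _); rewrite ?mulr1 ?mulr0.
split.
  by apply/integrable_mkcond; [exact: measurableX|rewrite -E].
rewrite [LHS]integral_mkcond -E ip_fin//.
suff -> : ip L F (\1_(`]p, q]%classic `*` `]r, s]%classic)) = 0 by [].
have := cvg_ip_dominated lF (L2_box p (q + 1) r (s + 1)) (measurable_box_bump p q r s)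
  (lB.1) _ (@box_bump_cvg p q r s).
rewrite (_ : (fun n => ip _ _ _) = cst 0); last by apply/funext => n; exact: h.
move=> /(_ _)/cvg_lim <-//; first by rewrite lim_cst.
by move=> n x; rewrite ger0_norm ?box_bump_ge0// box_bump_le.
Qed.

Lemma N2_mpres phi f : mpres phi -> measurable_fun setT f -> N2 L (fun x => f (phi x)) = N2 L f.
Proof.
by move=> [_ h] mf; apply: (h (fun x => (f x ^+ 2)%:E)); [mf|move=> x; rewrite lee_fin sqr_ge0].
Qed.

Lemma L2_mpres phi f : mpres phi -> L2 L f -> L2 L (fun x => f (phi x)).
Proof.
by move=> mp [mf lf]; have [mphi _] := mp; split; [mf|rewrite N2_mpres].
Qed.

Lemma ip_mpres phi f g : mpres phi -> L2 L f -> L2 L g ->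
  ip L (fun x => f (phi x)) (fun x => g (phi x)) = ip L f g.
Proof.
move=> mp [mf _] [mg _]; congr fine.
by apply: (mpres_integral mp (F := fun x => (f x * g x)%:E)); mf.
Qed.

Lemma ip_diff_shift f B c : L2 L f -> L2 L B ->
  ip L (fun x => f (x + c) - f x) B = - ip L f (fun x => B x - B (x - c)).
Proof.
move=> lf lB; have mps := mpres_shift c; have mpn := mpres_shift (- c).
have lfc := L2_mpres mps lf; have lBc := L2_mpres mpn lB.
rewrite (ipBl lfc lf lB) (ipBr lB lBc lf) opprB; congr (_ - _).
rewrite -(ip_mpres mpn lfc lB); congr (ip L _ _).
by apply/funext => x; rewrite subrK.
Qed.

Definition seg h : R1 -> R := \1_(`[0, h]%classic).
(** The integral of [g] over the horizontal segment of length [h] starting at [x]; [seg_sqr] is the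
    same for [g ^ 2]. Extended real values allow Tonelli before finiteness is known. *)
Definition seg_int g h (x : T2) : \bar R := (\int[mu]_s (g (x.1 + s, x.2)%R * seg h s)%:E)%E.
Definition seg_sqr g h (x : T2) : \bar R := (\int[mu]_s (g (x.1 + s, x.2)%R ^+ 2 * seg h s)%:E)%E.

Lemma measurable_seg h : measurable_fun setT (seg h).
Proof. exact: measurable_indic. Qed.

Lemma seg_ge0 h s : 0 <= seg h s.
Proof. by rewrite /seg indicE. Qed.

Lemma sqr_seg h s : seg h s ^+ 2 = seg h s.
Proof. by rewrite /seg indicE; case: (_ \in _); rewrite ?expr1n ?expr0n. Qed.

Lemma N2_seg h : 0 <= h -> N2 mu (seg h) = h%:E.
Proof.
move=> h0; rewrite /N2.
have -> : (\int[mu]_x (seg h x ^+ 2)%:E = \int[mu]_x (\1_(`[0, h]%classic) x)%:E)%E.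
  by apply: eq_integral => s _; rewrite sqr_seg.
rewrite integral_indic// setIT; apply: etrans (lebesgue_measure_itv `[0, h]) _.
by rewrite /= lte_fin; case: ltgtP h0 => // [h0|<-] _; rewrite ?sube0 ?subr0 ?oppr0 ?adde0.
Qed.

Lemma L2_seg h : 0 <= h -> L2 mu (seg h).
Proof. by move=> h0; split; [exact: measurable_seg|rewrite N2_seg ?ltry]. Qed.

Lemma measurable_seg_int k h : measurable_fun setT k -> (forall x, 0 <= k x) ->
  measurable_fun setT (seg_int k h).
Proof.
move=> mk k0; apply: (@measurable_fun_fubini_tonelli_F _ _ T2 R1 R mu
  (fun z : T2 * R1 => (k (z.1.1 + z.2, z.1.2)%R * seg h z.2)%:E)).
- by have ms := measurable_seg h; mf.
- by move=> z; rewrite lee_fin mulr_ge0 ?seg_ge0.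
Qed.

(** For each [s] the translation by [- s] along the axis moves the averaging from [k] onto [Phi],
    with the segment reversed. *)
Lemma seg_int_tonelli k (Phi : T2 -> R) h : measurable_fun setT k -> (forall x, 0 <= k x) ->
  measurable_fun setT Phi -> (forall x, 0 <= Phi x) ->
  (\int[L]_x ((Phi x)%:E * seg_int k h x) =
   \int[L]_x ((k x)%:E * \int[mu]_s (Phi (x.1 - s, x.2)%R * seg h s)%:E))%E.
Proof.
move=> mk k0 mP P0; have ms := measurable_seg h.
pose F (z : T2 * R1) : \bar R := (Phi z.1 * (k (z.1.1 + z.2, z.1.2) * seg h z.2))%:E.
pose G (z : T2 * R1) : \bar R := (k z.1 * (Phi (z.1.1 - z.2, z.1.2) * seg h z.2))%:E.
have mF : measurable_fun setT F by rewrite /F; mf.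
have mG : measurable_fun setT G by rewrite /G; mf.
have F0 z : (0 <= F z)%E by rewrite lee_fin !mulr_ge0 ?seg_ge0.
have G0 z : (0 <= G z)%E by rewrite lee_fin !mulr_ge0 ?seg_ge0.
have -> : (\int[L]_x ((Phi x)%:E * seg_int k h x) = \int[L]_x \int[mu]_s F (x, s))%E.
  apply: eq_integral => x _; rewrite -ge0_integral_EFinZ//; first by mf.
  by move=> s; rewrite mulr_ge0 ?seg_ge0.
have -> : (\int[L]_x ((k x)%:E * \int[mu]_s (Phi (x.1 - s, x.2)%R * seg h s)%:E) =
           \int[L]_x \int[mu]_s G (x, s))%E.
  apply: eq_integral => x _; rewrite -ge0_integral_EFinZ//; first by mf.
  by move=> s; rewrite mulr_ge0 ?seg_ge0.
apply: etrans (@fubini_tonelli _ _ _ _ R L mu F mF F0) _.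
apply: etrans _ (esym (@fubini_tonelli _ _ _ _ R L mu G mG G0)).
apply: eq_integral => s _.
apply: etrans (esym ((mpres_shift (- s, 0)%R).2 (fun x => F (x, s)) _ _)) _ => //.
- by rewrite /F/=; mf.
apply: eq_integral => x _; rewrite /F /G /= addr0 subrK; congr (_%:E).
rewrite -surjective_pairing (_ : (x + (- s, 0))%R = (x.1 - s, x.2)%R); first by ring.
by rewrite [LHS]addrpE /= addr0.
Qed.

Lemma slice_L2 k h (x : T2) : measurable_fun setT k -> (seg_sqr k h x < +oo)%E ->
  L2 mu (fun s => k (x.1 + s, x.2) * seg h s).
Proof.
move=> mk; have ms := measurable_seg h; split.
  by mf.
by rewrite (_ : N2 _ _ = seg_sqr k h x)//; apply: eq_integral => s _; rewrite exprMn sqr_seg.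
Qed.

Lemma seg_int_ip k h (x : T2) : 0 <= h -> measurable_fun setT k -> (seg_sqr k h x < +oo)%E ->
  seg_int k h x = (ip mu (fun s => k (x.1 + s, x.2) * seg h s) (seg h))%:E.
Proof.
move=> h0 mk q; rewrite -ip_fin//; [|exact: slice_L2|exact: L2_seg].
by apply: eq_integral => s _; rewrite -mulrA -expr2 sqr_seg.
Qed.

Lemma seg_sqr_integral g h (C : T2 -> R) : 0 <= h -> measurable_fun setT g ->
  measurable_fun setT C -> (forall x, 0 <= C x) ->
  (\int[L]_x ((C x)%:E * seg_sqr g h x) =
   \int[L]_x ((g x ^+ 2)%:E * \int[mu]_s (C (x.1 - s, x.2)%R * seg h s)%:E))%E.
Proof.
move=> h0 mg mC C0; apply: (@seg_int_tonelli (fun x => g x ^+ 2) C h) => //; first by mf.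
by move=> x; exact: sqr_ge0.
Qed.

Lemma integral_seg h : 0 <= h -> (\int[mu]_s (seg h s)%:E = h%:E)%E.
Proof. by move=> h0; rewrite -N2_seg//; apply: eq_integral => s _; rewrite sqr_seg. Qed.

Lemma measurable_seg_sqr g h : measurable_fun setT g -> measurable_fun setT (seg_sqr g h).
Proof.
move=> mg; apply: (@measurable_seg_int (fun x => g x ^+ 2)); first by mf.
by move=> x; exact: sqr_ge0.
Qed.

Lemma seg_sqr_ge0 g h x : (0 <= seg_sqr g h x)%E.
Proof. by apply: integral_ge0 => s _; rewrite lee_fin mulr_ge0 ?sqr_ge0 ?seg_ge0. Qed.

(** After averaging is moved to the indicator of [C], a point contributes only if some point of [C]
    lies at distance at most [h] to its left, and then it belongs to [C']; the segment contributes
    its length [h]. *)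
Lemma seg_sqr_local g h (C C' : set T2) : 0 <= h -> measurable_fun setT g ->
  measurable C -> measurable C' ->
  (forall x s, C x -> 0 <= s <= h -> C' (x.1 + s, x.2)) ->
  (\int[L]_(x in C) seg_sqr g h x <= h%:E * \int[L]_(x in C') (g x ^+ 2)%:E)%E.
Proof.
move=> h0 mg mC mC' CC'.
have -> : (\int[L]_(x in C) seg_sqr g h x = \int[L]_x ((\1_C x)%:E * seg_sqr g h x))%E.
  rewrite [LHS]integral_mkcond; apply: eq_integral => x _; rewrite patchE indicE.
  by case: (x \in C); rewrite ?mul1e ?mul0e.
have mC1 : measurable_fun setT (\1_C : T2 -> R) by exact: measurable_indic.
have mC1' : measurable_fun setT (\1_C' : T2 -> R) by exact: measurable_indic.
rewrite seg_sqr_integral//.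
have -> : (\int[L]_(x in C') (g x ^+ 2)%:E = \int[L]_x (g x ^+ 2 * \1_C' x)%:E)%E.
  rewrite [LHS]integral_mkcond; apply: eq_integral => x _; rewrite patchE indicE.
  by case: (x \in C'); rewrite ?mulr1 ?mulr0.
rewrite -ge0_integral_EFinZ//; [|by mf|by move=> x; rewrite mulr_ge0 ?sqr_ge0// indicE].
have ms := measurable_seg h.
apply: ge0_le_integral => //.
- move=> x _; rewrite mule_ge0 ?lee_fin ?sqr_ge0//.
  by apply: integral_ge0 => s _; rewrite lee_fin mulr_ge0 ?seg_ge0// indicE.
- apply: emeasurable_funM; first by mf.
  apply: (@measurable_fun_fubini_tonelli_F _ _ T2 R1 R mu
    (fun z : T2 * R1 => (\1_C (z.1.1 - z.2, z.1.2)%R * seg h z.2)%:E)); first by mf.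
  by move=> z; rewrite lee_fin mulr_ge0 ?seg_ge0// indicE.
- by mf.
- move=> x _; rewrite mulrCA [in leRHS]EFinM.
  apply: lee_wpmul2l; first by rewrite lee_fin sqr_ge0.
  rewrite mulrC [in leRHS]EFinM -(integral_seg h0) -(ge0_integral_EFinZ _ _ ms (@seg_ge0 h)) ?indicE//.
  apply: ge0_le_integral => //.
  + by move=> s _; rewrite lee_fin mulr_ge0 ?seg_ge0// indicE.
  + by mf.
  + by mf.
  move=> s _; rewrite lee_fin /seg !indicE.
  have [/set_mem/=|_] := boolP (s \in `[0, h]%classic); last by rewrite !mulr0.
  rewrite in_itv/= => hs; rewrite !mulr1.
  have [/set_mem/= hC|_] := boolP ((x.1 - s, x.2) \in C); last by rewrite ler0n.
  have := CC' _ _ hC hs; rewrite /= subrK -surjective_pairing => hC'.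
  by rewrite mem_set.
Qed.

Lemma ae_seg_sqr_fin g h : 0 <= h -> L2 L g -> {ae L, forall x, (seg_sqr g h x < +oo)%E}.
Proof.
move=> h0 [mg lg].
have ms := measurable_seg_sqr h mg.
have i : L.-integrable setT (seg_sqr g h).
  apply/integrableP; split=> //.
  apply: (@le_lt_trans _ _ (h%:E * \int[L]_(x in setT) (g x ^+ 2)%:E)%E).
    have -> : (\int[L]_x `|seg_sqr g h x| = \int[L]_x seg_sqr g h x)%E.
      by apply: eq_integral => x _; rewrite gee0_abs ?seg_sqr_ge0.
    exact: seg_sqr_local.
  by rewrite lte_mul_pinfty ?lee_fin.
have := integrable_ae measurableT i.
by apply: filterS => x /(_ I); rewrite ge0_fin_numE ?seg_sqr_ge0.
Qed.

Lemma test_fun_tensor (a b : R -> R) (P : R) : sm a -> sm b ->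
  (forall x, a x != 0 -> `|x| <= P) -> (forall x, b x != 0 -> `|x| <= P) ->
  test_fun (fun x : R * R => a x.1 * b x.2).
Proof.
move=> sa sb ha hb; split.
  exact: sm2_smooth (sm2_mul (sm2_fst sa) (sm2_snd sb)).
exists (P + P) => x hx; apply/eqP; apply: contraTT hx; rewrite mulf_eq0 negb_or.
move=> /andP[/ha h1 /hb h2]; rewrite -leNgt (le_trans (eucl_le_add x))//.
by apply: lerD.
Qed.

(** With [A] a primitive of the first factor of the bump, [(A x - A (x - h)) b] is a test function
    whose derivative along the first axis is the increment of the bump, and it is itself the segment
    average of the bump. Testing the weak derivative with it relates the increment of [f] to [g]. *)
Lemma weak_partial_box_bump f g h p q r s n : 0 < h -> L2 L f -> L2 L g ->
  weak_partial f g (@e1 R) ->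
  exists2 phi : T2 -> R, L2 L phi /\ (forall x,
    (\int[mu]_t (box_bump p q r s n (x.1 - t, x.2)%R * seg h t)%:E = (phi x)%:E)%E) &
  ip L (fun x => f (x + (h, 0)) - f x) (box_bump p q r s n) = ip L g phi.
Proof.
move=> h0 lf lg [_ wp].
have sa := sm_abump p q n; have sb := sm_abump r s n.
have [|x|A sA dA] := @sm_primitive R (abump p q n) p (q + 1) sa.
- by move=> x; rewrite ger0_norm ?abump_ge0 ?abump_le1.
- by move=> /abump_supp[/ltW ? /ltW ?].
have dAh (x : R) : is_derive x 1 (fun y => A y - A (y - h)) (abump p q n x - abump p q n (x - h)).
  apply: is_deriveB.
  have d1 : is_derive x 1 (fun y : R => y - h) 1.
    by have := is_deriveB (is_derive_id x 1) (is_derive_cst h x 1); rewrite subr0.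
  by have := @is_derive1_comp R A (fun y => y - h) x _ _ (dA _) d1; rewrite mulr1.
have sAh : sm (fun y => A y - A (y - h)).
  rewrite (_ : (fun y => _) = (fun y => A y + -1 * A (1 * y + - h))).
    by apply: sm_add => //; apply: sm_scale; exact: sm_aff.
  by apply/funext => y; rewrite mul1r mulN1r.
have AhE (y : R) : (\int[mu]_t (abump p q n (y - t)%R * seg h t)%:E = (A y - A (y - h)%R)%:E)%E.
  rewrite -(int_primitive y _ h0 dA); last by move=> z; exact: sm_continuous.
  rewrite [RHS]integral_mkcond; apply: eq_integral => t _; rewrite patchE /seg indicE.
  by case: (t \in _); rewrite ?mulr1 ?mulr0.
have Ahs y : A y - A (y - h) != 0 -> p <= y /\ y <= q + 1 + h.
  move=> hy; suff : ~ (forall t, 0 <= t <= h -> abump p q n (y - t) = 0).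
    move=> H; split; rewrite leNgt; apply/negP => yp; apply: H => t /andP[t0 th].
      by apply/eqP; apply: contraT => /abump_supp[]; lra.
    by apply/eqP; apply: contraT => /abump_supp[]; lra.
  move=> H; move/negP: hy; apply; apply/eqP.
  apply: EFin_inj; rewrite -AhE integral0_eq// => t _; rewrite /seg indicE.
  have [/set_mem/=|_] := boolP (t \in `[0, h]%classic); last by rewrite mulr0.
  by rewrite in_itv/= => /H ->; rewrite mul0r.
pose phi (x : T2) := (A x.1 - A (x.1 - h)) * abump r s n x.2.
have tphi : test_fun phi.
  apply: (@test_fun_tensor _ _ (`|p| + `|q + 1 + h| + `|r| + `|s + 1|) sAh sb).
    move=> x /Ahs[x1 x2]; have := ler_norm (q + 1 + h); have := lerNnormlW (lexx `|p|).
    have := normr_ge0 r; have := normr_ge0 (s + 1); have := normr_ge0 p; have := normr_ge0 (q + 1 + h).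
    by move=> *; rewrite ler_norml; apply/andP; split; lra.
  move=> x /abump_supp[x1 x2]; have := ler_norm (s + 1); have := lerNnormlW (lexx `|r|).
  have := normr_ge0 r; have := normr_ge0 (s + 1); have := normr_ge0 p; have := normr_ge0 (q + 1 + h).
  by move=> *; rewrite ler_norml; apply/andP; split; lra.
have lphi := test_fun_L2 tphi.
exists phi.
  split=> // x.
  rewrite /phi EFinM -AhE muleC -ge0_integral_EFinZ//; first last.
  - by move=> t; rewrite mulr_ge0 ?abump_ge0 ?seg_ge0.
  - by have ms := measurable_seg h; have ma := measurable_sm sa; mf.
  - exact: abump_ge0.
  by apply: eq_integral => t _; congr (_%:E); rewrite /box_bump/=; ring.
have lB := L2_box_bump p q r s n.
have mps := mpres_shift (h, 0); have mpn := mpres_shift (- h, 0).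
have D1 x : 'D_(@e1 R) phi x = box_bump p q r s n x - box_bump p q r s n (x + (- h, 0)).
  have [b' _ db] := sm_derive sb.
  by rewrite (derive_tensor x dAh db) addrpE /box_bump /= addr0; ring.
rewrite (ip_diff_shift _ lf lB) (_ : (fun x => _ - _) = 'D_(@e1 R) phi); last first.
  by apply/funext => x; rewrite D1; congr (_ - box_bump _ _ _ _ _ (_ + _)); rewrite oppr_pairE oppr0.
apply: EFin_inj; rewrite EFinN -(ip_fin lf (test_fun_L2 (test_fun_derive _ tphi))).
by rewrite (wp _ tphi) oppeK -(ip_fin lg lphi).
Qed.

Lemma ip_fine_seg_int k h (Phi phi : T2 -> R) : 0 <= h -> L2 L k -> (forall x, 0 <= k x) ->
  L2 L Phi -> (forall x, 0 <= Phi x) -> L2 L phi ->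
  (forall x, (\int[mu]_t (Phi (x.1 - t, x.2)%R * seg h t)%:E = (phi x)%:E)%E) ->
  ip L (fun x => fine (seg_int k h x)) Phi = ip L k phi.
Proof.
move=> h0 lk k0 lP P0 lphi hphi; have [mk _] := lk; have [mP _] := lP.
have mki := measurable_seg_int h mk k0.
congr fine; transitivity (\int[L]_x ((Phi x)%:E * seg_int k h x))%E.
  apply: ae_eq_integral => //.
  - by have mfk := measurableT_comp (@fine_measurable _ setT measurableT) mki; mf.
  - by mf.
  have := ae_seg_sqr_fin h0 lk; apply: filterS => x hx _.
  by rewrite seg_int_ip// -EFinM mulrC.
rewrite seg_int_tonelli//; apply: eq_integral => x _.
by rewrite hphi.
Qed.

Lemma le_seg_sqr k g h (x : T2) : measurable_fun setT k -> measurable_fun setT g ->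
  (forall x, k x ^+ 2 <= g x ^+ 2) -> (seg_sqr k h x <= seg_sqr g h x)%E.
Proof.
move=> mk mg kg; have ms := measurable_seg h; apply: ge0_le_integral => //.
- by move=> s _; rewrite lee_fin mulr_ge0 ?sqr_ge0 ?seg_ge0.
- by mf.
- by mf.
- by move=> s _; rewrite lee_fin ler_wpM2r ?seg_ge0.
Qed.

(** Positive and negative part of [g] are averaged separately, since Tonelli is applied to
    nonnegative functions. *)
Definition posp g : T2 -> R := fun x => Num.max (g x) 0.

Lemma sqr_posp_le g x : posp g x ^+ 2 <= g x ^+ 2.
Proof. by rewrite /posp; case: (leP (g x) 0) => h; rewrite ?expr0n ?sqr_ge0. Qed.

Lemma posp_ge0 g x : 0 <= posp g x.
Proof. by rewrite /posp le_max lexx orbT. Qed.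

Lemma pospBN g x : posp g x - posp (fun y => - g y) x = g x.
Proof.
by rewrite /posp; case: (leP (g x) 0) => h1; case: (leP (- g x) 0) => h2; lra.
Qed.

Lemma seg_int_CS g h (x : T2) : 0 < h -> measurable_fun setT g ->
  (((fine (seg_int (posp g) h x) - fine (seg_int (posp (fun y => - g y)) h x)) ^+ 2)%:E
    <= h%:E * seg_sqr g h x)%E.
Proof.
move=> h0 mg; have [q|q] := ltP (seg_sqr g h x) +oo%E; last first.
  have -> : seg_sqr g h x = +oo%E by apply/eqP; rewrite -leye_eq.
  by rewrite gt0_muley ?lte_fin// leey.
have h0' := ltW h0; have mp : measurable_fun setT (posp g) by rewrite /posp; mf.
have mn : measurable_fun setT (posp (fun y => - g y)) by rewrite /posp; mf.
have qp : (seg_sqr (posp g) h x < +oo)%E.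
  by apply: le_lt_trans q; apply: le_seg_sqr => // y; exact: sqr_posp_le.
have qn : (seg_sqr (posp (fun y => - g y)%R) h x < +oo)%E.
  apply: le_lt_trans q; apply: le_seg_sqr => // y.
  by rewrite -[leRHS]sqrrN; exact: sqr_posp_le.
rewrite (seg_int_ip h0' mp qp) (seg_int_ip h0' mn qn) /=.
have lp := slice_L2 mp qp; have ln := slice_L2 mn qn; have lx := slice_L2 mg q.
rewrite -(ipBl lp ln (L2_seg h0')).
have -> : (fun s : R1 => posp g (x.1 + s, x.2) * seg h s - posp (fun y => - g y) (x.1 + s, x.2) * seg h s)
  = (fun s : R1 => g (x.1 + s, x.2) * seg h s).
  by apply/funext => s; rewrite -mulrBl pospBN.
have -> : seg_sqr g h x = N2 mu (fun s : R1 => g (x.1 + s, x.2) * seg h s).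
  by apply: eq_integral => s _; rewrite exprMn sqr_seg.
rewrite (N2_ip lx) -EFinM lee_fin mulrC.
have := ip_CS lx (L2_seg h0').
by have := N2_ip (L2_seg h0'); rewrite N2_seg// => -[<-].
Qed.

(** The increment of [f] minus the segment integral [G] of [g] is orthogonal to all box bumps, hence
    zero almost everywhere; Cauchy-Schwarz on the segment then bounds [G ^ 2] by [h] times the
    integral of [g ^ 2]. *)
Lemma weak_diff_sqr f g h : 0 < h -> L2 L f -> L2 L g -> weak_partial f g (@e1 R) ->
  {ae L, forall x, (((f (x + (h, 0)) - f x) ^+ 2)%:E <= h%:E * seg_sqr g h x)%E}.
Proof.
move=> h0 lf lg wp; have h0' := ltW h0; have [mg fg] := lg.
pose gp := posp g; pose gn := posp (fun y => - g y).
have mp : measurable_fun setT gp by rewrite /gp /posp; mf.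
have mn : measurable_fun setT gn by rewrite /gn /posp; mf.
have lp : L2 L gp by apply: L2_le lg _ => // x; exact: sqr_posp_le.
have ln : L2 L gn by apply: L2_le lg _ => // x; rewrite -[leRHS]sqrrN; exact: sqr_posp_le.
pose G x := fine (seg_int gp h x) - fine (seg_int gn h x).
have GE x : ((G x ^+ 2)%:E <= h%:E * seg_sqr g h x)%E by exact: seg_int_CS.
have mip := measurableT_comp (@fine_measurable _ setT measurableT) (measurable_seg_int h mp (posp_ge0 _)).
have min_ := measurableT_comp (@fine_measurable _ setT measurableT) (measurable_seg_int h mn (posp_ge0 _)).
have ms := measurable_seg_sqr h mg.
have lG0 k : L2 L k -> (forall x, 0 <= k x) -> L2 L (fun x => fine (seg_int k h x)).
  move=> lk k0; have [mk _] := lk.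
  have mik := measurableT_comp (@fine_measurable _ setT measurableT) (measurable_seg_int h mk k0).
  split; first by exact: mik.
  apply: (@le_lt_trans _ _ (\int[L]_x (h%:E * seg_sqr k h x))%E).
    apply: ge0_le_integral => //.
    - by move=> x _; rewrite lee_fin sqr_ge0.
    - by mf.
    - by have msk := measurable_seg_sqr h mk; mf.
    - move=> x _; apply: le_trans (seg_int_CS x h0 mk).
      rewrite lee_fin (_ : posp k = k); last first.
        by apply/funext => y; apply/max_idPl.
      rewrite (_ : posp _ = cst 0); last first.
        by apply/funext => y; apply/max_idPr; rewrite oppr_le0.
      rewrite /seg_int (_ : (\int[mu]_s (cst 0 _ * _)%:E = 0)%E) ?subr0//.
      by apply: integral0_eq => s _; rewrite mul0r.
  rewrite ge0_integralZl//; last 2 first.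
  - exact: measurable_seg_sqr.
  - by move=> x _; exact: seg_sqr_ge0.
  rewrite lte_mul_pinfty//.
  apply: (@le_lt_trans _ _ (h%:E * \int[L]_(x in setT) (k x ^+ 2)%:E)%E).
    exact: seg_sqr_local.
  by rewrite lte_mul_pinfty//; case: lk.
have lGp := lG0 _ lp (posp_ge0 _); have lGn := lG0 _ ln (posp_ge0 _).
have lG : L2 L G := L2B lGp lGn.
have lD : L2 L (fun x => f (x + (h, 0)) - f x) := L2B (L2_mpres (mpres_shift (h, 0)) lf) lf.
have F0 p q r s n : ip L (fun x => f (x + (h, 0)) - f x - G x) (box_bump p q r s n) = 0.
  have lB := L2_box_bump p q r s n.
  have [phi [lphi hphi] e] := weak_partial_box_bump p q r s n h0 lf lg wp.
  rewrite (ipBl lD lG lB) e (ipBl lGp lGn lB).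
  rewrite (ip_fine_seg_int h0' lp (posp_ge0 _) lB (@box_bump_ge0 p q r s n) lphi hphi).
  rewrite (ip_fine_seg_int h0' ln (posp_ge0 _) lB (@box_bump_ge0 p q r s n) lphi hphi).
  rewrite -(ipBl lp ln lphi) (_ : (fun x => gp x - gn x) = g) ?subrr//.
  by apply/funext => x; exact: pospBN.
have := L2_ae0_box_bump (L2B lD lG) F0.
by apply: filterS => x /eqP; rewrite subr_eq0 => /eqP ->; exact: GE.
Qed.

End difference_quotient_formula.

(** * Difference quotients and directional Dirichlet energy *)

Section difference_quotients.
Variable R : realType.
Local Notation mu := (@lebesgue_measure R).
Local Notation L := (@leb2 R).
Local Notation R1 := (measurableTypeR R).
Local Notation T2 := (R1 * R1)%type.
Implicit Types (f g k : T2 -> R) (h : R) (b : bool).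

(** The boolean selects the axis: [false] is the first, [true] the second. *)
Definition axv b h : T2 := if b then (0, h) else (h, 0).
Definition diffq (c : T2) f : T2 -> R := fun x => f (x + c) - f x.

Lemma scaler_pairE (h : R) (x : R * R) : h *: x = (h * x.1, h * x.2).
Proof. by []. Qed.

Lemma axvE b h : h *: (if b then @e2 R else @e1 R) = axv b h.
Proof. by case: b; rewrite scaler_pairE /e1 /e2 /= mulr0 mulr1. Qed.

Lemma L2_diffq c f : L2 L f -> L2 L (diffq c f).
Proof. by move=> lf; apply: L2B => //; exact: (L2_mpres (mpres_shift c) lf). Qed.

Lemma ae_mono (P Q : T2 -> Prop) : (forall x, P x -> Q x) ->
  {ae L, forall x, P x} -> {ae L, forall x, Q x}.
Proof. by move=> PQ; apply: filterS => x; exact: PQ. Qed.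

Lemma integral_indicr (C : set T2) (F : T2 -> R) :
  (\int[L]_(x in C) (F x)%:E = \int[L]_x (F x * \1_C x)%:E)%E.
Proof.
rewrite [LHS]integral_mkcond; apply: eq_integral => x _; rewrite patchE indicE.
by case: (x \in C); rewrite ?mulr1 ?mulr0.
Qed.

(** The localised norm: on thin neighbourhoods of a circle the increments must be controlled by the
    gradient there alone, see [paste_dir]. *)
Definition N2on (C : set T2) f : \bar R := (\int[L]_x (f x ^+ 2 * \1_C x)%:E)%E.

Lemma N2on_mpres phi (C : set T2) f : mpres phi -> measurable C -> measurable_fun setT f ->
  N2on (phi @^-1` C) (fun x => f (phi x)) = N2on C f.
Proof.
move=> [_ h] mC mf; have mC1 : measurable_fun setT (\1_C : T2 -> R) by exact: measurable_indic.
apply: etrans (h (fun x => (f x ^+ 2 * \1_C x)%:E) _ _); last 2 first.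
- by mf.
- by move=> x; rewrite lee_fin mulr_ge0 ?sqr_ge0// indicE.
by apply: eq_integral => x _.
Qed.

Definition swp (x : T2) : T2 := (x.2, x.1).

Lemma mpres_swp : mpres swp. Proof. exact: mpres_swap. Qed.

Lemma weak_diff_local1 f g h (C C' : set T2) : 0 < h -> L2 L f -> L2 L g ->
  weak_partial f g (@e1 R) -> measurable C -> measurable C' ->
  (forall x s, C x -> 0 <= s <= h -> C' (x + axv false s)) ->
  (N2on C (diffq (axv false h) f) <= (h ^+ 2)%:E * N2on C' g)%E.
Proof.
move=> h0 lf lg wp mC mC' CC'; have [mg _] := lg; have h0' := ltW h0.
have [md _] := L2_diffq (axv false h) lf.
have msq := measurable_seg_sqr h mg.
rewrite /N2on -(integral_indicr C (fun x => diffq (axv false h) f x ^+ 2)).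
rewrite -(integral_indicr C' (fun x => g x ^+ 2)).
apply: (@le_trans _ _ (\int[L]_(x in C) (h%:E * seg_sqr g h x))%E).
  apply: ae_ge0_le_integral => //.
  - by move=> x _; rewrite lee_fin sqr_ge0.
  - by apply: measurable_funTS; mf.
  - by move=> x _; rewrite mule_ge0 ?seg_sqr_ge0 ?lee_fin.
  - by apply: measurable_funTS; mf.
  - have W : {ae L, forall x, C x -> ((diffq (axv false h) f x ^+ 2)%:E <= h%:E * seg_sqr g h x)%E}.
      by apply: ae_mono (weak_diff_sqr h0 lf lg wp) => x + _.
    exact: W.
rewrite ge0_integralZl//; last 2 first.
- by apply: measurable_funTS.
- by move=> x _; exact: seg_sqr_ge0.
rewrite expr2 EFinM -muleA lee_wpmul2l ?lee_fin//.
apply: seg_sqr_local => // x s Cx hs.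
by have := CC' x s Cx hs; rewrite /axv addrpE /= addr0.
Qed.

Lemma is_diff_swp (x : R * R) : is_diff x (swp : R * R -> R * R) swp.
Proof.
have := @is_diff_lin R 0 1 1 0 x.
rewrite (_ : (fun y : R * R => _) = swp)//.
by apply/funext => y; rewrite !mul0r !mul1r add0r addr0.
Qed.

Lemma weak_partial_swp f g : measurable_fun setT f ->
  weak_partial f g (@e2 R) -> weak_partial (fun x => f (swp x)) (fun x => g (swp x)) (@e1 R).
Proof.
move=> mf wp; apply: (@weak_partial_lin R swp swp) => //.
- exact: is_diff_swp.
- exact: mpres_swp.
- exact: mpres_swp.
- by case.
- by move=> x; rewrite /eucl /= addrC.
Qed.

(** The second axis is reduced to the first by swapping the coordinates. *)
Lemma weak_diff_local b f g h (C C' : set T2) : 0 < h -> L2 L f -> L2 L g ->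
  weak_partial f g (if b then @e2 R else @e1 R) -> measurable C -> measurable C' ->
  (forall x s, C x -> 0 <= s <= h -> C' (x + axv b s)) ->
  (N2on C (diffq (axv b h) f) <= (h ^+ 2)%:E * N2on C' g)%E.
Proof.
case: b => h0 lf lg wp mC mC' CC'; last exact: weak_diff_local1.
have [mf _] := lf; have [mg _] := lg; have [md _] := L2_diffq (axv true h) lf.
have [msw hsw] := mpres_swp.
pose C1 : set T2 := swp @^-1` C; pose C1' : set T2 := swp @^-1` C'.
have mC1 : measurable C1 by rewrite -[C1]setTI; exact: msw.
have mC1' : measurable C1' by rewrite -[C1']setTI; exact: msw.
have := @weak_diff_local1 _ _ h C1 C1' h0 (L2_mpres mpres_swp lf) (L2_mpres mpres_swp lg)
  (weak_partial_swp mf wp) mC1 mC1'.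
rewrite (N2on_mpres mpres_swp mC' mg).
have -> : diffq (axv false h) (fun y => f (swp y)) = fun x => diffq (axv true h) f (swp x) by [].
rewrite (N2on_mpres mpres_swp mC md).
apply => x s Cx hs.
by have := CC' _ s Cx hs.
Qed.

Lemma weak_diff b f g h : 0 < h -> L2 L f -> L2 L g ->
  weak_partial f g (if b then @e2 R else @e1 R) ->
  (N2 L (diffq (axv b h) f) <= (h ^+ 2)%:E * N2 L g)%E.
Proof.
have N2T k : N2on setT k = N2 L k by apply: eq_integral => x _; rewrite indicE in_setT mulr1.
by move=> h0 lf lg wp; rewrite -!N2T; exact: (weak_diff_local h0 lf lg wp).
Qed.

Lemma test_fun_diff_bound (phi : R * R -> R) d : test_fun phi -> exists2 M : R, 0 <= M &
  forall x h, 0 < h -> `|phi x - phi (x - h *: d)| <= M * h.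
Proof.
move=> tp; have [sp _] := tp; have tdp := test_fun_derive d tp.
have [M [_ [M0 _ hM _]]] := test_compact_bound (smooth_continuous tdp.1) tdp.2.
exists M => // x h h0.
pose G s := phi (x + (s - h) *: d).
have dG (s : R) : is_derive s 1 G ('D_d phi (x + (s - h) *: d)).
  have E : (fun k : R => k^-1 *: ((G \o shift s) (k *: 1) - G s)) =
      (fun k : R => k^-1 *: ((phi \o shift (x + (s - h) *: d)) (k *: d) - phi (x + (s - h) *: d))).
    apply/funext => k; rewrite /G /= /shift; congr (_ *: (phi _ - _)).
    by rewrite [k *: 1]mulr1 -addrA scalerDl addrCA.
  have dv : derivable phi (x + (s - h) *: d) d.
    by apply: diff_derivable; exact: smooth_differentiable.
  by apply: DeriveDef; rewrite /derivable /derive E.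
have [|c _] := MVT h0 (fun s _ => dG s).
  apply: continuous_subspaceT => s; apply: differentiable_continuous.
  by apply/derivable1_diffP; have [] := dG s.
rewrite /G subrr scale0r addr0 sub0r subr0 scaleNr => ->.
rewrite normrM (gtr0_norm h0); apply: ler_wpM2r; [exact: ltW|exact: hM].
Qed.

Lemma cvg_test_fun_quotient (phi : R * R -> R) d (hn : nat -> R) x : test_fun phi ->
  (forall n, 0 < hn n) -> hn n @[n --> \oo] --> (0 : R) ->
  (hn n)^-1 * (phi x - phi (x - hn n *: d)) @[n --> \oo] --> 'D_d phi x.
Proof.
move=> [sp _] h0 hc.
have dv : derivable phi x d by apply: diff_derivable; exact: smooth_differentiable.
have hc' : (fun n => - hn n) @ \oo --> (0 : R)^'.
  have hc2 : (fun n => - hn n) @ \oo --> (0 : R).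
    by rewrite -[X in _ --> X]oppr0; exact: cvgN.
  have hn0 n : - hn n != 0 :> R by rewrite oppr_eq0 gt_eqF.
  move=> A /= hA; have h1 : \forall n \near \oo, - hn n != 0 -> A (- hn n) := hc2 _ hA.
  have h2 : \forall n \near \oo, A (- hn n) by apply: filterS h1 => n; apply; exact: hn0.
  exact: h2.
have := cvg_comp _ _ hc' dv; apply: cvg_trans; apply: near_eq_cvg; apply: nearW => n /=.
by rewrite /shift /= scaleNr (addrC _ x) invrN -[_ *: _]/(_ * _) mulNr -mulrN opprB.
Qed.

Lemma cvg_ip_test_quotient f (phi : R * R -> R) d (hn : nat -> R) : L2 L f -> test_fun phi ->
  (forall n, 0 < hn n <= 1) -> hn n @[n --> \oo] --> (0 : R) ->
  ip L f (fun x => (hn n)^-1 * (phi x - phi (x - hn n *: d))) @[n --> \oo] --> ip L f ('D_d phi).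
Proof.
move=> lf tp h01 hc.
have h0 n : 0 < hn n by case/andP: (h01 n).
have [M M0 hM] := test_fun_diff_bound d tp.
have [K [P [K0 P0 _ hP]]] := test_compact_bound (smooth_continuous tp.1) tp.2.
(* Since the steps are at most 1, the supports of [phi] and of its shifts all lie in the box of
   half-width [Q]; the dominating function is constant there. *)
pose Q := P + `|d.1| + `|d.2|.
have mphi := continuous_measurable2 (smooth_continuous tp.1).
have mdphi := continuous_measurable2 (smooth_continuous (test_fun_derive d tp).1).
pose B : T2 -> R := fun x => M * \1_(`[- Q, Q]%classic `*` `[- Q, Q]%classic) x.
have mB : measurable_fun setT B.
  have m1 : measurable_fun setT (\1_(`[- Q, Q]%classic `*` `[- Q, Q]%classic) : T2 -> R).
    by apply: measurable_indic; apply: measurableX.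
  by rewrite /B; mf.
have lB : L2 L B.
  apply: (@L2_bounded_support _ _ M Q) => //.
  - move=> x; rewrite /B indicE; case: (_ \in _); rewrite ?mulr1 ?mulr0 ?normr0// ger0_norm//.
  - move=> x; rewrite /B indicE; case: (boolP (x \in _)); last by rewrite mulr0 eqxx.
    by rewrite inE/= !in_itv/= !ler_norml => -[-> ->].
apply: (cvg_ip_dominated lf lB).
- move=> n; have mq : measurable_fun setT (fun x : T2 => phi (x - hn n *: d)).
    have [ms _] := mpres_shift (- (hn n *: d)); exact: (measurableT_comp mphi ms).
  by mf.
- exact: mdphi.
- move=> n x; rewrite /B indicE; case: (boolP (x \in _)) => xQ.
    rewrite mulr1 normrM gtr0_norm ?invr_gt0// ler_pdivrMl// mulrC.
    exact: hM.
  rewrite mulr0; have -> : phi x = 0.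
    apply/eqP; apply: contraNT xQ => /hP[]; rewrite !ler_norml inE/= !in_itv/= /Q.
    by have := normr_ge0 d.1; have := normr_ge0 d.2; lra.
  have -> : phi (x - hn n *: d) = 0.
    apply/eqP; apply: contraNT xQ => /hP[]; rewrite scaler_pairE addrpE oppr_pairE/=.
    have b (y : R) : `|hn n * y| <= `|y|.
      by rewrite normrM gtr0_norm// ler_piMl//; case/andP: (h01 n).
    have b1 := b d.1; have b2 := b d.2.
    rewrite !ler_norml inE/= !in_itv/= /Q => h1 h2; move: b1 b2 h1 h2.
    rewrite !ler_norml; have := normr_ge0 d.1; have := normr_ge0 d.2.
    clear => ? ? /andP[? ?] /andP[? ?] /andP[? ?] /andP[? ?].
    by split; apply/andP; split; lra.
  by rewrite subrr mulr0 normr0.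
- by move=> x; exact: cvg_test_fun_quotient.
Qed.

(** Along a sequence of good steps, the quotients tested with [phi] tend to minus the pairing of [f]
    with the derivative of [phi], and Cauchy-Schwarz bounds that functional by [M] times the squared
    norm of [phi]. Riesz gives the weak derivative, with norm controlled by the same [M]. *)
Lemma weak_partial_of_diffq b f M : L2 L f -> 0 <= M ->
  (forall t, 0 < t -> exists h, [/\ 0 < h, h < t & (N2 L (diffq (axv b h) f) <= (M * h ^+ 2)%:E)%E]) ->
  exists g, [/\ L2 L g, (N2 L g <= M%:E)%E & weak_partial f g (if b then @e2 R else @e1 R)].
Proof.
move=> lf M0 H; set d := if b then @e2 R else @e1 R.
have /choice[hn hhn] : forall n, exists h, [/\ 0 < h, h < n.+1%:R^-1 &
    (N2 L (diffq (axv b h) f) <= (M * h ^+ 2)%:E)%E] by move=> n; apply: H.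
have hn01 n : 0 < hn n <= 1.
  have [-> /ltW h _] := hhn n; rewrite /= (le_trans h)// invf_le1 ?ltr0n//.
  by rewrite ler1n.
have hnc : hn n @[n --> \oo] --> (0 : R).
  apply: (squeeze_cvgr _ (cvg_cst 0) cvg_harmonic).
  by apply: nearW => n; have [/ltW -> /ltW h _] := hhn n.
have smd (phi : R * R -> R) x : test_fun phi -> derivable phi x d.
  by move=> [sp _]; apply: diff_derivable; exact: smooth_differentiable.
pose l (phi : T2 -> R) := - ip L f ('D_d (phi : R * R -> R)).
have ld (phi : R * R -> R) : test_fun phi -> L2 L ('D_d phi : T2 -> R).
  by move=> tp; apply: test_fun_L2; exact: test_fun_derive.
have [] := @L2_riesz _ T2 R L (fun phi => test_fun (phi : R * R -> R)) l M.
- have := sm_abump 0 0 0 => s1.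
  have t0 : test_fun (fun x : R * R => @abump R 0 0 0 x.1 * @abump R 0 0 0 x.2).
    apply: (@test_fun_tensor R _ _ 1) => //.
    + by move=> x /abump_supp[]; rewrite ler_norml; lra.
    + by move=> x /abump_supp[]; rewrite ler_norml; lra.
  have := test_funZ 0 t0; rewrite (_ : (fun x => _) = fun=> 0)//.
  by apply/funext => x; rewrite mul0r.
- by move=> phi; exact: test_fun_L2.
- by move=> phi psi; exact: test_funD.
- by move=> k phi; exact: test_funZ.
- move=> phi psi tp tq; rewrite /l (_ : 'D_d _ = fun x => 'D_d phi x + 'D_d psi x).
    by rewrite (ipDr (ld _ tp) (ld _ tq) lf) opprD.
  by apply/funext => x; rewrite (deriveD (smd _ x tp) (smd _ x tq)).
- move=> k phi tp; rewrite /l (_ : 'D_d _ = fun x => k * 'D_d phi x).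
    by rewrite (ipZr k (ld _ tp) lf) mulrN.
  by apply/funext => x; rewrite (deriveZ k (smd _ x tp)).
- by [].
- move=> phi tp; have lp := test_fun_L2 tp.
  have c := cvg_ip_test_quotient (d := d) lf tp hn01 hnc.
  rewrite /l sqrrN.
  have c2 : ip L f (fun x => (hn n)^-1 * (phi x - phi (x - hn n *: d))) ^+ 2 @[n --> \oo] -->
      ip L f ('D_d phi) ^+ 2 by apply: cvgM.
  rewrite -(cvg_lim _ c2)//; apply: limr_le.
    by apply/cvg_ex; exists (ip L f ('D_d phi) ^+ 2).
  apply: nearW => n; have [h0 _ hN] := hhn n.
  have lq : L2 L (fun x => phi (x - hn n *: d)) := L2_mpres (mpres_shift (- (hn n *: d))) lp.
  rewrite (ipZr _ (L2B lp lq) lf) -[ip L f _]opprK -(ip_diff_shift (hn n *: d) lf lp).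
  have lD := L2_diffq (axv b (hn n)) lf.
  rewrite axvE mulrN sqrrN exprMn.
  have := ip_CS lD lp.
  move: hN; rewrite (N2_ip lD) lee_fin => hN cs.
  rewrite exprVn ler_pdivrMl ?exprn_gt0//; apply: le_trans cs _.
  rewrite mulrCA mulrA; apply: ler_wpM2r; first exact: ip_ge0.
  exact: hN.
move=> g [lg gM gl]; exists g; split => //; split; first by case: lg.
move=> phi tp; have lp := test_fun_L2 tp.
by rewrite (ip_fin lf (ld _ tp)) (ip_fin lg lp) gl// /l EFinN oppeK.
Qed.

(** Passing through the weak derivative upgrades a bound for some arbitrarily small steps to all
    steps, with no loss in the constant. This is what allows averaging arguments that see no
    individual step. *)
Lemma diffq_bound_all b f M : L2 L f -> 0 <= M ->
  (forall t, 0 < t -> exists h, [/\ 0 < h, h < t & (N2 L (diffq (axv b h) f) <= (M * h ^+ 2)%:E)%E]) ->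
  forall h, 0 < h -> (N2 L (diffq (axv b h) f) <= (M * h ^+ 2)%:E)%E.
Proof.
move=> lf M0 H h h0; have [g [lg gM wp]] := weak_partial_of_diffq lf M0 H.
apply: le_trans (weak_diff h0 lf lg wp) _.
by rewrite [in leRHS]mulrC [in leRHS]EFinM; apply: lee_wpmul2l; rewrite ?lee_fin ?sqr_ge0.
Qed.

End difference_quotients.

(** * Directional Dirichlet energies *)

Section directional_energy.
Variable R : realType.
Local Notation mu := (@lebesgue_measure R).
Local Notation L := (@leb2 R).
Local Notation R1 := (measurableTypeR R).
Local Notation T2 := (R1 * R1)%type.
Implicit Types (f g k : T2 -> R) (h : R) (b : bool).

Definition dir_le b f (M : R) := forall h, 0 < h ->
  (N2 L (diffq (axv b h) f) <= (M * h ^+ 2)%:E)%E.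

(** This says that [s] is the squared norm of the partial derivative along one axis, with no
    derivative mentioned: [s] is both an upper bound of the normalised quotients and their limit at
    small steps. *)
Definition is_dir b f (s : R) := [/\ 0 <= s, dir_le b f s &
  forall e, 0 < e -> exists2 t, 0 < t & forall h, 0 < h -> h < t ->
    (((s - e) * h ^+ 2)%:E <= N2 L (diffq (axv b h) f))%E].

Lemma is_dir_min b f s M : is_dir b f s ->
  (forall t, 0 < t -> exists h, [/\ 0 < h, h < t & (N2 L (diffq (axv b h) f) <= (M * h ^+ 2)%:E)%E]) ->
  s <= M.
Proof.
move=> [s0 _ sl] fM; apply/ler_addgt0Pr => e e0; have [t t0 h] := sl _ e0.
have [k [k0 kt kM]] := fM _ t0.
have := le_trans (h _ k0 kt) kM; rewrite lee_fin ler_pM2r ?exprn_gt0//.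
by rewrite lerBlDr.
Qed.

Lemma dir_le_freq b f M : dir_le b f M ->
  (forall t, 0 < t -> exists h, [/\ 0 < h, h < t & (N2 L (diffq (axv b h) f) <= (M * h ^+ 2)%:E)%E]).
Proof.
move=> fM t t0; exists (t / 2); split; [by rewrite divr_gt0| |].
  by rewrite ltr_pdivrMr// ltr_pMr// ltr1n.
by apply: fM; rewrite divr_gt0.
Qed.

(** The infimum of the admissible constants works. If the lower bound failed for some [e], then the
    infimum minus [e] would be a bound at arbitrarily small steps, hence admissible by
    [diffq_bound_all]. *)
Lemma is_dir_exists b f M : L2 L f -> 0 <= M ->
  (forall t, 0 < t -> exists h, [/\ 0 < h, h < t & (N2 L (diffq (axv b h) f) <= (M * h ^+ 2)%:E)%E]) ->
  exists2 s, s <= M & is_dir b f s.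
Proof.
move=> lf M0 /(diffq_bound_all lf M0) fM.
pose A := [set m | 0 <= m /\ dir_le b f m].
have A0 : has_inf A by split; [exists M|exists 0 => m []].
have sM : inf A <= M by apply: ge_inf => //; exists 0 => m [].
exists (inf A) => //.
have s0 : 0 <= inf A by apply: lb_le_inf; [exists M|move=> m []].
split=> //.
- move=> h h0; have lD := L2_diffq (axv b h) lf; rewrite (N2_ip lD) lee_fin.
  rewrite -ler_pdivrMr ?exprn_gt0//; apply: lb_le_inf; first by exists M.
  by move=> m [_ /(_ _ h0)]; rewrite (N2_ip lD) lee_fin ler_pdivrMr ?exprn_gt0.
- move=> e e0; apply: contrapT => H.
  have [se|se] := leP (inf A - e) 0.
    apply: H; exists 1 => // h h0 _; apply: le_trans (N2_ge0 _ _).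
    by rewrite lee_fin mulr_le0_ge0// sqr_ge0.
  have : inf A <= inf A - e.
    apply: ge_inf; first by exists 0 => m [].
    split; first exact: ltW.
    apply: (diffq_bound_all lf (ltW se)) => t t0; apply: contrapT => K.
    apply: H; exists t => // h h0 ht; rewrite leNgt; apply/negP => hh.
    by apply: K; exists h; split => //; exact: ltW.
  by move: e0; lra.
Qed.

Lemma is_dir_ext b f g s : (forall h, 0 < h -> N2 L (diffq (axv b h) f) = N2 L (diffq (axv b h) g)) ->
  is_dir b f s -> is_dir b g s.
Proof.
move=> fg [s0 h1 h2]; split=> //.
- by move=> h h0; rewrite -fg//; exact: h1.
- by move=> e /h2[t t0 ht]; exists t => // h h0 hh; rewrite -fg//; exact: ht.
Qed.

Lemma is_dir0 b : is_dir b (fun=> 0) 0.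
Proof.
have E h : N2 L (diffq (axv b h) (fun=> 0)) = 0%E.
  by apply: integral0_eq => x _; rewrite /diffq subrr expr0n.
split=> //.
- by move=> h h0; rewrite E mul0r.
- by move=> e e0; exists 1 => // h h0 _; rewrite E lee_fin mulr_le0_ge0 ?sqr_ge0// sub0r oppr_le0 ltW.
Qed.

Lemma weak_partial_dir b f g s : L2 L f -> L2 L g -> is_dir b f s ->
  weak_partial f g (if b then @e2 R else @e1 R) -> (s%:E <= N2 L g)%E.
Proof.
move=> lf lg hs wp; rewrite (N2_ip lg) lee_fin; apply: (is_dir_min hs).
apply: dir_le_freq => h h0; rewrite mulrC EFinM -(N2_ip lg).
exact: weak_diff.
Qed.

Lemma dir_weak_partial b f s : L2 L f -> is_dir b f s ->
  exists g, [/\ L2 L g, (N2 L g <= s%:E)%E & weak_partial f g (if b then @e2 R else @e1 R)].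
Proof.
by move=> lf [s0 h _]; apply: weak_partial_of_diffq => //; exact: dir_le_freq.
Qed.

Lemma is_dir_of_weak_partial b f g : L2 L f -> L2 L g ->
  weak_partial f g (if b then @e2 R else @e1 R) -> exists s, is_dir b f s.
Proof.
move=> lf lg wp; have [|s _ hs] := @is_dir_exists b f (ip L g g) lf (ip_ge0 _ _).
  apply: dir_le_freq => h h0; rewrite mulrC EFinM -(N2_ip lg).
  exact: weak_diff.
by exists s.
Qed.

Lemma integral_sqr4 (g1 g2 h1 h2 : T2 -> R) : measurable_fun setT g1 -> measurable_fun setT g2 ->
  measurable_fun setT h1 -> measurable_fun setT h2 ->
  (\int[L]_x (g1 x ^+ 2 + g2 x ^+ 2 + h1 x ^+ 2 + h2 x ^+ 2)%:E =
   N2 L g1 + N2 L g2 + N2 L h1 + N2 L h2)%E.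
Proof.
move=> m1 m2 m3 m4.
have D (f g : T2 -> R) : measurable_fun setT f -> measurable_fun setT g ->
    (forall x, 0 <= f x) -> (forall x, 0 <= g x) ->
    (\int[L]_x (f x + g x)%:E = \int[L]_x (f x)%:E + \int[L]_x (g x)%:E)%E.
  move=> mf mg f0 g0; rewrite -ge0_integralD//.
  - by move=> x _; rewrite lee_fin.
  - by mf.
  - by move=> x _; rewrite lee_fin.
  - by mf.
rewrite D; [|by mf|by mf|by move=> x; rewrite !addr_ge0 ?sqr_ge0|by move=> x; rewrite sqr_ge0].
rewrite D; [|by mf|by mf|by move=> x; rewrite !addr_ge0 ?sqr_ge0|by move=> x; rewrite sqr_ge0].
by rewrite D; [|by mf|by mf|by move=> x; rewrite sqr_ge0|by move=> x; rewrite sqr_ge0].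
Qed.

Definition Rep (u : R * R -> R[i]) : T2 -> R := fun x => complex.Re (u x).
Definition Imp (u : R * R -> R[i]) : T2 -> R := fun x => complex.Im (u x).

Lemma L2_sum4_fin (g1 g2 h1 h2 : T2 -> R) : measurable_fun setT g1 -> measurable_fun setT g2 ->
  measurable_fun setT h1 -> measurable_fun setT h2 ->
  (\int[L]_x (g1 x ^+ 2 + g2 x ^+ 2 + h1 x ^+ 2 + h2 x ^+ 2)%:E < +oo)%E ->
  [/\ L2 L g1, L2 L g2, L2 L h1 & L2 L h2].
Proof.
move=> m1 m2 m3 m4 H.
have K g : measurable_fun setT g ->
    (forall x, g x ^+ 2 <= g1 x ^+ 2 + g2 x ^+ 2 + h1 x ^+ 2 + h2 x ^+ 2) -> L2 L g.
  move=> mg gl; split=> //; apply: le_lt_trans H; apply: ge0_le_integral => //.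
  - by move=> x _; rewrite lee_fin sqr_ge0.
  - by mf.
  - by mf.
  - by move=> x _; rewrite lee_fin.
by split; apply: K => // x; have := sqr_ge0 (g1 x); have := sqr_ge0 (g2 x);
  have := sqr_ge0 (h1 x); have := sqr_ge0 (h2 x); lra.
Qed.

(** Riesz produces weak derivatives of norm at most the directional energies, and any weak
    derivative has at least that norm; so the infimum in [dirichlet] is their sum. *)
Lemma dirichletE u s1 s2 t1 t2 : L2 L (Rep u) -> L2 L (Imp u) ->
  is_dir false (Rep u) s1 -> is_dir true (Rep u) s2 ->
  is_dir false (Imp u) t1 -> is_dir true (Imp u) t2 ->
  dirichlet u = (s1 + s2 + t1 + t2)%:E.
Proof.
move=> lR lI d1 d2 d3 d4; apply/eqP; rewrite eq_le; apply/andP; split.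
  have [g1 [l1 n1 w1]] := dir_weak_partial lR d1.
  have [g2 [l2 n2 w2]] := dir_weak_partial lR d2.
  have [g3 [l3 n3 w3]] := dir_weak_partial lI d3.
  have [g4 [l4 n4 w4]] := dir_weak_partial lI d4.
  apply: (@le_trans _ _ (\int[L]_x (g1 x ^+ 2 + g2 x ^+ 2 + g3 x ^+ 2 + g4 x ^+ 2)%:E)%E).
    by apply: ereal_inf_lbound; exists g1, g2, g3, g4; split.
  rewrite integral_sqr4; [|by case: l1|by case: l2|by case: l3|by case: l4].
  by rewrite !EFinD; do ?apply: leeD.
apply: le_ereal_inf_tmp => z [g1 [g2 [g3 [g4 [w1 w2 w3 w4 ->]]]]].
have [m1 _] := w1; have [m2 _] := w2; have [m3 _] := w3; have [m4 _] := w4.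
have [z1|z1] := leP +oo%E (\int[L]_x (g1 x ^+ 2 + g2 x ^+ 2 + g3 x ^+ 2 + g4 x ^+ 2)%:E)%E.
  by apply: le_trans z1; rewrite leey.
have [l1 l2 l3 l4] := L2_sum4_fin m1 m2 m3 m4 z1.
rewrite [leRHS](integral_sqr4 m1 m2 m3 m4) !EFinD.
do ?apply: leeD.
- exact: (weak_partial_dir lR l1 d1 w1).
- exact: (weak_partial_dir lR l2 d2 w2).
- exact: (weak_partial_dir lI l3 d3 w3).
- exact: (weak_partial_dir lI l4 d4 w4).
Qed.

Lemma dirichlet_fin u : L2 L (Rep u) -> L2 L (Imp u) -> (dirichlet u < +oo)%E ->
  exists s1 s2 t1 t2, [/\ is_dir false (Rep u) s1, is_dir true (Rep u) s2,
    is_dir false (Imp u) t1 & is_dir true (Imp u) t2].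
Proof.
move=> lR lI /ereal_inf_lt[z [g1 [g2 [g3 [g4 [w1 w2 w3 w4 ->]]]]] hz].
have [m1 _] := w1; have [m2 _] := w2; have [m3 _] := w3; have [m4 _] := w4.
have [l1 l2 l3 l4] := L2_sum4_fin m1 m2 m3 m4 hz.
have [s1 d1] := @is_dir_of_weak_partial false _ _ lR l1 w1.
have [s2 d2] := @is_dir_of_weak_partial true _ _ lR l2 w2.
have [s3 d3] := @is_dir_of_weak_partial false _ _ lI l3 w3.
have [s4 d4] := @is_dir_of_weak_partial true _ _ lI l4 w4.
by exists s1, s2, s3, s4.
Qed.

Lemma is_dir_shift b f c s : is_dir b f s -> measurable_fun setT f ->
  is_dir b (fun x => f (x + c)) s.
Proof.
move=> hs mf; apply: is_dir_ext hs => h h0.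
have mD : measurable_fun setT (diffq (axv b h) f).
  by have [ms _] := mpres_shift (axv b h); rewrite /diffq; mf.
rewrite -(N2_mpres (mpres_shift c) mD); congr (N2 L _); apply/funext => x.
by rewrite /diffq addrAC.
Qed.

(** In the plane the Jacobian of the dilation cancels the square of the derivative factor, so [k]
    drops out and only the amplitude [a] is seen. *)
Lemma is_dir_scale b f (k a s : R) : 0 < k -> is_dir b f s -> measurable_fun setT f ->
  is_dir b (fun x => a * f (k * x.1, k * x.2)) (a ^+ 2 * s).
Proof.
move=> k0 [s0 h1 h2] mf.
have E h : 0 < h -> N2 L (diffq (axv b h) (fun x => a * f (k * x.1, k * x.2))) =
   ((a ^+ 2 / k ^+ 2)%:E * N2 L (diffq (axv b (k * h)) f))%E.
  move=> h0.
  have mD : measurable_fun setT (diffq (axv b (k * h)) f).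
    by have [ms _] := mpres_shift (axv b (k * h)); rewrite /diffq; mf.
  rewrite /N2 -(leb2_scale k0 (F := fun x => (diffq (axv b (k * h)) f x ^+ 2)%:E)); first last.
  - by move=> x; rewrite lee_fin sqr_ge0.
  - by mf.
  rewrite muleA -EFinM divfK ?gt_eqF ?exprn_gt0// -ge0_integral_EFinZ ?sqr_ge0//; first last.
  - by move=> x; rewrite sqr_ge0.
  - by mf.
  apply: eq_integral => x _; rewrite -exprMn; congr ((_ ^+ 2)%:E).
  rewrite /diffq -mulrBr; congr (a * (f _ - _)); rewrite /axv.
  by case: (b); rewrite !addrpE /= ?addr0 mulrDr.
split; first by rewrite mulr_ge0 ?sqr_ge0.
- move=> h h0; rewrite E//.
  apply: (@le_trans _ _ ((a ^+ 2 / k ^+ 2)%:E * (s * (k * h) ^+ 2)%:E)%E).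
    by rewrite lee_wpmul2l ?lee_fin ?divr_ge0 ?sqr_ge0//; apply: h1; rewrite mulr_gt0.
  by rewrite -EFinM lee_fin exprMn le_eqVlt; apply/orP; left; apply/eqP; field; rewrite gt_eqF.
- move=> e e0; have [a0|a0] := eqVneq a 0.
    exists 1 => // h h0 _; rewrite a0 expr0n mul0r sub0r; apply: le_trans (N2_ge0 _ _).
    by rewrite lee_fin mulr_le0_ge0 ?sqr_ge0// oppr_le0 ltW.
  have a2 : 0 < a ^+ 2 by rewrite exprn_even_gt0.
  have [t t0 ht] := h2 (e / a ^+ 2) (divr_gt0 e0 a2).
  exists (t / k); first by rewrite divr_gt0.
  move=> h h0; rewrite ltr_pdivlMr// mulrC => hk; rewrite E//.
  have := ht _ (mulr_gt0 k0 h0) hk => hh.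
  apply: (@le_trans _ _ ((a ^+ 2 / k ^+ 2)%:E * ((s - e / a ^+ 2) * (k * h) ^+ 2)%:E)%E).
    rewrite -EFinM lee_fin exprMn le_eqVlt; apply/orP; left; apply/eqP; field.
    by rewrite a0 gt_eqF.
  by rewrite lee_wpmul2l ?lee_fin ?divr_ge0 ?sqr_ge0.
Qed.

End directional_energy.

(** * The logarithmic kernel *)

Section rotation.
Variable R : realType.
Local Notation L := (@leb2 R).
Local Notation R1 := (measurableTypeR R).
Local Notation T2 := (R1 * R1)%type.
Implicit Types (f g : T2 -> R).

Lemma derive_comb (phi : R * R -> R) (c s : R) x : smooth phi ->
  'D_(c, s) phi x = c * 'D_(@e1 R) phi x + s * 'D_(@e2 R) phi x.
Proof.
move=> sp; have dp := smooth_differentiable x sp.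
rewrite !deriveE// (_ : (c, s) = c *: @e1 R + s *: @e2 R).
  by rewrite linearD !linearZ.
by rewrite !scaler_pairE addrpE /= !mulr0 !mulr1 addr0 add0r.
Qed.

Lemma weak_partial_comb f g1 g2 (c s : R) : L2 L f -> L2 L g1 -> L2 L g2 ->
  weak_partial f g1 (@e1 R) -> weak_partial f g2 (@e2 R) ->
  weak_partial f (fun x => c * g1 x + s * g2 x) (c, s).
Proof.
move=> lf l1 l2 [m1 w1] [m2 w2]; split.
  have {}m1 : measurable_fun setT (g1 : T2 -> R) := m1.
  have {}m2 : measurable_fun setT (g2 : T2 -> R) := m2.
  suff : measurable_fun setT (fun x : T2 => c * g1 x + s * g2 x) by [].
  by mf.
move=> phi tp; have lp := test_fun_L2 tp.
have ld1 := test_fun_L2 (test_fun_derive (@e1 R) tp).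
have ld2 := test_fun_L2 (test_fun_derive (@e2 R) tp).
have lc := L2D (L2Z c ld1) (L2Z s ld2); have lg := L2D (L2Z c l1) (L2Z s l2).
have E1 := w1 _ tp; have E2 := w2 _ tp.
rewrite (ip_fin lf ld1) (ip_fin l1 lp) -EFinN in E1.
rewrite (ip_fin lf ld2) (ip_fin l2 lp) -EFinN in E2.
have -> : (\int[L]_x (f x * 'D_(c, s) phi x)%:E =
    \int[L]_x (f x * (c * 'D_(@e1 R) phi x + s * 'D_(@e2 R) phi x))%:E)%E.
  by apply: eq_integral => x _; rewrite derive_comb//; case: tp.
rewrite (ip_fin lf lc) (ip_fin lg lp) -EFinN; congr (_%:E).
rewrite (ipDr (L2Z c ld1) (L2Z s ld2) lf) (ipZr c ld1 lf) (ipZr s ld2 lf).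
rewrite (ipDl (L2Z c l1) (L2Z s l2) lp) (ipZl c l1 lp) (ipZl s l2 lp).
by case: E1 => ->; case: E2 => ->; ring.
Qed.

(** The two directional energies are mixed by a rotation, and only the sum is controlled: the
    rotated weak gradient has the same total norm. For minimisers an inequality is enough, as
    minimality supplies the converse. *)
Lemma is_dir_rot f (c s s1 s2 : R) : c ^+ 2 + s ^+ 2 = 1 -> L2 L f ->
  is_dir false f s1 -> is_dir true f s2 ->
  exists t1 t2, [/\ is_dir false (fun x => f (plane_rot c s x)) t1,
    is_dir true (fun x => f (plane_rot c s x)) t2 & t1 + t2 <= s1 + s2].
Proof.
move=> cs lf d1 d2; have [mf _] := lf.
have [g1 [l1 n1 w1]] := dir_weak_partial lf d1.
have [g2 [l2 n2 w2]] := dir_weak_partial lf d2.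
have mr := mpres_rot cs.
have cs' : c ^+ 2 + (- s) ^+ 2 = 1 by rewrite sqrrN.
have mr' := mpres_rot cs'.
have rK : cancel (plane_rot c s) (plane_rot c (- s)).
  move=> [a b]; rewrite /plane_rot /=; congr (_, _).
    by rewrite -[RHS]mul1r -cs; ring.
  by rewrite -[RHS]mul1r -cs; ring.
have dr x : is_diff x (plane_rot c (- s) : R * R -> R * R) (plane_rot c (- s)).
  have := @is_diff_lin R c s (- s) c x.
  rewrite (_ : (fun y : R * R => _) = plane_rot c (- s))//.
  by apply/funext => y; rewrite /plane_rot; congr (_, _); ring.
have er x : eucl (plane_rot c (- s) x) = eucl x.
  by rewrite /eucl /plane_rot /=; congr (Num.sqrt _); rewrite -[RHS]mul1r -cs; ring.
have lG1 := L2D (L2Z c l1) (L2Z s l2); have lG2 := L2D (L2Z (- s) l1) (L2Z c l2).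
have re1 : plane_rot c s (@e1 R) = (c, s) by rewrite /plane_rot /= !mulr1 !mulr0 subr0 addr0.
have re2 : plane_rot c s (@e2 R) = (- s, c) by rewrite /plane_rot /= !mulr1 !mulr0 sub0r add0r.
have W1 := weak_partial_comb c s lf l1 l2 w1 w2; rewrite -re1 in W1.
have W2 := weak_partial_comb (- s) c lf l1 l2 w1 w2; rewrite -re2 in W2.
have V1 := weak_partial_lin dr mr mr' rK er mf W1.
have V2 := weak_partial_lin dr mr mr' rK er mf W2.
have lfr := L2_mpres mr lf; have lH1 := L2_mpres mr lG1; have lH2 := L2_mpres mr lG2.
have [t1 e1] := @is_dir_of_weak_partial _ false _ _ lfr lH1 V1.
have [t2 e2] := @is_dir_of_weak_partial _ true _ _ lfr lH2 V2.
exists t1, t2; split=> //.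
have := @weak_partial_dir _ false _ _ _ lfr lH1 e1 V1.
have := @weak_partial_dir _ true _ _ _ lfr lH2 e2 V2.
have [mG1 _] := lG1; have [mG2 _] := lG2.
rewrite (N2_mpres mr mG1) (N2_mpres mr mG2) (N2_ip lG1) (N2_ip lG2) !lee_fin.
move: n1 n2; rewrite (N2_ip l1) (N2_ip l2) !lee_fin => n1 n2.
rewrite (ip_sqrD (L2Z c l1) (L2Z s l2)) (ip_sqrD (L2Z (- s) l1) (L2Z c l2)).
rewrite !(ipZl _ _ (L2Z _ _))// !ipZr//.
move=> h2 h1; apply: le_trans (lerD h1 h2) _.
apply: le_trans (lerD n1 n2); rewrite le_eqVlt; apply/orP; left; apply/eqP.
by rewrite -[RHS]mul1r -cs; ring.
Qed.

End rotation.

(** * Integrability of the logarithmic kernel *)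

Section log_kernel.
Variable R : realType.
Local Notation mu := (@lebesgue_measure R).
Local Notation L := (@leb2 R).
Local Notation R1 := (measurableTypeR R).
Local Notation T2 := (R1 * R1)%type.
Implicit Types (f g : T2 -> R) (rho sig : T2 -> R).

(** A trace estimate. Let [F] and [G] be [f] and its shift by [h], both cut off to the half-plane
    [x.1 > a]. The mass of the strip is the difference of their squared norms, that is, the product
    of [F - G] and [F + G]; the first factor has squared norm at most [s h ^ 2], the second at most
    [4 l]. *)
Lemma strip_bound f (s l a h : R) : L2 L f -> dir_le false f s -> 0 <= s -> N2 L f = l%:E -> 0 < h ->
  (N2on [set x | a < x.1 <= a + h]%R f <= (h * (s + l))%:E)%E.
Proof.
move=> lf ds s0 Nl h0; have [mf _] := lf.
have l0 : 0 <= l by rewrite -lee_fin -Nl N2_ge0.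
pose ch (x : T2) : R := if a < x.1 then 1 else 0.
have mch : measurable_fun setT ch by rewrite /ch; mf.
pose F x := ch x * f x; pose G x := ch x * f (x + (h, 0)).
have lfh := L2_mpres (mpres_shift (h, 0)) lf; have [mfh _] := lfh.
have ch1 (x : T2) (y : R) : (ch x * y) ^+ 2 <= y ^+ 2.
  by rewrite /ch; case: ifP => _; rewrite ?mul1r// mul0r expr0n sqr_ge0.
have lF : L2 L F by apply: L2_le lf _ => [|x]; [rewrite /F; mf|exact: ch1].
have lG : L2 L G by apply: L2_le lfh _ => [|x]; [rewrite /G; mf|exact: ch1].
have FE : N2 L F = (N2on [set x | a < x.1 <= a + h]%R f + N2 L G)%E.
  have -> : N2 L G = (\int[L]_x ((if (a + h < x.1)%R then 1 else 0) * f x ^+ 2)%:E)%E.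
    rewrite -((mpres_shift (h, 0)).2 (fun x => ((if (a + h < x.1)%R then 1 else 0) * f x ^+ 2)%:E)); first last.
    - by move=> x; rewrite lee_fin mulr_ge0 ?sqr_ge0//; case: ifP.
    - by mf.
    apply: eq_integral => x _; rewrite /G exprMn addrpE /= ltrD2r /ch.
    by case: ifP; rewrite ?expr1n ?expr0n.
  have mS : measurable [set x : T2 | a < x.1 <= a + h].
    have mS : measurable_fun setT (fun x : T2 => (a < x.1) && (x.1 <= a + h)) by mf.
    by have := mS measurableT [set true] I; rewrite setTI.
  have mS1 : measurable_fun setT (\1_[set x : T2 | a < x.1 <= a + h] : T2 -> R) by exact: measurable_indic.
  rewrite -ge0_integralD//; first last.
  - by mf.
  - by move=> x _; rewrite lee_fin mulr_ge0 ?sqr_ge0//; case: ifP.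
  - by mf.
  - by move=> x _; rewrite lee_fin mulr_ge0 ?sqr_ge0// indicE.
  apply: eq_integral => x _; rewrite -EFinD /F /ch exprMn indicE; congr (_%:E).
  rewrite (_ : (x \in _) = (a < x.1) && (x.1 <= a + h)); last by apply/idP/idP; rewrite inE.
  by case: (ltP a x.1) => ax; case: (leP x.1 (a + h)) => ahx /=; [ring|ring|ring|lra].
have fin : (N2on [set x | a < x.1 <= a + h]%R f) \is a fin_num.
  rewrite ge0_fin_numE; last by apply: integral_ge0 => x _; rewrite lee_fin mulr_ge0 ?sqr_ge0// indicE.
  apply: (@le_lt_trans _ _ (N2 L F)); last by case: lF.
  by rewrite FE leeDl// N2_ge0.
move: FE; rewrite (N2_ip lF) (N2_ip lG) -(fineK fin) -EFinD => -[FE].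
rewrite lee_fin; set S := fine _ in FE *.
have SE : S = - ip L (fun x => G x - F x) (fun x => G x + F x).
  by rewrite (ipBl lG lF (L2D lG lF)) !ipDr// (ipC L F G) FE; ring.
have cs := ip_CS (L2B lG lF) (L2D lG lF).
have lD := L2_diffq (axv false h) lf; have lS := L2D lfh lf.
have b1 : ip L (fun x => G x - F x) (fun x => G x - F x) <= s * h ^+ 2.
  rewrite -lee_fin -(N2_ip (L2B lG lF)); apply: le_trans (ds _ h0).
  apply: le_N2; [by case: (L2B lG lF)|by case: lD|].
  by move=> x; rewrite /G /F -mulrBr; exact: ch1.
have b2 : ip L (fun x => G x + F x) (fun x => G x + F x) <= 4 * l.
  have i1 : ip L G G <= l.
    rewrite -lee_fin -(N2_ip lG) -Nl -(N2_mpres (mpres_shift (h, 0)) mf).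
    by apply: le_N2 => //; [case: lG|move=> x; exact: ch1].
  have i2 : ip L F F <= l.
    rewrite -lee_fin -(N2_ip lF) -Nl.
    by apply: le_N2 => //; [case: lF|move=> x; exact: ch1].
  have := ip_ge0 L (fun x => G x - F x); rewrite (ip_sqrB lG lF) (ip_sqrD lG lF); lra.
have hs : S ^+ 2 <= (h * (s + l)) ^+ 2.
  rewrite SE sqrrN; apply: le_trans cs _.
  apply: (@le_trans _ _ (s * h ^+ 2 * (4 * l))).
    by apply: ler_pM => //; exact: ip_ge0.
  rewrite -subr_ge0 (_ : _ - _ = (h * (s - l)) ^+ 2); last by ring.
  exact: sqr_ge0.
have hl : 0 <= h * (s + l) by rewrite mulr_ge0 ?addr_ge0// ltW.
by apply: le_trans (ler_norm S) _; rewrite -(ger0_norm hl) -ler_sqr ?nnegrE// !real_normK ?num_real.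
Qed.

Definition between (r s t : R) : R := if (r <= t) && (t <= s) then 1 else 0.

Lemma integral_invr (r s : R) : 0 < r -> r <= s ->
  (\int[mu]_t (t^-1 * between r s t)%:E = (ln s - ln r)%:E)%E.
Proof.
move=> r0 rs.
have -> : (\int[mu]_t (t^-1 * between r s t)%:E = \int[mu]_(t in `[r, s]) (t^-1)%:E)%E.
  rewrite [RHS]integral_mkcond; apply: eq_integral => t _; rewrite patchE /between.
  have [/set_mem/=|/negP h] := boolP (t \in `[r, s]%classic).
    by rewrite in_itv/= => ->; rewrite mulr1.
  rewrite ifF ?mulr0//; apply/negP => hh; apply: h.
  by rewrite inE/= in_itv/=.
move: rs; rewrite le_eqVlt => /orP[/eqP <-|rs].
  by rewrite subrr set_itv1; exact: integral_set1.
have dl (x : R) : r <= x -> is_derive x 1 (@ln R) x^-1.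
  by move=> rx; apply: is_derive1_ln; exact: lt_le_trans rx.
have cl (x : R) : r <= x -> {for x, continuous (@ln R)}.
  by move=> rx; apply: continuous_ln; exact: lt_le_trans rx.
rewrite (@continuous_FTC2 R (fun t => t^-1) (@ln R) r s rs).
- by rewrite -EFinB.
- apply: continuous_in_subspaceT => x; rewrite inE/= in_itv/= => /andP[rx _].
  by apply: inv_continuous; rewrite gt_eqF// (lt_le_trans r0).
- split.
  + by move=> x; rewrite in_itv/= => /andP[/ltW rx _]; have [] := dl _ rx.
  + by apply: cvg_at_right_filter; exact: cl.
  + by apply: cvg_at_left_filter; apply: cl; exact: ltW.
- move=> x; rewrite in_itv/= => /andP[/ltW rx _].
  by rewrite derive1E; have [] := dl _ rx.
Qed.

Lemma measurable_invr : measurable_fun setT (fun x : R1 => x^-1 : R).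
Proof.
rewrite (_ : setT = [set 0] `|` ~` [set (0 : R)]); last by rewrite setUv.
have mC : measurable (~` [set (0 : R)] : set R1) by exact: measurableC.
apply/measurable_funU => //; split; first exact: measurable_fun_set1.
apply: open_continuous_measurable_fun.
  by apply: closed_openC; exact: (@accessible_closed_set1 _ (@hausdorff_accessible _ (@Rhausdorff _)) 0).
by move=> x; rewrite inE/= => /eqP x0; exact: inv_continuous.
Qed.

Lemma betweenE r s : between r s = \1_(`[r, s]%classic).
Proof.
apply/funext => t; rewrite indicE /between (_ : (t \in _) = (r <= t) && (t <= s)).
  by case: ifP.
by apply/idP/idP; rewrite inE/= in_itv.
Qed.

Lemma measurable_between r s : measurable_fun setT (between r s : R1 -> R).
Proof. by rewrite betweenE; exact: measurable_indic. Qed.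

Lemma between_ge0 r s t : 0 <= between r s t.
Proof. by rewrite /between; case: ifP. Qed.

Lemma inv_between_ge0 r s t : 0 <= r -> 0 <= t^-1 * between r s t.
Proof.
rewrite /between; case: ifP => [/andP[rt _] r0|_ _]; rewrite ?mulr0// mulr1 invr_ge0.
exact: le_trans rt.
Qed.

(** The negative part of [ln |a|] for nonzero [a], written as an integral over levels so that
    Tonelli turns it into strips. *)
Definition neglog (a : R) : \bar R := (\int[mu]_t (t^-1 * between `|a|%R 1 t)%:E)%E.

Lemma neglog_ge0 a : (0 <= neglog a)%E.
Proof. by apply: integral_ge0 => t _; rewrite lee_fin inv_between_ge0. Qed.

Lemma le_neglog a r : 0 < r -> `|a| <= r -> r <= 1 -> ((- ln r)%:E <= neglog a)%E.
Proof.
move=> r0 ar r1; have mi := measurable_invr.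
have -> : - ln r = ln 1 - ln r by rewrite ln1 sub0r.
rewrite -integral_invr//; apply: ge0_le_integral => //.
- by move=> t _; rewrite lee_fin inv_between_ge0// ltW.
- by have mb := measurable_between r 1; mf.
- by have mb := measurable_between `|a| 1; mf.
- move=> t _; rewrite lee_fin; have [rt|rt] := leP r t; last first.
    have -> : between r 1 t = 0 by rewrite /between leNgt rt.
    by rewrite mulr0 inv_between_ge0.
  rewrite ler_wpM2l ?invr_ge0 ?(le_trans (ltW r0))// /between rt (le_trans ar rt).
  by [].
Qed.

(** The last clause, mass linear in the width of vertical strips, replaces boundedness of the
    density: it is all that is needed against the singularity of the logarithm. *)
Definition logdens rho := [/\ measurable_fun setT rho, forall x, 0 <= rho x,
  (\int[L]_x (rho x)%:E < +oo)%E, (\int[L]_x (ln (1 + eucl x) * rho x)%:E < +oo)%E &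
  exists2 C, 0 <= C & forall a t, 0 < t ->
    (\int[L]_x (rho x * (if `|a - x.1| <= t then 1 else 0))%:E <= (C * t)%:E)%E].

(** After exchanging the integrals, the level [t] contributes [1 / t] times the mass of a strip of
    half-width [t], at most [C], and the levels range over the unit interval. *)
Lemma neglog_strip rho (C : R) : measurable_fun setT rho -> (forall x, 0 <= rho x) -> 0 <= C ->
  (forall a t, 0 < t ->
    (\int[L]_x (rho x * (if (`|a - x.1| <= t)%R then 1 else 0))%:E <= (C * t)%:E)%E) ->
  forall a, (\int[L]_x ((rho x)%:E * neglog (a - x.1)) <= C%:E)%E.
Proof.
move=> mr r0 C0 hC a; have mi := measurable_invr.
pose F (z : T2 * R1) : \bar R := (rho z.1 * (z.2^-1 * between `|a - z.1.1| 1 z.2))%:E.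
have mF : measurable_fun setT F by rewrite /F /between; mf.
have F0 z : (0 <= F z)%E by rewrite lee_fin mulr_ge0 ?inv_between_ge0.
have -> : (\int[L]_x ((rho x)%:E * neglog (a - x.1)) = \int[L]_x \int[mu]_t F (x, t))%E.
  apply: eq_integral => x _; rewrite -ge0_integral_EFinZ//.
    by have mb := measurable_between `|a - x.1| 1; mf.
  by move=> t; rewrite inv_between_ge0.
apply: le_trans (_ : _ <= \int[mu]_t (C * between 0 1 t)%:E)%E _; last first.
  rewrite ge0_integral_EFinZ//; last 2 first.
  - exact: measurable_between.
  - exact: between_ge0.
  have -> : (\int[mu]_t (between 0 1 t)%:E = \int[mu]_t (\1_(`[0, 1]%classic) t)%:E)%E.
    by rewrite betweenE.
  have := @integral_seg R 1 ler01; rewrite /seg => ->.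
  by rewrite mule1.
rewrite (@fubini_tonelli _ _ _ _ R L mu F mF F0).
apply: ge0_le_integral => //.
- by move=> t _; apply: integral_ge0 => x _; exact: F0.
- exact: (@measurable_fun_fubini_tonelli_G _ _ T2 R1 R L F mF F0).
- by have mb := measurable_between 0 1; mf.
move=> t _; have [t0|t0] := leP t 0.
  rewrite integral0_eq ?lee_fin ?mulr_ge0 ?between_ge0// => x _.
  rewrite /F /between/=; case: ifP => [/andP[h _]|]; last by rewrite !mulr0.
  have -> : t = 0 by apply/eqP; rewrite eq_le t0 (le_trans (normr_ge0 _) h).
  by rewrite invr0 mul0r mulr0.
have [t1|t1] := leP t 1; last first.
  rewrite integral0_eq ?lee_fin ?mulr_ge0 ?between_ge0// => x _.
  by rewrite /F /between/= [t <= 1]leNgt t1 andbF !mulr0.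
have -> : (\int[L]_x F (x, t) = (t^-1)%:E * \int[L]_x (rho x * (if (`|a - x.1| <= t)%R then 1 else 0))%:E)%E.
  rewrite -ge0_integral_EFinZ ?invr_ge0 ?(ltW t0)//; first last.
  - by move=> x; rewrite mulr_ge0//; case: ifP.
  - by mf.
  by apply: eq_integral => x _; rewrite /F /between/= t1 andbT; congr (_%:E); exact: mulrCA.
apply: (@le_trans _ _ ((t^-1)%:E * (C * t)%:E)%E).
  by rewrite lee_wpmul2l ?lee_fin ?invr_ge0 ?(ltW t0)//; exact: hC.
by rewrite -EFinM lee_fin /between t1 (ltW t0)/= mulr1 mulrC mulfK ?gt_eqF.
Qed.

Lemma eucl_triangle (x y : R * R) : eucl (x + y) <= eucl x + eucl y.
Proof.
have e0 : 0 <= eucl x + eucl y by rewrite addr_ge0 ?eucl_ge0.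
rewrite le_eucl// addrpE /=; have e1 := eucl_sqr x; have e2 := eucl_sqr y.
have h : x.1 * y.1 + x.2 * y.2 <= eucl x * eucl y.
  apply: le_trans (ler_norm _) _; rewrite -ler_sqr ?nnegrE ?mulr_ge0 ?eucl_ge0//.
  rewrite real_normK ?num_real// exprMn !eucl_sqr -subr_ge0.
  by rewrite (_ : _ - _ = (x.1 * y.2 - x.2 * y.1) ^+ 2) ?sqr_ge0//; ring.
by move: h e1 e2; nra.
Qed.

Lemma euclN (x : R * R) : eucl (- x) = eucl x.
Proof. by rewrite /eucl oppr_pairE /= !sqrrN. Qed.

(** At small distances [- ln |x - y|] is dominated by its value for the first coordinates alone,
    which is where vertical strips enter; at large distances [|x - y| <= (1 + |x|) (1 + |y|)]. *)
Lemma abs_ln_eucl (x y : T2) :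
  (`|ln (eucl (x - y))|%:E <= (ln (1 + eucl x) + ln (1 + eucl y))%:E + neglog (x.1 - y.1))%E.
Proof.
have l0 (z : T2) : 0 <= ln (1 + eucl z) by rewrite ln_ge0// lerDl eucl_ge0.
have n0 := neglog_ge0 (x.1 - y.1).
have [r0|r0] := leP (eucl (x - y)) 0.
  by rewrite ln0// normr0 adde_ge0// lee_fin addr_ge0.
have [r1|r1] := leP (eucl (x - y)) 1.
  rewrite ler0_norm ?ln_le0//; apply: le_trans (_ : _ <= neglog (x.1 - y.1))%E _.
    by apply: le_neglog => //; have := normr1_le_eucl (x - y).
  by rewrite leeDr// lee_fin addr_ge0.
rewrite ger0_norm; last by rewrite ln_ge0// ltW.
apply: (@le_trans _ _ (ln (1 + eucl x) + ln (1 + eucl y))%:E).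
  have p (z : T2) : 1 + eucl z \is Num.pos by rewrite posrE ltr_pwDl// eucl_ge0.
  rewrite lee_fin -lnM// ler_ln ?posrE//.
    apply: le_trans (eucl_triangle x (- y)) _; rewrite euclN.
    by have := mulr_ge0 (eucl_ge0 x) (eucl_ge0 y); nra.
  by rewrite mulr_gt0// -posrE.
by rewrite leeDl.
Qed.

Lemma measurable_neglog : measurable_fun setT (neglog : R1 -> \bar R).
Proof.
have mi := measurable_invr.
apply: (@measurable_fun_fubini_tonelli_F _ _ R1 R1 R mu
  (fun z : R1 * R1 => (z.2^-1 * between `|z.1| 1 z.2)%:E)).
  by rewrite /between; mf.
by move=> z; rewrite lee_fin inv_between_ge0.
Qed.

Lemma measurable_ln_eucl : measurable_fun setT (fun z : T2 * T2 => ln (eucl (z.1 - z.2)) : R).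
Proof.
have me := @measurable_eucl R.
apply: (measurableT_comp (@measurable_ln R)).
apply: (measurableT_comp me); mf.
Qed.

Local Notation LL := (L \x L)%E.

(** For fixed [x] the integral over [y] is estimated with [abs_ln_eucl]: two terms are logarithmic
    moments, and the singular one is bounded by [C] uniformly in [x]. *)
Lemma ln_eucl_integrable rho sig : logdens rho -> logdens sig ->
  LL.-integrable setT (fun z : T2 * T2 => (ln (eucl (z.1 - z.2)) * (rho z.1 * sig z.2))%:E).
Proof.
move=> [mr r0 rf rl _] [ms s0 sf sl [C C0 hC]].
have me := @measurable_eucl R; have mk := measurable_ln_eucl.
apply/integrable12ltyP; first by mf.
have l0 (z : T2) : 0 <= ln (1 + eucl z) by rewrite ln_ge0// lerDl eucl_ge0.
pose a := fine (\int[L]_x (sig x)%:E); pose b := fine (\int[L]_x (ln (1 + eucl x) * sig x)%:E).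
have aE : (\int[L]_x (sig x)%:E = a%:E)%E.
  by rewrite fineK// ge0_fin_numE// integral_ge0// => x _; rewrite lee_fin.
have bE : (\int[L]_x (ln (1 + eucl x) * sig x)%:E = b%:E)%E.
  by rewrite fineK// ge0_fin_numE// integral_ge0// => x _; rewrite lee_fin mulr_ge0.
have a0 : 0 <= a by rewrite -lee_fin -aE integral_ge0// => x _; rewrite lee_fin.
have b0 : 0 <= b by rewrite -lee_fin -bE integral_ge0// => x _; rewrite lee_fin mulr_ge0.
apply: (@le_lt_trans _ _ (\int[L]_x ((ln (1 + eucl x) * rho x) * a + rho x * (b + C))%:E)%E).
  apply: ge0_le_integral => //.
  - by move=> x _; apply: integral_ge0.
  - apply: (@measurable_fun_fubini_tonelli_F _ _ T2 T2 R L
      (fun z => `|(ln (eucl (z.1 - z.2)) * (rho z.1 * sig z.2))%:E|)%E) => //.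
    by apply: (measurableT_comp (@abse_measurable _ _)); mf.
  - by mf.
  move=> x _.
  apply: (@le_trans _ _ (\int[L]_y ((rho x)%:E * ((ln (1 + eucl x) * sig y + ln (1 + eucl y) * sig y)%:E +
      (sig y)%:E * neglog (x.1 - y.1))))%E).
    apply: ge0_le_integral => //.
    - have mkx : measurable_fun setT (fun y : T2 => ln (eucl (x - y)) : R).
        apply: (measurableT_comp (@measurable_ln R)); apply: (measurableT_comp me).
        have [m1 _] := mpres_comp (mpres_shift x) (@mpres_opp R).
        by rewrite (_ : (fun y : T2 => x - y) = (fun y : T2 => - y + x))//; apply/funext => y; rewrite addrC.
      by apply: (measurableT_comp (@abse_measurable _ _)); mf.
    - apply: emeasurable_funM; first by mf.
      apply: emeasurable_funD; first by mf.
      apply: emeasurable_funM; first by mf.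
      by apply: (measurableT_comp measurable_neglog); mf.
    move=> y _; rewrite /= normrM (ger0_norm (mulr_ge0 (r0 _) (s0 _))).
    have -> : ((`|ln (eucl (x - y))| * (rho x * sig y))%:E =
        (rho x)%:E * ((sig y)%:E * (`|ln (eucl (x - y))|)%:E))%E.
      by rewrite -!EFinM; congr (_%:E); ring.
    have -> : ((ln (1 + eucl x) * sig y + ln (1 + eucl y) * sig y)%:E + (sig y)%:E * neglog (x.1 - y.1) =
        (sig y)%:E * ((ln (1 + eucl x) + ln (1 + eucl y))%:E + neglog (x.1 - y.1)))%E.
      rewrite [RHS]ge0_muleDr; [|by rewrite lee_fin addr_ge0|exact: neglog_ge0].
      by congr (_ + _)%E; rewrite -EFinM; congr (_%:E); ring.
    do 2 (apply: lee_wpmul2l; first by rewrite lee_fin).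
    exact: abs_ln_eucl.
  rewrite ge0_integralZl ?lee_fin//; first last.
  - by move=> y _; rewrite adde_ge0 ?lee_fin ?addr_ge0 ?mulr_ge0// mule_ge0 ?lee_fin ?neglog_ge0.
  - apply: emeasurable_funD; first by mf.
    apply: emeasurable_funM; first by mf.
    by apply: (measurableT_comp measurable_neglog); mf.
  rewrite (_ : (_ * _ * _ + _) = rho x * (ln (1 + eucl x) * a + b + C)); last by ring.
  rewrite EFinM lee_wpmul2l ?lee_fin//.
  rewrite ge0_integralD//; first last.
  - apply: emeasurable_funM; first by mf.
    by apply: (measurableT_comp measurable_neglog); mf.
  - by move=> y _; rewrite mule_ge0 ?lee_fin ?neglog_ge0.
  - by mf.
  - by move=> y _; rewrite lee_fin addr_ge0 ?mulr_ge0.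
  rewrite EFinD; apply: leeD; last exact: neglog_strip.
  under eq_integral do rewrite EFinD.
  rewrite ge0_integralD//; first last.
  - by mf.
  - by move=> y _; rewrite lee_fin mulr_ge0.
  - by mf.
  - by move=> y _; rewrite lee_fin mulr_ge0.
  by rewrite ge0_integral_EFinZ// aE bE -EFinM -EFinD.
under eq_integral do rewrite EFinD.
rewrite ge0_integralD//; first last.
- by mf.
- by move=> y _; rewrite lee_fin mulr_ge0 ?addr_ge0.
- by mf.
- by move=> y _; rewrite lee_fin !mulr_ge0.
under eq_integral do rewrite mulrC.
under [X in (_ + X)%E]eq_integral do rewrite mulrC.
rewrite !ge0_integral_EFinZ ?addr_ge0//; [|by mf|by move=> x; rewrite mulr_ge0].
by rewrite lte_add_pinfty// lte_mul_pinfty ?lee_fin ?addr_ge0.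
Qed.

End log_kernel.

(** * The logarithmic interaction *)

Section energy.
Variable R : realType.
Local Notation mu := (@lebesgue_measure R).
Local Notation L := (@leb2 R).
Local Notation R1 := (measurableTypeR R).
Local Notation T2 := (R1 * R1)%type.
Local Notation LL := (L \x L)%E.
Implicit Types (f g w : T2 -> R) (rho sig : T2 -> R).

Lemma LL_mpres phi psi (F : T2 * T2 -> \bar R) : mpres phi -> mpres psi ->
  measurable_fun setT F -> (forall z, 0 <= F z)%E ->
  (\int[LL]_z F (phi z.1, psi z.2) = \int[LL]_z F z)%E.
Proof.
move=> [mp hp] [mq hq] mF F0.
pose G (z : T2 * T2) := F (phi z.1, psi z.2).
have mG : measurable_fun setT G.
  by apply: (measurableT_comp mF); mf.
have G0 z : (0 <= G z)%E by exact: F0.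
apply: etrans (fubini_tonelli1 G mG G0) _.
apply: etrans _ (esym (fubini_tonelli1 F mF F0)).
transitivity (\int[L]_x \int[L]_y F (phi x, y))%E.
  apply: eq_integral => x _; apply: (hq (fun y => F (phi x, y))) => //.
  exact: (measurableT_comp mF (pair1_measurable _)).
apply: (hp (fun x => \int[L]_y F (x, y))%E).
  exact: (@measurable_fun_fubini_tonelli_F _ _ T2 T2 R L F mF F0).
by move=> x; apply: integral_ge0.
Qed.

Lemma integral_signed_inv d (X : measurableType d) (m : {measure set X -> \bar R})
    (tau : X -> X) (F : X -> \bar R) : measurable_fun setT tau ->
  (forall G, measurable_fun setT G -> (forall z, 0 <= G z)%E ->
    (\int[m]_z G (tau z) = \int[m]_z G z)%E) -> measurable_fun setT F ->
  (\int[m]_z F (tau z) = \int[m]_z F z)%E.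
Proof.
move=> mt h mF; rewrite [LHS]integralE [RHS]integralE; congr (_ - _)%E.
  apply: etrans (h (F^\+)%E (measurable_funepos mF) _) => //.
  by apply: eq_integral => z _; rewrite !funeposE.
apply: etrans (h (F^\-)%E (measurable_funeneg mF) _) => //.
by apply: eq_integral => z _; rewrite !funenegE.
Qed.

Definition Ilog rho sig : R :=
  fine (\int[LL]_z (ln (eucl (z.1 - z.2)) * (rho z.1 * sig z.2))%:E)%E.

Lemma measurable_Ilog rho sig : measurable_fun setT rho -> measurable_fun setT sig ->
  measurable_fun setT (fun z : T2 * T2 => (ln (eucl (z.1 - z.2)) * (rho z.1 * sig z.2))%:E).
Proof. by move=> mr ms; have mk := @measurable_ln_eucl R; mf. Qed.

Lemma IlogE rho sig : logdens rho -> logdens sig ->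
  (\int[LL]_z (ln (eucl (z.1 - z.2)) * (rho z.1 * sig z.2))%:E = (Ilog rho sig)%:E)%E.
Proof.
by move=> lr ls; rewrite fineK//; apply: integrable_fin_num => //; exact: ln_eucl_integrable.
Qed.

Lemma Ilog_iterated rho : logdens rho ->
  (\int[L]_x \int[L]_y (ln (eucl (x - y)) * rho x * rho y)%:E = (Ilog rho rho)%:E)%E.
Proof.
move=> lr; rewrite -(IlogE lr lr) -(integral12_prod_meas1 (ln_eucl_integrable lr lr)).
apply: eq_integral => x _; apply: eq_integral => y _.
by rewrite -mulrA.
Qed.

Lemma Ilog_isom phi rho : mpres phi -> (forall x y, eucl (phi x - phi y) = eucl (x - y)) ->
  measurable_fun setT rho -> Ilog (fun x => rho (phi x)) (fun x => rho (phi x)) = Ilog rho rho.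
Proof.
move=> mp ip mr; congr fine; have [mphi _] := mp.
apply: etrans (@integral_signed_inv _ _ LL (fun z : T2 * T2 => (phi z.1, phi z.2))
  (fun z => (ln (eucl (z.1 - z.2)) * (rho z.1 * rho z.2))%:E) _ _ _).
- by apply: eq_integral => z _ /=; rewrite ip.
- by mf.
- by move=> G mG G0; exact: LL_mpres.
- exact: measurable_Ilog.
Qed.

Lemma LL_scale (k : R) (F : T2 * T2 -> \bar R) : 0 < k -> measurable_fun setT F ->
  (forall z, 0 <= F z)%E ->
  ((k ^+ 4)%:E * \int[LL]_z F ((k * z.1.1, k * z.1.2), (k * z.2.1, k * z.2.2))%R = \int[LL]_z F z)%E.
Proof.
move=> k0 mF F0.
pose ksc (x : T2) : T2 := (k * x.1, k * x.2)%R.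
have mk : measurable_fun setT ksc by rewrite /ksc; mf.
pose G (z : T2 * T2) := F (ksc z.1, ksc z.2).
have mG : measurable_fun setT G by apply: (measurableT_comp mF); mf.
have G0 z : (0 <= G z)%E by exact: F0.
rewrite [X in (_ * X)%E](fubini_tonelli1 G mG G0) (fubini_tonelli1 F mF F0).
have mH : measurable_fun setT (fun x : T2 => \int[L]_y F (x, y))%E.
  exact: (@measurable_fun_fubini_tonelli_F _ _ T2 T2 R L F mF F0).
rewrite -(leb2_scale k0 mH); last by move=> x; apply: integral_ge0.
rewrite (_ : k ^+ 4 = k ^+ 2 * k ^+ 2)%R; last by ring.
rewrite EFinM -muleA; congr (_ * _)%E.
rewrite -ge0_integralZl//.
- apply: eq_integral => x _; apply: (leb2_scale k0 (F := fun y => F (ksc x, y))) => //.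
  exact: (measurableT_comp mF (pair1_measurable _)).
- exact: (@measurable_fun_fubini_tonelli_F _ _ T2 T2 R L G mG G0).
- by move=> x _; apply: integral_ge0.
- by rewrite lee_fin sqr_ge0.
Qed.

Lemma ge0_integral_EFinD d (X : measurableType d) (m : {measure set X -> \bar R}) (f g : X -> R) :
  measurable_fun setT f -> measurable_fun setT g -> (forall x, 0 <= f x) -> (forall x, 0 <= g x) ->
  (\int[m]_x (f x + g x)%:E = \int[m]_x (f x)%:E + \int[m]_x (g x)%:E)%E.
Proof.
move=> mf mg f0 g0; rewrite -ge0_integralD//.
- by move=> x _; rewrite lee_fin.
- by mf.
- by move=> x _; rewrite lee_fin.
- by mf.
Qed.

Lemma logdensD rho sig : logdens rho -> logdens sig -> logdens (fun x => rho x + sig x).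
Proof.
move=> [mr r0 rf rl [C C0 hC]] [ms s0 sf sl [C' C0' hC']].
have me := @measurable_eucl R.
have l0 (z : T2) : 0 <= ln (1 + eucl z) by rewrite ln_ge0// lerDl eucl_ge0.
split=> //.
- by mf.
- by move=> x; rewrite addr_ge0.
- by rewrite ge0_integral_EFinD// lte_add_pinfty.
- under eq_integral do rewrite mulrDr.
  rewrite ge0_integral_EFinD; [exact: lte_add_pinfty|by mf|by mf|
    by move=> x; rewrite mulr_ge0|by move=> x; rewrite mulr_ge0].
- exists (C + C'); first by rewrite addr_ge0.
  move=> a t t0; under eq_integral do rewrite mulrDl.
  rewrite ge0_integral_EFinD; [|by mf|by mf|by move=> x; rewrite mulr_ge0//; case: ifP|
    by move=> x; rewrite mulr_ge0//; case: ifP].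
  by rewrite mulrDl EFinD; exact: leeD (hC a t t0) (hC' a t t0).
Qed.

(** The closed strip of half-width [t] around [a] is covered by the half-open strip from [a - 2 t]
    to [a + 2 t]; its width [4 t] is the origin of the constant. *)
Lemma logdens_sqr f s : L2 L f -> 0 <= s -> dir_le false f s ->
  (\int[L]_x (ln (1 + eucl x) * f x ^+ 2)%:E < +oo)%E -> logdens (fun x => f x ^+ 2).
Proof.
move=> lf s0 ds lg; have [mf nf] := lf; split=> //.
- by mf.
- by move=> x; rewrite sqr_ge0.
pose l := ip L f f; have Nl : N2 L f = l%:E by exact: N2_ip.
have l0 : 0 <= l by exact: ip_ge0.
exists (4 * (s + l)); first by rewrite mulr_ge0// addr_ge0.
move=> a t t0; have t4 : 0 < 4 * t by rewrite mulr_gt0.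
have := strip_bound (a - 2 * t) lf ds s0 Nl t4.
rewrite (_ : 4 * t * (s + l) = 4 * (s + l) * t); last by ring.
apply: le_trans.
have mS : measurable [set x : T2 | a - 2 * t < x.1 <= a - 2 * t + 4 * t].
  have mS : measurable_fun setT (fun x : T2 => (a - 2 * t < x.1) && (x.1 <= a - 2 * t + 4 * t)) by mf.
  by have := mS measurableT [set true] I; rewrite setTI.
have mS1 : measurable_fun setT (\1_[set x : T2 | a - 2 * t < x.1 <= a - 2 * t + 4 * t] : T2 -> R).
  exact: measurable_indic.
apply: ge0_le_integral => //.
- by move=> x _; rewrite lee_fin mulr_ge0 ?sqr_ge0//; case: ifP.
- by mf.
- by mf.
- move=> x _; rewrite lee_fin ler_wpM2l ?sqr_ge0//.
  case: ifP => [|_]; last by rewrite indicE.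
  rewrite ler_norml => /andP[h1 h2]; rewrite indicE mem_set//=.
  by apply/andP; split; lra.
Qed.

End energy.

(** * The energy space and the minimisation problem *)

Section energy_space.
Variable R : realType.
Local Notation mu := (@lebesgue_measure R).
Local Notation L := (@leb2 R).
Local Notation R1 := (measurableTypeR R).
Local Notation T2 := (R1 * R1)%type.
Local Notation LL := (L \x L)%E.
Implicit Types (f g w : T2 -> R) (rho sig : T2 -> R).

(** Real functions of the energy space with mass [lam], carrying their two directional energies as
    data, so that [s1 + s2] is the Dirichlet energy as a real number. *)
Definition WX w lam s1 s2 := [/\ L2 L w, N2 L w = lam%:E, is_dir false w s1, is_dir true w s2 &
  (\int[L]_x (ln (1 + eucl x) * w x ^+ 2)%:E < +oo)%E].

Definition Elog w := Ilog (fun x => w x ^+ 2) (fun x => w x ^+ 2).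

Lemma WX_logdens w lam s1 s2 : WX w lam s1 s2 -> logdens (fun x => w x ^+ 2).
Proof. by move=> [lw _ [s0 ds _] _ ll]; exact: (logdens_sqr lw s0 ds ll). Qed.

Lemma ae_eq_integrable d (X : measurableType d) (m : {measure set X -> \bar R})
    (f g : X -> \bar R) : m.-integrable setT f -> measurable_fun setT g ->
  ae_eq m setT f g -> m.-integrable setT g.
Proof.
move=> /integrableP[mf fi] mg fg; apply/integrableP; split=> //.
have := ae_eq_integral (abse \o f) (abse \o g) measurableT
  (measurableT_comp (@abse_measurable _ _) mg) (measurableT_comp (@abse_measurable _ _) mf).
move=> /(_ m (ae_eq_sym (ae_eq_abse fg))) e.
by suff -> : (\int[m]_x `|g x| = \int[m]_x `|f x|)%E by [].
Qed.

Lemma LL_prod rho sig : measurable_fun setT rho -> measurable_fun setT sig ->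
  (forall x, 0 <= rho x) -> (forall x, 0 <= sig x) ->
  (\int[LL]_z (rho z.1 * sig z.2)%:E = \int[L]_x (rho x)%:E * \int[L]_x (sig x)%:E)%E.
Proof.
move=> mr ms r0 s0.
pose F (z : T2 * T2) : \bar R := (rho z.1 * sig z.2)%:E.
have mF : measurable_fun setT F by rewrite /F; mf.
have F0 z : (0 <= F z)%E by rewrite lee_fin mulr_ge0.
apply: etrans (fubini_tonelli1 F mF F0) _.
have s1 : (0 <= \int[L]_x (sig x)%:E)%E by apply: integral_ge0 => x _; rewrite lee_fin.
rewrite muleC -ge0_integralZl//; [|by mf|by move=> x _; rewrite lee_fin].
by apply: eq_integral => x _; rewrite muleC -ge0_integral_EFinZ.
Qed.

Lemma leb2_set1 (x : T2) : L [set x] = 0%E.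
Proof.
have -> : [set x] = [set x.1] `*` [set x.2].
  by apply/seteqP; split => [y ->|[a b] [/= -> ->]]//; rewrite -surjective_pairing.
rewrite /leb2 product_measure1E//.
rewrite [X in (X * _)%E](_ : _ = 0%E) ?mul0e//.
exact: (lebesgue_measure_set1 x.1).
Qed.

Lemma eucl_eq0 (x : R * R) : eucl x = 0 -> x = 0.
Proof.
move=> h; have := eucl_sqr x; rewrite h expr0n/= => /esym/eqP.
rewrite paddr_eq0 ?sqr_ge0// !sqrf_eq0 => /andP[/eqP h1 /eqP h2].
by rewrite (surjective_pairing x) h1 h2.
Qed.

(** On the diagonal the convention [ln 0 = 0] destroys [ln (r / k) = ln r - ln k]; the scaling law
    of the energy therefore only holds off this null set. *)
Lemma LL_diag_ae : {ae LL, forall z, z.1 != z.2}.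
Proof.
pose D : set (T2 * T2) := [set z | z.1 = z.2].
have mD : measurable D.
  have m1 : measurable_fun setT (fun z : T2 * T2 => (eucl (z.1 - z.2) : R)).
    by apply: (measurableT_comp (@measurable_eucl R)); mf.
  have := m1 measurableT [set 0] (measurable_set1 0); rewrite setTI.
  rewrite (_ : _ @^-1` _ = D)//; apply/seteqP; split => z /=; last first.
    by move=> ->; rewrite subrr /eucl /= expr0n addr0 sqrtr0.
  by move=> /eucl_eq0 /eqP; rewrite subr_eq0 => /eqP.
exists D; split=> //; last by move=> z /= /negP; rewrite negbK => /eqP.
transitivity (\int[L]_x (L \o xsection D) x)%E; first by [].
apply: integral0_eq => x _; rewrite /= (_ : xsection D x = [set x]); first exact: leb2_set1.
by apply/seteqP; split => y /=; rewrite /xsection /= inE /D /=.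
Qed.

Lemma eucl_scale (k : R) (x : R * R) : 0 <= k -> eucl (k * x.1, k * x.2) = k * eucl x.
Proof.
by move=> k0; rewrite /eucl /= !exprMn -mulrDr sqrtrM ?sqr_ge0// sqrtr_sqr ger0_norm.
Qed.

Lemma LL_scale_signed (k : R) (F : T2 * T2 -> \bar R) : 0 < k -> LL.-integrable setT F ->
  (\int[LL]_z F ((k * z.1.1, k * z.1.2), (k * z.2.1, k * z.2.2))%R =
   (k ^- 4)%:E * \int[LL]_z F z)%E.
Proof.
move=> k0 iF; have mF := measurable_int _ iF.
have k4 : (k ^+ 4 != 0)%R by rewrite gt_eqF ?exprn_gt0.
have S G : measurable_fun setT G -> (forall z, 0 <= G z)%E ->
  (\int[LL]_z G ((k * z.1.1, k * z.1.2), (k * z.2.1, k * z.2.2))%R =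
   (k ^- 4)%:E * \int[LL]_z G z)%E.
  by move=> mG G0; rewrite -(LL_scale k0 mG G0) muleA -EFinM mulVf// mul1e.
rewrite [LHS]integralE [in RHS]integralE muleBr//; last first.
  by apply: fin_num_adde_defl; rewrite fin_numN; exact: integrable_neg_fin_num.
congr (_ - _)%E.
  apply: etrans (S (F^\+)%E (measurable_funepos mF) _) => //.
  by apply: eq_integral => z _; rewrite !funeposE.
apply: etrans (S (F^\-)%E (measurable_funeneg mF) _) => //.
by apply: eq_integral => z _; rewrite !funenegE.
Qed.

Lemma mass_prod_int rho sig : logdens rho -> logdens sig ->
  LL.-integrable setT (fun z : T2 * T2 => (rho z.1 * sig z.2)%:E).
Proof.
move=> [mr r0 rf _ _] [ms s0 sf _ _]; apply/integrableP; split; first by mf.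
have -> : (\int[LL]_z `|(rho z.1 * sig z.2)%:E| = \int[LL]_z (rho z.1 * sig z.2)%:E)%E.
  by apply: eq_integral => z _; rewrite gee0_abs// lee_fin mulr_ge0.
rewrite LL_prod// lte_mul_pinfty//.
  by apply: integral_ge0 => x _; rewrite lee_fin.
by rewrite ge0_fin_numE// integral_ge0// => x _; rewrite lee_fin.
Qed.

(** The substitution in both variables contributes [k ^ -4], the amplitude [a ^ 4], and the kernel
    splits off the constant [- ln k], which multiplies the squared mass. *)
Lemma Elog_scale w lam s1 s2 (k a : R) : WX w lam s1 s2 -> 0 < k ->
  Elog (fun x => a * w (k * x.1, k * x.2)) = a ^+ 4 / k ^+ 4 * (Elog w - ln k * lam ^+ 2).
Proof.
move=> hw k0; have lr := WX_logdens hw; have [lw Nw _ _ _] := hw.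
have [mr r0 _ _ _] := lr.
set rho := fun x => w x ^+ 2 in lr mr r0.
pose H (z : T2 * T2) : \bar R := (a ^+ 4 * (ln (eucl (z.1 - z.2) / k) * (rho z.1 * rho z.2)))%:E.
have i1 := ln_eucl_integrable lr lr; have i2 := mass_prod_int lr lr.
pose H' (z : T2 * T2) : \bar R := ((a ^+ 4)%:E * (ln (eucl (z.1 - z.2)) * (rho z.1 * rho z.2))%:E
   - (a ^+ 4 * ln k)%:E * (rho z.1 * rho z.2)%:E)%E.
have mH : measurable_fun setT H.
  have me : measurable_fun setT (fun z : T2 * T2 => (eucl (z.1 - z.2) : R)).
    by apply: (measurableT_comp (@measurable_eucl R)); mf.
  by rewrite /H; mf.
have iH' : LL.-integrable setT H'.
  by apply: integrableB => //; apply: integrableZl.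
have HH' : ae_eq LL setT H H'.
  have := LL_diag_ae; apply: filterS => z zn _; rewrite /H /H' -!EFinM -EFinB; congr (_%:E).
  have e0 : 0 < eucl (z.1 - z.2).
    rewrite lt_neqAle eucl_ge0 andbT eq_sym; apply: contra zn => /eqP h.
    by rewrite -subr_eq0; apply/eqP; exact: eucl_eq0.
  by rewrite lnM ?posrE ?invr_gt0// lnV ?posrE//; ring.
have iH : LL.-integrable setT H.
  by apply: ae_eq_integrable iH' mH _; exact: ae_eq_sym.
apply: EFin_inj.
transitivity (\int[LL]_z H ((k * z.1.1, k * z.1.2), (k * z.2.1, k * z.2.2))%R)%E.
  have e : (\int[LL]_z (ln (eucl (z.1 - z.2)) * ((a * w (k * z.1.1, k * z.1.2)%R) ^+ 2 *
      (a * w (k * z.2.1, k * z.2.2)%R) ^+ 2))%:E =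
      \int[LL]_z H ((k * z.1.1, k * z.1.2), (k * z.2.1, k * z.2.2))%R)%E.
    apply: eq_integral => z _; rewrite /H /rho/=; congr (_%:E).
    have -> : ((k * z.1.1, k * z.1.2) - (k * z.2.1, k * z.2.2) = (k * (z.1 - z.2).1, k * (z.1 - z.2).2) :> R * R)%R.
      by rewrite addrpE oppr_pairE /= !mulrBr.
    by rewrite eucl_scale ?(ltW k0)// [k * eucl _]mulrC mulfK ?gt_eqF//; ring.
  rewrite /Elog /Ilog e fineK// (LL_scale_signed k0 iH) fin_numM//.
  exact: integrable_fin_num.
rewrite (LL_scale_signed k0 iH).
have -> : (\int[LL]_z H z = \int[LL]_z H' z)%E.
  by apply: ae_eq_integral => //; exact: measurable_int iH'.
rewrite integralB//; [|exact: integrableZl|exact: integrableZl].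
rewrite !integralZl// (IlogE lr lr) (LL_prod mr mr r0 r0).
have -> : (\int[L]_x (rho x)%:E = lam%:E)%E by exact: Nw.
transitivity ((k ^- 4 * (a ^+ 4 * Ilog rho rho - a ^+ 4 * ln k * (lam * lam)))%:E); first by [].
by rewrite -/(Elog w); congr (_%:E); ring.
Qed.

Lemma WX_shift w lam s1 s2 (c : T2) : WX w lam s1 s2 -> WX (fun x => w (x + c)) lam s1 s2.
Proof.
move=> [lw Nw d1 d2 ll]; have [mw _] := lw; have me := @measurable_eucl R.
have mp := mpres_shift c.
have l0 (z : T2) : 0 <= ln (1 + eucl z) by rewrite ln_ge0// lerDl eucl_ge0.
split.
- exact: (L2_mpres mp lw).
- by rewrite (N2_mpres mp mw).
- exact: is_dir_shift.
- exact: is_dir_shift.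
(* The weight is moved by [1 + |x| <= (1 + |x + c|) (1 + |c|)]. *)
apply: (@le_lt_trans _ _ (\int[L]_x (ln (1 + eucl (x + c)%R) * w (x + c)%R ^+ 2 + ln (1 + eucl c) * w (x + c)%R ^+ 2)%:E)%E).
  have [ms _] := mp; apply: ge0_le_integral => //.
  - by move=> x _; rewrite lee_fin mulr_ge0 ?sqr_ge0.
  - by mf.
  - by mf.
  move=> x _; rewrite lee_fin -mulrDl ler_wpM2r ?sqr_ge0//.
  have p (z : T2) : 1 + eucl z \is Num.pos by rewrite posrE ltr_pwDl// eucl_ge0.
  rewrite -lnM// ler_ln ?posrE ?mulr_gt0// -?posrE//.
  have := eucl_triangle (x + c) (- c); rewrite addrK euclN.
  by have := mulr_ge0 (eucl_ge0 (x + c)) (eucl_ge0 c); have := eucl_ge0 x; nra.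
have -> : (\int[L]_x (ln (1 + eucl (x + c)%R) * w (x + c)%R ^+ 2 + ln (1 + eucl c) * w (x + c)%R ^+ 2)%:E =
    \int[L]_x (ln (1 + eucl x) * w x ^+ 2 + ln (1 + eucl c) * w x ^+ 2)%:E)%E.
  apply: (mpres_integral mp (F := fun x => (ln (1 + eucl x) * w x ^+ 2 + ln (1 + eucl c) * w x ^+ 2)%:E)).
  by mf.
rewrite ge0_integral_EFinD; [|by mf|by mf|by move=> x; rewrite mulr_ge0 ?sqr_ge0|
  by move=> x; rewrite mulr_ge0 ?sqr_ge0].
apply: lte_add_pinfty; first exact: ll.
rewrite ge0_integral_EFinZ; [|exact: l0|by mf|by move=> x; rewrite sqr_ge0].
have -> : (\int[L]_x (w x ^+ 2)%:E = lam%:E)%E by exact: Nw.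
by rewrite -EFinM ltry.
Qed.

Lemma WX_scale w lam s1 s2 (k a : R) : WX w lam s1 s2 -> 0 < k ->
  WX (fun x => a * w (k * x.1, k * x.2)) (a ^+ 2 / k ^+ 2 * lam) (a ^+ 2 * s1) (a ^+ 2 * s2).
Proof.
move=> [lw Nw d1 d2 ll] k0; have [mw _] := lw; have me := @measurable_eucl R.
have l0 (z : T2) : 0 <= ln (1 + eucl z) by rewrite ln_ge0// lerDl eucl_ge0.
have k2 : k ^+ 2 != 0 by rewrite expf_neq0// gt_eqF.
have S (F : T2 -> R) : measurable_fun setT F -> (forall x, 0 <= F x) ->
    (\int[L]_x (F (k * x.1, k * x.2)%R)%:E = (k ^- 2)%:E * \int[L]_x (F x)%:E)%E.
  move=> mF F0; rewrite -(leb2_scale k0 (F := fun x => (F x)%:E)); [|by mf|by move=> x; rewrite lee_fin].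
  by rewrite muleA -EFinM mulVf// mul1e.
have m1 : measurable_fun setT (fun x : T2 => a * w (k * x.1, k * x.2)) by mf.
have N1 : N2 L (fun x : T2 => a * w (k * x.1, k * x.2)) = (a ^+ 2 / k ^+ 2 * lam)%:E.
  have -> : N2 L (fun x : T2 => a * w (k * x.1, k * x.2)) =
      (\int[L]_x (a ^+ 2 * w (k * x.1, k * x.2)%R ^+ 2)%:E)%E.
    by apply: eq_integral => x _; rewrite exprMn.
  rewrite ge0_integral_EFinZ ?sqr_ge0//; [|by mf|by move=> x; rewrite sqr_ge0].
  rewrite (S (fun x => w x ^+ 2)); [|by mf|by move=> x; rewrite sqr_ge0].
  have -> : (\int[L]_x (w x ^+ 2)%:E = lam%:E)%E by exact: Nw.
  by rewrite -!EFinM mulrA.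
split=> //.
- by split=> //; rewrite N1 ltry.
- exact: is_dir_scale.
- exact: is_dir_scale.
pose G (x : T2) := a ^+ 2 * (ln (1 + eucl x / k) * w x ^+ 2).
have mG : measurable_fun setT G by rewrite /G; mf.
have dk (x : T2) : 0 <= eucl x / k by rewrite divr_ge0 ?eucl_ge0// ltW.
have G0 x : 0 <= G x.
  apply: mulr_ge0; [exact: sqr_ge0|apply: mulr_ge0; last exact: sqr_ge0].
  by apply: ln_ge0; rewrite lerDl.
have -> : (\int[L]_x (ln (1 + eucl x) * (a * w (k * x.1, k * x.2)%R) ^+ 2)%:E =
   \int[L]_x (G (k * x.1, k * x.2)%R)%:E)%E.
  apply: eq_integral => x _; rewrite /G eucl_scale ?(ltW k0)// [k * eucl _]mulrC mulfK ?gt_eqF//.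
  by congr (_%:E); ring.
rewrite S// lte_mul_pinfty ?lee_fin ?invr_ge0 ?sqr_ge0//.
rewrite /G ge0_integral_EFinZ ?sqr_ge0//; first last.
- by move=> x; rewrite mulr_ge0 ?sqr_ge0// ln_ge0// lerDl.
- by mf.
rewrite lte_mul_pinfty ?lee_fin ?sqr_ge0//.
have kp : 0 < 1 + k^-1 by rewrite addr_gt0// invr_gt0.
have lk : 0 <= ln (1 + k^-1) by rewrite ln_ge0// lerDl invr_ge0 ltW.
apply: (@le_lt_trans _ _ (\int[L]_x (ln (1 + eucl x) * w x ^+ 2 + ln (1 + k^-1) * w x ^+ 2)%:E)%E).
  apply: ge0_le_integral => //.
  - by move=> x _; rewrite lee_fin mulr_ge0 ?sqr_ge0// ln_ge0// lerDl.
  - by mf.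
  - by mf.
  move=> x _; rewrite lee_fin -mulrDl ler_wpM2r ?sqr_ge0//.
  have p (z : T2) : 1 + eucl z \is Num.pos by rewrite posrE ltr_pwDl// eucl_ge0.
  rewrite -lnM// ler_ln ?posrE.
  - have := eucl_ge0 x; have : 0 < k^-1 by rewrite invr_gt0.
    by move=> *; nra.
  - by rewrite ltr_pwDl.
  - by rewrite mulr_gt0// -posrE.
rewrite ge0_integral_EFinD; [|by mf|by mf|by move=> x; rewrite mulr_ge0 ?sqr_ge0|
  by move=> x; rewrite mulr_ge0 ?sqr_ge0].
apply: lte_add_pinfty; first exact: ll.
rewrite ge0_integral_EFinZ; [|exact: lk|by mf|by move=> x; rewrite sqr_ge0].
have -> : (\int[L]_x (w x ^+ 2)%:E = lam%:E)%E by exact: Nw.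
by rewrite -EFinM ltry.
Qed.

Lemma eucl_rot (c s : R) (x : R * R) : c ^+ 2 + s ^+ 2 = 1 -> eucl (plane_rot c s x) = eucl x.
Proof.
by move=> cs; rewrite /eucl /plane_rot /=; congr (Num.sqrt _); rewrite -[RHS]mul1r -cs; ring.
Qed.

Lemma WX_rot w lam s1 s2 (c s : R) : c ^+ 2 + s ^+ 2 = 1 -> WX w lam s1 s2 ->
  exists t1 t2, WX (fun x => w (plane_rot c s x)) lam t1 t2 /\ t1 + t2 <= s1 + s2.
Proof.
move=> cs [lw Nw d1 d2 ll]; have [mw _] := lw; have me := @measurable_eucl R.
have [t1 [t2 [e1 e2 t12]]] := is_dir_rot cs lw d1 d2.
have mp := mpres_rot cs.
exists t1, t2; split=> //; split=> //.
- exact: (L2_mpres mp lw).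
- by rewrite (N2_mpres mp mw).
suff -> : (\int[L]_x (ln (1 + eucl x) * w (plane_rot c s x) ^+ 2)%:E =
   \int[L]_x (ln (1 + eucl x) * w x ^+ 2)%:E)%E by [].
rewrite -[RHS](mpres_integral mp (F := fun x => (ln (1 + eucl x) * w x ^+ 2)%:E)); last by mf.
by apply: eq_integral => x _; rewrite eucl_rot.
Qed.

Lemma Elog_shift w c : measurable_fun setT w -> Elog (fun x => w (x + c)) = Elog w.
Proof.
move=> mw; apply: (@Ilog_isom _ (fun x => x + c) (fun x => w x ^+ 2)).
- exact: mpres_shift.
- by move=> x y; rewrite opprD addrACA subrr addr0.
- by mf.
Qed.

Lemma Elog_rot w (c s : R) : c ^+ 2 + s ^+ 2 = 1 -> measurable_fun setT w ->
  Elog (fun x => w (plane_rot c s x)) = Elog w.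
Proof.
move=> cs mw; apply: (@Ilog_isom _ (plane_rot c s) (fun x => w x ^+ 2)).
- exact: mpres_rot.
- move=> x y; rewrite -(eucl_rot (x - y) cs); congr eucl.
  by rewrite /plane_rot addrpE oppr_pairE /=; congr (_, _); ring.
- by mf.
Qed.

End energy_space.

(** * The minimisation problem for real functions and the virial identity *)

Section minimization.
Variable R : realType.
Local Notation mu := (@lebesgue_measure R).
Local Notation L := (@leb2 R).
Local Notation R1 := (measurableTypeR R).
Local Notation T2 := (R1 * R1)%type.
Local Notation LL := (L \x L)%E.
Implicit Types (f g w : T2 -> R) (rho sig : T2 -> R).

(** The variational problem in real numbers and for real functions only; [c] stands for
    [gamma / (4 pi)]. Attainment of the bound is left to [is_min]. *)
Definition minprob (c e lam : R) := forall w s1 s2, WX w lam s1 s2 -> e <= s1 + s2 + c * Elog w.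

Definition is_min (c e lam : R) w s1 s2 := WX w lam s1 s2 /\ s1 + s2 + c * Elog w = e.

(** Both sides vanish at [k = 1], so their derivatives [B] and [2 D] agree there. Instead of
    differentiating, [k = 1 - d] and [k = 1 + d] are inserted, with elementary bounds for the
    logarithm and [d] small enough to absorb the terms of higher order. *)
Lemma virial_real (D B : R) : 0 <= D -> 0 <= B ->
  (forall k, 0 < k -> B * ln k <= (k ^+ 2 - 1) * D) -> 2 * D = B.
Proof.
move=> D0 B0 H; apply/eqP; rewrite eq_le; apply/andP; split.
- apply/ler_addgt0Pr => e e0.
  pose d := Num.min (2^-1) (e / (3 * (D + 1))).
  have D1 : 0 < 3 * (D + 1) by rewrite mulr_gt0// ltr_wpDl.
  have d0 : 0 < d by rewrite lt_min divr_gt0// invr_gt0 ltr0n.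
  have d1 : d <= 2^-1 by rewrite ge_min lexx.
  have d2 : d * (3 * (D + 1)) <= e by rewrite -ler_pdivlMr// ge_min lexx orbT.
  have k0 : 0 < 1 - d by move: d1; lra.
  have hl : - ln (1 - d) <= d / (1 - d).
    rewrite -lnV ?posrE//.
    have e1 : (1 - d)^-1 = 1 + d / (1 - d) by field; rewrite gt_eqF.
    rewrite [in leLHS]e1; apply: le_ln1Dx; rewrite (lt_le_trans (ltrN10 _))//.
    by apply: divr_ge0; exact: ltW.
  have := H _ k0 => hk.
  have h1 : (1 - (1 - d) ^+ 2) * D <= B * (d / (1 - d)).
    by apply: le_trans (_ : B * - ln (1 - d) <= _); [lra|exact: ler_wpM2l].
  have h2 : (2 - d) * (1 - d) * D <= B.
    rewrite -(ler_pM2l d0); move: h1; rewrite mulrA ler_pdivlMr//; nra.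
  have : 0 <= d ^+ 2 * D by rewrite mulr_ge0 ?sqr_ge0.
  by nra.
- apply/ler_addgt0Pr => e e0.
  pose d := Num.min 1 (e / (5 * (D + 1))).
  have D1 : 0 < 5 * (D + 1) by rewrite mulr_gt0// ltr_wpDl.
  have d0 : 0 < d by rewrite lt_min divr_gt0// ltr01.
  have d1 : d <= 1 by rewrite ge_min lexx.
  have d2 : d * (5 * (D + 1)) <= e by rewrite -ler_pdivlMr// ge_min lexx orbT.
  have k0 : 0 < 1 + d by rewrite addr_gt0.
  have hl : d / (1 + d) <= ln (1 + d).
    rewrite -[ln _]opprK -lnV ?posrE// lerNr.
    have e1 : (1 + d)^-1 = 1 + (- (d / (1 + d))) by field; rewrite gt_eqF.
    rewrite [in leLHS]e1; apply: le_ln1Dx; rewrite ltrN2 ltr_pdivrMr// mul1r; lra.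
  have h1 : B * (d / (1 + d)) <= ((1 + d) ^+ 2 - 1) * D.
    by apply: le_trans (H _ k0); exact: ler_wpM2l.
  have h2 : B <= (2 + d) * (1 + d) * D.
    rewrite -(ler_pM2l d0); move: h1; rewrite mulrA ler_pdivrMr//; nra.
  have : 0 <= (1 - d) * d * D by rewrite !mulr_ge0 ?subr_ge0// ltW.
  by nra.
Qed.

(** The competitors [k w (k x)] keep the mass, multiply the Dirichlet energy by [k ^ 2] and change
    the logarithmic energy by [- ln k] times the squared mass. The right hand side does not depend
    on the minimiser. *)
Lemma virial c e lam w s1 s2 : 0 <= c -> minprob c e lam -> is_min c e lam w s1 s2 ->
  2 * (s1 + s2) = c * lam ^+ 2.
Proof.
move=> c0 hmin [hw he]; have [_ _ [s10 _ _] [s20 _ _] _] := hw.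
apply: virial_real; [by rewrite addr_ge0|by rewrite mulr_ge0 ?sqr_ge0|].
move=> k k0; have k1 : k != 0 by rewrite gt_eqF.
have hk := WX_scale k hw k0; rewrite divff ?expf_neq0// mul1r in hk.
have := hmin _ _ _ hk; rewrite (Elog_scale k hw k0) divff ?expf_neq0// mul1r -he; nra.
Qed.

(** A function of mass [t ^ 2 lam] is brought to mass [lam] by [t ^ -2 w (x / t)], the inverse of
    the dilation used in the uniqueness proof. *)
Lemma minprob_scale c e lam w s1 s2 (t : R) : 0 < t -> minprob c e lam ->
  WX w (t ^+ 2 * lam) s1 s2 -> e <= (s1 + s2 + c * Elog w) / t ^+ 4 + c * ln t * lam ^+ 2.
Proof.
move=> t0 hmin hw; have ti : 0 < t^-1 by rewrite invr_gt0.
have t1 : t != 0 by rewrite gt_eqF.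
have hk := WX_scale (t^-2) hw ti.
have E1 : (t ^- 2) ^+ 2 / (t^-1) ^+ 2 * (t ^+ 2 * lam) = lam by field.
rewrite E1 in hk; have := hmin _ _ _ hk; rewrite (Elog_scale (t^-2) hw ti) lnV ?posrE//.
move=> h; apply: le_trans h _; rewrite le_eqVlt; apply/orP; left; apply/eqP.
by field.
Qed.

Lemma energy_complex gamma (u : R * R -> R[i]) lam : inX u -> mass u = lam%:E ->
  exists s1 s2 t1 t2, [/\ L2 L (Rep u), L2 L (Imp u),
    logdens (fun x : T2 => cabs2 (u x)),
    energy gamma u = (s1 + s2 + t1 + t2 + gamma / (4 * pi) *
      Ilog (fun x : T2 => cabs2 (u x)) (fun x : T2 => cabs2 (u x)))%:E &
    [/\ is_dir false (Rep u) s1, is_dir true (Rep u) s2,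
    is_dir false (Imp u) t1 & is_dir true (Imp u) t2]].
Proof.
move=> [mR mI hd hm hl] hM.
have {}mR : measurable_fun setT (Rep u) := mR.
have {}mI : measurable_fun setT (Imp u) := mI.
have me := @measurable_eucl R.
have l0 (z : T2) : 0 <= ln (1 + eucl z) by rewrite ln_ge0// lerDl eucl_ge0.
have mc : measurable_fun setT (fun x : T2 => cabs2 (u x)).
  suff : measurable_fun setT (fun x : T2 => Rep u x ^+ 2 + Imp u x ^+ 2) by [].
  by mf.
have c0 (x : T2) : 0 <= cabs2 (u x) by rewrite addr_ge0 ?sqr_ge0.
have lR : L2 L (Rep u).
  split=> //; apply: le_lt_trans hm; apply: ge0_le_integral => //.
  - by move=> x _; rewrite lee_fin sqr_ge0.
  - by mf.
  - by mf.
  - by move=> x _; rewrite lee_fin lerDl sqr_ge0.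
have lI : L2 L (Imp u).
  split=> //; apply: le_lt_trans hm; apply: ge0_le_integral => //.
  - by move=> x _; rewrite lee_fin sqr_ge0.
  - by mf.
  - by mf.
  - by move=> x _; rewrite lee_fin lerDr sqr_ge0.
have [s1 [s2 [t1 [t2 [d1 d2 d3 d4]]]]] := dirichlet_fin lR lI hd.
have wR : (\int[L]_x (ln (1 + eucl x) * Rep u x ^+ 2)%:E < +oo)%E.
  apply: le_lt_trans hl; apply: ge0_le_integral => //.
  - by move=> x _; rewrite lee_fin mulr_ge0 ?sqr_ge0.
  - by mf.
  - by mf.
  - by move=> x _; rewrite lee_fin ler_wpM2l// lerDl sqr_ge0.
have wI : (\int[L]_x (ln (1 + eucl x) * Imp u x ^+ 2)%:E < +oo)%E.
  apply: le_lt_trans hl; apply: ge0_le_integral => //.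
  - by move=> x _; rewrite lee_fin mulr_ge0 ?sqr_ge0.
  - by mf.
  - by mf.
  - by move=> x _; rewrite lee_fin ler_wpM2l// lerDr sqr_ge0.
have ld : logdens (fun x : T2 => cabs2 (u x)).
  have [a0 a1 _] := d1; have [b0 b1 _] := d3.
  exact: logdensD (logdens_sqr lR a0 a1 wR) (logdens_sqr lI b0 b1 wI).
exists s1, s2, t1, t2; split=> //.
rewrite /energy (dirichletE lR lI d1 d2 d3 d4) (Ilog_iterated ld).
by rewrite -EFinM -EFinD.
Qed.

Lemma energy_WX gamma w lam s1 s2 : WX w lam s1 s2 ->
  [/\ inX (fun x => (w x)%:C%C), mass (fun x => (w x)%:C%C) = lam%:E &
    energy gamma (fun x => (w x)%:C%C) = (s1 + s2 + gamma / (4 * pi) * Elog w)%:E].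
Proof.
move=> hw; have ld := WX_logdens hw; have [lw Nw d1 d2 ll] := hw; have [mw _] := lw.
have cE x : cabs2 ((w x)%:C%C) = w x ^+ 2 by rewrite /cabs2/= expr0n addr0.
have l0 : L2 L (fun=> 0 : R).
  split; first exact: measurable_cst.
  by rewrite (_ : N2 _ _ = 0%E) ?ltry//; apply: integral0_eq => x _; rewrite expr0n.
have dE : dirichlet (fun x => (w x)%:C%C) = (s1 + s2 + 0 + 0)%:E.
  exact: (@dirichletE _ (fun x => (w x)%:C%C) _ _ _ _ lw l0 d1 d2 (is_dir0 _ _) (is_dir0 _ _)).
have mE : mass (fun x => (w x)%:C%C) = lam%:E.
  by rewrite -Nw; apply: eq_integral => x _; rewrite cE.
split=> //.
- split=> //.
  + by rewrite dE ltry.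
  + by rewrite mE ltry.
  + suff -> : (\int[L]_x (ln (1 + eucl x) * cabs2 ((w x)%:C%C))%:E =
      \int[L]_x (ln (1 + eucl x) * w x ^+ 2)%:E)%E by [].
    by apply: eq_integral => x _; rewrite cE.
- rewrite /energy dE !addr0.
  have -> : (\int[L]_x \int[L]_y (ln (eucl (x - y)) * cabs2 ((w x)%:C%C) * cabs2 ((w y)%:C%C))%:E =
      (Elog w)%:E)%E.
    rewrite -(Ilog_iterated ld); apply: eq_integral => x _; apply: eq_integral => y _.
    by rewrite !cE.
  by rewrite -EFinM -EFinD.
Qed.

Lemma WX_of_inX w lam : inX (fun x => (w x)%:C%C) -> mass (fun x => (w x)%:C%C) = lam%:E ->
  exists s1 s2, WX w lam s1 s2.
Proof.
move=> hX hM; have [s1 [s2 [t1 [t2 [lR lI _ _ [d1 d2 _ _]]]]]] := energy_complex 0 hX hM.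
have cE x : cabs2 ((w x)%:C%C) = w x ^+ 2 by rewrite /cabs2/= expr0n addr0.
have [_ _ _ _ hl] := hX.
exists s1, s2; split=> //.
- by rewrite -hM; apply: eq_integral => x _; rewrite cE.
- suff -> : (\int[L]_x (ln (1 + eucl x) * w x ^+ 2)%:E =
     \int[L]_x (ln (1 + eucl x) * cabs2 ((w x)%:C%C))%:E)%E by [].
  by apply: eq_integral => x _; rewrite cE.
Qed.

Lemma sqr_modulus_sub (a b c d : R) :
  (Num.sqrt (a ^+ 2 + b ^+ 2) - Num.sqrt (c ^+ 2 + d ^+ 2)) ^+ 2 <= (a - c) ^+ 2 + (b - d) ^+ 2.
Proof.
have E1 : Num.sqrt (a ^+ 2 + b ^+ 2) ^+ 2 = a ^+ 2 + b ^+ 2 by rewrite sqr_sqrtr// addr_ge0 ?sqr_ge0.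
have E2 : Num.sqrt (c ^+ 2 + d ^+ 2) ^+ 2 = c ^+ 2 + d ^+ 2 by rewrite sqr_sqrtr// addr_ge0 ?sqr_ge0.
have := eucl_triangle (a, b) (0, 0).
have h : a * c + b * d <= Num.sqrt (a ^+ 2 + b ^+ 2) * Num.sqrt (c ^+ 2 + d ^+ 2).
  apply: le_trans (ler_norm _) _; rewrite -ler_sqr ?nnegrE ?mulr_ge0 ?sqrtr_ge0//.
  rewrite real_normK ?num_real// exprMn E1 E2 -subr_ge0.
  by rewrite (_ : _ - _ = (a * d - b * c) ^+ 2) ?sqr_ge0//; ring.
by move=> _; nra.
Qed.

(** The reverse triangle inequality for complex numbers, applied to every difference quotient, in
    each direction separately. *)
Lemma WX_modulus (u : R * R -> R[i]) lam s1 s2 t1 t2 : inX u -> mass u = lam%:E ->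
  L2 L (Rep u) -> L2 L (Imp u) -> is_dir false (Rep u) s1 -> is_dir true (Rep u) s2 ->
  is_dir false (Imp u) t1 -> is_dir true (Imp u) t2 ->
  let w x := Num.sqrt (cabs2 (u x)) in
  exists p1 p2, [/\ WX w lam p1 p2, p1 <= s1 + t1 & p2 <= s2 + t2].
Proof.
move=> [_ _ _ _ hl] hM lR lI d1 d2 d3 d4 w; have [mR _] := lR; have [mI _] := lI.
have mw : measurable_fun setT (w : T2 -> R).
  suff : measurable_fun setT (fun x : T2 => Num.sqrt (Rep u x ^+ 2 + Imp u x ^+ 2)) by [].
  by mf.
have w2 x : w x ^+ 2 = cabs2 (u x) by rewrite sqr_sqrtr// addr_ge0 ?sqr_ge0.
have Nw : N2 L (w : T2 -> R) = lam%:E by rewrite -hM; apply: eq_integral => x _; rewrite w2.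
have lw : L2 L (w : T2 -> R) by split=> //; rewrite Nw ltry.
have key b s t : is_dir b (Rep u) s -> is_dir b (Imp u) t -> exists2 p, p <= s + t & is_dir b w p.
  move=> [s0 hs _] [t0 ht _]; apply: is_dir_exists => //; first by rewrite addr_ge0.
  apply: dir_le_freq => h h0; rewrite mulrDl EFinD.
  apply: le_trans (leeD (hs _ h0) (ht _ h0)).
  apply: N2_le_add.
  - by case: (L2_diffq (axv b h) lw).
  - by case: (L2_diffq (axv b h) lR).
  - by case: (L2_diffq (axv b h) lI).
  - by move=> x; exact: sqr_modulus_sub.
have [p1 h1 e1] := key _ _ _ d1 d3; have [p2 h2 e2] := key _ _ _ d2 d4.
exists p1, p2; split=> //; split=> //.
suff -> : (\int[L]_x (ln (1 + eucl x) * w x ^+ 2)%:E =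
   \int[L]_x (ln (1 + eucl x) * cabs2 (u x))%:E)%E by [].
by apply: eq_integral => x _; rewrite w2.
Qed.

End minimization.

(** * Polarisation and radial symmetry *)

Section polarization.
Variable R : realType.
Local Notation mu := (@lebesgue_measure R).
Local Notation L := (@leb2 R).
Local Notation R1 := (measurableTypeR R).
Local Notation T2 := (R1 * R1)%type.
Local Notation LL := (L \x L)%E.
Implicit Types (f g w : T2 -> R) (rho sig : T2 -> R).

Definition refl (x : T2) : T2 := (- x.1, x.2).

Lemma mpres_refl : mpres refl. Proof. exact: mpres_refl1. Qed.

Lemma reflK : involutive refl.
Proof. by case=> a b; rewrite /refl /= opprK. Qed.

Lemma eucl_refl (x : T2) : eucl (refl x) = eucl x.
Proof. by rewrite /eucl /= sqrrN. Qed.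

(** Two-point rearrangement: the larger of the two mirror values goes to the side [x.1 > 0]. On the
    mirror line both coincide, so the choice of [min] there changes nothing. *)
Definition polar w (x : T2) : R :=
  if 0 < x.1 then Num.max (w x) (w (refl x)) else Num.min (w x) (w (refl x)).

Lemma measurable_polar w : measurable_fun setT w -> measurable_fun setT (polar w).
Proof. by move=> mw; have [mr _] := mpres_refl; rewrite /polar; mf. Qed.

Lemma polar_pos w (x : T2) : 0 < x.1 ->
  polar w x = Num.max (w x) (w (refl x)) /\ polar w (refl x) = Num.min (w x) (w (refl x)).
Proof.
move=> x0; rewrite /polar x0 reflK; split=> //.
by rewrite /= oppr_gt0 ltNge (ltW x0)/= minC.
Qed.

Lemma refl0 (x : T2) : x.1 = 0 -> refl x = x.
Proof. by case: x => a b /= ->; rewrite /refl /= oppr0. Qed.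

Lemma polar0 w (x : T2) : x.1 = 0 -> polar w x = w x.
Proof. by move=> x0; rewrite /polar x0 ltxx refl0// minxx. Qed.

Lemma integral_refl_sym (F G : T2 -> R) : measurable_fun setT F -> measurable_fun setT G ->
  (forall x, 0 <= F x) -> (forall x, 0 <= G x) ->
  (forall x, F x + F (refl x) <= G x + G (refl x)) ->
  (\int[L]_x (F x)%:E <= \int[L]_x (G x)%:E)%E.
Proof.
move=> mF mG F0 G0 FG; have [mr hr] := mpres_refl.
have S (H : T2 -> R) : measurable_fun setT H -> (forall x, 0 <= H x) ->
    (\int[L]_x (H x + H (refl x))%:E = 2%:E * \int[L]_x (H x)%:E)%E.
  move=> mH H0; rewrite ge0_integral_EFinD//; last by mf.
  have -> : (\int[L]_x (H (refl x))%:E = \int[L]_x (H x)%:E)%E.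
    by apply: (hr (fun x => (H x)%:E)); [mf|move=> x; rewrite lee_fin].
  by rewrite -[2]/(1 + 1)%R EFinD ge0_muleDl ?mul1e ?lee_fin.
have : (2%:E * \int[L]_x (F x)%:E <= 2%:E * \int[L]_x (G x)%:E)%E.
  rewrite -(S _ mF F0) -(S _ mG G0); apply: ge0_le_integral; first exact: measurableT.
  - by move=> x _; rewrite lee_fin addr_ge0.
  - by mf.
  - by mf.
  - by move=> x _; rewrite lee_fin.
by rewrite lee_pmul2l.
Qed.

Lemma integral_refl_eq (F G : T2 -> R) : measurable_fun setT F -> measurable_fun setT G ->
  (forall x, 0 <= F x) -> (forall x, 0 <= G x) ->
  (forall x, F x + F (refl x) = G x + G (refl x)) ->
  (\int[L]_x (F x)%:E = \int[L]_x (G x)%:E)%E.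
Proof.
move=> mF mG F0 G0 FG; apply/eqP; rewrite eq_le.
by apply/andP; split; apply: integral_refl_sym => // x; rewrite FG.
Qed.

Lemma polar_sym w (P : R -> R -> Prop) x :
  P (Num.max (w x) (w (refl x))) (Num.min (w x) (w (refl x))) ->
  P (Num.min (w x) (w (refl x))) (Num.max (w x) (w (refl x))) -> P (polar w x) (polar w (refl x)).
Proof.
move=> h1 h2; have [x0|x0|x0] := ltgtP x.1 0.
- have r0 : 0 < (refl x).1 by rewrite /= oppr_gt0.
  have [e1 e2] := polar_pos w r0; rewrite reflK in e1 e2.
  by rewrite e1 e2 maxC minC.
- by have [-> ->] := polar_pos w x0.
- by move: h1; rewrite refl0// maxxx minxx polar0.
Qed.

Lemma polar_sqr_sum w x (k : R) :
  k * polar w x ^+ 2 + k * polar w (refl x) ^+ 2 = k * w x ^+ 2 + k * w (refl x) ^+ 2.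
Proof.
apply: (polar_sym (P := fun a b => k * a ^+ 2 + k * b ^+ 2 = _)).
  by rewrite maxEle minEle; case: ifP => _; ring.
by rewrite maxEle minEle; case: ifP => _; ring.
Qed.

Lemma N2_polar w : measurable_fun setT w -> N2 L (polar w) = N2 L w.
Proof.
move=> mw; have mp := measurable_polar mw; apply: integral_refl_eq.
- by mf.
- by mf.
- by move=> x; rewrite sqr_ge0.
- by move=> x; rewrite sqr_ge0.
- by move=> x; have := polar_sqr_sum w x 1; rewrite !mul1r.
Qed.

Lemma ln_polar w : measurable_fun setT w ->
  (\int[L]_x (ln (1 + eucl x) * polar w x ^+ 2)%:E = \int[L]_x (ln (1 + eucl x) * w x ^+ 2)%:E)%E.
Proof.
move=> mw; have mp := measurable_polar mw; have me := @measurable_eucl R.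
have l0 (z : T2) : 0 <= ln (1 + eucl z) by rewrite ln_ge0// lerDl eucl_ge0.
apply: integral_refl_eq.
- by mf.
- by mf.
- by move=> x; rewrite mulr_ge0 ?sqr_ge0.
- by move=> x; rewrite mulr_ge0 ?sqr_ge0.
- by move=> x; rewrite eucl_refl polar_sqr_sum.
Qed.

Lemma maxmin_sqr_sub (p q r s : R) :
  (Num.max p q - Num.max r s) ^+ 2 + (Num.min p q - Num.min r s) ^+ 2 <= (p - r) ^+ 2 + (q - s) ^+ 2.
Proof.
rewrite !maxEle !minEle; case: (leP p q) => h1; case: (leP r s) => h2; nra.
Qed.

Lemma N2_diffq_polar2 w h : measurable_fun setT w ->
  (N2 L (diffq (axv true h) (polar w)) <= N2 L (diffq (axv true h) w))%E.
Proof.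
move=> mw; have mp := measurable_polar mw.
have [ms _] := mpres_shift (axv true h).
apply: integral_refl_sym.
- by rewrite /diffq; mf.
- by rewrite /diffq; mf.
- by move=> x; rewrite sqr_ge0.
- by move=> x; rewrite sqr_ge0.
move=> x; rewrite /diffq.
have E (y : T2) : refl y + axv true h = refl (y + axv true h).
  by rewrite /refl /axv !addrpE /= !addr0.
have E1 (y : T2) : (y + axv true h).1 = y.1 by rewrite /axv addrpE /= addr0.
rewrite !E; set y := x + axv true h; have y1 : y.1 = x.1 by exact: E1.
have [x0|x0|x0] := ltgtP x.1 0.
- have y0 : 0 < (refl y).1 by rewrite -[(refl y).1]/(- y.1) y1 oppr_gt0.
  have r0 : 0 < (refl x).1 by rewrite /= oppr_gt0.
  have [e1 e2] := polar_pos w r0; have [e3 e4] := polar_pos w y0; rewrite !reflK in e1 e2 e3 e4.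
  by rewrite e1 e2 e3 e4 addrC [leRHS]addrC; exact: maxmin_sqr_sub.
- have y0 : 0 < y.1 by rewrite y1.
  have [-> ->] := polar_pos w x0; have [-> ->] := polar_pos w y0; exact: maxmin_sqr_sub.
- have y0 : y.1 = 0 by rewrite y1.
  by rewrite !(refl0 x0) !(refl0 y0) !polar0.
Qed.

(** The sum over independent sign changes of the first coordinate of the point and of the second
    abscissa; integration cannot distinguish [F] from a quarter of it, and polarisation is compared
    on these four terms. *)
Definition quad1 (F : T2 * R1 -> R) (z : T2 * R1) : R :=
  F z + F (refl z.1, z.2) + F (z.1, - z.2) + F (refl z.1, - z.2).

Lemma quad1_le_integral (F G : T2 * R1 -> R) : measurable_fun setT F -> measurable_fun setT G ->
  (forall z, 0 <= F z) -> (forall z, 0 <= G z) -> (forall z, quad1 F z <= quad1 G z) ->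
  (\int[L]_x \int[mu]_b (F (x, b))%:E <= \int[L]_x \int[mu]_b (G (x, b))%:E)%E.
Proof.
move=> mF mG F0 G0 FG; have [mr hr] := mpres_refl.
have mx (H : T2 * R1 -> R) : measurable_fun setT H -> (forall z, 0 <= H z) ->
    measurable_fun setT (fun x : T2 => \int[mu]_b (H (x, b))%:E)%E.
  move=> mH H0; apply: (@measurable_fun_fubini_tonelli_F _ _ T2 R1 R mu (fun z => (H z)%:E)).
    by mf.
  by move=> z; rewrite lee_fin.
have ge (H : T2 * R1 -> R) : (forall z, 0 <= H z) -> (0 <= \int[L]_x \int[mu]_b (H (x, b))%:E)%E.
  by move=> H0; apply: integral_ge0 => x _; apply: integral_ge0 => b _; rewrite lee_fin.
have D (H K : T2 * R1 -> R) : measurable_fun setT H -> measurable_fun setT K ->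
    (forall z, 0 <= H z) -> (forall z, 0 <= K z) ->
    (\int[L]_x \int[mu]_b (H (x, b) + K (x, b))%:E =
     \int[L]_x \int[mu]_b (H (x, b))%:E + \int[L]_x \int[mu]_b (K (x, b))%:E)%E.
  move=> mH mK H0 K0; rewrite -ge0_integralD//; last 4 first.
  - by move=> x _; apply: integral_ge0 => b _; rewrite lee_fin.
  - exact: mx.
  - by move=> x _; apply: integral_ge0 => b _; rewrite lee_fin.
  - exact: mx.
  apply: eq_integral => x _; rewrite ge0_integral_EFinD//.
  - exact: (measurableT_comp mH (pair1_measurable x)).
  - exact: (measurableT_comp mK (pair1_measurable x)).
have S (H : T2 * R1 -> R) : measurable_fun setT H -> (forall z, 0 <= H z) ->
    (\int[L]_x \int[mu]_b (quad1 H (x, b))%:E = 4%:E * \int[L]_x \int[mu]_b (H (x, b))%:E)%E.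
  move=> mH H0; pose H1 z := H (refl z.1, z.2); pose H2 (z : T2 * R1) := H (z.1, - z.2).
  pose H3 (z : T2 * R1) := H (refl z.1, - z.2).
  have m1 : measurable_fun setT H1 by rewrite /H1; mf.
  have m2 : measurable_fun setT H2 by rewrite /H2; mf.
  have m3 : measurable_fun setT H3 by rewrite /H3; mf.
  have p1 z : 0 <= H1 z by exact: H0.
  have p2 z : 0 <= H2 z by exact: H0.
  have p3 z : 0 <= H3 z by exact: H0.
  have E1 : (\int[L]_x \int[mu]_b (H1 (x, b))%:E = \int[L]_x \int[mu]_b (H (x, b))%:E)%E.
    apply: (hr (fun x => \int[mu]_b (H (x, b))%:E)%E); first exact: mx.
    by move=> x; apply: integral_ge0 => b _; rewrite lee_fin.
  have o (x : T2) : (\int[mu]_b (H (x, - b))%:E = \int[mu]_b (H (x, b))%:E)%E.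
    apply: (@integral_oppr R (fun b => (H (x, b))%:E)).
      apply/measurable_EFinP; exact: (measurableT_comp mH (pair1_measurable x)).
    by move=> b; rewrite lee_fin.
  have E2 : (\int[L]_x \int[mu]_b (H2 (x, b))%:E = \int[L]_x \int[mu]_b (H (x, b))%:E)%E.
    by apply: eq_integral => x _; exact: o.
  have E3 : (\int[L]_x \int[mu]_b (H3 (x, b))%:E = \int[L]_x \int[mu]_b (H (x, b))%:E)%E.
    by rewrite -E1; apply: eq_integral => x _; exact: (o (refl x)).
  have d1 : measurable_fun setT (fun z => H z + H1 z) by mf.
  have d2 : measurable_fun setT (fun z => H z + H1 z + H2 z) by mf.
  have g1 z : 0 <= H z + H1 z by rewrite addr_ge0.
  have g2 z : 0 <= H z + H1 z + H2 z by rewrite addr_ge0.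
  rewrite (D _ _ d2 m3 g2 p3) (D _ _ d1 m2 g1 p2) (D _ _ mH m1 H0 p1) E1 E2 E3.
  have -> : (4 : R) = 1 + 1 + 1 + 1 by ring.
  by rewrite !EFinD !ge0_muleDl ?mul1e ?lee_fin//; apply: ge.
have mq (H : T2 * R1 -> R) : measurable_fun setT H -> measurable_fun setT (quad1 H).
  by move=> mH; rewrite /quad1; mf.
have q0 (H : T2 * R1 -> R) : (forall z, 0 <= H z) -> forall z, 0 <= quad1 H z.
  by move=> H0 z; rewrite /quad1 !addr_ge0.
have : (4%:E * \int[L]_x \int[mu]_b (F (x, b))%:E <= 4%:E * \int[L]_x \int[mu]_b (G (x, b))%:E)%E.
  rewrite -(S _ mF F0) -(S _ mG G0); apply: ge0_le_integral; first exact: measurableT.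
  - by move=> x _; apply: integral_ge0 => b _; rewrite lee_fin q0.
  - by apply: mx; [exact: mq|exact: q0].
  - by apply: mx; [exact: mq|exact: q0].
  move=> x _; apply: ge0_le_integral => //.
  - by move=> b _; rewrite lee_fin q0.
  - by apply/measurable_EFinP; exact: (measurableT_comp (mq _ mF) (pair1_measurable x)).
  - by apply/measurable_EFinP; exact: (measurableT_comp (mq _ mG) (pair1_measurable x)).
  - by move=> b _; rewrite lee_fin.
by rewrite lee_pmul2l.
Qed.

(** Across the mirror line a shift does not commute with the reflection, so increments at one fixed
    step cannot be compared pointwise. Integrated over all steps shorter than [t], they become a
    double integral with a kernel that favours points on the same side, and this form does
    decrease. *)
Definition nearsq w (t : R) (z : T2 * R1) : R :=
  (if `|z.1.1 - z.2| < t then 1 else 0) * (w z.1 - w (z.2, z.1.2)) ^+ 2.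

Lemma nearsq_ge0 w t z : 0 <= nearsq w t z.
Proof. by rewrite mulr_ge0 ?sqr_ge0//; case: ifP. Qed.

Lemma measurable_nearsq w t : measurable_fun setT w -> measurable_fun setT (nearsq w t).
Proof. by move=> mw; rewrite /nearsq; mf. Qed.

(** The sum of the four squares is invariant under polarisation, while the sum of the two squares
    within the same side decreases; hence giving the latter the larger weight [k1] can only help. *)
Lemma two_point_sqr (k1 k2 p q r s : R) : k2 <= k1 ->
  k1 * ((Num.max p q - Num.max r s) ^+ 2 + (Num.min p q - Num.min r s) ^+ 2) +
  k2 * ((Num.max p q - Num.min r s) ^+ 2 + (Num.min p q - Num.max r s) ^+ 2) <=
  k1 * ((p - r) ^+ 2 + (q - s) ^+ 2) + k2 * ((p - s) ^+ 2 + (q - r) ^+ 2).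
Proof.
move=> k12.
have E : (Num.max p q - Num.max r s) ^+ 2 + (Num.min p q - Num.min r s) ^+ 2 +
  ((Num.max p q - Num.min r s) ^+ 2 + (Num.min p q - Num.max r s) ^+ 2) =
  (p - r) ^+ 2 + (q - s) ^+ 2 + ((p - s) ^+ 2 + (q - r) ^+ 2).
  by rewrite !maxEle !minEle; case: ifP => _; case: ifP => _; ring.
have M := maxmin_sqr_sub p q r s.
move: E M; generalize ((Num.max p q - Num.max r s) ^+ 2 + (Num.min p q - Num.min r s) ^+ 2).
generalize ((Num.max p q - Num.min r s) ^+ 2 + (Num.min p q - Num.max r s) ^+ 2).
generalize ((p - r) ^+ 2 + (q - s) ^+ 2); generalize ((p - s) ^+ 2 + (q - r) ^+ 2) => D C B A E M.
have : 0 <= (k1 - k2) * (C - A) by rewrite mulr_ge0 ?subr_ge0.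
have -> : D = A + B - C by lra.
by lra.
Qed.

Lemma quad1_nearsq_polar w t z : quad1 (nearsq (polar w) t) z <= quad1 (nearsq w t) z.
Proof.
have pos (x : T2) (b : R) : 0 <= x.1 -> 0 <= b ->
    quad1 (nearsq (polar w) t) (x, b) <= quad1 (nearsq w t) (x, b).
  case: x => a y /= a0 b0; rewrite /quad1 /nearsq /=.
  rewrite -/(refl (a, y)) -[(- b, y)]/(refl (b, y)).
  have n1 : `|- a - b| = `|a + b| by rewrite -opprD normrN.
  have n2 : `|- a - - b| = `|a - b| by rewrite opprK addrC distrC.
  rewrite n1 n2 opprK.
  set k1 := (if `|a - b| < t then 1 else 0); set k2 := (if `|a + b| < t then 1 else 0).
  have k12 : k2 <= k1.
    rewrite /k1 /k2; case: ifP => h; last by case: ifP.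
    rewrite (le_lt_trans _ h)//.
    by rewrite [leRHS]ger0_norm ?addr_ge0// ler_norml; apply/andP; split; lra.
  have pE (c : R) : 0 <= c -> polar w (c, y) = Num.max (w (c, y)) (w (refl (c, y))) /\
      polar w (refl (c, y)) = Num.min (w (c, y)) (w (refl (c, y))).
    rewrite le_eqVlt => /orP[/eqP <-|c0]; last exact: polar_pos.
    by rewrite refl0// maxxx minxx polar0.
  have [-> ->] := pE _ a0; have [-> ->] := pE _ b0.
  by have := two_point_sqr (w (a, y)) (w (refl (a, y))) (w (b, y)) (w (refl (b, y))) k12; lra.
have s1 (F : T2 * R1 -> R) x b : quad1 F (refl x, b) = quad1 F (x, b).
  by rewrite /quad1 /= reflK; ring.
have s2 (F : T2 * R1 -> R) x b : quad1 F (x, - b) = quad1 F (x, b).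
  by rewrite /quad1 /= opprK; ring.
case: z => x b; have [x0|x0] := leP 0 x.1; have [b0|b0] := leP 0 b.
- exact: pos.
- by rewrite -s2 -[leRHS]s2; apply: pos => //; rewrite oppr_ge0 ltW.
- by rewrite -s1 -[leRHS]s1; apply: pos => //; rewrite /= oppr_ge0 ltW.
- by rewrite -s1 -s2 -[leRHS]s1 -[leRHS]s2; apply: pos => //=; rewrite oppr_ge0 ltW.
Qed.

Lemma integral_nearsq w t : measurable_fun setT w ->
  (\int[L]_x \int[mu]_b (nearsq w t (x, b))%:E =
   \int[mu]_s ((if (`|s| < t)%R then 1 else 0)%:E * N2 L (diffq (axv false s) w)))%E.
Proof.
move=> mw; pose F (z : T2 * R1) : \bar R := (nearsq w t (z.1, z.2 + z.1.1))%:E.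
have mF : measurable_fun setT F by rewrite /F /nearsq; mf.
have F0 z : (0 <= F z)%E by rewrite lee_fin nearsq_ge0.
transitivity (\int[L]_x \int[mu]_s F (x, s))%E.
  apply: eq_integral => x _; apply: esym.
  apply: (@integral_shift R x.1 (fun b => (nearsq w t (x, b))%:E)) => [|b].
    apply/measurable_EFinP; exact: (measurableT_comp (measurable_nearsq t mw) (pair1_measurable x)).
  by rewrite lee_fin nearsq_ge0.
rewrite (@fubini_tonelli _ _ _ _ R L mu F mF F0).
apply: eq_integral => s _; rewrite -ge0_integral_EFinZ//; last 3 first.
- by case: ifP.
- by have [ms _] := mpres_shift (axv false s); rewrite /diffq; mf.
- by move=> x; rewrite sqr_ge0.
apply: eq_integral => x _; rewrite /F /nearsq /=.
rewrite opprD addrCA subrr addr0 normrN; congr ((_ * _)%:E).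
by rewrite -sqrrN opprB /diffq /axv addrpE /= addr0 (addrC s).
Qed.

Lemma N2_diffqN (c : T2) f : measurable_fun setT f -> N2 L (diffq (- c) f) = N2 L (diffq c f).
Proof.
move=> mf; have [ms _] := mpres_shift c.
have mD : measurable_fun setT (diffq c f) by rewrite /diffq; mf.
rewrite -(N2_mpres (mpres_shift (- c)) mD); apply: eq_integral => x _.
by rewrite /diffq subrK -sqrrN opprB.
Qed.

Lemma axvN b (h : R) : axv b (- h) = - axv b h.
Proof. by case: b; rewrite /axv oppr_pairE /= oppr0. Qed.

Lemma diffq0 f : N2 L (diffq 0 f) = 0%E.
Proof. by apply: integral0_eq => x _; rewrite /diffq addr0 subrr expr0n. Qed.

Lemma axv0 b : axv b (0 : R) = 0.
Proof. by case: b. Qed.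

Lemma dir_le_abs b f (s h : R) : measurable_fun setT f -> dir_le b f s ->
  (N2 L (diffq (axv b h) f) <= (s * h ^+ 2)%:E)%E.
Proof.
move=> mf ds; have [h0|h0|->] := ltgtP h 0; last by rewrite axv0 diffq0 expr0n mulr0.
- rewrite -[h]opprK axvN N2_diffqN// sqrrN; apply: ds; by rewrite oppr_gt0.
- exact: ds.
Qed.

Definition near2 (t s : R) : R := (if `|s| < t then 1 else 0) * s ^+ 2.

Lemma integral_near2 t : 0 < t -> exists2 J : R, 0 < J & (\int[mu]_s (near2 t s)%:E = J%:E)%E.
Proof.
move=> t0; have m1 : measurable_fun setT (near2 t : R1 -> R) by rewrite /near2; mf.
have n0 s : 0 <= near2 t s by rewrite mulr_ge0 ?sqr_ge0//; case: ifP.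
have bl (a b : R) : a <= b -> (\int[mu]_s (between a b s)%:E = (b - a)%:E)%E.
  move=> ab; rewrite betweenE integral_indic// setIT; apply: etrans (lebesgue_measure_itv `[a, b]) _.
  by rewrite /= lte_fin; have [_|ba] := ltP a b; [rewrite -EFinB|rewrite (@le_anti _ _ a b) ?subrr// ab].
have mb a b : measurable_fun setT (between a b : R1 -> R) by exact: measurable_between.
have up : (\int[mu]_s (near2 t s)%:E <= (t ^+ 2 * (t - - t))%:E)%E.
  rewrite EFinM -bl; last by lra.
  rewrite -ge0_integral_EFinZ ?sqr_ge0//; last exact: between_ge0.
  have mbt := mb (- t) t.
  apply: ge0_le_integral => //.
  - by move=> s _; rewrite lee_fin.
  - by mf.
  - by mf.
  move=> s _; rewrite lee_fin /near2 /between; case: ifP => h; last first.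
    by rewrite mul0r mulr_ge0 ?sqr_ge0//; case: ifP.
  have := ltW h; rewrite ler_norml => hh; rewrite hh mul1r mulr1.
  by rewrite -(real_normK (num_real s)) lerXn2r ?nnegrE ?(ltW t0)// ltW.
have lo : (((t / 2) ^+ 2 * (t / 4))%:E <= \int[mu]_s (near2 t s)%:E)%E.
  have -> : t / 4 = (3 * t / 4) - t / 2 by field.
  rewrite EFinM -bl; last by lra.
  rewrite -ge0_integral_EFinZ ?sqr_ge0//; last exact: between_ge0.
  have mbt := mb (t / 2) (3 * t / 4).
  apply: ge0_le_integral => //.
  - by move=> s _; rewrite lee_fin mulr_ge0 ?sqr_ge0 ?between_ge0.
  - by mf.
  - by mf.
  move=> s _; rewrite lee_fin /near2 /between; case: ifP => [/andP[h1 h2]|_]; last first.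
    by rewrite mulr0 mulr_ge0 ?sqr_ge0//; case: ifP.
  have s0 : 0 <= s by apply: le_trans h1; rewrite divr_ge0// ltW.
  rewrite mulr1 ger0_norm// ifT; last by lra.
  by rewrite mul1r lerXn2r ?nnegrE// divr_ge0// ltW.
have fin : (\int[mu]_s (near2 t s)%:E)%E \is a fin_num.
  rewrite ge0_fin_numE; first by apply: le_lt_trans up _; rewrite ltry.
  by apply: integral_ge0 => s _; rewrite lee_fin.
exists (fine (\int[mu]_s (near2 t s)%:E)%E); last by rewrite fineK.
rewrite -lte_fin fineK//; apply: lt_le_trans lo.
by rewrite lte_fin mulr_gt0 ?exprn_gt0 ?divr_gt0.
Qed.

(** If the polarised function exceeded the energy [s] by [e] at all small steps, integrating over
    those steps would contradict the comparison of the [nearsq] integrals. So good steps exist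
    arbitrarily close to 0, which is all that [is_dir_exists] asks for. *)
Lemma is_dir_polar1 w s : L2 L w -> is_dir false w s ->
  exists2 p, p <= s & is_dir false (polar w) p.
Proof.
move=> lw [s0 ds _]; have [mw _] := lw.
have mp := measurable_polar mw.
have lp : L2 L (polar w) by split=> //; rewrite N2_polar//; case: lw.
have key e t : 0 < e -> 0 < t -> exists h, [/\ 0 < h, h < t &
    (N2 L (diffq (axv false h) (polar w)) <= ((s + e) * h ^+ 2)%:E)%E].
  move=> e0 t0; apply: contrapT => H.
  have {}H h : 0 < h -> h < t -> (((s + e) * h ^+ 2)%:E <= N2 L (diffq (axv false h) (polar w)))%E.
    move=> h0 ht; rewrite leNgt; apply/negP => hh; apply: H; exists h; split=> //.
    exact: ltW.
  have {}H h : `|h| < t -> (((s + e) * h ^+ 2)%:E <= N2 L (diffq (axv false h) (polar w)))%E.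
    move=> ht; have [h0|h0|->] := ltgtP h 0.
    - rewrite -[h]opprK axvN N2_diffqN// sqrrN; apply: H; first by rewrite oppr_gt0.
      by rewrite -(ltr0_norm h0).
    - by apply: H => //; rewrite -(gtr0_norm h0).
    - by rewrite axv0 diffq0 expr0n mulr0.
  have [J J0 JE] := integral_near2 t0.
  have m2 : measurable_fun setT (near2 t : R1 -> R) by rewrite /near2; mf.
  have n0 h : 0 <= near2 t h by rewrite mulr_ge0 ?sqr_ge0//; case: ifP.
  have mN f : measurable_fun setT f ->
      measurable_fun setT (fun h : R1 => ((if `|h| < t then 1 else 0)%:E * N2 L (diffq (axv false h) f))%E).
    move=> mf; apply: emeasurable_funM; first by mf.
    apply: (@measurable_fun_fubini_tonelli_F _ _ R1 T2 R L
      (fun z : R1 * T2 => (diffq (axv false z.1) f z.2 ^+ 2)%:E)).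
      by rewrite /diffq /axv; mf.
    by move=> z; rewrite lee_fin sqr_ge0.
  have c1 : (((s + e) * J)%:E <= \int[L]_x \int[mu]_b (nearsq (polar w) t (x, b))%:E)%E.
    rewrite integral_nearsq// EFinM -JE -ge0_integral_EFinZ//; last by rewrite addr_ge0// ltW.
    apply: ge0_le_integral => //.
    - by move=> h _; rewrite lee_fin mulr_ge0// addr_ge0// ltW.
    - by mf.
    - exact: mN.
    move=> h _; rewrite /near2; case: ifP => hh; last by rewrite mul0r mulr0 mul0e.
    by rewrite mul1r mul1e; exact: H.
  have c2 : (\int[L]_x \int[mu]_b (nearsq w t (x, b))%:E <= (s * J)%:E)%E.
    rewrite integral_nearsq// EFinM -JE -ge0_integral_EFinZ//.
    apply: ge0_le_integral => //.
    - by move=> h _; rewrite mule_ge0 ?N2_ge0// lee_fin; case: ifP.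
    - exact: mN.
    - by mf.
    move=> h _; rewrite /near2; case: ifP => hh; last by rewrite mul0r mulr0 mul0e.
    by rewrite mul1r mul1e; exact: dir_le_abs.
  have c3 := quad1_le_integral (measurable_nearsq t mp) (measurable_nearsq t mw)
    (nearsq_ge0 _ t) (nearsq_ge0 _ t) (quad1_nearsq_polar w t).
  have := le_trans c1 (le_trans c3 c2); rewrite lee_fin ler_pM2r//.
  by move: e0; lra.
have [|t|p _ hp] := @is_dir_exists _ false (polar w) (s + 1) lp; first by rewrite addr_ge0.
  by move=> t0; apply: key.
exists p => //; apply/ler_addgt0Pr => e e0; apply: (is_dir_min hp) => t t0.
exact: key.
Qed.

(** Shifts along the mirror line commute with the reflection, so here the comparison holds at every
    step. *)
Lemma is_dir_polar2 w s : L2 L w -> is_dir true w s ->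
  exists2 p, p <= s & is_dir true (polar w) p.
Proof.
move=> lw [s0 ds _]; have [mw _] := lw.
have lp : L2 L (polar w) by split; [exact: measurable_polar|rewrite N2_polar//; case: lw].
apply: (is_dir_exists lp s0); apply: dir_le_freq => h h0.
by apply: le_trans (ds _ h0); exact: N2_diffq_polar2.
Qed.

Lemma WX_polar w lam s1 s2 : WX w lam s1 s2 ->
  exists p1 p2, [/\ WX (polar w) lam p1 p2, p1 <= s1 & p2 <= s2].
Proof.
move=> [lw Nw d1 d2 ll]; have [mw _] := lw.
have [p1 h1 e1] := is_dir_polar1 lw d1; have [p2 h2 e2] := is_dir_polar2 lw d2.
exists p1, p2; split=> //; split=> //.
- by split; [exact: measurable_polar|rewrite N2_polar//; case: lw].
- by rewrite N2_polar.
- by rewrite ln_polar.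
Qed.

End polarization.

(** * Polarisation and the logarithmic energy *)

Section polarization_log.
Variable R : realType.
Local Notation mu := (@lebesgue_measure R).
Local Notation L := (@leb2 R).
Local Notation R1 := (measurableTypeR R).
Local Notation T2 := (R1 * R1)%type.
Local Notation LL := (L \x L)%E.
Implicit Types (f g w : T2 -> R) (rho sig : T2 -> R).

Lemma ae_mono2 (P Q S : T2 -> Prop) : (forall x, P x -> Q x -> S x) ->
  {ae L, forall x, P x} -> {ae L, forall x, Q x} -> {ae L, forall x, S x}.
Proof. by move=> PQ; apply: filterS2 => x; exact: PQ. Qed.

Lemma integrable_mpres2 phi psi (D : T2 * T2 -> R) : mpres phi -> mpres psi ->
  LL.-integrable setT (fun z => (D z)%:E) ->
  LL.-integrable setT (fun z => (D (phi z.1, psi z.2))%:E) /\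
  (\int[LL]_z (D (phi z.1, psi z.2))%:E = \int[LL]_z (D z)%:E)%E.
Proof.
move=> mp mq /integrableP[mD fD]; have [mphi _] := mp; have [mpsi _] := mq.
have mt : measurable_fun setT (fun z : T2 * T2 => (phi z.1, psi z.2)) by mf.
split.
- apply/integrableP; split; first exact: (measurableT_comp mD mt).
  have mA := measurableT_comp (@abse_measurable _ _) mD.
  by rewrite (LL_mpres mp mq mA (fun z => abse_ge0 _)).
- apply: (@integral_signed_inv _ _ _ LL _ (fun z => (D z)%:E) mt) => // G mG G0.
  exact: LL_mpres.
Qed.

(** The four mirror images of a pair of points, over which the change of the interaction is a single
    product, see [quad2_log]. *)
Definition quad2 (D : T2 * T2 -> R) (z : T2 * T2) : R :=
  D z + D (refl z.1, z.2) + D (z.1, refl z.2) + D (refl z.1, refl z.2).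

Lemma mpres_id : mpres (fun x : T2 => x).
Proof. by split=> //; exact: measurable_id. Qed.

Lemma quad2_int (D : T2 * T2 -> R) : LL.-integrable setT (fun z => (D z)%:E) ->
  LL.-integrable setT (fun z => (quad2 D z)%:E) /\
  (\int[LL]_z (quad2 D z)%:E = 4%:E * \int[LL]_z (D z)%:E)%E.
Proof.
move=> iD.
have [i1 e1] := integrable_mpres2 (@mpres_refl R) mpres_id iD.
have [i2 e2] := integrable_mpres2 mpres_id (@mpres_refl R) iD.
have [i3 e3] := integrable_mpres2 (@mpres_refl R) (@mpres_refl R) iD.
have E : (fun z => (quad2 D z)%:E) = (fun z => (D z)%:E) \+ (fun z => (D (refl z.1, z.2))%:E) \+
   (fun z => (D (z.1, refl z.2))%:E) \+ (fun z => (D (refl z.1, refl z.2))%:E) by [].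
have j1 := integrableD measurableT iD i1.
have j2 := integrableD measurableT j1 i2.
split.
  by rewrite E; exact: integrableD.
rewrite E (integralD measurableT j2 i3) (integralD measurableT j1 i2) (integralD measurableT iD i1).
rewrite e1 e2 e3.
have /fineK <- := integrable_fin_num measurableT iD.
by rewrite -!EFinD -EFinM; congr (_%:E); ring.
Qed.

Definition logG w (z : T2 * T2) : R := ln (eucl (z.1 - z.2)) * (w z.1 ^+ 2 * w z.2 ^+ 2).

(** The gain in [p r + q s] when both pairs are put in decreasing order (rearrangement inequality).
    It vanishes only if the pairs were already ordered alike. *)
Definition crossB (p q r s : R) : R :=
  Num.max p q * Num.max r s + Num.min p q * Num.min r s - (p * r + q * s).

Lemma crossB_ge0 p q r s : 0 <= crossB p q r s.
Proof.
by rewrite /crossB !maxEle !minEle; case: (leP p q) => h1; case: (leP r s) => h2; nra.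
Qed.

Lemma crossB_eq0 p q r s : crossB p q r s = 0 -> 0 <= (p - q) * (r - s).
Proof.
by rewrite /crossB !maxEle !minEle; case: (leP p q) => h1; case: (leP r s) => h2; nra.
Qed.

Lemma crossB_diag p q : crossB p q p q = 0.
Proof. by rewrite /crossB !maxEle !minEle; case: (leP p q) => h1; ring. Qed.

Lemma sqr_max (p q : R) : 0 <= p -> 0 <= q -> Num.max p q ^+ 2 = Num.max (p ^+ 2) (q ^+ 2).
Proof. by move=> p0 q0; rewrite !maxEle ler_sqr ?nnegrE//; case: ifP. Qed.

Lemma sqr_min (p q : R) : 0 <= p -> 0 <= q -> Num.min p q ^+ 2 = Num.min (p ^+ 2) (q ^+ 2).
Proof. by move=> p0 q0; rewrite !minEle ler_sqr ?nnegrE//; case: ifP. Qed.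

(** Reflection leaves only two distances, [|x - y|] and the larger [|x - refl y|], and polarisation
    moves exactly [crossB] units of squared mass products from the far pairs to the near ones. *)
Lemma quad2_log w (x y : T2) : (forall x, 0 <= w x) -> 0 <= x.1 -> 0 <= y.1 ->
  quad2 (fun z => logG w z - logG (polar w) z) (x, y) =
  (ln (eucl (x - refl y)) - ln (eucl (x - y))) *
  crossB (w x ^+ 2) (w (refl x) ^+ 2) (w y ^+ 2) (w (refl y) ^+ 2).
Proof.
move=> w0 x0 y0; rewrite /quad2 /logG /=.
have k1 : eucl (refl x - refl y) = eucl (x - y).
  by rewrite -(eucl_refl (x - y)); congr eucl; rewrite /refl addrpE oppr_pairE /= opprD opprK.
have k2 : eucl (refl x - y) = eucl (x - refl y).
  by rewrite -(eucl_refl (x - refl y)); congr eucl; rewrite /refl addrpE oppr_pairE /= opprD opprK.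
have pE (c : T2) : 0 <= c.1 -> polar w c = Num.max (w c) (w (refl c)) /\
      polar w (refl c) = Num.min (w c) (w (refl c)).
  rewrite le_eqVlt => /orP[/eqP c0|c0]; last exact: polar_pos.
  by rewrite refl0// maxxx minxx polar0.
rewrite k1 k2; have [-> ->] := pE _ x0; have [-> ->] := pE _ y0.
rewrite !sqr_max// !sqr_min// /crossB.
have S (p q : R) : Num.min p q = p + q - Num.max p q by rewrite -(addr_max_min p q); ring.
by rewrite !S; ring.
Qed.

Lemma eucl_refl_lt (x y : T2) : 0 < x.1 -> 0 < y.1 -> eucl (x - y) < eucl (x - refl y).
Proof.
move=> x0 y0; rewrite -ltr_sqr ?nnegrE ?eucl_ge0// !eucl_sqr /refl !addrpE !oppr_pairE /=.
by have := mulr_gt0 x0 y0; lra.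
Qed.

Lemma eucl_gt0 (x : R * R) : x != 0 -> 0 < eucl x.
Proof.
move=> xn; rewrite lt_neqAle eucl_ge0 andbT eq_sym; apply: contra xn => /eqP h.
by apply/eqP; exact: eucl_eq0.
Qed.

Lemma quad2_log_ge0 w z : (forall x, 0 <= w x) ->
  0 <= quad2 (fun z => logG w z - logG (polar w) z) z.
Proof.
move=> w0; set D := fun z => _.
have pos (x y : T2) : 0 <= x.1 -> 0 <= y.1 -> 0 <= quad2 D (x, y).
  move=> x0 y0; rewrite quad2_log//.
  have [->|xy] := eqVneq x y; first by rewrite crossB_diag mulr0.
  rewrite mulr_ge0 ?crossB_ge0// subr_ge0.
  have e0 : 0 < eucl (x - y) by apply: eucl_gt0; rewrite subr_eq0.
  have ee : eucl (x - y) <= eucl (x - refl y).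
    move: x0 y0; rewrite le_eqVlt => /orP[/eqP x0|x0].
      move=> _; rewrite -(eucl_refl (x - refl y)); rewrite le_eqVlt; apply/orP; left; apply/eqP.
      by congr eucl; rewrite /refl addrpE !oppr_pairE /= -x0 !sub0r !opprK.
    rewrite le_eqVlt => /orP[/eqP y0|y0]; first by rewrite (refl0 (esym y0)).
    by apply: ltW; exact: eucl_refl_lt.
  by rewrite ler_ln ?posrE// (lt_le_trans e0).
have s1 (F : T2 * T2 -> R) x y : quad2 F (refl x, y) = quad2 F (x, y).
  by rewrite /quad2 /= reflK; ring.
have s2 (F : T2 * T2 -> R) x y : quad2 F (x, refl y) = quad2 F (x, y).
  by rewrite /quad2 /= reflK; ring.
case: z => x y; have [x0|x0] := leP 0 x.1; have [y0|y0] := leP 0 y.1.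
- exact: pos.
- by rewrite -s2; apply: pos => //; rewrite /= oppr_ge0 ltW.
- by rewrite -s1; apply: pos => //; rewrite /= oppr_ge0 ltW.
- by rewrite -s1 -s2; apply: pos => //=; rewrite oppr_ge0 ltW.
Qed.

Lemma LL_ae_pair (P : T2 * T2 -> Prop) : {ae LL, forall z, P z} ->
  {ae L, forall x, {ae L, forall y, P (x, y)}}.
Proof.
move=> [N [mN N0 PN]].
have mf : measurable_fun setT (L \o xsection N) by exact: measurable_fun_xsection.
have : {ae L, forall x, L (xsection N x) = 0%E}.
  have h : (\int[L]_x `|(L \o xsection N) x| = 0)%E.
    by rewrite -[RHS]N0; apply: eq_integral => x _; rewrite gee0_abs.
  have /(ae_eq_integral_abs L measurableT mf) := h.
  by apply: filterS => x /(_ I).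
apply: ae_mono => x x0; exists (xsection N x); split=> //; first exact: measurable_xsection.
by move=> y /= Py; rewrite /xsection/= inE; exact: PN.
Qed.

(** By minimality the integral of the nonnegative [quad2 D] is at most 0, so [crossB] vanishes for
    almost every pair. If the second alternative fails, there is a typical point [x] with strictly
    larger value than its mirror image, and it dictates the order at almost every other point. *)
Lemma polar_dichotomy c e lam w s1 s2 : 0 < c -> minprob c e lam -> is_min c e lam w s1 s2 ->
  (forall x, 0 <= w x) ->
  {ae L, forall x, 0 < x.1 -> w (refl x) <= w x} \/ {ae L, forall x, 0 < x.1 -> w x <= w (refl x)}.
Proof.
move=> c0 hmin [hw he] w0; have ld := WX_logdens hw.
have [p1 [p2 [hp h1 h2]]] := WX_polar hw; have ldp := WX_logdens hp.
have iw := ln_eucl_integrable ld ld; have ip := ln_eucl_integrable ldp ldp.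
pose D (z : T2 * T2) := logG w z - logG (polar w) z.
have iD : LL.-integrable setT (fun z => (D z)%:E).
  have := integrableB measurableT iw ip.
  by apply: eq_integrable => // z _; rewrite /D /logG EFinB.
have DE : (\int[LL]_z (D z)%:E = (Elog w - Elog (polar w))%:E)%E.
  rewrite EFinB /Elog -(IlogE ld ld) -(IlogE ldp ldp) -(integralB measurableT iw ip).
  by apply: eq_integral => z _; rewrite /D /logG EFinB.
have [iq qE] := quad2_int iD.
have q0 z : 0 <= quad2 D z by exact: quad2_log_ge0.
have E1 := hmin _ _ _ hp.
have EE : Elog w <= Elog (polar w).
  have : c * Elog w <= c * Elog (polar w) by lra.
  by rewrite ler_pM2l.
have q00 : (\int[LL]_z `|(quad2 D z)%:E| = 0)%E.
  have -> : (\int[LL]_z `|(quad2 D z)%:E| = \int[LL]_z (quad2 D z)%:E)%E.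
    by apply: eq_integral => z _; rewrite gee0_abs// lee_fin.
  apply/eqP; rewrite eq_le; apply/andP; split; last first.
    by apply: integral_ge0 => z _; rewrite lee_fin.
  by rewrite qE DE -EFinM lee_fin pmulr_rle0// subr_le0.
have mq := measurable_int _ iq.
have aeq : {ae LL, forall z, quad2 D z = 0}.
  have /(ae_eq_integral_abs LL measurableT mq) := q00.
  by apply: filterS => z /(_ I) [].
have [N|N] := pselect {ae L, forall x, 0 < x.1 -> w x <= w (refl x)}; first by right.
left; have := LL_ae_pair aeq => ap.
have [x [x0 [xw xy]]] : exists x : T2, 0 < x.1 /\ w (refl x) < w x /\
    {ae L, forall y, quad2 D (x, y) = 0}.
  apply: contrapT => H; apply: N; apply: ae_mono ap => x hx x0.
  rewrite leNgt; apply/negP => hh; apply: H; exists x; split=> //; split=> //.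
have xd : {ae L, forall y, y <> x}.
  exists [set x]; split; [|exact: leb2_set1|].
    have -> : [set x] = [set x.1] `*` [set x.2].
      by apply/seteqP; split => [y ->|[a b] [/= -> ->]]//; rewrite -surjective_pairing.
    by apply: measurableX; exact: measurable_set1.
  by move=> y /= /contrapT.
apply: ae_mono2 xy xd => y h yx y0.
move: h; rewrite (quad2_log w0 (ltW x0) (ltW y0)) => /eqP; rewrite mulf_eq0 => /orP[|/eqP].
  rewrite subr_eq0 => /eqP h; exfalso.
  have e0 : 0 < eucl (x - y).
    by apply: eucl_gt0; rewrite subr_eq0; apply/eqP => xy'; apply: yx.
  have := eucl_refl_lt x0 y0; rewrite -ltr_ln ?posrE//; last first.
    by apply: lt_trans e0 _; exact: eucl_refl_lt.
  by rewrite h ltxx.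
move=> /crossB_eq0 h.
have hx : 0 < w x ^+ 2 - w (refl x) ^+ 2 by rewrite subr_gt0 ltr_sqr ?nnegrE.
by move: h; rewrite pmulr_rge0// subr_ge0 ler_sqr ?nnegrE.
Qed.

End polarization_log.

(** * Reflection symmetry of minimisers *)

Section reflection_symmetry.
Variable R : realType.
Local Notation mu := (@lebesgue_measure R).
Local Notation L := (@leb2 R).
Local Notation R1 := (measurableTypeR R).
Local Notation T2 := (R1 * R1)%type.
Local Notation LL := (L \x L)%E.
Implicit Types (f g w : T2 -> R).
Variables (c e lam : R).
Hypotheses (c0 : 0 < c) (lam0 : 0 < lam) (hmin : minprob c e lam).

Definition nnmin w := (forall x, 0 <= w x) /\ exists s1 s2, is_min c e lam w s1 s2.

Lemma nnmin_measurable w : nnmin w -> measurable_fun setT w.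
Proof. by move=> [_ [s1 [s2 [[[mw _] _ _ _ _] _]]]]. Qed.

Lemma nnmin_shift w d : nnmin w -> nnmin (fun x => w (x + d)).
Proof.
move=> hw; have mw := nnmin_measurable hw; case: hw => w0 [s1 [s2 [hw he]]]; split=> [x|]; first exact: w0.
exists s1, s2; split; first exact: WX_shift.
by rewrite Elog_shift.
Qed.

(** Rotation is only known not to increase the Dirichlet energy; minimality excludes a strict
    decrease. *)
Lemma nnmin_rot w a b : a ^+ 2 + b ^+ 2 = 1 -> nnmin w -> nnmin (fun x => w (plane_rot a b x)).
Proof.
move=> ab hw; have mw := nnmin_measurable hw; case: hw => w0 [s1 [s2 [hw he]]]; split=> [x|]; first exact: w0.
have [t1 [t2 [ht t12]]] := WX_rot ab hw; exists t1, t2; split=> //.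
have := hmin ht; rewrite Elog_rot//; lra.
Qed.

Lemma ae_mpres phi (P : T2 -> Prop) : mpres phi -> {ae L, forall x, P x} ->
  {ae L, forall x, P (phi x)}.
Proof.
move=> [mp hp] [N [mN N0 PN]]; exists (phi @^-1` N); split.
- by rewrite -[_ @^-1` _]setTI; exact: mp.
- have m1 : measurable_fun setT (fun x : T2 => (\1_N x)%:E : \bar R).
    by apply/measurable_EFinP; exact: measurable_indic.
  have mp1 : measurable (phi @^-1` N) by rewrite -[_ @^-1` _]setTI; exact: mp.
  have h1 : (\int[L]_x (\1_N x)%:E = 0)%E by rewrite integral_indic ?setIT.
  have h2 := hp _ m1; rewrite h1 in h2.
  transitivity (\int[L]_x (\1_(phi @^-1` N) x)%:E)%E; first by rewrite integral_indic ?setIT.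
  by apply: h2 => x; rewrite lee_fin indicE.
- by move=> x /= hx; apply: PN.
Qed.

Definition mright w (a : R) : \bar R := (\int[L]_x ((if (a < x.1)%R then 1 else 0) * w x ^+ 2)%:E)%E.
Definition mleft w (a : R) : \bar R := (\int[L]_x ((if (x.1 < a)%R then 1 else 0) * w x ^+ 2)%:E)%E.

Lemma mleft_refl w : measurable_fun setT w ->
  mleft w 0 = (\int[L]_x ((if (0 < x.1)%R then 1 else 0) * w (refl x) ^+ 2)%:E)%E.
Proof.
move=> mw; have [mr hr] := @mpres_refl R.
apply: etrans (esym (hr (fun x => ((if (x.1 < 0)%R then 1 else 0) * w x ^+ 2)%:E) _ _)) _.
- by mf.
- by move=> x; rewrite lee_fin mulr_ge0 ?sqr_ge0//; case: ifP.
by apply: eq_integral => x _; rewrite /= oppr_lt0.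
Qed.

(** The equality case that is used throughout: an ordered pair of functions whose finite integrals
    are ordered the other way. *)
Lemma ge0_integral_ae_eq d (X : measurableType d) (m : {measure set X -> \bar R}) (F G : X -> R) :
  measurable_fun setT F -> measurable_fun setT G ->
  (forall x, 0 <= F x) -> (forall x, 0 <= G x) -> {ae m, forall x, F x <= G x} ->
  (\int[m]_x (G x)%:E <= \int[m]_x (F x)%:E)%E -> (\int[m]_x (G x)%:E < +oo)%E ->
  {ae m, forall x, F x = G x}.
Proof.
move=> mF mG F0 G0 FG GF Gf.
have Ff : (\int[m]_x (F x)%:E <= \int[m]_x (G x)%:E)%E.
  apply: ae_ge0_le_integral => //.
  - by move=> x _; rewrite lee_fin.
  - by mf.
  - by move=> x _; rewrite lee_fin.
  - by mf.
  - by apply: filterS FG => x; rewrite lee_fin.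
have iG : m.-integrable setT (fun x => (G x)%:E).
  apply/integrableP; split; first by mf.
  suff -> : (\int[m]_x `|(G x)%:E| = \int[m]_x (G x)%:E)%E by [].
  by apply: eq_integral => x _; rewrite gee0_abs ?lee_fin.
have iF : m.-integrable setT (fun x => (F x)%:E).
  apply/integrableP; split; first by mf.
  suff -> : (\int[m]_x `|(F x)%:E| = \int[m]_x (F x)%:E)%E by apply: le_lt_trans Ff Gf.
  by apply: eq_integral => x _; rewrite gee0_abs ?lee_fin.
have h0 : (\int[m]_x `|(G x - F x)%:E| = 0)%E.
  transitivity (\int[m]_x ((G x)%:E - (F x)%:E))%E.
    have mD : measurable_fun setT (fun x => (G x - F x)%:E) by mf.
    apply: ae_eq_integral => //.
    - by apply: (measurableT_comp (@abse_measurable _ _)).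
    - apply: filterS FG => x h _.
      by rewrite gee0_abs// lee_fin subr_ge0.
  rewrite (integralB measurableT iG iF) (_ : (\int[m]_x (G x)%:E = \int[m]_x (F x)%:E)%E).
    by rewrite subee//; exact: integrable_fin_num.
  by apply/eqP; rewrite eq_le GF.
have mD : measurable_fun setT (fun x => (G x - F x)%:E) by mf.
have /(ae_eq_integral_abs m measurableT mD) := h0.
by apply: filterS => x /(_ I) [] /eqP; rewrite subr_eq0 => /eqP.
Qed.

(** If the order given by [polar_dichotomy] is the opposite one, the comparison of the two
    half-plane masses forces equality. *)
Lemma nnmin_half w : nnmin w -> (mright w 0 <= mleft w 0)%E ->
  {ae L, forall x, 0 < x.1 -> w x <= w (refl x)}.
Proof.
move=> hw RL; have mw := nnmin_measurable hw; case: hw => w0 [s1 [s2 hw]].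
have [mr hr] := @mpres_refl R.
have [h|//] := polar_dichotomy c0 hmin hw w0.
have : {ae L, forall x, (if (0 < x.1)%R then 1 else 0) * w (refl x) ^+ 2 =
    (if (0 < x.1)%R then 1 else 0) * w x ^+ 2}.
  apply: ge0_integral_ae_eq.
  - by mf.
  - by mf.
  - by move=> x; rewrite mulr_ge0 ?sqr_ge0//; case: ifP.
  - by move=> x; rewrite mulr_ge0 ?sqr_ge0//; case: ifP.
  - apply: ae_mono h => x; case: ifP => _; last by rewrite !mul0r.
    by move=> /(_ isT) hx; rewrite !mul1r ler_sqr ?nnegrE.
  - by rewrite -mleft_refl.
  - have [[[_ Nf] _ _ _ _] _] := hw; apply: le_lt_trans Nf; apply: ge0_le_integral => //.
    + by move=> x _; rewrite lee_fin mulr_ge0 ?sqr_ge0//; case: ifP.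
    + by mf.
    + by mf.
    + by move=> x _; rewrite lee_fin; case: ifP => _; rewrite ?mul1r// mul0r sqr_ge0.
apply: ae_mono => x + x0; rewrite x0 !mul1r => /eqP; rewrite eqrXn2// => /eqP ->.
by [].
Qed.

Lemma nnmin_half_eq w : nnmin w -> mright w 0 = mleft w 0 -> {ae L, forall x, w x = w (refl x)}.
Proof.
move=> hw RL; have h : {ae L, forall x, 0 < x.1 -> w x <= w (refl x)}.
  by apply: nnmin_half => //; rewrite RL.
have mw := nnmin_measurable hw; case: hw => w0 [s1 [s2 hw]].
have [mr hr] := @mpres_refl R.
have a1 : {ae L, forall x, (if (0 < x.1)%R then 1 else 0) * w x ^+ 2 =
    (if (0 < x.1)%R then 1 else 0) * w (refl x) ^+ 2}.
  apply: ge0_integral_ae_eq.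
  - by mf.
  - by mf.
  - by move=> x; rewrite mulr_ge0 ?sqr_ge0//; case: ifP.
  - by move=> x; rewrite mulr_ge0 ?sqr_ge0//; case: ifP.
  - apply: ae_mono h => x; case: ifP => _; last by rewrite !mul0r.
    by move=> /(_ isT) hx; rewrite !mul1r ler_sqr ?nnegrE.
  - by rewrite -mleft_refl// -RL.
  - rewrite -mleft_refl// -RL.
    have [[[_ Nf] _ _ _ _] _] := hw; apply: le_lt_trans Nf; apply: ge0_le_integral => //.
    + by move=> x _; rewrite lee_fin mulr_ge0 ?sqr_ge0//; case: ifP.
    + by mf.
    + by mf.
    + by move=> x _; rewrite lee_fin; case: ifP => _; rewrite ?mul1r// mul0r sqr_ge0.
have a2 : {ae L, forall x, 0 < x.1 -> w x = w (refl x)}.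
  by apply: ae_mono a1 => x + x0; rewrite x0 !mul1r => /eqP; rewrite eqrXn2// => /eqP ->.
have a3 := ae_mpres (@mpres_refl R) a2.
apply: ae_mono2 a2 a3 => x h1 h2.
have [x0|x0|x0] := ltgtP x.1 0.
- by rewrite h2 ?reflK//= oppr_gt0.
- exact: h1.
- by rewrite refl0.
Qed.

Lemma mright_shift w a : measurable_fun setT w -> mright (fun x => w (x + (a, 0))) 0 = mright w a.
Proof.
move=> mw; apply: etrans ((mpres_shift (a, 0)).2 (fun x => ((if (a < x.1)%R then 1 else 0) * w x ^+ 2)%:E) _ _).
- by apply: eq_integral => x _; rewrite /= ltrDr.
- by mf.
- by move=> x; rewrite lee_fin mulr_ge0 ?sqr_ge0//; case: ifP.
Qed.

Lemma mleft_shift w a : measurable_fun setT w -> mleft (fun x => w (x + (a, 0))) 0 = mleft w a.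
Proof.
move=> mw; apply: etrans ((mpres_shift (a, 0)).2 (fun x => ((if (x.1 < a)%R then 1 else 0) * w x ^+ 2)%:E) _ _).
- by apply: eq_integral => x _; rewrite /= gtrDr.
- by mf.
- by move=> x; rewrite lee_fin mulr_ge0 ?sqr_ge0//; case: ifP.
Qed.

Lemma le_weighted w (F G : T2 -> R) : measurable_fun setT w -> measurable_fun setT F ->
  measurable_fun setT G -> (forall x, 0 <= F x) -> (forall x, F x <= G x) ->
  (\int[L]_x (F x * w x ^+ 2)%:E <= \int[L]_x (G x * w x ^+ 2)%:E)%E.
Proof.
move=> mw mF mG F0 FG; apply: ge0_le_integral => //.
- by move=> x _; rewrite lee_fin mulr_ge0 ?sqr_ge0.
- by mf.
- by mf.
- by move=> x _; rewrite lee_fin ler_wpM2r ?sqr_ge0.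
Qed.

Lemma continuous_lipschitz (phi : R -> R) (K : R) : 0 <= K ->
  (forall a h, 0 < h -> `|phi (a + h) - phi a| <= K * h) -> continuous phi.
Proof.
move=> K0 H x; apply/cvgrPdist_le => /= eps eps0.
have d0 : 0 < eps / (K + 1) by rewrite divr_gt0// ltr_wpDl.
have key y : `|x - y| < eps / (K + 1) -> `|phi x - phi y| <= eps.
  move=> xy; have h : `|phi x - phi y| <= K * `|x - y|.
    have [yx|yx|->] := ltgtP y x; last by rewrite !subrr normr0 mulr0.
    - have := H y (x - y); rewrite subr_gt0 (_ : y + (x - y) = x) => [/(_ yx)|]; last by rewrite addrC subrK.
      by rewrite (gtr0_norm (_ : 0 < x - y)) ?subr_gt0.
    - have := H x (y - x); rewrite subr_gt0 (_ : x + (y - x) = y) => [/(_ yx)|]; last by rewrite addrC subrK.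
      rewrite distrC.
      by rewrite (distrC x) (gtr0_norm (_ : 0 < y - x)) ?subr_gt0.
  apply: le_trans h _; move: xy; rewrite ltr_pdivlMr ?ltr_wpDl// => xy.
  have := normr_ge0 (x - y); nra.
by near=> y; apply: key; near: y; exact: cvgr_dist_lt.
Unshelve. all: by end_near.
Qed.

(** Intermediate values for the difference of right and left mass. It is Lipschitz in the position
    of the line by [strip_bound], and the logarithmic moment bounds the mass far out, which fixes
    its signs at two distant lines. *)
Lemma nnmin_centre1 w : nnmin w -> exists a, {ae L, forall x, w (x + (a, 0)) = w (refl x + (a, 0))}.
Proof.
move=> hw; have mw := nnmin_measurable hw.
suff [a ha] : exists a, mright w a = mleft w a.
  exists a; have := nnmin_half_eq (nnmin_shift (a, 0) hw).
  by rewrite mright_shift// mleft_shift//; apply.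
have [w0 [s1 [s2 [[lw Nw [s10 ds _] _ ll] _]]]] := hw.
have me := @measurable_eucl R.
have iE (F : T2 -> R) : measurable_fun setT F -> (forall x, 0 <= F x <= 1) ->
    (\int[L]_x (F x * w x ^+ 2)%:E)%E \is a fin_num.
  move=> mF F01; rewrite ge0_fin_numE; last first.
    by apply: integral_ge0 => x _; rewrite lee_fin mulr_ge0 ?sqr_ge0//; case/andP: (F01 x).
  apply: (@le_lt_trans _ _ (N2 L w)); last by rewrite Nw ltry.
  apply: le_trans (le_weighted mw mF (measurable_cst (1 : R)) _ _) _.
  - by move=> x; case/andP: (F01 x).
  - by move=> x; case/andP: (F01 x).
  - by rewrite le_eqVlt; apply/orP; left; apply/eqP; apply: eq_integral => x _; rewrite mul1r.
have rf a : mright w a \is a fin_num by apply: iE => [|x]; [mf|case: ifP; rewrite ?lexx ?ler01].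
have lf a : mleft w a \is a fin_num by apply: iE => [|x]; [mf|case: ifP; rewrite ?lexx ?ler01].
pose phi a := fine (mright w a) - fine (mleft w a).
pose K := s1 + lam.
have strip a h : 0 < h -> (\int[L]_x ((if (a < x.1)%R && (x.1 <= a + h)%R then 1 else 0) * w x ^+ 2)%:E <= (h * K)%:E)%E.
  move=> h0; apply: le_trans (strip_bound a lw ds s10 Nw h0).
  rewrite le_eqVlt; apply/orP; left; apply/eqP; apply: eq_integral => x _; rewrite mulrC indicE.
  rewrite (_ : (x \in _) = (a < x.1) && (x.1 <= a + h)); first by case: ifP.
  by apply/idP/idP; rewrite inE.
have add3 (F G H : T2 -> R) : measurable_fun setT F -> measurable_fun setT G -> measurable_fun setT H ->
    (forall x, 0 <= F x) -> (forall x, 0 <= G x) -> (forall x, 0 <= H x) ->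
    (forall x, F x <= G x + H x) ->
    (\int[L]_x (F x * w x ^+ 2)%:E <= \int[L]_x (G x * w x ^+ 2)%:E + \int[L]_x (H x * w x ^+ 2)%:E)%E.
  move=> mF mG mH F0 G0 H0 FGH.
  rewrite -ge0_integral_EFinD; [|by mf|by mf|by move=> x; rewrite mulr_ge0 ?sqr_ge0|
    by move=> x; rewrite mulr_ge0 ?sqr_ge0].
  have -> : (\int[L]_x (G x * w x ^+ 2 + H x * w x ^+ 2)%:E = \int[L]_x ((G x + H x) * w x ^+ 2)%:E)%E.
    by apply: eq_integral => x _; rewrite mulrDl.
  by apply: le_weighted => //; mf.
have i0 (b : bool) : 0 <= (if b then 1 else 0 : R) by case: b.
have rmono a h : 0 < h -> fine (mright w (a + h)) <= fine (mright w a) <= fine (mright w (a + h)) + h * K.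
  move=> h0; apply/andP; split.
    rewrite -lee_fin !fineK//; apply: le_weighted => //; [by mf|by mf|].
    by move=> x; case: ifP => h1; case: ifP => h2 //; exfalso; move: h0 h1 h2 => h0 h1 /negbT; lra.
  rewrite -lee_fin EFinD !fineK//; apply: le_trans (leeD (lexx _) (strip a h h0)).
  apply: add3 => //; [by mf|by mf|by mf|] => x.
  case: ifP => h1; last by rewrite addr_ge0.
  by have [h2|h2] := leP x.1 (a + h); rewrite /= ?add0r ?addr0.
(* [mleft] excludes its boundary line, so the mass gained lies in a strip that contains its left
   edge, whereas [strip] excludes it; the strip is widened to the left by [h], whence the factor
   2. *)
have lmono a h : 0 < h -> fine (mleft w a) <= fine (mleft w (a + h)) <= fine (mleft w a) + 2 * h * K.
  move=> h0; apply/andP; split.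
    rewrite -lee_fin !fineK//; apply: le_weighted => //; [by mf|by mf|].
    by move=> x; case: ifP => h1; case: ifP => h2 //; exfalso; move: h0 h1 h2 => h0 h1 /negbT; lra.
  have h20 : 0 < 2 * h by rewrite mulr_gt0.
  rewrite -lee_fin EFinD !fineK//; apply: le_trans (leeD (lexx _) (strip (a - h) (2 * h) h20)).
  apply: add3 => //; [by mf|by mf|by mf|] => x.
  case: ifP => h1; last by rewrite addr_ge0.
  have [h2|h2] := ltP x.1 a; first by rewrite lerDl.
  rewrite ifT ?add0r//; apply/andP; split; lra.
have cphi : continuous phi.
  apply: (@continuous_lipschitz _ (3 * K)) => [|a h h0].
    by rewrite mulr_ge0// addr_ge0// ltW.
  have /andP[r1 r2] := rmono a h h0; have /andP[l1 l2] := lmono a h h0.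
  by rewrite /phi ler_norml; move: r1 r2 l1 l2; clear => *; apply/andP; split; lra.
pose Lam := fine (\int[L]_x (ln (1 + eucl x) * w x ^+ 2)%:E)%E.
have l0 (z : T2) : 0 <= ln (1 + eucl z) by rewrite ln_ge0// lerDl eucl_ge0.
have LamE : (\int[L]_x (ln (1 + eucl x) * w x ^+ 2)%:E = Lam%:E)%E.
  by rewrite fineK// ge0_fin_numE// integral_ge0// => x _; rewrite lee_fin mulr_ge0 ?sqr_ge0.
have Lam0 : 0 <= Lam by rewrite -lee_fin -LamE integral_ge0// => x _; rewrite lee_fin mulr_ge0 ?sqr_ge0.
(* Beyond distance [A = exp q] the weight [ln (1 + |x|)] is at least [q], so the mass there is at
   most [Lam / q], less than a quarter of [lam]. *)
pose q := 4 * (Lam + 1) / lam; have q0 : 0 < q by rewrite divr_gt0// mulr_gt0// ltr_wpDl.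
pose A := expR q; have A0 : 0 < A by exact: expR_gt0.
have tf : (\int[L]_x ((if (A <= `|x.1|)%R then 1 else 0) * w x ^+ 2)%:E)%E \is a fin_num.
  by apply: iE => [|x]; [mf|case: ifP; rewrite ?lexx ?ler01].
pose t := fine (\int[L]_x ((if (A <= `|x.1|)%R then 1 else 0) * w x ^+ 2)%:E)%E.
have tail : t <= lam / 4.
  have h : q * t <= Lam.
    rewrite -lee_fin EFinM fineK// -LamE -ge0_integral_EFinZ ?(ltW q0)//; first last.
    - by move=> x; rewrite mulr_ge0 ?sqr_ge0.
    - by mf.
    apply: ge0_le_integral => //.
    - move=> x _; rewrite lee_fin mulr_ge0 ?(ltW q0)// mulr_ge0 ?sqr_ge0//.
    - by mf.
    - by mf.
    move=> x _; rewrite lee_fin; case: ifP => h; last by rewrite mul0r mulr0 mulr_ge0 ?sqr_ge0.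
    rewrite mul1r ler_wpM2r ?sqr_ge0// -(expRK q) ler_ln ?posrE//.
      by rewrite (le_trans h)// (le_trans (normr1_le_eucl _))// lerDr.
    by rewrite ltr_pwDl// eucl_ge0.
  have : q * t <= q * (lam / 4).
    by apply: le_trans h _; rewrite /q (_ : _ * _ = Lam + 1) ?lerDl//; field; rewrite gt_eqF.
  by rewrite ler_pM2l.
have full : (\int[L]_x (1 * w x ^+ 2)%:E = lam%:E)%E.
  by rewrite -Nw; apply: eq_integral => x _; rewrite mul1r.
have p1 : phi A <= 0.
  have h1 : fine (mright w A) <= t.
    rewrite -lee_fin !fineK//; apply: le_weighted => //; [by mf|by mf|] => x.
    case: ifP => // h1; by rewrite ifT// (le_trans (ltW h1))// ler_norm.
  have h2 : lam <= fine (mleft w A) + t.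
    rewrite -lee_fin EFinD !fineK// -full; apply: (@add3 (fun=> 1)) => //; [by mf|by mf|] => x.
    have [h|h] := ltP x.1 A; first by rewrite lerDl.
    by rewrite ifT ?add0r// (le_trans h)// ler_norm.
  by rewrite /phi; move: lam0 tail h1 h2; clear; lra.
have p2 : 0 <= phi (- A).
  have h1 : fine (mleft w (- A)) <= t.
    rewrite -lee_fin !fineK//; apply: le_weighted => //; [by mf|by mf|] => x.
    case: ifP => // h1; by rewrite ifT// -normrN (le_trans _ (ler_norm _))// lerNr ltW.
  have h2 : lam <= fine (mright w (- A)) + t.
    rewrite -lee_fin EFinD !fineK// -full; apply: (@add3 (fun=> 1)) => //; [by mf|by mf|] => x.
    have [h|h] := ltP (- A) x.1; first by rewrite lerDl.
    by rewrite ifT ?add0r// -normrN (le_trans _ (ler_norm _))// lerNr.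
  by rewrite /phi; move: lam0 tail h1 h2; clear; lra.
have AA : - A <= A by move: A0; clear; lra.
have [|a _ ha] := @IVT R phi (- A) A 0 AA (continuous_subspaceT cphi).
  by rewrite ge_min le_max p1 p2 orbT.
exists a; rewrite -(fineK (rf a)) -(fineK (lf a)); congr (_%:E).
by move: ha => /eqP; rewrite /phi subr_eq0 => /eqP.
Qed.

(** After centring in the first direction, a quarter turn allows centring in the second. The product
    of the two reflections is the point reflection. *)
Lemma nnmin_centre w : nnmin w -> exists x0, nnmin (fun x => w (x + x0)) /\
  {ae L, forall x, w (- x + x0) = w (x + x0)}.
Proof.
move=> hw; have [a ha] := nnmin_centre1 hw.
pose w1 x := w (x + (a, 0)); have hw1 : nnmin w1 := nnmin_shift (a, 0) hw.
have cs : (0 : R) ^+ 2 + 1 ^+ 2 = 1 by rewrite expr0n expr1n add0r.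
have cs' : (0 : R) ^+ 2 + (- 1) ^+ 2 = 1 by rewrite sqrrN expr0n expr1n add0r.
have [b hb] := nnmin_centre1 (nnmin_rot cs hw1).
exists (a, b); split; first exact: (nnmin_shift (a, b) hw).
pose w3 x := w (x + (a, b)).
have w31 (y : T2) : w3 y = w1 (y + (0, b)).
  by rewrite /w3 /w1; congr w; rewrite !addrpE /= !addr0.
have e1 : {ae L, forall x, w3 x = w3 (refl x)}.
  have := ae_mpres (mpres_shift (0, b)) ha; apply: ae_mono => x; rewrite -!/(w1 _).
  rewrite w31 w31 => ->; congr w1; rewrite /refl !addrpE /=.
  by rewrite !addr0.
have e2 : {ae L, forall x, w3 x = w3 (x.1, - x.2)}.
  have := ae_mpres (mpres_rot cs') hb; apply: ae_mono => x.
  rewrite /plane_rot /refl /= !w31 !addrpE /=.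
  rewrite !(mul0r, mul1r, mulN1r, addr0, add0r, sub0r, opprK, subr0) => h.
  by rewrite {1}(surjective_pairing x) h.
have e3 := ae_mpres (@mpres_refl2 R) e1.
apply: ae_mono2 e2 e3 => x h2 h3.
rewrite -!/(w3 _) h2 h3; congr w3.
Qed.

(** A line through the centre of an even function halves its mass, so no further search for halving
    lines is needed; after rotations every direction is covered. *)
Lemma nnmin_even_half w : nnmin w -> {ae L, forall x, w (- x) = w x} -> mright w 0 = mleft w 0.
Proof.
move=> hw ev; have mw := nnmin_measurable hw.
apply: etrans (esym ((@mpres_opp R).2 (fun x => ((if (0 < x.1)%R then 1 else 0) * w x ^+ 2)%:E) _ _)) _.
- by mf.
- by move=> x; rewrite lee_fin mulr_ge0 ?sqr_ge0//; case: ifP.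
have [mo _] := @mpres_opp R.
apply: ae_eq_integral => //.
- by mf.
- by mf.
- by apply: ae_mono ev => x h _; rewrite h /= oppr_gt0.
Qed.

Lemma nnmin_even_refl w : nnmin w -> {ae L, forall x, w (- x) = w x} ->
  {ae L, forall x, w x = w (refl x)}.
Proof. by move=> hw ev; apply: nnmin_half_eq => //; exact: nnmin_even_half. Qed.

(** A line off the centre has less mass on its outer side, which decides the alternative of
    [nnmin_half]. *)
Lemma nnmin_even_decr w a : nnmin w -> {ae L, forall x, w (- x) = w x} -> 0 <= a ->
  {ae L, forall x, 0 < x.1 -> w (x + (a, 0)) <= w (refl x + (a, 0))}.
Proof.
move=> hw ev a0; have mw := nnmin_measurable hw.
apply: (nnmin_half (nnmin_shift (a, 0) hw)); rewrite mright_shift// mleft_shift//.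
apply: (@le_trans _ _ (mright w 0)).
  apply: le_weighted => //; [by mf|by mf|by move=> x; case: ifP|] => x.
  by case: ifP => h1; case: ifP => h2 //; exfalso; move: a0 h1 h2 => a0 h1 /negbT; lra.
rewrite nnmin_even_half//; apply: le_weighted => //; [by mf|by mf|by move=> x; case: ifP|] => x.
by case: ifP => h1; case: ifP => h2 //; exfalso; move: a0 h1 h2 => a0 h1 /negbT; lra.
Qed.

(** A rotation brings [t] to the first axis. The reflection at the line at distance [|t| / 2] from
    the centre, combined with the symmetry about the parallel line through the centre, is the
    translation by [t], and the condition on the norms says on which side of the line the point
    lies. *)
Lemma nnmin_mono_shift w (t : T2) : nnmin w -> {ae L, forall x, w (- x) = w x} ->
  {ae L, forall x, (eucl x < eucl (x + t)) ==> (w (x + t) <= w x)}.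
Proof.
move=> hw ev; have [->|t0] := eqVneq t 0.
  by apply: aeW => x; rewrite addr0 ltxx.
have r0 : 0 < eucl t by exact: eucl_gt0.
pose a := t.1 / eucl t; pose b := t.2 / eucl t.
have ab : a ^+ 2 + b ^+ 2 = 1.
  by rewrite !expr_div_n -mulrDl -eucl_sqr divff// expf_neq0// gt_eqF.
have ab' : a ^+ 2 + (- b) ^+ 2 = 1 by rewrite sqrrN.
pose w' x := w (plane_rot a b x); have hw' : nnmin w' := nnmin_rot ab hw.
have ev' : {ae L, forall x, w' (- x) = w' x}.
  apply: ae_mono (ae_mpres (mpres_rot ab) ev) => x h; rewrite /w' -h; congr w.
  by rewrite /plane_rot !oppr_pairE /=; congr (_, _); ring.
pose r := eucl t / 2.
have h1 := nnmin_even_refl hw' ev'.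
have rr : 0 <= r by rewrite divr_ge0// ltW.
have h2 := ae_mpres (mpres_shift (r, 0)) (nnmin_even_decr hw' ev' rr).
(* The inequality of [h2] compares [x + (2 r, 0)] with [refl x], and [h1] replaces the latter by
   [x]. *)
have h3 : {ae L, forall x, - r < x.1 -> w' (x + (2 * r, 0)) <= w' x}.
  apply: ae_mono2 h1 h2 => x e1 e2 xr.
  have xr' : 0 < (x + (r, 0)).1 by rewrite addrpE /=; lra.
  have := e2 xr'; rewrite (_ : x + (r, 0) + (r, 0) = x + (2 * r, 0)); last first.
    by rewrite !addrpE /=; congr (_, _); ring.
  rewrite (_ : refl (x + (r, 0)) + (r, 0) = refl x) ?e1//.
  by rewrite /refl !addrpE /=; congr (_, _); ring.
have := ae_mpres (mpres_rot ab') h3; apply: ae_mono => x.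
have rK : plane_rot a b (plane_rot a (- b) x) = x.
  rewrite /plane_rot /= (surjective_pairing x) /=; congr (_, _).
    by rewrite -[RHS]mul1r -ab; ring.
  by rewrite -[RHS]mul1r -ab; ring.
have rK2 : plane_rot a b (plane_rot a (- b) x + (2 * r, 0)) = x + t.
  have -> : x + t = plane_rot a b (plane_rot a (- b) x) + t by rewrite rK.
  have E : 2 * r = eucl t by rewrite /r mulrC divfK ?pnatr_eq0.
  have t1 : a * eucl t = t.1 by rewrite /a divfK ?gt_eqF.
  have t2 : b * eucl t = t.2 by rewrite /b divfK ?gt_eqF.
  rewrite E {1}/plane_rot !addrpE /= -t1 -t2; congr (_, _); ring.
rewrite /w' rK rK2 => h; apply/implyP => xt; apply: h.
have : 0 < 2 * (x.1 * t.1 + x.2 * t.2) + eucl t ^+ 2.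
  move: xt; rewrite -ltr_sqr ?nnegrE ?eucl_ge0// !eucl_sqr addrpE /=; lra.
have -> : x.1 * t.1 + x.2 * t.2 = eucl t * (a * x.1 + b * x.2).
  by rewrite /a /b; field; rewrite gt_eqF.
rewrite /plane_rot /= mulNr opprK /r => h.
rewrite -(ltr_pM2l r0); move: h; rewrite expr2; lra.
Qed.

End reflection_symmetry.

(** * Radially decreasing representatives *)

Section radial_representation.
Variable R : realType.
Local Notation mu := (@lebesgue_measure R).
Local Notation L := (@leb2 R).
Local Notation R1 := (measurableTypeR R).
Local Notation T2 := (R1 * R1)%type.
Implicit Types (f g w u : T2 -> R).

(* The origin is excluded because a radially decreasing function of the energy space need not be
   bounded there. *)
Definition rdec u := forall x y : T2, 0 < eucl x -> eucl x <= eucl y -> u y <= u x.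

Lemma annulus_nonnull (r s : R) : 0 <= r -> r < s -> ~ {ae L, forall z, ~ (r < eucl z < s)}.
Proof.
move=> r0 rs [N [mN N0 PN]].
pose m := (r + s) / 2; pose d := (s - r) / 8.
have d0 : 0 < d by rewrite divr_gt0// subr_gt0.
have hm : m - d < m + d by move: d0; lra.
have hd : - d < d by move: d0; lra.
pose B : set T2 := `]m - d, m + d]%classic `*` `]- d, d]%classic.
have BN : B `<=` N.
  move=> z [/= ]; rewrite !in_itv/= => /andP[h1 h2] /andP[h3 h4]; apply: PN => /=; apply.
  have n1 : `|z.2| <= d by rewrite ler_norml h4 ltW.
  have z0 : 0 <= z.1 by move: h1 r0 rs; rewrite /m /d; lra.
  have e1 := normr1_le_eucl z; have e2 := eucl_le_add z.
  rewrite (ger0_norm z0) in e1 e2.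
  by apply/andP; split; move: h1 h2 n1 e1 e2 rs; rewrite /m /d; lra.
have mB : measurable B by exact: measurableX.
have : (L B <= L N)%E by apply: le_measure; rewrite ?inE.
rewrite N0 /leb2 product_measure1E// leNgt => /negP; apply.
have E (a b : R) : a < b -> mu `]a, b]%classic = (b - a)%:E.
  by move=> ab; rewrite lebesgue_measure_itv/= lte_fin ab -EFinB.
have E1 := E _ _ hm; have E2 := E _ _ hd.
suff : (0 < (m + d - (m - d))%:E * (d - - d)%:E :> \bar R)%E by rewrite -E1 -E2.
by rewrite -EFinM lte_fin mulr_gt0//; move: d0; lra.
Qed.

(** Apart from the origin, superlevel sets are preimages under [eucl] of intervals of radii. *)
Lemma rdec_measurable u : rdec u -> measurable_fun setT u.
Proof.
move=> hu.
apply: (@measurability _ _ T2 R setT u _ (RGenOInfty.measurableE R)).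
move=> _ [_ [c ->] <-]; rewrite setTI.
pose A : set R := [set r | 0 < r /\ exists x : T2, eucl x = r /\ c < u x].
have iA : is_interval A.
  move=> a b [a0 _] [b0 [x [xb cx]]] z /andP[az zb]; split; first exact: lt_le_trans az.
  have z0 : 0 < z by exact: lt_le_trans az.
  have ez : eucl ((z, 0) : T2) = z by rewrite /eucl/= expr0n addr0 sqrtr_sqr gtr0_norm.
  exists (z, 0); split=> //; apply: lt_le_trans cx _; apply: hu; rewrite ez//.
  by rewrite xb.
have mA : measurable ((fun x : T2 => eucl x) @^-1` A).
  rewrite -[_ @^-1` _]setTI; apply: (@measurable_eucl R) => //.
  exact: is_interval_measurable.
have E : u @^-1` `]c, +oo[%classic = ((fun x : T2 => eucl x) @^-1` A) `|`
    (if c < u 0 then [set (0 : T2)] else set0).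
  apply/seteqP; split => x /=; rewrite in_itv/= andbT.
    move=> cx; have [x0|x0] := eqVneq x 0; first by right; move: cx; rewrite x0 => ->.
    by left; split; [exact: eucl_gt0|exists x].
  case=> [[x0 [y [yx cy]]]|]; last by case: ifP => // h ->.
  by apply: lt_le_trans cy _; apply: hu => //; rewrite yx.
rewrite E; apply: measurableU => //; case: ifP => // _.
have -> : [set (0 : T2)] = [set (0 : R1)] `*` [set (0 : R1)].
  by apply/seteqP; split => [y ->|[a b] [/= -> ->]].
by apply: measurableX; exact: measurable_set1.
Qed.

Lemma N2_scale_arg (k : R) f : 0 < k -> measurable_fun setT f ->
  ((k ^+ 2)%:E * N2 L (fun x => f (k * x.1, k * x.2)%R) = N2 L f)%E.
Proof.
move=> k0 mf; apply: (@leb2_scale R k (fun x => (f x ^+ 2)%:E) k0); first by mf.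
by move=> x; rewrite lee_fin sqr_ge0.
Qed.

Lemma ae_eucl_gt0 : {ae L, forall x : T2, 0 < eucl x}.
Proof.
exists [set 0]; split.
- have -> : [set (0 : T2)] = [set (0 : R1)] `*` [set (0 : R1)].
    by apply/seteqP; split => [y ->|[a b] [/= -> ->]].
  by apply: measurableX; exact: measurable_set1.
- exact: leb2_set1.
- by move=> x /= h; apply: contrapT => x0; apply: h; apply: eucl_gt0; apply/eqP.
Qed.

(** The hypothesis concerns each translation separately; [ae_pair] turns it into monotonicity on a
    set of typical points. The representative is the supremum over typical points at least as far
    out. It lies above [w], and its dilations by [k > 1] lie below [w]; letting [k] tend to 1, the
    norms agree. *)
Lemma radial_representation w : (forall x, 0 <= w x) -> L2 L w ->
  (forall t, {ae L, forall x, (eucl x < eucl (x + t)) ==> (w (x + t) <= w x)}) ->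
  exists u, [/\ rdec u, (forall x, 0 <= u x) & {ae L, forall x, w x = u x}].
Proof.
move=> w0 lw H; have [mw _] := lw; have me := @measurable_eucl R.
pose P (x y : T2) := (eucl x < eucl y) ==> (w y <= w x).
have mP : measurable_fun setT (fun z : T2 * T2 => P z.1 z.2).
  rewrite (_ : (fun z => P z.1 z.2) = (fun z : T2 * T2 => ~~ (eucl z.1 < eucl z.2) || (w z.2 <= w z.1))).
    by mf.
  by apply/funext => z; rewrite /P implybE.
have mP' : measurable_fun setT (fun z : T2 * T2 => P z.2 z.1).
  apply: (measurableT_comp mP (_ : measurable_fun setT (fun z : T2 * T2 => (z.2, z.1)))).
  by mf.
have a1 := ae_pair mP H.
have a2 : {ae L, forall x, {ae L, forall y, P y x}}.
  apply: (@ae_pair R (fun x y => P y x) mP') => t.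
  have := ae_mpres (mpres_shift t) (H (- t)); apply: ae_mono => x.
  by rewrite addrK.
(* Typical points are compared correctly with almost every other point. Two of them are then
   compared with each other through a third one in the annulus between them. *)
pose G (x : T2) := {ae L, forall y, P x y} /\ {ae L, forall y, P y x}.
have aG : {ae L, forall x, G x} by apply: ae_mono2 a1 a2 => x; split.
have mono x y : G x -> G y -> eucl x < eucl y -> w y <= w x.
  move=> [h1 _] [_ h2] xy; apply: contrapT => /negP; rewrite -ltNge => hlt.
  apply: (annulus_nonnull (eucl_ge0 x) xy); apply: ae_mono2 h1 h2 => z /implyP p1 /implyP p2 /andP[z1 z2].
  by have := le_trans (p2 z2) (p1 z1); rewrite leNgt hlt.
have exG r s : 0 <= r -> r < s -> exists x, G x /\ r < eucl x < s.
  move=> r0 rs; apply: contrapT => N; apply: (annulus_nonnull r0 rs).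
  by apply: ae_mono aG => z gz hz; apply: N; exists z.
pose S r := [set w y | y in [set y | G y /\ r <= eucl y]].
have S0 r : 0 < r -> has_sup (S r).
  move=> r0; split.
    have r1 : r < r + 1 by rewrite ltrDl.
    have [y [gy /andP[h1 _]]] := exG _ _ (ltW r0) r1.
    by exists (w y), y => //; split=> //; exact: ltW.
  have [x [gx /andP[_ xr]]] := exG _ _ (lexx 0) r0.
  by exists (w x) => _ [y [gy ry] <-]; apply: mono => //; exact: lt_le_trans ry.
pose u (x : T2) : R := if 0 < eucl x then sup (S (eucl x)) else 0.
have u0 x : 0 <= u x.
  rewrite /u; case: ifP => // x0; have [[z [y hy yz]] ub] := S0 _ x0.
  by apply: le_trans (w0 y) _; apply: ub_le_sup => //; exists y.
have ru : rdec u.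
  move=> x y x0 xy; have y0 := lt_le_trans x0 xy; rewrite /u x0 y0.
  apply: ge_sup; first by case: (S0 _ y0).
  move=> _ [z [gz yz] <-]; apply: ub_le_sup; first by case: (S0 _ x0).
  by exists z => //; split=> //; exact: le_trans yz.
have mu_ := rdec_measurable ru.
have wu : {ae L, forall x, w x <= u x}.
  apply: ae_mono2 aG ae_eucl_gt0 => x gx x0; rewrite /u x0.
  by apply: ub_le_sup; [case: (S0 _ x0)|exists x].
(* Typical points at distance at least [k |x|] are strictly farther out than [x], which is what
   monotonicity requires. *)
have uk (k : R) : 1 < k -> {ae L, forall x, u (k * x.1, k * x.2) <= w x}.
  move=> k1; have k0 : 0 < k by exact: lt_trans k1.
  apply: ae_mono2 aG ae_eucl_gt0 => x gx x0.
  have E : eucl (k * x.1, k * x.2) = k * eucl x by exact: eucl_scale (ltW k0).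
  have kx : 0 < k * eucl x by rewrite mulr_gt0.
  rewrite /u E kx; apply: ge_sup; first by case: (S0 _ kx).
  move=> _ [y [gy hy] <-]; apply: mono => //; apply: lt_le_trans hy.
  by rewrite ltr_pMl.
exists u; split=> //.
have [l Nl] : exists l : R, N2 L w = l%:E by exists (ip L w w); exact: N2_ip.
have l0 : 0 <= l by rewrite -lee_fin -Nl N2_ge0.
(* Undoing the dilation costs the factor [k ^ 2], which tends to 1. *)
have Nk (k : R) : 1 < k -> (N2 L u <= (k ^+ 2 * l)%:E)%E.
  move=> k1; have k0 : 0 < k by exact: lt_trans k1.
  rewrite -(N2_scale_arg k0 mu_) [in leRHS]EFinM -Nl; apply: lee_wpmul2l; first by rewrite lee_fin sqr_ge0.
  apply: ae_ge0_le_integral => //.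
  - by move=> x _; rewrite lee_fin sqr_ge0.
  - by mf.
  - by move=> x _; rewrite lee_fin sqr_ge0.
  - by mf.
  - by apply: ae_mono (uk _ k1) => x h _; rewrite lee_fin ler_sqr ?nnegrE.
have uf : (N2 L u < +oo)%E by apply: le_lt_trans (Nk 2 _) _; rewrite ?ltry// ltr1n.
have Nu : (N2 L u <= N2 L w)%E.
  have lu : L2 L u by split.
  rewrite (N2_ip lu) Nl lee_fin; apply/ler_addgt0Pr => eps eps0.
  pose d := Num.min 1 (eps / (3 * (l + 1))).
  have l1 : 0 < 3 * (l + 1) by rewrite mulr_gt0// ltr_wpDl.
  have d0 : 0 < d by rewrite lt_min ltr01 divr_gt0.
  have d1 : d <= 1 by rewrite ge_min lexx.
  have d2 : d * (3 * (l + 1)) <= eps by rewrite -ler_pdivlMr// ge_min lexx orbT.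
  have k1 : 1 < 1 + d by rewrite ltrDl.
  have := Nk _ k1; rewrite (N2_ip lu) lee_fin => h; apply: le_trans h _.
  have : d * d <= d by rewrite ler_piMl// ltW.
  by nra.
have h2 : {ae L, forall x, w x ^+ 2 = u x ^+ 2}.
  apply: ge0_integral_ae_eq => //.
  - by mf.
  - by mf.
  - by move=> x; rewrite sqr_ge0.
  - by move=> x; rewrite sqr_ge0.
  - by apply: ae_mono wu => x h; rewrite ler_sqr ?nnegrE.
by apply: ae_mono h2 => x /eqP; rewrite eqrXn2// => /eqP.
Qed.

End radial_representation.

Section radial_minimizers.
Variable R : realType.
Local Notation mu := (@lebesgue_measure R).
Local Notation L := (@leb2 R).
Local Notation R1 := (measurableTypeR R).
Local Notation T2 := (R1 * R1)%type.
Local Notation LL := (L \x L)%E.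
Implicit Types (f g w u : T2 -> R).

Lemma N2_ae f g : measurable_fun setT f -> measurable_fun setT g ->
  {ae L, forall x, f x = g x} -> N2 L f = N2 L g.
Proof.
move=> mf mg fg; apply: ae_eq_integral => //.
- by mf.
- by mf.
- by apply: ae_mono fg => x -> _.
Qed.

Lemma is_dir_ae b f g s : measurable_fun setT f -> measurable_fun setT g ->
  {ae L, forall x, f x = g x} -> is_dir b f s -> is_dir b g s.
Proof.
move=> mf mg fg; apply: is_dir_ext => h h0; have [ms _] := mpres_shift (axv b h).
apply: N2_ae; [by rewrite /diffq; mf|by rewrite /diffq; mf|].
by apply: ae_mono2 fg (ae_mpres (mpres_shift (axv b h)) fg) => x; rewrite /diffq => -> ->.
Qed.

Lemma LL_ae_fst (P : T2 -> Prop) : {ae L, forall x, P x} -> {ae LL, forall z, P z.1}.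
Proof.
move=> [N [mN N0 PN]]; exists (N `*` setT); split; first exact: measurableX.
- by rewrite product_measure1E// [X in (X * _)%E](_ : _ = 0%E) ?mul0e//; exact: N0.
- by move=> z /= hz; split=> //; exact: PN.
Qed.

Lemma LL_ae_snd (P : T2 -> Prop) : {ae L, forall x, P x} -> {ae LL, forall z, P z.2}.
Proof.
move=> [N [mN N0 PN]]; exists (setT `*` N); split; first exact: measurableX.
- by rewrite product_measure1E// [X in (_ * X)%E](_ : _ = 0%E) ?mule0//; exact: N0.
- by move=> z /= hz; split=> //; exact: PN.
Qed.

Lemma LL_ae_mono (P Q : T2 * T2 -> Prop) : (forall z, P z -> Q z) ->
  {ae LL, forall z, P z} -> {ae LL, forall z, Q z}.
Proof. by move=> PQ; apply: filterS => z; exact: PQ. Qed.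

Lemma LL_ae_mono2 (P Q S : T2 * T2 -> Prop) : (forall z, P z -> Q z -> S z) ->
  {ae LL, forall z, P z} -> {ae LL, forall z, Q z} -> {ae LL, forall z, S z}.
Proof. by move=> PQ; apply: filterS2 => z; exact: PQ. Qed.

Lemma Elog_ae f g : measurable_fun setT f -> measurable_fun setT g ->
  {ae L, forall x, f x = g x} -> Elog f = Elog g.
Proof.
move=> mf mg fg; congr fine; apply: ae_eq_integral => //.
- by apply: (@measurable_Ilog R (fun x => f x ^+ 2) (fun x => f x ^+ 2)); mf.
- by apply: (@measurable_Ilog R (fun x => g x ^+ 2) (fun x => g x ^+ 2)); mf.
- apply: LL_ae_mono2 (LL_ae_fst fg) (LL_ae_snd fg) => z h1 h2 _.
  by rewrite /= h1 h2.
Qed.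

Lemma WX_ae f g lam s1 s2 : measurable_fun setT g -> {ae L, forall x, f x = g x} ->
  WX f lam s1 s2 -> WX g lam s1 s2.
Proof.
move=> mg fg [lf Nf d1 d2 ll]; have [mf _] := lf; have me := @measurable_eucl R.
have Ng : N2 L g = lam%:E by rewrite -(N2_ae mf mg fg).
split=> //.
- by split=> //; rewrite Ng ltry.
- exact: is_dir_ae fg d1.
- exact: is_dir_ae fg d2.
suff -> : (\int[L]_x (ln (1 + eucl x) * g x ^+ 2)%:E = \int[L]_x (ln (1 + eucl x) * f x ^+ 2)%:E)%E by [].
apply: ae_eq_integral => //.
- by mf.
- by mf.
- by apply: ae_mono fg => x -> _.
Qed.

Definition rmin (c e lam : R) u := nnmin c e lam u /\ rdec u.

Lemma nnmin_radial c e lam w : 0 < c -> 0 < lam -> minprob c e lam -> nnmin c e lam w ->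
  exists u x0, rmin c e lam u /\ {ae L, forall x, w (x + x0) = u x}.
Proof.
move=> c0 lam0 hmin hw; have [x0 [hw1 ev]] := nnmin_centre c0 lam0 hmin hw.
have [w10 [s1 [s2 [wx we]]]] := hw1.
have lw1 : L2 L (fun x => w (x + x0)) by case: wx.
have [|u [ru u0 wu]] := radial_representation w10 lw1.
  by move=> t; apply: nnmin_mono_shift hw1 ev.
have mu_ := rdec_measurable ru.
exists u, x0; split=> //; split=> //; split=> //.
exists s1, s2; split; first exact: (WX_ae mu_ wu wx).
by rewrite -(Elog_ae (nnmin_measurable hw1) mu_ wu).
Qed.

Lemma outer_region_infinite (r K : R) : 0 <= r ->
  ~ (L [set x | r < eucl x]%R <= K%:E)%E.
Proof.
move=> r0 H; have K0 : 0 <= K.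
  by rewrite -lee_fin; apply: le_trans H; exact: measure_ge0.
have me := @measurable_eucl R.
have mS : measurable [set x : T2 | r < eucl x].
  have m1 : measurable_fun setT (fun x : T2 => r < eucl x) by mf.
  by have := m1 measurableT [set true] I; rewrite setTI.
pose B : set T2 := `]r, r + (K + 1)]%classic `*` `]0, 1]%classic.
have mB : measurable B by exact: measurableX.
have : (L B <= L [set x | r < eucl x]%R)%E.
  apply: le_measure; rewrite ?inE// => x [/=]; rewrite !in_itv/= => /andP[h _] _.
  by apply: lt_le_trans h _; apply: le_trans (ler_norm _) (normr1_le_eucl _).
move=> /le_trans/(_ H); rewrite /leb2 product_measure1E//.
have E (a b : R) : a < b -> mu `]a, b]%classic = (b - a)%:E.
  by move=> ab; rewrite lebesgue_measure_itv/= lte_fin ab -EFinB.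
have h1 : r < r + (K + 1) by rewrite ltrDl ltr_wpDl.
have E1 := E _ _ h1; have E2 := E _ _ (@ltr01 R).
have -> : (mu `]r, (r + (K + 1))%R]%classic * mu `]0%R, 1%R]%classic = (K + 1)%:E)%E.
  by rewrite E1 E2 -EFinM; congr (_%:E); ring.
by rewrite lee_fin gerDl ler10.
Qed.

(** A negative value would persist, at least as negative, on the whole region farther out, which has
    infinite area, against square integrability. *)
Lemma rdec_ge0 u : rdec u -> L2 L u -> forall x : T2, 0 < eucl x -> 0 <= u x.
Proof.
move=> ru lu x x0; have [mu_ Nu] := lu; rewrite leNgt; apply/negP => ux.
have me := @measurable_eucl R.
have ux2 : 0 < u x ^+ 2 by rewrite exprn_even_gt0//= lt_eqF.
apply: (@outer_region_infinite (eucl x) (ip L u u / u x ^+ 2)) => //.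
  exact: eucl_ge0.
have mS : measurable [set y : T2 | eucl x < eucl y].
  have m1 : measurable_fun setT (fun y : T2 => eucl x < eucl y) by mf.
  by have := m1 measurableT [set true] I; rewrite setTI.
have mS1 : measurable_fun setT (\1_[set y : T2 | eucl x < eucl y] : T2 -> R) by exact: measurable_indic.
have h : ((u x ^+ 2)%:E * L [set y : T2 | eucl x < eucl y]%R <= (ip L u u)%:E)%E.
  rewrite -(N2_ip lu).
  have -> : L [set y : T2 | eucl x < eucl y]%R = (\int[L]_y (\1_[set y : T2 | eucl x < eucl y]%R y)%:E)%E.
    by rewrite integral_indic ?setIT.
  rewrite -ge0_integral_EFinZ ?sqr_ge0//.
  apply: ge0_le_integral => //.
  - by move=> y _; rewrite lee_fin mulr_ge0 ?sqr_ge0// indicE.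
  - by mf.
  - by mf.
  move=> y _; rewrite lee_fin indicE; have [/set_mem/= xy|_] := boolP (y \in _); last first.
    by rewrite mulr0 sqr_ge0.
  rewrite mulr1; have := ru x y x0 (ltW xy); move: ux => ux uy; nra.
by rewrite [in leRHS]mulrC [in leRHS]EFinM lee_pdivlMl.
Qed.

Lemma circle_null (r : R) : L [set x | eucl x = r] = 0%E.
Proof.
have mD : measurable [set x : T2 | eucl x = r].
  by have := @measurable_eucl R measurableT [set r] (measurable_set1 r); rewrite setTI.
transitivity (\int[mu]_a (mu \o xsection [set x : T2 | eucl x = r]) a)%E; first by [].
apply: integral0_eq => a _ /=.
pose b := Num.sqrt (r ^+ 2 - a ^+ 2).
have S : xsection [set x : T2 | eucl x = r] a `<=` [set b] `|` [set - b].
  move=> y; rewrite /xsection /= inE /= => h; have := eucl_sqr (a, y); rewrite h /= => h2.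
  have : `|y| = b by rewrite -sqrtr_sqr /b; congr Num.sqrt; rewrite h2; ring.
  by move=> <-; have [y0|y0] := leP 0 (y : R); [left; rewrite ger0_norm|right; rewrite ltr0_norm ?opprK].
apply/eqP; rewrite eq_le measure_ge0 andbT.
apply: (@le_trans _ _ (mu ([set b] `|` [set - b]%R))%E).
  by apply: le_measure => //; rewrite ?inE; [exact: measurable_xsection|exact: measurableU].
apply: le_trans (measureU2 _ _ _) _ => //.
rewrite -[leRHS]adde0; apply: leeD.
- by rewrite le_eqVlt; apply/orP; left; apply/eqP; exact: (lebesgue_measure_set1 b).
- by rewrite le_eqVlt; apply/orP; left; apply/eqP; exact: (lebesgue_measure_set1 (- b)).
Qed.

Lemma ae_eucl_neq (r0 : R) : {ae L, forall x, eucl x != r0}.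
Proof.
exists [set x : T2 | eucl x = r0]; split; last by move=> x /= /negP; rewrite negbK => /eqP.
- by have := @measurable_eucl R measurableT [set r0] (measurable_set1 r0); rewrite setTI.
- exact: circle_null.
Qed.

Lemma LL_eucl_neq : {ae LL, forall z, eucl z.1 != eucl z.2}.
Proof.
have me := @measurable_eucl R.
pose D : set (T2 * T2) := [set z | eucl z.1 - eucl z.2 = 0].
have mD : measurable D.
  have m1 : measurable_fun setT (fun z : T2 * T2 => (eucl z.1 - eucl z.2 : R)) by mf.
  by have := m1 measurableT [set 0] (measurable_set1 0); rewrite setTI.
exists D; split=> //; last first.
  by move=> z /= /negP; rewrite negbK => /eqP h; rewrite /D /= h subrr.
transitivity (\int[L]_x (L \o xsection D) x)%E; first by [].
apply: integral0_eq => x _; rewrite /= -(circle_null (eucl x)); congr (L _).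
apply/seteqP; split => y /=; rewrite /xsection /= inE /D /=; last by move=> ->; rewrite subrr.
by move/eqP; rewrite subr_eq0 => /eqP.
Qed.

End radial_minimizers.

(** * Newton's theorem and disc masses *)

Section newton.
Variable R : realType.
Local Notation mu := (@lebesgue_measure R).
Local Notation L := (@leb2 R).
Local Notation R1 := (measurableTypeR R).
Local Notation T2 := (R1 * R1)%type.
Local Notation LL := (L \x L)%E.
Implicit Types (f g w u rho sig : T2 -> R).

(** The complex square of [x.1 + i x.2]. *)
Definition csq (x : T2) : T2 := (x.1 ^+ 2 - x.2 ^+ 2, 2 * (x.1 * x.2)).

Definition lmax (z : T2 * T2) : R := ln (Num.max (eucl z.1) (eucl z.2)).

(** The error made in replacing [ln |x - y|] by Newton's kernel [ln max(|x|, |y|)]. *)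
Definition kap (z : T2 * T2) : R := ln (eucl (z.1 - z.2)) - lmax z.

(** Pairs whose radii have a ratio less than [q]. This region is stable under rotations of either
    point and under squaring both, and it stays away from the singularity of the logarithm. *)
Definition far (q : R) (z : T2 * T2) : bool :=
  (eucl z.1 < q * eucl z.2) || (eucl z.2 < q * eucl z.1).

Lemma eucl_csq x : eucl (csq x) = eucl x ^+ 2.
Proof.
rewrite eucl_sqr /eucl /csq /= -[RHS]ger0_norm ?addr_ge0 ?sqr_ge0//.
by rewrite -sqrtr_sqr; congr Num.sqrt; ring.
Qed.

Lemma eucl_csq_sub x y : eucl (csq x - csq y) = eucl (x - y) * eucl (x + y).
Proof.
rewrite /eucl -sqrtrM ?addr_ge0 ?sqr_ge0//; congr Num.sqrt.
by rewrite /csq !oppr_pairE !addrpE /=; ring.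
Qed.

Lemma csq_rot (c s : R) x : csq (plane_rot c s x) = plane_rot (c ^+ 2 - s ^+ 2) (2 * (c * s)) (csq x).
Proof. by rewrite /csq /plane_rot /=; congr (_, _); ring. Qed.

Lemma half_angle (c s : R) : c ^+ 2 + s ^+ 2 = 1 ->
  exists a b, [/\ a ^+ 2 + b ^+ 2 = 1, a ^+ 2 - b ^+ 2 = c & 2 * (a * b) = s].
Proof.
move=> cs; have c1 : -1 <= c by have := sqr_ge0 s; nra.
have [ce|cn] := eqVneq c (-1).
  have s0 : s = 0 by apply/eqP; rewrite -sqrf_eq0; apply/eqP; move: cs; rewrite ce; lra.
  by exists 0, 1; rewrite ce s0; split; ring.
have c0 : 0 < (1 + c) / 2.
  have : -1 < c by rewrite lt_neqAle eq_sym cn.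
  by lra.
pose a := Num.sqrt ((1 + c) / 2); have a2 : a ^+ 2 = (1 + c) / 2 by rewrite sqr_sqrtr// ltW.
have a0 : a != 0 by rewrite gt_eqF// sqrtr_gt0.
exists a, (s / (2 * a)); have b2 : (s / (2 * a)) ^+ 2 = (1 - c) / 2.
  rewrite expr_div_n exprMn a2 (_ : s ^+ 2 = (1 - c) * (1 + c)); last by move: cs; lra.
  by field; rewrite gt_eqF//; move: c0; lra.
by split; rewrite ?a2 ?b2; field.
Qed.

(** Squaring doubles angles, and angles can be halved, so every rotation of the image under iterated
    squaring is induced by a rotation of the plane. *)
Lemma iter_csq_rot k : forall c s : R, c ^+ 2 + s ^+ 2 = 1 -> exists c' s', c' ^+ 2 + s' ^+ 2 = 1 /\
  forall y, iter k csq (plane_rot c' s' y) = plane_rot c s (iter k csq y).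
Proof.
elim: k => [|k IH] c s cs; first by exists c, s.
have [a [b [ab <- <-]]] := half_angle cs.
have [c' [s' [cs' h]]] := IH _ _ ab; exists c', s'; split=> // y.
by rewrite !iterS h csq_rot.
Qed.

Lemma measurable_iter_csq k : measurable_fun setT (iter k csq).
Proof.
elim: k => [|k IH]; first exact: measurable_id.
have mc : measurable_fun setT csq by rewrite /csq; mf.
exact: (measurableT_comp mc IH).
Qed.

Lemma maxr_gt0 (q a b : R) : q < 1 -> 0 <= a -> 0 <= b -> (a < q * b) || (b < q * a) -> 0 < Num.max a b.
Proof.
by move=> q1 a0 b0 /orP[h|h]; rewrite lt_max; [apply/orP; right|apply/orP; left]; nra.
Qed.

Lemma far_neq q x y : q < 1 -> far q (x, y) -> eucl x != eucl y.
Proof.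
move=> q1; have := eucl_ge0 x; have := eucl_ge0 y; rewrite /far /= => y0 x0 /orP[h|h]; apply/eqP; nra.
Qed.

(* Complex squaring doubles the integral of [kap] against a rotation invariant density, while [kap]
   stays bounded on [far q]; hence that integral vanishes. *)
Lemma kap_csq q x y : 0 < q < 1 -> far q (x, y) ->
  kap (csq x, csq y) = kap (x, y) + kap (x, - y).
Proof.
move=> /andP[q0 q1] h; have nxy := far_neq q1 h.
have p1 : 0 < eucl (x - y).
  by apply: eucl_gt0; apply: contraNneq nxy => /eqP; rewrite subr_eq0 => /eqP ->.
have p2 : 0 < eucl (x + y).
  by apply: eucl_gt0; apply: contraNneq nxy => /eqP; rewrite addr_eq0 => /eqP ->; rewrite euclN.
have p3 := maxr_gt0 q1 (eucl_ge0 x) (eucl_ge0 y) h.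
rewrite /kap /lmax /= !eucl_csq euclN opprK eucl_csq_sub lnM ?posrE//.
have -> : Num.max (eucl x ^+ 2) (eucl y ^+ 2) = Num.max (eucl x) (eucl y) ^+ 2.
  by rewrite sqr_max// eucl_ge0.
by rewrite expr2 lnM ?posrE//; ring.
Qed.

Lemma far_csq q x y : 0 < q < 1 -> far q (x, y) -> far q (csq x, csq y).
Proof.
move=> /andP[q0 q1]; rewrite /far /= !eucl_csq.
by have := eucl_ge0 x; have := eucl_ge0 y => y0 x0 /orP[h|h]; apply/orP; [left|right]; nra.
Qed.

Lemma far_iter q k x y : 0 < q < 1 -> far q (x, y) -> far q (iter k csq x, iter k csq y).
Proof. by move=> q01 h; elim: k => [//|k IH]; rewrite !iterS; exact: far_csq. Qed.

(** On this region [(1 - q) max(|x|, |y|) <= |x - y| <= 2 max(|x|, |y|)]. *)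
Lemma kap_far q z : 0 < q < 1 -> far q z -> `|kap z| <= ln 2 - ln (1 - q).
Proof.
case: z => x y /andP[q0 q1] h.
have p3 := maxr_gt0 q1 (eucl_ge0 x) (eucl_ge0 y) h.
set M := Num.max (eucl x) (eucl y) in p3.
have q1' : 0 < 1 - q by lra.
have lo : (1 - q) * M <= eucl (x - y).
  have h1 := eucl_triangle (x - y) y; have h2 := eucl_triangle (y - x) x.
  rewrite subrK in h1; rewrite subrK -[y - x]opprB euclN in h2.
  have := eucl_ge0 x; have := eucl_ge0 y => y0 x0.
  have qx : eucl x <= eucl y -> q * eucl x <= q * eucl y by apply: ler_wpM2l; exact: ltW.
  have qy : eucl y < eucl x -> q * eucl y <= q * eucl x by move=> ?; apply: ler_wpM2l; exact: ltW.
  rewrite /M maxEle; move: h; rewrite /far /=; case: (leP (eucl x) (eucl y)) => xy /orP[] h;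
    [lra|have := qx xy; nra|have := qy xy; nra|lra].
have up : eucl (x - y) <= 2 * M.
  have := eucl_triangle x (- y); rewrite euclN => /le_trans; apply.
  by rewrite /M maxEle; case: (leP (eucl x) (eucl y)); lra.
have p : 0 < eucl (x - y) by apply: lt_le_trans lo; rewrite mulr_gt0.
have l1 : ln (1 - q) + ln M <= ln (eucl (x - y)).
  by rewrite -lnM ?posrE// ler_ln ?posrE// mulr_gt0.
have l2 : ln (eucl (x - y)) <= ln 2 + ln M.
  by rewrite -lnM ?posrE// ler_ln ?posrE// mulr_gt0.
have l3 : 0 <= ln (2 : R) by rewrite ln_ge0// ler1n.
have l4 : ln (1 - q) <= 0 by apply: ln_le0; lra.
by rewrite /kap /lmax /= -/M ler_norml; apply/andP; split; lra.
Qed.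

Lemma far_rot q c s x y : c ^+ 2 + s ^+ 2 = 1 -> far q (x, plane_rot c s y) = far q (x, y).
Proof. by move=> cs; rewrite /far /= eucl_rot. Qed.

Lemma measurable_lmax : measurable_fun setT lmax.
Proof.
have me := @measurable_eucl R; rewrite /lmax.
by apply: (measurableT_comp (@measurable_ln R)); apply: measurable_maxr; mf.
Qed.

Lemma measurable_kap : measurable_fun setT kap.
Proof. by have m1 := @measurable_ln_eucl R; have m2 := measurable_lmax; rewrite /kap; mf. Qed.

Lemma measurable_far q : measurable_fun setT (fun z => (far q z)%:R : R).
Proof.
have me := @measurable_eucl R; rewrite /far.
have mb : measurable_fun setT (fun z : T2 * T2 => (eucl z.1 < q * eucl z.2) || (eucl z.2 < q * eucl z.1)).
  by apply: measurable_or; mf.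
rewrite (_ : (fun z => _) = (fun z : T2 * T2 => if (eucl z.1 < q * eucl z.2) || (eucl z.2 < q * eucl z.1) then 1 else 0)).
  by apply: measurable_fun_ifT.
by apply/funext => z; case: ifP.
Qed.

Section vanishing.
Variable rho : T2 -> R.
Hypotheses (lr : logdens rho)
  (rr : forall c s x, c ^+ 2 + s ^+ 2 = 1 -> rho (plane_rot c s x) = rho x).

Let G q k (z : T2 * T2) : R :=
  kap (iter k csq z.1, iter k csq z.2) * (rho z.1 * rho z.2) * (far q z)%:R.

Lemma kap_iter_int q k : 0 < q < 1 -> LL.-integrable setT (fun z => (G q k z)%:E) /\
  forall z, `|G q k z| <= (ln 2 - ln (1 - q)) * (rho z.1 * rho z.2).
Proof.
move=> q01; have [mr r0 _ _ _] := lr.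
have b z : `|G q k z| <= (ln 2 - ln (1 - q)) * (rho z.1 * rho z.2).
  rewrite /G; case: z => x y /=; have rxy := mulr_ge0 (r0 x) (r0 y).
  have [h|_] := boolP (far q (x, y)); last first.
    rewrite mulr0 normr0 mulr_ge0// subr_ge0; apply: (@le_trans _ _ 0).
      by apply: ln_le0; case/andP: q01; lra.
    by rewrite ln_ge0// ler1n.
  by rewrite mulr1 normrM (ger0_norm rxy) ler_wpM2r// (kap_far q01)// far_iter.
split=> //; have i := integrableZl measurableT (ln 2 - ln (1 - q)) (mass_prod_int lr lr).
apply: le_integrable i => //.
  have m1 := measurable_far q; have mi := measurable_iter_csq k.
  have m2 : measurable_fun setT (fun z : T2 * T2 => kap (iter k csq z.1, iter k csq z.2)).
    by apply: (measurableT_comp measurable_kap); apply: measurable_fun_pair;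
      [apply: (measurableT_comp mi)|apply: (measurableT_comp mi)]; mf.
  by rewrite /G; mf.
move=> z _; rewrite /= lee_fin; apply: le_trans (b z) _; exact: ler_norm.
Qed.

(** One more squaring splits the kernel into its values at the pair and at the pair with the second
    iterate negated. The negation is induced by a rotation of [z.2], under which density and measure
    are invariant, so both terms have the same integral. *)
Lemma kap_iterS q k : 0 < q < 1 ->
  (\int[LL]_z (G q k.+1 z)%:E = 2%:E * \int[LL]_z (G q k z)%:E)%E.
Proof.
move=> q01; have [iG _] := kap_iter_int k q01.
have cs : (-1) ^+ 2 + 0 ^+ 2 = 1 :> R by ring.
have [c' [s' [cs' hr]]] := iter_csq_rot k cs.
have [i2 e2] := integrable_mpres2 (mpres_id R) (mpres_rot cs') iG.
have E z : (G q k.+1 z)%:E = ((G q k z)%:E + (G q k (z.1, plane_rot c' s' z.2))%:E)%E.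
  rewrite -EFinD /G /= rr// hr far_rot//.
  have -> : plane_rot (-1) 0 (iter k csq z.2) = - iter k csq z.2.
    by rewrite /plane_rot oppr_pairE; congr (_, _); ring.
  case: z => x y /=; congr (_%:E); have [h|_] := boolP (far q (x, y)); last by rewrite !mulr0 addr0.
  by rewrite (kap_csq q01 (far_iter k q01 h)); ring.
have -> : (\int[LL]_z (G q k.+1 z)%:E =
    \int[LL]_z ((G q k z)%:E + (G q k (z.1, plane_rot c' s' z.2))%:E))%E.
  by apply: eq_integral => z _; exact: E.
rewrite (integralD measurableT iG i2) e2.
have fG := integrable_fin_num measurableT iG.
by rewrite -(fineK fG) -EFinD -EFinM; congr (_%:E); ring.
Qed.

(** The integrals grow like [2 ^ k] but are bounded independently of [k], because the bound of
    [kap_far] survives iteration. *)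
Lemma kap_far_int0 q : 0 < q < 1 -> (\int[LL]_z (G q 0 z)%:E = 0)%E.
Proof.
move=> q01; have [mr r0 _ _ _] := lr.
pose a k := fine (\int[LL]_z (G q k z)%:E)%E.
have aE k : (\int[LL]_z (G q k z)%:E = (a k)%:E)%E.
  have [iG _] := kap_iter_int k q01.
  by rewrite fineK//; exact: (integrable_fin_num measurableT iG).
have a2 k : a k = 2 ^+ k * a 0%N.
  elim: k => [|k IH]; first by rewrite mul1r.
  have := kap_iterS k q01; rewrite !aE -EFinM => -[->].
  by rewrite IH exprS mulrA.
pose C := (ln 2 - ln (1 - q)) * fine (\int[LL]_z (rho z.1 * rho z.2)%:E)%E.
have aC k : `|a k| <= C.
  have [iG b] := kap_iter_int k q01.
  rewrite -lee_fin -abse_EFin -aE; apply: le_trans (le_abse_integral _ measurableT _) _.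
    by case/integrableP: iG.
  have ip := mass_prod_int lr lr.
  rewrite /C EFinM fineK; last exact: (integrable_fin_num measurableT ip).
  rewrite -integralZl//; apply: ge0_le_integral => //.
  - by apply: (measurableT_comp (@abse_measurable _ _)); case/integrableP: iG.
  - by have := integrableZl measurableT (ln 2 - ln (1 - q)) ip; case/integrableP.
  - by move=> z _; rewrite /= -EFinM lee_fin.
rewrite aE; congr (_%:E); apply/eqP; rewrite -normr_le0 leNgt; apply/negP => a0.
have [k hk] : exists k : nat, C / `|a 0%N| < k%:R.
  by exists (Num.trunc (C / `|a 0%N|)).+1; exact: Num.Theory.truncnS_gt.
have := aC k; rewrite a2 normrM; apply/negP; rewrite -ltNge.
rewrite (ger0_norm (exprn_ge0 _ _))// -ltr_pdivrMr//; apply: lt_le_trans hk _.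
by rewrite -natrX ler_nat ltnW// ltn_expl.
Qed.

(** Each pair is dominated by the sum of [|ln|] of its two radii, and a single radius is the
    distance to the origin, so [abs_ln_eucl] and the strip bound apply once more. *)
Lemma ln_eucl_int : LL.-integrable setT (fun z => (lmax z * (rho z.1 * rho z.2))%:E).
Proof.
have [mr r0 rf rl [C C0 hC]] := lr; have me := @measurable_eucl R; have mm := measurable_lmax.
have l0 (z : T2) : 0 <= ln (1 + eucl z) by rewrite ln_ge0// lerDl eucl_ge0.
have mle : measurable_fun setT (fun x : T2 => `|ln (eucl x)|).
  by apply: (measurableT_comp (@normr_measurable R setT)); apply: (measurableT_comp (@measurable_ln R)).
have fl : (\int[L]_x (`|ln (eucl x)| * rho x)%:E < +oo)%E.
  apply: (@le_lt_trans _ _ (\int[L]_x ((ln (1 + eucl x) * rho x)%:E + (rho x)%:E * neglog (0 - x.1)))%E).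
    apply: ge0_le_integral => //.
    - by move=> x _; rewrite lee_fin mulr_ge0.
    - by mf.
    - apply: emeasurable_funD; first by mf.
      apply: emeasurable_funM; first by mf.
      by apply: (measurableT_comp (@measurable_neglog R)); mf.
    move=> x _; have := @abs_ln_eucl R 0 x; rewrite sub0r euclN /= => h.
    have e00 : eucl (0 : R * R) = 0 by rewrite /eucl /= expr0n addr0 sqrtr0.
    move: h; rewrite e00 addr0 ln1 add0r => h.
    rewrite EFinM muleC; apply: le_trans (lee_wpmul2l _ h) _; first by rewrite lee_fin.
    rewrite ge0_muleDr ?lee_fin ?neglog_ge0//.
    by rewrite leeD2r// -EFinM lee_fin mulrC.
  rewrite ge0_integralD//; first last.
  - apply: emeasurable_funM; first by mf.
    by apply: (measurableT_comp (@measurable_neglog R)); mf.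
  - by move=> x _; rewrite mule_ge0 ?lee_fin ?neglog_ge0.
  - by mf.
  - by move=> x _; rewrite lee_fin mulr_ge0.
  rewrite lte_add_pinfty//; apply: le_lt_trans (neglog_strip mr r0 C0 hC 0) _.
  by rewrite ltry.
apply/integrableP; split; first by mf.
apply: (@le_lt_trans _ _ (\int[LL]_z ((`|ln (eucl z.1)| * rho z.1) * rho z.2 + rho z.1 * (`|ln (eucl z.2)| * rho z.2))%:E)%E).
  apply: ge0_le_integral => //.
  - by apply: (measurableT_comp (@abse_measurable _ _)); mf.
  - by mf.
  move=> [x y] _; rewrite /= lee_fin normrM (ger0_norm (mulr_ge0 (r0 _) (r0 _))).
  have -> : `|ln (eucl x)| * rho x * rho y + rho x * (`|ln (eucl y)| * rho y) =
    (`|ln (eucl x)| + `|ln (eucl y)|) * (rho x * rho y) by ring.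
  apply: ler_wpM2r; first by rewrite mulr_ge0.
  by rewrite /lmax /= maxEle; case: (leP (eucl x) (eucl y)) => _; rewrite ?lerDl ?lerDr ?normr_ge0.
have a0 z : 0 <= (`|ln (eucl z)| * rho z) by rewrite mulr_ge0.
rewrite ge0_integral_EFinD; [|by mf|by mf|by move=> z; rewrite mulr_ge0|by move=> z; rewrite mulr_ge0].
have ml : measurable_fun setT (fun x : T2 => `|ln (eucl x)| * rho x) by mf.
have F f : (forall x, 0 <= f x) -> (\int[L]_x (f x)%:E < +oo)%E -> (\int[L]_x (f x)%:E)%E \is a fin_num.
  by move=> f0 h; rewrite ge0_fin_numE// integral_ge0// => x _; rewrite lee_fin.
rewrite (LL_prod ml mr a0 r0) (LL_prod mr ml r0 a0).
by rewrite -ge0_fin_numE ?adde_ge0 ?mule_ge0 ?integral_ge0//; [rewrite fin_numD !fin_numM ?F|move=> *; rewrite lee_fin..].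
Qed.

(* Newton's theorem: a rotation invariant density sees ln |x - y| as ln max(|x|, |y|). *)
Lemma newton : Ilog rho rho = fine (\int[LL]_z (lmax z * (rho z.1 * rho z.2))%:E)%E.
Proof.
have [mr r0 _ _ _] := lr; have i1 := ln_eucl_integrable lr lr; have i2 := ln_eucl_int.
have ik : LL.-integrable setT (fun z => (kap z * (rho z.1 * rho z.2))%:E).
  apply: eq_integrable (integrableB measurableT i1 i2) => // z _.
  by rewrite -EFinB /kap; congr (_%:E); ring.
have mk : measurable_fun setT (fun z => (kap z * (rho z.1 * rho z.2))%:E) by case/integrableP: ik.
suff k0 : (\int[LL]_z (kap z * (rho z.1 * rho z.2))%:E = 0)%E.
  have f1 := integrable_fin_num measurableT i1; have f2 := integrable_fin_num measurableT i2.
  have := k0; have -> : (\int[LL]_z (kap z * (rho z.1 * rho z.2))%:E =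
      \int[LL]_z ((ln (eucl (z.1 - z.2)) * (rho z.1 * rho z.2))%:E - (lmax z * (rho z.1 * rho z.2))%:E))%E.
    by apply: eq_integral => z _; rewrite -EFinB /kap; congr (_%:E); ring.
  rewrite (integralB measurableT i1 i2) -(fineK f1) -(fineK f2) -EFinB => -[] /eqP.
  by rewrite subr_eq0 => /eqP.
(* These ratios increase to 1 and exhaust all pairs of different radii, which is almost every
   pair. *)
pose q n : R := 1 - (n.+2%:R)^-1.
have q01 n : 0 < q n < 1.
  rewrite /q subr_gt0 gtrBl invr_gt0 ltr0n andbT/= invf_lt1 ?ltr0n//.
  by rewrite ltr1n.
have [|||||_ _] := @dominated_convergence _ _ R LL setT measurableT
  (fun n z => (G (q n) 0 z)%:E) (fun z => (kap z * (rho z.1 * rho z.2))%:E)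
  (abse \o (fun z => (kap z * (rho z.1 * rho z.2))%:E)).
- by move=> n; have [+ _] := kap_iter_int 0 (q01 n); case/integrableP.
- by [].
- apply: LL_ae_mono (LL_eucl_neq R) => z hz _.
  suff [N hN] : exists N : nat, forall n, (N <= n)%N -> far (q n) z.
    apply: cvg_near_cst; exists N => // n /= Nn; rewrite /G /= hN// mulr1.
    by case: (z).
  have key (a b : R) : 0 <= a -> a < b -> exists N : nat, forall n, (N <= n)%N -> a < q n * b.
    move=> a0 ab; have ba : 0 < b - a by rewrite subr_gt0.
    exists (Num.trunc (b / (b - a))).+1 => n Nn.
    have h1 : b / (b - a) < n.+2%:R.
      apply: lt_le_trans (Num.Theory.truncnS_gt _) _; rewrite ler_nat.
      by apply: leq_trans Nn _; rewrite (leq_trans (leqnSn _)).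
    rewrite ltr_pdivrMr// in h1.
    have n0 : 0 < n.+2%:R :> R by rewrite ltr0n.
    rewrite /q mulrBl mul1r ltrBrDr -ltrBrDl mulrC ltr_pdivrMr//; lra.
  have [h|h|h] := ltgtP (eucl z.1) (eucl z.2).
  - have [N hN] := key _ _ (eucl_ge0 _) h; exists N => n /hN hn.
    by rewrite /far hn.
  - have [N hN] := key _ _ (eucl_ge0 _) h; exists N => n /hN hn.
    by rewrite /far hn orbT.
  - by rewrite h eqxx in hz.
- exact: integrable_abse.
- apply: aeW => z n _ /=; rewrite lee_fin /G /= normrM.
  rewrite [X in X * _ <= _](_ : _ = `|kap z * (rho z.1 * rho z.2)|); last by case: (z).
  by rewrite ler_piMr//; case: (far _ _); rewrite ?normr1 ?normr0 ?ler01.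
rewrite (_ : [sequence _]_n = cst 0%E); last first.
  by apply/funext => n /=; exact: kap_far_int0.
move=> h; have := cvg_lim _ h => <-//; exact: lim_cst.
Qed.

End vanishing.
End newton.

(** * The logarithmic energy in terms of disc masses *)

Section layer_cake.
Variable R : realType.
Local Notation mu := (@lebesgue_measure R).
Local Notation L := (@leb2 R).
Local Notation R1 := (measurableTypeR R).
Local Notation T2 := (R1 * R1)%type.
Local Notation LL := (L \x L)%E.
Implicit Types (f g w u rho sig : T2 -> R).

Definition dens rho (lam : R) := [/\ measurable_fun setT rho, forall x, 0 <= rho x &
  (\int[L]_x (rho x)%:E = lam%:E)%E].

Definition bmass rho (t : R) : R :=
  fine (\int[L]_x (rho x * (if eucl x <= t then 1 else 0))%:E)%E.

Lemma dens_le rho lam f : dens rho lam -> measurable_fun setT f -> (forall x, 0 <= f x <= 1) ->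
  (0 <= \int[L]_x (rho x * f x)%:E <= lam%:E)%E.
Proof.
move=> [mr r0 rl] mf f01; apply/andP; split.
  by apply: integral_ge0 => x _; rewrite lee_fin mulr_ge0//; case/andP: (f01 x).
rewrite -rl; apply: ge0_le_integral => //.
- by move=> x _; rewrite lee_fin mulr_ge0//; case/andP: (f01 x).
- by mf.
- by mf.
- by move=> x _; rewrite lee_fin ler_piMr//; case/andP: (f01 x).
Qed.

Lemma bmassE rho lam t : dens rho lam ->
  (\int[L]_x (rho x * (if (eucl x <= t)%R then 1 else 0))%:E = (bmass rho t)%:E)%E.
Proof.
move=> dr; have me := @measurable_eucl R.
have mi : measurable_fun setT (fun x : T2 => (if eucl x <= t then 1 else 0) : R) by mf.
have i01 x : 0 <= ((if eucl (x : T2) <= t then 1 else 0) : R) <= 1 by case: ifP; rewrite lexx ler01.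
have /andP[h1 h2] := dens_le dr mi i01.
by rewrite fineK// ge0_fin_numE//; apply: le_lt_trans h2 _; rewrite ltry.
Qed.

Lemma bmass_lt rho lam t : dens rho lam ->
  (\int[L]_x (rho x * (if (eucl x < t)%R then 1 else 0))%:E = (bmass rho t)%:E)%E.
Proof.
move=> dr; rewrite -(bmassE t dr); have [mr r0 _] := dr; have me := @measurable_eucl R.
apply: ae_eq_integral => //; [by mf|by mf|].
by apply: ae_mono (@ae_eucl_neq R t) => x h _; rewrite lt_neqAle h.
Qed.

Lemma bmass_ge0 rho t : (forall x, 0 <= rho x) -> 0 <= bmass rho t.
Proof.
move=> r0; apply: fine_ge0; apply: integral_ge0 => x _; rewrite lee_fin mulr_ge0//.
by case: ifP.
Qed.

Lemma bmass_le rho lam t : dens rho lam -> bmass rho t <= lam.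
Proof.
move=> dr; have me := @measurable_eucl R; rewrite -lee_fin -(bmassE t dr).
have mi : measurable_fun setT (fun x : T2 => (if eucl x <= t then 1 else 0) : R) by mf.
have i01 x : 0 <= ((if eucl (x : T2) <= t then 1 else 0) : R) <= 1 by case: ifP; rewrite lexx ler01.
by have /andP[] := dens_le dr mi i01.
Qed.

Lemma bmass_mono rho lam s t : dens rho lam -> s <= t -> bmass rho s <= bmass rho t.
Proof.
move=> dr st; have [mr r0 _] := dr; have me := @measurable_eucl R.
rewrite -lee_fin -(bmassE s dr) -(bmassE t dr); apply: ge0_le_integral => //.
- by move=> x _; rewrite lee_fin mulr_ge0//; case: ifP.
- by mf.
- by mf.
move=> x _; rewrite lee_fin ler_wpM2l//; case: (leP (eucl x) s) => h.
  by rewrite (le_trans h st).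
by case: ifP; rewrite ?lexx ?ler01.
Qed.

Lemma measurable_bmass rho lam : dens rho lam -> measurable_fun setT (bmass rho : R1 -> R).
Proof.
move=> dr; apply: nondecreasing_measurable => // s t st.
exact: (bmass_mono dr st).
Qed.

(** Pairs not both in the open disc of radius [t]; circles being null, they carry the total squared
    mass minus that of the disc. *)
Definition outer rho (t : R) : \bar R := (\int[LL]_z ((rho z.1 * rho z.2) *
  (if (t <= Num.max (eucl z.1) (eucl z.2))%R then 1 else 0))%:E)%E.

Lemma inner_sqr rho lam t : dens rho lam ->
  (\int[LL]_z ((rho z.1 * rho z.2) * (if (Num.max (eucl z.1) (eucl z.2) <= t)%R then 1 else 0))%:E =
  (bmass rho t ^+ 2)%:E)%E.
Proof.
move=> dr; have [mr r0 rl] := dr; have me := @measurable_eucl R.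
have -> : (\int[LL]_z ((rho z.1 * rho z.2) * (if (Num.max (eucl z.1) (eucl z.2) <= t)%R then 1 else 0))%:E =
    \int[LL]_z ((rho z.1 * (if (eucl z.1 <= t)%R then 1 else 0)) *
      (rho z.2 * (if (eucl z.2 <= t)%R then 1 else 0)))%:E)%E.
  apply: eq_integral => z _; rewrite ge_max; congr (_%:E).
  by case: (eucl z.1 <= t); case: (eucl z.2 <= t) => /=; ring.
pose f x := rho x * (if eucl x <= t then 1 else 0).
have mf : measurable_fun setT f by rewrite /f; mf.
have f0 x : 0 <= f x by rewrite /f mulr_ge0//; case: ifP.
by rewrite (LL_prod mf mf f0 f0) /f (bmassE t dr) -EFinM expr2.
Qed.

Lemma outerE rho lam t : dens rho lam -> outer rho t = (lam ^+ 2 - bmass rho t ^+ 2)%:E.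
Proof.
move=> dr; have [mr r0 rl] := dr; have me := @measurable_eucl R.
pose f x := rho x * (if eucl x < t then 1 else 0).
have mf : measurable_fun setT f by rewrite /f; mf.
have f0 x : 0 <= f x by rewrite /f mulr_ge0//; case: ifP.
have mM : measurable_fun setT (fun z : T2 * T2 => Num.max (eucl z.1) (eucl z.2) : R).
  by apply: measurable_maxr; mf.
have h : (outer rho t + (bmass rho t ^+ 2)%:E = (lam ^+ 2)%:E)%E.
  have -> : ((lam ^+ 2)%:E = \int[LL]_z (rho z.1 * rho z.2)%:E)%E.
    by rewrite (LL_prod mr mr r0 r0) rl -EFinM.
  have -> : ((bmass rho t ^+ 2)%:E = \int[LL]_z (f z.1 * f z.2)%:E)%E.
    by rewrite (LL_prod mf mf f0 f0) /f (bmass_lt t dr) -EFinM expr2.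
  rewrite /outer -ge0_integral_EFinD.
  - apply: eq_integral => z _; congr (_%:E); rewrite /f le_max !leNgt.
    by case: (eucl z.1 < t); case: (eucl z.2 < t) => /=; ring.
  - by mf.
  - by mf.
  - by move=> z; rewrite mulr_ge0 ?mulr_ge0//; case: ifP.
  - by move=> z; rewrite mulr_ge0.
have : outer rho t \is a fin_num.
  by move: h; case: (outer rho t) => //=.
move=> /fineK hf; move: h; rewrite -hf -EFinD => -[h]; congr (_%:E); lra.
Qed.

Definition lpos rho : \bar R := (\int[LL]_z (Num.max 0 (lmax z) * (rho z.1 * rho z.2))%:E)%E.
Definition lneg rho : \bar R := (\int[LL]_z (Num.max 0 (- lmax z) * (rho z.1 * rho z.2))%:E)%E.

Let cake (F : T2 * T2 -> R1 -> R) : measurable_fun setT (fun z => F z.1 z.2) -> (forall z t, 0 <= F z t) ->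
  (\int[LL]_z \int[mu]_t (F z t)%:E = \int[mu]_t \int[LL]_z (F z t)%:E)%E.
Proof.
move=> mF F0.
have mH : measurable_fun setT (fun a : (T2 * R1) * T2 => (F (a.1.1, a.2) a.1.2)%:E).
  have m1 : measurable_fun setT (fun a : (T2 * R1) * T2 => ((a.1.1, a.2), a.1.2)) by mf.
  by apply/measurable_EFinP; exact: (measurableT_comp mF m1).
have H0 a : (0 <= (F (a.1.1, a.2) a.1.2)%:E)%E by rewrite lee_fin.
have m2 : measurable_fun setT (fun a : T2 * R1 => \int[L]_y (F (a.1, y) a.2)%:E)%E.
  exact: (@measurable_fun_fubini_tonelli_F _ _ (T2 * R1)%type T2 R L (fun a => (F (a.1.1, a.2) a.1.2)%:E) mH H0).
have m3 : measurable_fun setT (fun z : T2 * T2 => \int[mu]_t (F z t)%:E)%E.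
  apply: (@measurable_fun_fubini_tonelli_F _ _ (T2 * T2)%type R1 R mu (fun z => (F z.1 z.2)%:E)); first by mf.
  by move=> z; rewrite lee_fin.
have p3 z : (0 <= \int[mu]_t (F z t)%:E)%E by apply: integral_ge0 => t _; rewrite lee_fin.
have p2 a : (0 <= \int[L]_y (F (a.1, y) a.2)%:E)%E by apply: integral_ge0 => t _; rewrite lee_fin.
apply: etrans (fubini_tonelli1 (fun z : T2 * T2 => \int[mu]_t (F z t)%:E)%E m3 p3) _.
transitivity (\int[L]_x \int[mu]_t \int[L]_y (F (x, y) t)%:E)%E.
  apply: eq_integral => x _.
  apply: (@fubini_tonelli _ _ T2 R1 R L mu (fun a => (F (x, a.1) a.2)%:E)).
    have m1 : measurable_fun setT (fun a : T2 * R1 => ((x, a.1), a.2)) by mf.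
    by apply/measurable_EFinP; exact: (measurableT_comp mF m1).
  by move=> a; rewrite lee_fin.
apply: etrans (@fubini_tonelli _ _ T2 R1 R L mu (fun a => \int[L]_y (F (a.1, y) a.2)%:E)%E m2 p2) _.
apply: eq_integral => t _; apply/esym.
have m4 : measurable_fun setT (fun z : T2 * T2 => (F z t)%:E).
  have m1 : measurable_fun setT (fun a : T2 * T2 => (a, t : R1)) by mf.
  by apply/measurable_EFinP; exact: (measurableT_comp mF m1).
apply: (fubini_tonelli1 (fun z : T2 * T2 => (F z t)%:E) m4) => z.
by rewrite lee_fin.
Qed.

Lemma between_inv_ge0 (a b t : R) : 0 <= a -> 0 <= t^-1 * between a b t.
Proof. by move=> a0; rewrite -(ger0_norm a0) inv_between_ge0. Qed.

(** The logarithm of a number at least 1 is the integral of [1 / t] from 1 to it; exchanging the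
    integrals leaves at level [t] the pairs whose larger radius is at least [t]. *)
Lemma lposE rho lam : dens rho lam ->
  lpos rho = (\int[mu]_t (t^-1 * (if (1 <= t)%R then lam ^+ 2 - bmass rho t ^+ 2 else 0))%:E)%E.
Proof.
move=> dr; have [mr r0 rl] := dr; have me := @measurable_eucl R; have mi := @measurable_invr R.
have mM : measurable_fun setT (fun z : T2 * T2 => Num.max (eucl z.1) (eucl z.2) : R).
  by apply: measurable_maxr; mf.
pose F (z : T2 * T2) (t : R1) : R := t^-1 * between 1 (Num.max (eucl z.1) (eucl z.2)) t * (rho z.1 * rho z.2).
have F0 z t : 0 <= F z t by apply: mulr_ge0; [exact: between_inv_ge0|exact: mulr_ge0].
have mF : measurable_fun setT (fun z : (T2 * T2) * R1 => F z.1 z.2).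
  by rewrite /F /between; mf.
transitivity (\int[LL]_z \int[mu]_t (F z t)%:E)%E.
  apply: eq_integral => z _.
  have -> : (\int[mu]_t (F z t)%:E = (rho z.1 * rho z.2)%:E *
      \int[mu]_t (t^-1 * between 1 (Num.max (eucl z.1) (eucl z.2)) t)%:E)%E.
    rewrite -ge0_integral_EFinZ ?mulr_ge0//; first last.
    - by move=> t; exact: between_inv_ge0.
    - by have mb := @measurable_between R 1 (Num.max (eucl z.1) (eucl z.2)); mf.
    by apply: eq_integral => t _; rewrite /F mulrC.
  rewrite mulrC EFinM; congr (_ * _)%E; rewrite /lmax.
  have [h|h] := leP 1 (Num.max (eucl z.1) (eucl z.2)).
    rewrite integral_invr// ln1 subr0; congr (_%:E); apply/max_idPr.
    exact: ln_ge0.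
  rewrite integral0_eq; last first.
    move=> t _; rewrite /between; case: ifP => [/andP[h1 h2]|]; last by rewrite mulr0.
    by have := le_lt_trans (le_trans h1 h2) h; rewrite ltxx.
  congr (_%:E); apply/max_idPl; apply: ln_le0; exact: ltW.
rewrite cake//; apply: eq_integral => t _.
have [h|h] := leP 1 t; last first.
  rewrite mulr0; apply: integral0_eq => z _.
  by rewrite /F /between leNgt h/= mulr0 mul0r.
rewrite EFinM -(outerE t dr) /outer -ge0_integral_EFinZ ?invr_ge0 ?(le_trans ler01 h)//; first last.
- by move=> z; rewrite mulr_ge0 ?mulr_ge0//; case: ifP.
- by mf.
by apply: eq_integral => z _; rewrite /F /between h/= -mulrA; congr (_%:E); congr (_ * _); exact: mulrC.
Qed.

Lemma lnegE rho lam : dens rho lam ->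
  lneg rho = (\int[mu]_t (t^-1 * (if (0 < t <= 1)%R then bmass rho t ^+ 2 else 0))%:E)%E.
Proof.
move=> dr; have [mr r0 rl] := dr; have me := @measurable_eucl R; have mi := @measurable_invr R.
have mM : measurable_fun setT (fun z : T2 * T2 => Num.max (eucl z.1) (eucl z.2) : R).
  by apply: measurable_maxr; mf.
pose F (z : T2 * T2) (t : R1) : R := t^-1 * between (Num.max (eucl z.1) (eucl z.2)) 1 t * (rho z.1 * rho z.2).
have M0 (z : T2 * T2) : 0 <= Num.max (eucl z.1) (eucl z.2) by rewrite le_max eucl_ge0.
have F0 z t : 0 <= F z t.
  by apply: mulr_ge0; [exact: between_inv_ge0|exact: mulr_ge0].
have mF : measurable_fun setT (fun z : (T2 * T2) * R1 => F z.1 z.2).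
  by rewrite /F /between; mf.
have mml := @measurable_lmax R.
transitivity (\int[LL]_z \int[mu]_t (F z t)%:E)%E.
  apply: ae_eq_integral => //.
  - have m1 : measurable_fun setT (fun z => Num.max 0 (- lmax z) : R) by apply: measurable_maxr; mf.
    by mf.
  - apply: (@measurable_fun_fubini_tonelli_F _ _ (T2 * T2)%type R1 R mu (fun z => (F z.1 z.2)%:E)); first by mf.
    by move=> z; rewrite lee_fin.
  (* Different radii guarantee a positive maximum; at maximum 0 the convention [ln 0 = 0] would
     disagree with the divergent integral of [1 / t]. *)
  apply: LL_ae_mono (@LL_eucl_neq R) => z hz _.
  have Mp : 0 < Num.max (eucl z.1) (eucl z.2).
    rewrite lt_neqAle M0 andbT; apply: contraNneq hz => /esym h.
    have := lexx (Num.max (eucl z.1) (eucl z.2)); rewrite {2}h ge_max => /andP[h1 h2].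
    by rewrite eq_le (le_trans h1 (eucl_ge0 _)) (le_trans h2 (eucl_ge0 _)).
  have -> : (\int[mu]_t (F z t)%:E = (rho z.1 * rho z.2)%:E *
      \int[mu]_t (t^-1 * between (Num.max (eucl z.1) (eucl z.2)) 1 t)%:E)%E.
    rewrite -ge0_integral_EFinZ ?mulr_ge0//; first last.
    - by move=> t; exact: between_inv_ge0.
    - by have mb := @measurable_between R (Num.max (eucl z.1) (eucl z.2)) 1; mf.
    by apply: eq_integral => t _; rewrite /F mulrC.
  rewrite mulrC EFinM; congr (_ * _)%E; rewrite /lmax.
  have [h|h] := leP (Num.max (eucl z.1) (eucl z.2)) 1.
    rewrite integral_invr// ln1 sub0r; congr (_%:E); apply/max_idPr.
    by rewrite oppr_ge0; exact: ln_le0.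
  rewrite integral0_eq; last first.
    move=> t _; rewrite /between; case: ifP => [/andP[h1 h2]|]; last by rewrite mulr0.
    by have := le_lt_trans (le_trans h1 h2) h; rewrite ltxx.
  congr (_%:E); apply/max_idPl; rewrite oppr_le0; apply: ln_ge0; exact: ltW.
rewrite cake//; apply: eq_integral => t _.
case: ifP => [/andP[t0 t1]|h]; last first.
  rewrite mulr0; apply: integral0_eq => z _.
  rewrite /F /between; case: ifP => [/andP[h1 h2]|]; last by rewrite mulr0 mul0r.
  have : t <= 0 by rewrite leNgt; apply/negP => t0; move: h; rewrite t0 h2.
  have := le_trans (M0 z) h1 => a b; have -> : t = 0 by apply/eqP; rewrite eq_le a b.
  by rewrite invr0 !mul0r.
rewrite EFinM -(inner_sqr t dr) -ge0_integral_EFinZ ?invr_ge0 ?(ltW t0)//; first last.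
- by move=> z; rewrite mulr_ge0 ?mulr_ge0//; case: ifP.
- by mf.
by apply: eq_integral => z _; rewrite /F /between t1 andbT -mulrA; congr (_%:E); congr (_ * _); exact: mulrC.
Qed.

Definition Imax rho : R := fine (\int[LL]_z (lmax z * (rho z.1 * rho z.2))%:E)%E.

Lemma logdens_dens rho lam : logdens rho -> (\int[L]_x (rho x)%:E = lam%:E)%E -> dens rho lam.
Proof. by case. Qed.

Lemma posneg_split (l : R) : l = Num.max 0 l - Num.max 0 (- l).
Proof. by rewrite !maxEle; case: (leP 0 l); case: (leP 0 (- l)); lra. Qed.

Lemma ImaxE rho : logdens rho -> [/\ lpos rho \is a fin_num, lneg rho \is a fin_num &
  Imax rho = fine (lpos rho) - fine (lneg rho)].
Proof.
move=> lr; have [mr r0 _ _ _] := lr; have i := ln_eucl_int lr; have ml := @measurable_lmax R.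
have ia := integrable_abse i.
have I (f : T2 * T2 -> R) : measurable_fun setT f -> (forall z, `|f z| <= `|lmax z|) ->
    LL.-integrable setT (fun z => (f z * (rho z.1 * rho z.2))%:E).
  move=> mf hf; apply: le_integrable ia => //; first by mf.
  move=> z _; rewrite /= lee_fin normr_id !normrM ler_wpM2r//.
have m1 : measurable_fun setT (fun z => Num.max 0 (lmax z) : R) by apply: measurable_maxr; mf.
have m2 : measurable_fun setT (fun z => Num.max 0 (- lmax z) : R) by apply: measurable_maxr; mf.
have i1 : LL.-integrable setT (fun z => (Num.max 0 (lmax z) * (rho z.1 * rho z.2))%:E).
  apply: I => // z; rewrite maxEle; case: (leP 0 (lmax z)) => // _.
  by rewrite normr0.
have i2 : LL.-integrable setT (fun z => (Num.max 0 (- lmax z) * (rho z.1 * rho z.2))%:E).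
  apply: I => // z; rewrite maxEle; case: (leP 0 (- lmax z)) => // _; rewrite ?normrN//.
  by rewrite normr0.
have f1 := integrable_fin_num measurableT i1; have f2 := integrable_fin_num measurableT i2.
split=> //; rewrite /Imax.
have -> : (\int[LL]_z (lmax z * (rho z.1 * rho z.2))%:E = \int[LL]_z
    ((Num.max 0 (lmax z) * (rho z.1 * rho z.2))%:E - (Num.max 0 (- lmax z) * (rho z.1 * rho z.2))%:E))%E.
  apply: eq_integral => z _; rewrite -EFinB -mulrBl; congr ((_ * _)%:E).
  exact: posneg_split.
by rewrite (integralB measurableT i1 i2) -(fineK f1) -(fineK f2) -EFinB.
Qed.

(** Larger disc masses decrease the integrand of the positive part and increase that of the negative
    part, so both contributions push the energy down. The reverse inequality of the energies
    therefore forces equality of both integrands at almost every level. *)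
Lemma bmass_eq_of_Imax rho sig lam : logdens rho -> logdens sig ->
  (\int[L]_x (rho x)%:E = lam%:E)%E -> (\int[L]_x (sig x)%:E = lam%:E)%E ->
  (forall t, 0 < t -> bmass rho t <= bmass sig t) -> Imax rho <= Imax sig ->
  {ae mu, forall t : R1, 0 < t -> bmass rho t = bmass sig t}.
Proof.
move=> lr ls rl sl h J; have dr := logdens_dens lr rl; have ds := logdens_dens ls sl.
have [_ r0 _] := dr; have [_ s0 _] := ds.
have mr := measurable_bmass dr; have ms := measurable_bmass ds; have mi := @measurable_invr R.
have [a1 a2 aE] := ImaxE lr; have [b1 b2 bE] := ImaxE ls.
have hs t : 0 < t -> bmass rho t ^+ 2 <= bmass sig t ^+ 2.
  by move=> t0; rewrite ler_sqr ?nnegrE ?bmass_ge0// h.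
have bl t : bmass sig t ^+ 2 <= lam ^+ 2.
  by rewrite ler_sqr ?nnegrE ?bmass_ge0// ?(bmass_le t ds)// (le_trans (bmass_ge0 t s0) (bmass_le t ds)).
pose P (m : R -> R) (t : R1) : R := t^-1 * (if 1 <= t then lam ^+ 2 - m t ^+ 2 else 0).
pose Q (m : R -> R) (t : R1) : R := t^-1 * (if 0 < t <= 1 then m t ^+ 2 else 0).
have P0 m t : m t ^+ 2 <= lam ^+ 2 -> 0 <= P m t.
  move=> hm; rewrite /P; case: (leP 1 t) => t1; last by rewrite mulr0.
  by rewrite mulr_ge0 ?invr_ge0 ?subr_ge0// (le_trans ler01 t1).
have Q0 m t : 0 <= Q m t.
  rewrite /Q; case: ifP => [/andP[t0 t1]|]; last by rewrite mulr0.
  by rewrite mulr_ge0 ?invr_ge0 ?sqr_ge0// ltW.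
have al t : bmass rho t ^+ 2 <= lam ^+ 2.
  by rewrite ler_sqr ?nnegrE ?bmass_ge0// ?(bmass_le t dr)// (le_trans (bmass_ge0 t r0) (bmass_le t dr)).
have m1 := measurable_fun_ler (measurable_cst (1 : R)) (@measurable_id _ R1 setT).
have m0 := measurable_fun_ltr (measurable_cst (0 : R)) (@measurable_id _ R1 setT).
have mP (m : R1 -> R) : measurable_fun setT m -> measurable_fun setT (P m) by move=> mm; rewrite /P; mf.
have mQ (m : R1 -> R) : measurable_fun setT m -> measurable_fun setT (Q m) by move=> mm; rewrite /Q; mf.
have lP1 := lposE dr; have lP2 := lposE ds; have lQ1 := lnegE dr; have lQ2 := lnegE ds.
have PP t : P (bmass sig) t <= P (bmass rho) t.
  rewrite /P; case: (leP 1 t) => t1 //; rewrite ler_wpM2l ?invr_ge0 ?(le_trans ler01 t1)//.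
  by rewrite lerD2l lerN2 hs// (lt_le_trans ltr01 t1).
have QQ t : Q (bmass rho) t <= Q (bmass sig) t.
  rewrite /Q; case: ifP => [/andP[t0 t1]|//].
  by rewrite ler_wpM2l ?invr_ge0 ?(ltW t0)// hs.
have c1 : (lpos sig <= lpos rho)%E.
  rewrite lP1 lP2; apply: ge0_le_integral => //.
  - by move=> t _; rewrite lee_fin P0.
  - by apply/measurable_EFinP; exact: mP.
  - by apply/measurable_EFinP; exact: mP.
  - by move=> t _; rewrite lee_fin; exact: PP.
have c2 : (lneg rho <= lneg sig)%E.
  rewrite lQ1 lQ2; apply: ge0_le_integral => //.
  - by move=> t _; rewrite lee_fin Q0.
  - by apply/measurable_EFinP; exact: mQ.
  - by apply/measurable_EFinP; exact: mQ.
  - by move=> t _; rewrite lee_fin; exact: QQ.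
have c1' := c1; have c2' := c2.
rewrite -(fineK a1) -(fineK b1) lee_fin in c1'.
rewrite -(fineK a2) -(fineK b2) lee_fin in c2'.
have e1 : (lpos rho <= lpos sig)%E by rewrite -(fineK a1) -(fineK b1) lee_fin; move: J; rewrite aE bE; lra.
have e2 : (lneg sig <= lneg rho)%E by rewrite -(fineK a2) -(fineK b2) lee_fin; move: J; rewrite aE bE; lra.
have aeP : {ae mu, forall t : R1, P (bmass sig) t = P (bmass rho) t}.
  apply: (@ge0_integral_ae_eq R _ R1 mu (P (bmass sig)) (P (bmass rho))).
  - exact: mP.
  - exact: mP.
  - by move=> t; exact: P0.
  - by move=> t; exact: P0.
  - by apply: aeW => t; exact: PP.
  - by move: e1; rewrite lP1 lP2.
  - by have := a1; rewrite lP1 fin_numElt => /andP[].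
have aeQ : {ae mu, forall t : R1, Q (bmass rho) t = Q (bmass sig) t}.
  apply: (@ge0_integral_ae_eq R _ R1 mu (Q (bmass rho)) (Q (bmass sig))).
  - exact: mQ.
  - exact: mQ.
  - by move=> t; exact: Q0.
  - by move=> t; exact: Q0.
  - by apply: aeW => t; exact: QQ.
  - by move: e2; rewrite lQ1 lQ2.
  - by have := b2; rewrite lQ2 fin_numElt => /andP[].
apply: filterS2 aeP aeQ => t; rewrite /P /Q => h1 h2 t0.
suff /eqP : bmass rho t ^+ 2 = bmass sig t ^+ 2 by rewrite eqrXn2 ?bmass_ge0// => /eqP.
have ti : t^-1 != 0 :> R by rewrite invr_eq0 gt_eqF.
move: h1 h2; rewrite t0 /=; case: (leP 1 t) => t1 h1 h2.
  by have := mulfI ti h1; lra.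
by move: h2; rewrite (ltW t1) => /(mulfI ti).
Qed.

End layer_cake.

(** * Radial profiles and their disc masses *)

Section radial_mass.
Variable R : realType.
Local Notation mu := (@lebesgue_measure R).
Local Notation L := (@leb2 R).
Local Notation R1 := (measurableTypeR R).
Local Notation T2 := (R1 * R1)%type.
Local Notation LL := (L \x L)%E.
Implicit Types (f g w u rho sig : T2 -> R).

Definition annulus (r s : R) (x : T2) : R := if (r < eucl x) && (eucl x <= s) then 1 else 0.

Definition area (r s : R) : R := fine (\int[L]_x (annulus r s x)%:E)%E.

Lemma measurable_annulus r s : measurable_fun setT (annulus r s).
Proof. by have me := @measurable_eucl R; rewrite /annulus; mf. Qed.

Lemma annulus_ge0 r s x : 0 <= annulus r s x.
Proof. by rewrite /annulus; case: ifP. Qed.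

Lemma areaE r s : (\int[L]_x (annulus r s x)%:E = (area r s)%:E)%E.
Proof.
rewrite fineK// ge0_fin_numE; last by apply: integral_ge0 => x _; rewrite lee_fin annulus_ge0.
pose B : set T2 := `[- s, s]%classic `*` `[- s, s]%classic.
have mB : measurable B by exact: measurableX.
apply: (@le_lt_trans _ _ (L B)).
  have -> : L B = (\int[L]_x (\1_B x)%:E)%E by rewrite integral_indic ?setIT.
  apply: ge0_le_integral => //.
  - by move=> x _; rewrite lee_fin annulus_ge0.
  - by apply/measurable_EFinP; exact: measurable_annulus.
  - by apply/measurable_EFinP; exact: measurable_indic.
  move=> x _; rewrite lee_fin /annulus indicE; case: ifP => // /andP[_ xs].
  have h2 : `|x.2| <= eucl x.
    by rewrite -sqrtr_sqr /eucl ler_wsqrtr// lerDr sqr_ge0.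
  rewrite (_ : x \in B) //; apply/mem_set; split => /=; rewrite in_itv/= -ler_norml.
    exact: le_trans (normr1_le_eucl _) xs.
  exact: le_trans h2 xs.
rewrite /leb2 product_measure1E//.
have E : mu `[- s, s]%classic \is a fin_num.
  by rewrite lebesgue_measure_itv/=; case: ifP.
have : (mu `[(- s)%R, s]%classic * mu `[(- s)%R, s]%classic)%E \is a fin_num by rewrite fin_numM.
by rewrite fin_numElt => /andP[].
Qed.

Lemma area_gt0 r s : 0 <= r -> r < s -> 0 < area r s.
Proof.
move=> r0 rs; rewrite lt_neqAle; apply/andP; split; last first.
  by apply: fine_ge0; apply: integral_ge0 => x _; rewrite lee_fin annulus_ge0.
apply/eqP => h; apply: (annulus_nonnull r0 rs).
have m1 := measurable_annulus r s.
have h0 : (\int[L]_x `|(annulus r s x)%:E| = 0)%E.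
  apply: (@etrans _ _ (area r s)%:E); last by rewrite -h.
  rewrite -areaE; by apply: eq_integral => x _; rewrite gee0_abs// lee_fin annulus_ge0.
have mE : measurable_fun setT (fun x => (annulus r s x)%:E) by apply/measurable_EFinP.
have /(ae_eq_integral_abs L measurableT mE) := h0.
apply: ae_mono => x /(_ I) [] /eqP; rewrite /annulus => + /andP[h1 h2].
by rewrite h1 (ltW h2) oner_eq0.
Qed.

Lemma bmass_diff rho lam r s : dens rho lam -> r <= s ->
  (\int[L]_x (rho x * annulus r s x)%:E = (bmass rho s - bmass rho r)%:E)%E.
Proof.
move=> dr rs; have [mr r0 _] := dr; have me := @measurable_eucl R; have ma := measurable_annulus r s.
have h : ((bmass rho r)%:E + \int[L]_x (rho x * annulus r s x)%:E = (bmass rho s)%:E)%E.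
  rewrite -(bmassE r dr) -(bmassE s dr) -ge0_integral_EFinD.
  - apply: eq_integral => x _; congr (_%:E); rewrite /annulus ltNge.
    have [h|h] := leP (eucl x) r; first by rewrite (le_trans h rs)/=; ring.
    by rewrite /=; ring.
  - by mf.
  - by mf.
  - by move=> x; rewrite mulr_ge0//; case: ifP.
  - by move=> x; rewrite mulr_ge0// annulus_ge0.
have : (\int[L]_x (rho x * annulus r s x)%:E)%E \is a fin_num.
  by move: h; case: (\int[L]_x (rho x * annulus r s x)%:E)%E.
move=> /fineK hf; move: h; rewrite -hf -EFinD => -[<-]; congr (_%:E); lra.
Qed.

Lemma bmass_diff_le rho lam r s (b : R) : dens rho lam -> r <= s -> 0 <= b ->
  (forall x, r < eucl x -> eucl x <= s -> rho x <= b) -> bmass rho s - bmass rho r <= b * area r s.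
Proof.
move=> dr rs b0 h; have [mr r0 _] := dr; have ma := measurable_annulus r s.
rewrite -lee_fin -(bmass_diff dr rs) EFinM -areaE -ge0_integral_EFinZ//; last exact: annulus_ge0.
apply: ge0_le_integral => //.
- by move=> x _; rewrite lee_fin mulr_ge0// annulus_ge0.
- by mf.
- by mf.
- move=> x _; rewrite lee_fin /annulus; case: ifP => [/andP[h1 h2]|]; last by rewrite !mulr0.
  by rewrite !mulr1 h.
Qed.

Lemma bmass_diff_ge rho lam r s (a : R) : dens rho lam -> r <= s -> 0 <= a ->
  (forall x, r < eucl x -> eucl x <= s -> a <= rho x) -> a * area r s <= bmass rho s - bmass rho r.
Proof.
move=> dr rs a0 h; have [mr r0 _] := dr; have ma := measurable_annulus r s.
rewrite -lee_fin -(bmass_diff dr rs) EFinM -areaE -ge0_integral_EFinZ//; last exact: annulus_ge0.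
apply: ge0_le_integral => //.
- by move=> x _; rewrite lee_fin mulr_ge0// annulus_ge0.
- by mf.
- by mf.
- move=> x _; rewrite lee_fin /annulus; case: ifP => [/andP[h1 h2]|]; last by rewrite !mulr0.
  by rewrite !mulr1 h.
Qed.

Lemma bmass0 rho : measurable_fun setT rho -> bmass rho 0 = 0.
Proof.
move=> mr; have me := @measurable_eucl R.
rewrite /bmass (ae_eq_integral (fun=> 0%E))//; first by rewrite integral0.
- by mf.
- apply: ae_mono (@ae_eucl_gt0 R) => x h _.
  by rewrite leNgt h mulr0.
Qed.

Definition prof u lam := [/\ rdec u, forall x, 0 <= u x & dens (fun x => u x ^+ 2) lam].

Local Notation bm u := (bmass (fun x => u x ^+ 2)).

Lemma prof_upper u lam r s x : prof u lam -> r <= s -> 0 < eucl x -> eucl x <= r ->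
  bm u s - bm u r <= u x ^+ 2 * area r s.
Proof.
move=> [ru u0 du] rs x0 xr.
apply: (bmass_diff_le du rs (sqr_ge0 _)) => y h1 h2.
by rewrite ler_sqr ?nnegrE// ru// (le_trans xr (ltW h1)).
Qed.

Lemma prof_lower u lam r s x : prof u lam -> 0 <= r -> r <= s -> s <= eucl x ->
  u x ^+ 2 * area r s <= bm u s - bm u r.
Proof.
move=> [ru u0 du] r0 rs sx; apply: (bmass_diff_ge du rs (sqr_ge0 _)) => y h1 h2.
by rewrite ler_sqr ?nnegrE// ru// ?(le_lt_trans r0 h1)// (le_trans h2 sx).
Qed.

Lemma bmass_dilate w lam (a k t : R) : 0 < k -> measurable_fun setT w -> dens (fun x => w x ^+ 2) lam ->
  bm (fun x => a * w (k * x.1, k * x.2)) t = a ^+ 2 / k ^+ 2 * bm w (k * t).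
Proof.
move=> k0 mw dw; have me := @measurable_eucl R.
pose F (x : T2) : \bar R := (w x ^+ 2 * (if eucl x <= k * t then 1 else 0))%:E.
have mF : measurable_fun setT F by rewrite /F; mf.
have F0 x : (0 <= F x)%E by rewrite lee_fin mulr_ge0 ?sqr_ge0//; case: ifP.
have mw2 : measurable_fun setT (fun x : T2 => w (k * x.1, k * x.2)).
  have m1 : measurable_fun setT (fun x : T2 => (k * x.1, k * x.2) : T2) by mf.
  exact: (measurableT_comp mw m1).
have E : (\int[L]_x ((a * w (k * x.1, k * x.2)) ^+ 2 * (if (eucl x <= t)%R then 1 else 0))%:E =
   (a ^+ 2)%:E * \int[L]_x F (k * x.1, k * x.2)%R)%E.
  rewrite -ge0_integral_EFinZ ?sqr_ge0//; first last.
  - by move=> x; rewrite mulr_ge0 ?sqr_ge0//; case: ifP.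
  - by mf.
  apply: eq_integral => x _; congr (_%:E).
  by rewrite eucl_scale ?(ltW k0)// ler_pM2l// exprMn mulrA.
have S := leb2_scale k0 mF F0.
have f1 : (\int[L]_x F x)%E = (bm w (k * t))%:E by exact: (bmassE (k * t) dw).
have X : (\int[L]_x F (k * x.1, k * x.2)%R)%E = (bm w (k * t) / k ^+ 2)%:E.
  rewrite mulrC EFinM -f1 -S muleA -EFinM mulVf ?mul1e// expf_neq0//.
  by rewrite gt_eqF.
rewrite [LHS](_ : _ = fine ((a ^+ 2)%:E * (bm w (k * t) / k ^+ 2)%:E)%E); first by rewrite -EFinM /=; ring.
by rewrite -X -E.
Qed.

Lemma prof_dilate u lam (a k : R) : 0 <= a -> 0 < k -> prof u lam ->
  prof (fun x => a * u (k * x.1, k * x.2)) (a ^+ 2 / k ^+ 2 * lam).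
Proof.
move=> a0 k0 [ru u0 [_ _ du]]; have mu_ := rdec_measurable ru.
have ru' : rdec (fun x => a * u (k * x.1, k * x.2)).
  move=> x y x0 xy; rewrite ler_wpM2l// ru// !eucl_scale ?(ltW k0)// ?mulr_gt0//.
  by rewrite ler_pM2l.
split=> //; first by move=> x; rewrite mulr_ge0.
have mv := rdec_measurable ru'.
split; [by mf|by move=> x; exact: sqr_ge0|].
have mw2 : measurable_fun setT (fun x : T2 => u (k * x.1, k * x.2)).
  have m1 : measurable_fun setT (fun x : T2 => (k * x.1, k * x.2) : T2) by mf.
  exact: (measurableT_comp mu_ m1).
have := N2_scale_arg k0 mu_; rewrite [N2 L u]du => h.
have X : N2 L (fun x => u (k * x.1, k * x.2)) = (lam / k ^+ 2)%:E.
  rewrite mulrC EFinM -h muleA -EFinM mulVf ?mul1e// expf_neq0//.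
  by rewrite gt_eqF.
have -> : (\int[L]_x ((a * u (k * x.1, k * x.2)) ^+ 2)%:E = (a ^+ 2)%:E * N2 L (fun x => u (k * x.1, k * x.2)%R))%E.
  rewrite -ge0_integral_EFinZ ?sqr_ge0//; first last.
  - by move=> x; exact: sqr_ge0.
  - by mf.
  by apply: eq_integral => x _; rewrite exprMn.
by rewrite X -EFinM; congr (_%:E); ring.
Qed.

(** The dilation [u (k x)] of a decreasing profile with [k >= 1] lies below [u]. This inequality is
    the only source of continuity of disc masses below. *)
Lemma prof_doubling u lam (k t : R) : prof u lam -> 1 <= k -> 0 < t -> bm u (k * t) <= k ^+ 2 * bm u t.
Proof.
move=> pu k1 t0; have k0 : 0 < k := lt_le_trans ltr01 k1.
have [ru u0 du] := pu; have mu_ := rdec_measurable ru.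
have [_ v0 dv] := prof_dilate ler01 k0 pu; have me := @measurable_eucl R.
have [mv _ _] := dv; have [mu2 _ _] := du.
have := bmass_dilate 1 t k0 mu_ du; rewrite expr1n mul1r => E.
suff h : bm (fun x => 1 * u (k * x.1, k * x.2)) t <= bm u t.
  by rewrite E ler_pdivrMl ?exprn_gt0// in h.
rewrite -lee_fin -(bmassE t dv) -(bmassE t du); apply: ae_ge0_le_integral => //.
- by move=> x _; rewrite lee_fin mulr_ge0 ?sqr_ge0//; case: ifP.
- by mf.
- by move=> x _; rewrite lee_fin mulr_ge0 ?sqr_ge0//; case: ifP.
- by mf.
- apply: ae_mono (@ae_eucl_gt0 R) => x x0 _; rewrite lee_fin ler_wpM2r//; first by case: ifP.
  rewrite ler_sqr ?nnegrE// mul1r ru// eucl_scale ?(ltW k0)//.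
  by rewrite ler_peMl// eucl_ge0.
Qed.

Lemma ae_itv_ex (P : R1 -> Prop) (a b : R) : {ae mu, forall t, P t} -> a < b -> exists t : R, [/\ a < t, t < b & P t].
Proof.
move=> [N [mN N0 PN]] ab; apply: contrapT => h.
have : (mu `]a, b[%classic <= mu N)%E.
  apply: le_measure; rewrite ?inE//.
  move=> t /=; rewrite in_itv/= => /andP[h1 h2]; apply: PN => /= Pt; apply: h.
  by exists t.
by rewrite N0 lebesgue_measure_itv/= lte_fin ab -EFinB lee_fin subr_le0 leNgt ab.
Qed.

(** Radii [r < s] with equal masses are picked strictly between [|x|] and [k |x|]. The common mass
    of the annulus is at least its area times the square of [u] at the outer point, and at most its
    area times the square of [v] at the inner point. *)
Lemma prof_le_of_bmass u v lam : prof u lam -> prof v lam ->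
  {ae mu, forall t : R1, 0 < t -> bm u t = bm v t} ->
  forall k x, 1 < k -> 0 < eucl x -> u (k * x.1, k * x.2) <= v x.
Proof.
move=> pu pv h k x k1 x0; have k0 : 0 < k := lt_trans ltr01 k1.
have m1 : eucl x < (1 + k) / 2 * eucl x by rewrite ltr_pMl//; lra.
have m2 : (1 + k) / 2 * eucl x < k * eucl x by rewrite ltr_pM2r//; lra.
have [r [r1 r2 hr]] := ae_itv_ex h m1; have [s [s1 s2 hs]] := ae_itv_ex h m2.
have r0 : 0 < r := lt_trans x0 r1; have rs : r < s := lt_trans r2 s1.
have a0 := area_gt0 (ltW r0) rs.
have l := prof_lower pu (ltW r0) (ltW rs) (_ : s <= eucl (k * x.1, k * x.2)).
have {}l := l _; rewrite eucl_scale ?(ltW k0)// in l; have {}l := l (ltW s2).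
have r' := prof_upper pv (ltW rs) x0 (ltW r1).
have [_ u0 _] := pu; have [_ v0 _] := pv.
rewrite -ler_sqr ?nnegrE// -(ler_pM2r a0); apply: le_trans l _.
by rewrite hr// hs// (lt_trans r0 rs).
Qed.

Lemma quad_small (a d e : R) : 0 <= a -> 0 < d -> d <= 1 -> d * (3 * (a + 1)) <= e ->
  (1 + d) ^+ 2 * a <= a + e.
Proof.
move=> a0 d0 d1 h; have := mulr_ge0 (mulr_ge0 (ltW d0) a0) (_ : 0 <= 1 - d).
by rewrite subr_ge0 => /(_ d1); lra.
Qed.

(** By the previous lemma and monotonicity, the maximum of the profiles at [k x] lies below their
    minimum at [x]. With [k] tending to 1 the norm of the maximum does not exceed that of the
    minimum. *)
Lemma prof_eq_of_bmass u v lam : prof u lam -> prof v lam ->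
  {ae mu, forall t : R1, 0 < t -> bm u t = bm v t} -> {ae L, forall x, u x = v x}.
Proof.
move=> pu pv h; have h' : {ae mu, forall t : R1, 0 < t -> bm v t = bm u t}.
  by apply: filterS h => t ht t0; rewrite ht.
have uv := prof_le_of_bmass pu pv h; have vu := prof_le_of_bmass pv pu h'.
have [ru u0 [_ _ ul]] := pu; have [rv v0 [_ _ vl]] := pv.
have mu_ := rdec_measurable ru; have mv := rdec_measurable rv.
pose M x := Num.max (u x) (v x); pose m x := Num.min (u x) (v x).
have mM : measurable_fun setT M by apply: measurable_maxr.
have mm : measurable_fun setT m by apply: measurable_minr.
have M0 x : 0 <= M x by rewrite le_max u0.
have m0 x : 0 <= m x by rewrite le_min u0 v0.
have mM_ x : m x <= M x by rewrite ge_min le_max lexx.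
have lm : (N2 L m <= lam%:E)%E.
  rewrite -ul; apply: ge0_le_integral => //.
  - by move=> x _; rewrite lee_fin sqr_ge0.
  - by mf.
  - by mf.
  - by move=> x _; rewrite lee_fin ler_sqr ?nnegrE// ge_min lexx.
have fm : N2 L m \is a fin_num.
  rewrite ge0_fin_numE; first by apply: le_lt_trans lm _; rewrite ltry.
  by apply: integral_ge0 => x _; rewrite lee_fin sqr_ge0.
have key k : 1 < k -> (N2 L M <= (k ^+ 2)%:E * N2 L m)%E.
  move=> k1; have k0 : 0 < k := lt_trans ltr01 k1.
  rewrite -(N2_scale_arg k0 mM); apply: lee_wpmul2l; first by rewrite lee_fin sqr_ge0.
  have mMk : measurable_fun setT (fun x : T2 => M (k * x.1, k * x.2)).
    have m1 : measurable_fun setT (fun x : T2 => (k * x.1, k * x.2) : T2) by mf.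
    exact: (measurableT_comp mM m1).
  apply: ae_ge0_le_integral => //.
  - by move=> x _; rewrite lee_fin sqr_ge0.
  - by mf.
  - by move=> x _; rewrite lee_fin sqr_ge0.
  - by mf.
  apply: ae_mono (@ae_eucl_gt0 R) => x x0 _; rewrite lee_fin ler_sqr ?nnegrE// /M /m.
  have kx : eucl x <= eucl (k * x.1, k * x.2).
    by rewrite eucl_scale ?(ltW k0)// ler_peMl ?eucl_ge0// ltW.
  by rewrite ge_max !le_min (ru _ _ x0 kx) (rv _ _ x0 kx) uv// vu.
have e : {ae L, forall x, m x ^+ 2 = M x ^+ 2}.
  have MM : (N2 L M <= N2 L m)%E.
    rewrite -(fineK fm); apply/lee_addgt0Pr => e e0.
    have f0 : 0 <= fine (N2 L m) by apply: fine_ge0; apply: integral_ge0 => x _; rewrite lee_fin sqr_ge0.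
    pose d := Num.min 1 (e / (3 * (fine (N2 L m) + 1))).
    have d0 : 0 < d by rewrite lt_min ltr01 divr_gt0// mulr_gt0// ltr_wpDl.
    have := key (1 + d); rewrite ltrDl => /(_ d0) /le_trans; apply.
    rewrite -{1}(fineK fm) -EFinM -EFinD lee_fin.
    have d1 : d <= 1 by rewrite ge_min lexx.
    have d2 : d * (3 * (fine (N2 L m) + 1)) <= e.
      by rewrite -ler_pdivlMr ?mulr_gt0 ?ltr_wpDl// ge_min lexx orbT.
    exact: quad_small f0 d0 d1 d2.
  apply: ge0_integral_ae_eq.
  - by mf.
  - by mf.
  - by move=> x; exact: sqr_ge0.
  - by move=> x; exact: sqr_ge0.
  - by apply: aeW => x; rewrite ler_sqr ?nnegrE.
  - exact: MM.
  - by apply: le_lt_trans MM _; rewrite -(fineK fm) ltry.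
apply: ae_mono e => x /eqP; rewrite eqrXn2// /m /M => /eqP.
by rewrite minEle maxEle; case: leP.
Qed.

End radial_mass.

(** * Exchanging radial profiles *)

Section pasting.
Variable R : realType.
Local Notation mu := (@lebesgue_measure R).
Local Notation L := (@leb2 R).
Local Notation R1 := (measurableTypeR R).
Local Notation T2 := (R1 * R1)%type.
Local Notation LL := (L \x L)%E.
Implicit Types (f g w u rho sig : T2 -> R).
Local Notation bm u := (bmass (fun x => u x ^+ 2)).

(** Only points within distance [h] of the circle can be separated from their translate by a step
    [h] across it. *)
Definition collar (r0 d : R) : set T2 := [set x | `|eucl x - r0| <= d].

Lemma measurable_collar r0 d : measurable (collar r0 d).
Proof.
have me := @measurable_eucl R.
have m1 : measurable_fun setT (fun x : T2 => `|eucl x - r0| <= d) by mf.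
by have := m1 measurableT [set true] I; rewrite setTI.
Qed.

Lemma collar_small g (r0 e : R) : L2 L g -> 0 < e ->
  exists2 d, 0 < d & (N2on (collar r0 d) g <= e%:E)%E.
Proof.
move=> lg e0; have [mg _] := lg; have ig := L2_sqr_int lg.
pose D n := collar r0 (n.+1%:R^-1).
have mD n : measurable_fun setT (\1_(D n) : T2 -> R) by apply: measurable_indic; exact: measurable_collar.
have [|||||_ _] := @dominated_convergence _ _ R L setT measurableT
  (fun n x => (g x ^+ 2 * \1_(D n) x)%:E) (fun=> 0%E) (fun x => (g x ^+ 2)%:E).
- by move=> n; have := mD n => mDn; mf.
- by mf.
- apply: ae_mono (ae_eucl_neq r0) => x hx _.
  apply: cvg_near_cst.
  have d0 : 0 < `|eucl x - r0| by rewrite normr_gt0 subr_eq0.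
  exists (Num.trunc (`|eucl x - r0|^-1)) => // n /= Nn.
  rewrite indicE (_ : (x \in D n) = false) ?mulr0//; apply/negbTE/negP => /set_mem.
  rewrite /D /collar /= leNgt => /negP; apply.
  rewrite invf_plt ?posrE//; apply: lt_le_trans (Num.Theory.truncnS_gt _) _.
  by rewrite ler_nat ltnS.
- exact: ig.
- apply: aeW => x n _; rewrite /= lee_fin normrM (ger0_norm (sqr_ge0 _)) ler_piMr ?sqr_ge0//.
  by rewrite indicE; case: (_ \in _); rewrite ?normr1 ?normr0.
rewrite integral0 => h.
have /fine_cvgP[_ hc] := h.
have /cvgrPdist_lt /(_ _ e0) [N _ /(_ N (leqnn N))] := hc.
rewrite /= sub0r normrN => hN; exists (N.+1%:R^-1); first by rewrite invr_gt0.
have f : N2on (D N) g \is a fin_num.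
  rewrite ge0_fin_numE; last first.
    by apply: integral_ge0 => x _; rewrite lee_fin mulr_ge0 ?sqr_ge0// indicE.
  have [_] := lg; apply: le_lt_trans; apply: ge0_le_integral => //.
  - by move=> x _; rewrite lee_fin mulr_ge0 ?sqr_ge0// indicE.
  - by have := mD N => mDn; mf.
  - by mf.
  - by move=> x _; rewrite lee_fin ler_piMr ?sqr_ge0// indicE.
rewrite -(fineK f) lee_fin; apply: le_trans (ltW hN); exact: ler_norm.
Qed.

Definition paste (r0 : R) f g (x : T2) : R := if eucl x <= r0 then f x else g x.

Lemma measurable_paste r0 f g : measurable_fun setT f -> measurable_fun setT g ->
  measurable_fun setT (paste r0 f g).
Proof. by move=> mf mg; have me := @measurable_eucl R; rewrite /paste; mf. Qed.

Lemma paste_sqr_le r0 f g x : paste r0 f g x ^+ 2 <= f x ^+ 2 + g x ^+ 2.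
Proof. by rewrite /paste; case: ifP => _; rewrite ?lerDl ?lerDr sqr_ge0. Qed.

Lemma eucl_axv d (h : R) : eucl (axv d h) = `|h|.
Proof. by rewrite /axv /eucl; case: d => /=; rewrite expr0n/= ?add0r ?addr0 sqrtr_sqr. Qed.

(** For a step across the circle, [a] and [b] are the inner values and [c] and [d] the outer ones,
    separated by the level [k]. The exchanged increments cost at most twice the original ones; the
    factor 2 is harmless because such steps are confined to the collar. *)
Lemma cross_bound (a b c d k : R) : k <= a -> k <= b -> c <= k -> d <= k ->
  (d - a) ^+ 2 + (c - b) ^+ 2 <= 2 * ((c - a) ^+ 2 + (d - b) ^+ 2).
Proof.
move=> ka kb ck dk.
have := mulr_ge0 (_ : 0 <= a - k) (_ : 0 <= b - k); rewrite !subr_ge0 => /(_ ka kb).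
have := mulr_ge0 (_ : 0 <= k - c) (_ : 0 <= k - d); rewrite !subr_ge0 => /(_ ck dk).
have := mulr_ge0 (_ : 0 <= a - k) (_ : 0 <= k - c); rewrite !subr_ge0 => /(_ ka ck).
have := mulr_ge0 (_ : 0 <= b - k) (_ : 0 <= k - d); rewrite !subr_ge0 => /(_ kb dk).
have := sqr_ge0 ((c - a) - (d - b)).
nra.
Qed.

Section dirichlet_paste.
Variables (f1 f2 : T2 -> R) (r0 k : R).
Hypotheses (r0p : 0 < r0) (l1 : L2 L f1) (l2 : L2 L f2)
  (hin : forall x, 0 < eucl x -> eucl x < r0 -> k <= f1 x /\ k <= f2 x)
  (hout : forall x, r0 < eucl x -> f1 x <= k /\ f2 x <= k).

Let a := paste r0 f1 f2.
Let b := paste r0 f2 f1.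

(** Away from the circle the pair of increments is only permuted by the exchange. Steps across it
    are estimated by [cross_bound], which charges the original increments on the collar a second
    time. *)
Lemma paste_diff d h : 0 < h ->
  (N2 L (diffq (axv d h) a) + N2 L (diffq (axv d h) b) <=
   (N2 L (diffq (axv d h) f1) + N2 L (diffq (axv d h) f2)) +
   (N2on (collar r0 h) (diffq (axv d h) f1) + N2on (collar r0 h) (diffq (axv d h) f2)))%E.
Proof.
move=> h0; have [m1 _] := l1; have [m2 _] := l2.
have ma : measurable_fun setT a by exact: measurable_paste.
have mb : measurable_fun setT b by exact: measurable_paste.
have [ms _] := mpres_shift (axv d h).
have mD f : measurable_fun setT f -> measurable_fun setT (diffq (axv d h) f).
  by move=> mf; rewrite /diffq; mf.
have d1 := mD _ m1; have d2 := mD _ m2; have da := mD _ ma; have db := mD _ mb.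
have mC : measurable_fun setT (\1_(collar r0 h) : T2 -> R) by apply: measurable_indic; exact: measurable_collar.
have i0 x : 0 <= (\1_(collar r0 h) x : R) by rewrite indicE.
have q0 f x : 0 <= f x ^+ 2 * (\1_(collar r0 h) x : R) by apply: mulr_ge0 => //; exact: sqr_ge0.
have s2 f g x : 0 <= f x ^+ 2 + g x ^+ 2 by apply: addr_ge0; exact: sqr_ge0.
rewrite /N2 /N2on -!ge0_integral_EFinD; try by [mf|move=> x; rewrite ?s2 ?q0 ?sqr_ge0 ?addr_ge0].
apply: ae_ge0_le_integral => //.
- by move=> x _; rewrite lee_fin addr_ge0 ?sqr_ge0.
- by mf.
- by move=> x _; rewrite lee_fin; apply: addr_ge0; [exact: s2|apply: addr_ge0; exact: q0].
- by mf.
have A := ae_mono2 (fun x p q => conj p q) (ae_eucl_neq r0) (@ae_eucl_gt0 R).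
have B := ae_mpres (mpres_shift (axv d h)) A.
apply: ae_mono2 A B => x [xr x0] [yr y0] _; rewrite lee_fin /diffq /a /b /paste.
set y := x + axv d h in yr y0 *.
have eh : eucl (axv d h) = h by rewrite eucl_axv gtr0_norm.
have t1 : eucl y <= eucl x + h by rewrite -eh; exact: eucl_triangle.
have t2 : eucl x <= eucl y + h.
  by rewrite -eh -[eucl (axv d h)]euclN -{1}[x](addrK (axv d h)); exact: eucl_triangle.
have [hx|hx] := leP (eucl x) r0; have [hy|hy] := leP (eucl y) r0.
- by rewrite lerDl; apply: addr_ge0; apply: mulr_ge0 => //; exact: sqr_ge0.
- have C : \1_(collar r0 h) x = 1 :> R.
    rewrite indicE mem_set// /collar /= ler_norml; apply/andP; split; lra.
  have hx' : eucl x < r0 by rewrite lt_neqAle xr.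
  have [g1 g2] := hin x0 hx'; have [g3 g4] := hout hy.
  have := cross_bound g1 g2 g3 g4; rewrite C; lra.
- have C : \1_(collar r0 h) x = 1 :> R.
    rewrite indicE mem_set// /collar /= ler_norml; apply/andP; split; lra.
  have hy' : eucl y < r0 by rewrite lt_neqAle yr.
  have [g1 g2] := hin y0 hy'; have [g3 g4] := hout hx.
  have := cross_bound g1 g2 g3 g4; rewrite C; nra.
- by rewrite [X in X <= _]addrC lerDl; apply: addr_ge0; apply: mulr_ge0 => //; exact: sqr_ge0.
Qed.

Lemma paste_L2 : L2 L a /\ L2 L b.
Proof.
have [m1 n1] := l1; have [m2 n2] := l2.
have ma : measurable_fun setT a by exact: measurable_paste.
have mb : measurable_fun setT b by exact: measurable_paste.
have S : (\int[L]_x (f1 x ^+ 2 + f2 x ^+ 2)%:E < +oo)%E.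
  rewrite ge0_integral_EFinD; [|by mf|by mf|by move=> x; exact: sqr_ge0|by move=> x; exact: sqr_ge0].
  exact: lte_add_pinfty.
split; split=> //; apply: le_lt_trans S; apply: ge0_le_integral => //; try by mf.
- by move=> x _; rewrite lee_fin sqr_ge0.
- by move=> x _; rewrite lee_fin; exact: paste_sqr_le.
- by move=> x _; rewrite lee_fin sqr_ge0.
- by move=> x _; rewrite lee_fin addrC; exact: paste_sqr_le.
Qed.

Lemma collar_shift d (h s : R) x : collar r0 h x -> 0 <= s <= h -> collar r0 (2 * h) (x + axv d s).
Proof.
rewrite /collar /= !ler_norml => /andP[c1 c2] /andP[s0 sh].
have es : eucl (axv d s) = s by rewrite eucl_axv ger0_norm.
have t1 := eucl_triangle x (axv d s); rewrite es in t1.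
have t2 : eucl x <= eucl (x + axv d s) + s.
  by rewrite -{2}es -[eucl (axv d s)]euclN -{1}[x](addrK (axv d s)); exact: eucl_triangle.
apply/andP; split; lra.
Qed.

(** The surplus on the collar is at most [h ^ 2] times the gradient energy in a slightly larger
    collar, and this tends to 0 because the circle is a null set. In the limit no energy is
    created. *)
Lemma paste_dir d p q : is_dir d f1 p -> is_dir d f2 q ->
  exists sa sb, [/\ is_dir d a sa, is_dir d b sb & sa + sb <= p + q].
Proof.
move=> hp hq; have [la lb] := paste_L2.
have [g1 [lg1 _ w1]] := dir_weak_partial l1 hp; have [g2 [lg2 _ w2]] := dir_weak_partial l2 hq.
have [p0 dp _] := hp; have [q0 dq _] := hq.
have key e : 0 < e -> exists2 t, 0 < t & forall h, 0 < h -> h < t ->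
    (N2 L (diffq (axv d h) a) + N2 L (diffq (axv d h) b) <= ((p + q + e) * h ^+ 2)%:E)%E.
  move=> e0; have e02 : 0 < e / 2 by rewrite divr_gt0.
  have [t1 t10 c1] := collar_small r0 lg1 e02; have [t2 t20 c2] := collar_small r0 lg2 e02.
  exists (Num.min t1 t2 / 2); first by rewrite divr_gt0// lt_min t10 t20.
  move=> h h0; rewrite ltr_pdivlMr// lt_min => /andP[h1 h2].
  have loc f g t : L2 L f -> L2 L g -> weak_partial f g (if d then @e2 R else @e1 R) -> h * 2 < t ->
      (N2on (collar r0 t) g <= (e / 2)%:E)%E -> (N2on (collar r0 h) (diffq (axv d h) f) <= (e / 2 * h ^+ 2)%:E)%E.
    move=> lf lg wp ht c; apply: (@le_trans _ _ ((h ^+ 2)%:E * N2on (collar r0 t) g)%E).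
      apply: (weak_diff_local h0 lf lg wp); [exact: measurable_collar|exact: measurable_collar|].
      move=> x s cx hs; have := collar_shift d cx hs; rewrite /collar /= => /le_trans; apply.
      by rewrite mulrC ltW.
    by rewrite [in leRHS]mulrC [in leRHS]EFinM lee_wpmul2l// lee_fin sqr_ge0.
  apply: le_trans (paste_diff d h0) _.
  have -> : (p + q + e) * h ^+ 2 = (p * h ^+ 2 + q * h ^+ 2) + (e / 2 * h ^+ 2 + e / 2 * h ^+ 2) by field.
  apply: le_trans (leeD (leeD (dp _ h0) (dq _ h0)) (leeD (loc _ _ _ l1 lg1 w1 h1 c1) (loc _ _ _ l2 lg2 w2 h2 c2))) _.
  by rewrite -!EFinD.
have N0 f : (0 <= N2 L f)%E by apply: integral_ge0 => x _; rewrite lee_fin sqr_ge0.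
have M0 : 0 <= p + q + 1 by rewrite !addr_ge0.
have [sa _ da] : exists2 s, s <= p + q + 1 & is_dir d a s.
  apply: is_dir_exists => // t t0; have [t' t'0 ht] := key 1 ltr01.
  have m0 : 0 < Num.min t t' by rewrite lt_min t0.
  have h0 : 0 < Num.min t t' / 2 by rewrite divr_gt0.
  have h1 : Num.min t t' / 2 < Num.min t t' by rewrite ltr_pdivrMr// ltr_pMr// ltr1n.
  exists (Num.min t t' / 2); split=> //; first by rewrite (lt_le_trans h1)// ge_min lexx.
  apply: le_trans (ht _ h0 _); last by rewrite (lt_le_trans h1)// ge_min lexx orbT.
  by rewrite leeDl.
have [sb _ db] : exists2 s, s <= p + q + 1 & is_dir d b s.
  apply: is_dir_exists => // t t0; have [t' t'0 ht] := key 1 ltr01.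
  have m0 : 0 < Num.min t t' by rewrite lt_min t0.
  have h0 : 0 < Num.min t t' / 2 by rewrite divr_gt0.
  have h1 : Num.min t t' / 2 < Num.min t t' by rewrite ltr_pdivrMr// ltr_pMr// ltr1n.
  exists (Num.min t t' / 2); split=> //; first by rewrite (lt_le_trans h1)// ge_min lexx.
  apply: le_trans (ht _ h0 _); last by rewrite (lt_le_trans h1)// ge_min lexx orbT.
  by rewrite leeDr.
exists sa, sb; split=> //; apply/ler_addgt0Pr => e e0; have e3 : 0 < e / 3 by rewrite divr_gt0.
have [_ _ /(_ _ e3) [t1 t10 c1]] := da; have [_ _ /(_ _ e3) [t2 t20 c2]] := db.
have [t3 t30 c3] := key _ e3.
pose h := Num.min t1 (Num.min t2 t3) / 2.
have m0 : 0 < Num.min t1 (Num.min t2 t3) by rewrite !lt_min t10 t20.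
have h0 : 0 < h by rewrite divr_gt0.
have h1 : h < Num.min t1 (Num.min t2 t3) by rewrite ltr_pdivrMr// ltr_pMr// ltr1n.
move: h1; rewrite !lt_min => /and3P[h1 h2 h3].
have := le_trans (leeD (c1 _ h0 h1) (c2 _ h0 h2)) (c3 _ h0 h3).
rewrite -EFinD lee_fin -mulrDl ler_pM2r ?exprn_gt0//; lra.
Qed.

End dirichlet_paste.

Lemma rdec_rot u c s x : rdec u -> c ^+ 2 + s ^+ 2 = 1 -> u (plane_rot c s x) = u x.
Proof.
move=> ru cs; have E := eucl_rot x cs.
have [x0|x0] := leP (eucl x) 0.
  have xe : x = 0 by apply: eucl_eq0; apply/eqP; rewrite eq_le x0 eucl_ge0.
  by rewrite xe /plane_rot /= !mulr0 subr0 addr0.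
by apply/eqP; rewrite eq_le !ru// ?E.
Qed.

Lemma Elog_Imax w lam s1 s2 : WX w lam s1 s2 ->
  (forall c s x, c ^+ 2 + s ^+ 2 = 1 -> w (plane_rot c s x) = w x) ->
  Elog w = Imax (fun x => w x ^+ 2).
Proof.
move=> hw rw; apply: newton (WX_logdens hw) _ => c s x cs.
by rewrite rw.
Qed.

Lemma WX_dens w lam s1 s2 : WX w lam s1 s2 -> dens (fun x => w x ^+ 2) lam.
Proof. by move=> hw; apply: logdens_dens (WX_logdens hw) _; case: hw. Qed.

(** The logarithmic energy is linear in the squares of the disc masses, so redistributing these
    squares between two densities keeps the total. *)
Lemma Imax_exchange rho1 rho2 sig1 sig2 lam1 lam2 : logdens rho1 -> logdens rho2 -> logdens sig1 -> logdens sig2 ->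
  dens rho1 lam1 -> dens rho2 lam2 -> dens sig1 lam2 -> dens sig2 lam1 ->
  (forall t, 0 < t -> bmass sig1 t ^+ 2 + bmass sig2 t ^+ 2 = bmass rho1 t ^+ 2 + bmass rho2 t ^+ 2) ->
  Imax sig1 + Imax sig2 = Imax rho1 + Imax rho2.
Proof.
move=> lr1 lr2 ls1 ls2 dr1 dr2 ds1 ds2 h.
have [p1 n1 ->] := ImaxE lr1; have [p2 n2 ->] := ImaxE lr2.
have [p3 n3 ->] := ImaxE ls1; have [p4 n4 ->] := ImaxE ls2.
have mi := @measurable_invr R.
have m1 := measurable_fun_ler (measurable_cst (1 : R)) (@measurable_id _ R1 setT).
have m0 := measurable_fun_ltr (measurable_cst (0 : R)) (@measurable_id _ R1 setT).
pose P rho (lam : R) (t : R1) : R := t^-1 * (if 1 <= t then lam ^+ 2 - bmass rho t ^+ 2 else 0).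
pose Q rho (t : R1) : R := t^-1 * (if 0 < t <= 1 then bmass rho t ^+ 2 else 0).
have P0 rho lam : dens rho lam -> forall t : R1, 0 <= P rho lam t.
  move=> dr t; have [_ r0 _] := dr; rewrite /P; case: (leP 1 t) => t1; last by rewrite mulr0.
  rewrite mulr_ge0 ?invr_ge0 ?(le_trans ler01 t1)// subr_ge0 ler_sqr ?nnegrE ?bmass_ge0// ?(bmass_le t dr)//.
  exact: le_trans (bmass_ge0 t r0) (bmass_le t dr).
have Q0 rho (t : R1) : 0 <= Q rho t.
  rewrite /Q; case: ifP => [/andP[t0 t1]|]; last by rewrite mulr0.
  by rewrite mulr_ge0 ?invr_ge0 ?sqr_ge0// ltW.
have mP rho lam : dens rho lam -> measurable_fun setT (P rho lam).
  by move=> dr; have k := measurable_bmass dr; rewrite /P; mf.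
have mQ rho lam : dens rho lam -> measurable_fun setT (Q rho).
  by move=> dr; have k := measurable_bmass dr; rewrite /Q; mf.
have EP : (lpos sig1 + lpos sig2 = lpos rho1 + lpos rho2)%E.
  rewrite (lposE dr1) (lposE dr2) (lposE ds1) (lposE ds2).
  apply: etrans (esym (ge0_integral_EFinD mu (mP _ _ ds1) (mP _ _ ds2) (P0 _ _ ds1) (P0 _ _ ds2))) _.
  apply: etrans _ (ge0_integral_EFinD mu (mP _ _ dr1) (mP _ _ dr2) (P0 _ _ dr1) (P0 _ _ dr2)).
  apply: eq_integral => t _; congr (_%:E); rewrite /P -!mulrDr; case: (leP 1 t) => t1; last by [].
  by congr (_ * _); have := h t (lt_le_trans ltr01 t1); lra.
have EQ : (lneg sig1 + lneg sig2 = lneg rho1 + lneg rho2)%E.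
  rewrite (lnegE dr1) (lnegE dr2) (lnegE ds1) (lnegE ds2).
  apply: etrans (esym (ge0_integral_EFinD mu (mQ _ _ ds1) (mQ _ _ ds2) (Q0 _) (Q0 _))) _.
  apply: etrans _ (ge0_integral_EFinD mu (mQ _ _ dr1) (mQ _ _ dr2) (Q0 _) (Q0 _)).
  apply: eq_integral => t _; congr (_%:E); rewrite /Q -!mulrDr; case: ifP => // /andP[t0 _].
  by congr (_ * _); exact: h.
move: EP EQ; rewrite -(fineK p1) -(fineK p2) -(fineK p3) -(fineK p4).
rewrite -(fineK n1) -(fineK n2) -(fineK n3) -(fineK n4) -!EFinD => -[E1] [E2].
by rewrite /= addrACA E1 -opprD E2 opprD addrACA.
Qed.

Lemma bmass_paste r0 f g lf lg t : dens (fun x => f x ^+ 2) lf -> dens (fun x => g x ^+ 2) lg ->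
  measurable_fun setT f -> measurable_fun setT g -> bm f r0 = bm g r0 ->
  bm (paste r0 f g) t = if t <= r0 then bm f t else bm g t.
Proof.
move=> df dg mf mg e; have me := @measurable_eucl R; have mp := measurable_paste r0 mf mg.
case: (leP t r0) => h.
  rewrite /bmass; congr fine; apply: eq_integral => x _; congr (_%:E); rewrite /paste.
  case: (leP (eucl x) t) => xt; last by rewrite !mulr0.
  by rewrite (le_trans xt h).
have ma := measurable_annulus r0 t.
have E : (\int[L]_x (paste r0 f g x ^+ 2 * (if (eucl x <= t)%R then 1 else 0))%:E =
  \int[L]_x (f x ^+ 2 * (if (eucl x <= r0)%R then 1 else 0))%:E + \int[L]_x (g x ^+ 2 * annulus r0 t x)%:E)%E.
  rewrite -ge0_integral_EFinD.
  - apply: eq_integral => x _; congr (_%:E); rewrite /paste /annulus.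
    case: (leP (eucl x) r0) => xr; first by rewrite (le_trans xr (ltW h))/=; ring.
    by rewrite /=; ring.
  - by mf.
  - by mf.
  - by move=> x; rewrite mulr_ge0 ?sqr_ge0//; case: ifP.
  - by move=> x; rewrite mulr_ge0 ?sqr_ge0// annulus_ge0.
apply: EFin_inj; rewrite -[RHS](_ : (bm f r0)%:E + (bm g t - bm g r0)%:E = _)%E; last first.
  by rewrite -EFinD e; congr (_%:E); lra.
rewrite -(bmass_diff dg (ltW h)) -(bmassE r0 df) -E fineK// E (bmass_diff dg (ltW h)) (bmassE r0 df).
by rewrite -EFinD.
Qed.

Lemma paste_mass r0 f g lf lg : dens (fun x => f x ^+ 2) lf -> dens (fun x => g x ^+ 2) lg ->
  measurable_fun setT f -> measurable_fun setT g -> bm f r0 = bm g r0 ->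
  N2 L (paste r0 f g) = lg%:E.
Proof.
move=> df dg mf mg e; have me := @measurable_eucl R; have mp := measurable_paste r0 mf mg.
have [_ _ dgl] := dg.
pose I x : R := if eucl (x : T2) <= r0 then 1 else 0.
pose O x : R := if eucl (x : T2) <= r0 then 0 else 1.
have mI : measurable_fun setT I by rewrite /I; mf.
have mO : measurable_fun setT O by rewrite /O; mf.
have I0 x : 0 <= I x by rewrite /I; case: ifP.
have O0 x : 0 <= O x by rewrite /O; case: ifP.
have E1 : (N2 L (paste r0 f g) = \int[L]_x (f x ^+ 2 * I x)%:E + \int[L]_x (g x ^+ 2 * O x)%:E)%E.
  rewrite -ge0_integral_EFinD; [|by mf|by mf|by move=> x; rewrite mulr_ge0 ?sqr_ge0|by move=> x; rewrite mulr_ge0 ?sqr_ge0].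
  by apply: eq_integral => x _; congr (_%:E); rewrite /paste /I /O; case: ifP => _; ring.
have E2 : (lg%:E = \int[L]_x (g x ^+ 2 * I x)%:E + \int[L]_x (g x ^+ 2 * O x)%:E)%E.
  rewrite -dgl -ge0_integral_EFinD; [|by mf|by mf|by move=> x; rewrite mulr_ge0 ?sqr_ge0|by move=> x; rewrite mulr_ge0 ?sqr_ge0].
  by apply: eq_integral => x _; congr (_%:E); rewrite /I /O; case: ifP => _; ring.
by rewrite E1 E2 (bmassE r0 df) (bmassE r0 dg) e.
Qed.

(** Equality of the disc masses at [r0] makes the disc masses of the pasted functions those of the
    originals in exchanged roles, so the total logarithmic energy is unchanged. *)
Lemma paste_energy f1 f2 (r0 k lam1 lam2 p1 p2 q1 q2 : R) : 0 < r0 -> rdec f1 -> rdec f2 ->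
  (forall x, 0 < eucl x -> eucl x < r0 -> k <= f1 x /\ k <= f2 x) ->
  (forall x, r0 < eucl x -> f1 x <= k /\ f2 x <= k) ->
  WX f1 lam1 p1 p2 -> WX f2 lam2 q1 q2 -> bm f1 r0 = bm f2 r0 ->
  exists a1 a2 b1 b2, [/\ WX (paste r0 f1 f2) lam2 a1 a2, WX (paste r0 f2 f1) lam1 b1 b2,
    (a1 + a2) + (b1 + b2) <= (p1 + p2) + (q1 + q2) &
    Elog (paste r0 f1 f2) + Elog (paste r0 f2 f1) = Elog f1 + Elog f2].
Proof.
move=> r0p r1 r2 hin hout w1 w2 e.
have [l1 n1 d11 d12 g1] := w1; have [l2 n2 d21 d22 g2] := w2.
have [m1 _] := l1; have [m2 _] := l2; have me := @measurable_eucl R.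
have [a1 [b1 [da1 db1 s1]]] := paste_dir l1 l2 hin hout d11 d21.
have [a2 [b2 [da2 db2 s2]]] := paste_dir l1 l2 hin hout d12 d22.
have [la lb] := paste_L2 r0 l1 l2.
have D1 := WX_dens w1; have D2 := WX_dens w2.
have l0 (z : T2) : 0 <= ln (1 + eucl z) by rewrite ln_ge0// lerDl eucl_ge0.
have G f : measurable_fun setT f -> (forall x, f x ^+ 2 <= f1 x ^+ 2 + f2 x ^+ 2) ->
    (\int[L]_x (ln (1 + eucl x) * f x ^+ 2)%:E < +oo)%E.
  move=> mf hf; apply: (@le_lt_trans _ _ (\int[L]_x (ln (1 + eucl x) * f1 x ^+ 2 + ln (1 + eucl x) * f2 x ^+ 2)%:E)%E).
    apply: ge0_le_integral => //.
    - by move=> x _; rewrite lee_fin mulr_ge0 ?sqr_ge0.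
    - by mf.
    - by mf.
    - by move=> x _; rewrite lee_fin -mulrDr ler_wpM2l.
  rewrite ge0_integral_EFinD; [|by mf|by mf|by move=> x; rewrite mulr_ge0 ?sqr_ge0|by move=> x; rewrite mulr_ge0 ?sqr_ge0].
  exact: lte_add_pinfty.
have [ma _] := la; have [mb _] := lb.
have wa : WX (paste r0 f1 f2) lam2 a1 a2.
  split; [exact: la|exact: (paste_mass D1 D2 m1 m2 e)|exact: da1|exact: da2|].
  by apply: (G _ ma) => x; exact: paste_sqr_le.
have wb : WX (paste r0 f2 f1) lam1 b1 b2.
  split; [exact: lb|exact: (paste_mass D2 D1 m2 m1 (esym e))|exact: db1|exact: db2|].
  by apply: (G _ mb) => x; rewrite addrC; exact: paste_sqr_le.
exists a1, a2, b1, b2; split=> //; first by move: s1 s2; lra.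
have rotp f g : rdec f -> rdec g -> forall c s x, c ^+ 2 + s ^+ 2 = 1 ->
    paste r0 f g (plane_rot c s x) = paste r0 f g x.
  by move=> rf rg c s x cs; rewrite /paste eucl_rot// !rdec_rot.
rewrite (Elog_Imax wa (rotp _ _ r1 r2)) (Elog_Imax wb (rotp _ _ r2 r1)).
rewrite (Elog_Imax w1) ?(Elog_Imax w2); try by move=> c s x; exact: rdec_rot.
apply: (Imax_exchange (WX_logdens w1) (WX_logdens w2) (WX_logdens wa) (WX_logdens wb)
  D1 D2 (WX_dens wa) (WX_dens wb)).
move=> t t0; rewrite (bmass_paste t D1 D2 m1 m2 e) (bmass_paste t D2 D1 m2 m1 (esym e)).
by case: ifP => _; ring.
Qed.

End pasting.

(** * Uniqueness of the radial minimiser *)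

Section uniqueness.
Variable R : realType.
Local Notation mu := (@lebesgue_measure R).
Local Notation L := (@leb2 R).
Local Notation R1 := (measurableTypeR R).
Local Notation T2 := (R1 * R1)%type.
Local Notation LL := (L \x L)%E.
Implicit Types (f g w u v rho sig : T2 -> R).
Local Notation bm u := (bmass (fun x => u x ^+ 2)).

Lemma dens_bmass_lim rho lam (e : R) : dens rho lam -> 0 < e -> exists2 S, 0 < S & lam - e < bmass rho S.
Proof.
move=> dr e0; have [mr r0 rl] := dr; have me := @measurable_eucl R.
have [|||||_ _] := @dominated_convergence _ _ R L setT measurableT
  (fun n x => (rho x * (if eucl x <= n.+1%:R then 1 else 0))%:E) (fun x => (rho x)%:E) (fun x => (rho x)%:E).
- by move=> n; mf.
- by mf.
- apply: aeW => x _; apply: cvg_near_cst; exists (Num.trunc (eucl x)) => // n /= Nn.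
  rewrite (_ : eucl x <= n.+1%:R) ?mulr1//.
  by rewrite (le_trans (ltW (Num.Theory.truncnS_gt _)))// ler_nat.
- apply/integrableP; split; first by mf.
  have -> : (\int[L]_x `|(rho x)%:E| = \int[L]_x (rho x)%:E)%E.
    by apply: eq_integral => x _; rewrite gee0_abs ?lee_fin.
  by rewrite rl ltry.
- apply: aeW => x n _; rewrite /= lee_fin ger0_norm; last by rewrite mulr_ge0//; case: ifP.
  by rewrite ler_piMr//; case: ifP.
rewrite rl => /fine_cvgP[_ /cvgrPdist_lt /(_ _ e0) [N _ /(_ N (leqnn N))]] /= h.
exists N.+1%:R => //; move: h; rewrite -/(bmass rho N.+1%:R) ltr_distlC => /andP[h _].
exact: h.
Qed.

Lemma prof_lip u lam (r1 r s R0 : R) : prof u lam -> 0 < r1 -> r1 <= r -> r <= s -> s <= R0 ->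
  `|bm u s - bm u r| <= 2 * R0 * lam / r1 ^+ 2 * (s - r).
Proof.
move=> pu r10 r1r rs sR; have [_ _ du] := pu; have r0 : 0 < r := lt_le_trans r10 r1r.
rewrite ger0_norm ?subr_ge0 ?(bmass_mono du rs)//.
have k1 : 1 <= s / r by rewrite ler_pdivlMr// mul1r.
have := prof_doubling pu k1 r0; rewrite divfK ?gt_eqF// => h.
have b0 : 0 <= bm u r by apply: bmass_ge0 => x; exact: sqr_ge0.
have bl := bmass_le r du.
have l0 : 0 <= lam := le_trans b0 bl.
have h1 : bm u s - bm u r <= ((s / r) ^+ 2 - 1) * lam.
  have k2 : 0 <= (s / r) ^+ 2 - 1 by rewrite subr_ge0 expr_ge1// (le_trans ler01 k1).
  by have := ler_wpM2l k2 bl; lra.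
apply: le_trans h1 _.
have -> : 2 * R0 * lam / r1 ^+ 2 * (s - r) = (2 * R0 * (s - r) / r1 ^+ 2) * lam by field; rewrite gt_eqF.
apply: ler_wpM2r => //.
have -> : (s / r) ^+ 2 - 1 = (s + r) * (s - r) / r ^+ 2 by field; rewrite gt_eqF.
have sr : 0 <= s - r by rewrite subr_ge0.
apply: ler_pM.
- by rewrite mulr_ge0// addr_ge0// ?(ltW r0)// (le_trans (ltW r0)).
- by rewrite invr_ge0 sqr_ge0.
- by rewrite ler_wpM2r//; lra.
- by rewrite lef_pV2 ?posrE ?exprn_gt0// ler_sqr ?nnegrE ?(ltW r0) ?(ltW r10).
Qed.

Lemma prof_gap u v lam1 lam2 (r1 R0 : R) : prof u lam1 -> prof v lam2 -> 0 < r1 -> r1 <= R0 ->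
  (forall r, 0 < r -> bm u r < bm v r) ->
  exists2 eta, 0 < eta & forall r, r1 <= r -> r <= R0 -> bm u r + eta <= bm v r.
Proof.
move=> pu pv r10 rR uv.
(* Radii are clamped to the interval, so that a function continuous on the whole line is available
   for the extreme value theorem. *)
pose cl (a : R) := Num.max r1 (Num.min a R0).
have cl1 a : r1 <= cl a by rewrite le_max lexx.
have cl2 a : cl a <= R0 by rewrite ge_max rR ge_min lexx orbT.
have clm a h : 0 < h -> cl a <= cl (a + h) <= cl a + h.
  move=> h0; rewrite /cl !maxEle !minEle; move: h0 rR; clear => h0 rR.
  by case: (leP a R0) => ?; case: (leP (a + h) R0) => ?;
    case: (leP r1 a) => ?; case: (leP r1 (a + h)) => ?; case: (leP r1 R0) => ?; apply/andP; split; lra.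
pose phi a := bm v (cl a) - bm u (cl a).
have l0 w lam : prof w lam -> 0 <= lam.
  by move=> [_ _ dw]; apply: le_trans (bmass_le 1 dw); apply: bmass_ge0 => x; exact: sqr_ge0.
pose K := 2 * R0 * lam2 / r1 ^+ 2 + 2 * R0 * lam1 / r1 ^+ 2.
have R00 : 0 <= R0 := le_trans (ltW r10) rR.
have K1 : 0 <= 2 * R0 * lam1 / r1 ^+ 2 by rewrite divr_ge0 ?sqr_ge0// !mulr_ge0// (l0 _ _ pu).
have K2 : 0 <= 2 * R0 * lam2 / r1 ^+ 2 by rewrite divr_ge0 ?sqr_ge0// !mulr_ge0// (l0 _ _ pv).
have cphi : continuous phi.
  apply: (@continuous_lipschitz R phi K); first exact: addr_ge0.
  move=> a h h0; have /andP[c1 c2] := clm a h h0.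
  have b1 := prof_lip pv r10 (cl1 a) c1 (cl2 _); have b2 := prof_lip pu r10 (cl1 a) c1 (cl2 _).
  have d : cl (a + h) - cl a <= h by lra.
  have e1 := ler_wpM2l K1 d; have e2 := ler_wpM2l K2 d.
  rewrite /phi (_ : _ - _ - _ = (bm v (cl (a + h)) - bm v (cl a)) - (bm u (cl (a + h)) - bm u (cl a))); last by ring.
  apply: le_trans (ler_normB _ _) _; rewrite /K mulrDl; apply: lerD.
    exact: le_trans b1 e2.
  exact: le_trans b2 e1.
have [r0 _ hr0] := EVT_min rR (continuous_subspaceT cphi).
exists (phi r0); first by rewrite subr_gt0 uv// (lt_le_trans r10).
move=> r h1 h2; have := hr0 r; rewrite in_itv/= h1 h2 => /(_ isT).
have -> : phi r = bm v r - bm u r.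
  have clr : cl r = r by rewrite /cl min_l// max_r.
  by rewrite /phi clr.
lra.
Qed.

(** On small discs both masses are compared with the area: the profile [u] stays below [M], while
    the dilated [v] stays above its value at the point dilated onto [xp]. *)
Lemma bmass_near0 u v lam1 lam2 (M t r : R) (xp : T2) : prof u lam1 -> prof v lam2 ->
  (forall x, 0 < eucl x -> u x <= M) -> 0 < t -> 0 < eucl xp -> M <= t ^+ 2 * v xp -> 0 < r -> t * r <= eucl xp ->
  bm u r <= M ^+ 2 * area 0 r /\ (t ^+ 2 * v xp) ^+ 2 * area 0 r <= bm (fun x => t ^+ 2 * v (t * x.1, t * x.2)) r.
Proof.
move=> pu pv hM t0 xp0 hMt r0 tr; have [ru u0 du] := pu.
have pf := prof_dilate (sqr_ge0 t) t0 pv; have [rf f0 df] := pf.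
have [mu2 _ _] := du; have [mf2 _ _] := df; have [rv v0 _] := pv.
have M0 : 0 <= M by apply: le_trans (u0 xp) (hM _ xp0).
split.
  have := @bmass_diff_le R _ _ 0 r (M ^+ 2) du (ltW r0) (sqr_ge0 _).
  rewrite (bmass0 mu2) subr0; apply=> x x0 _; rewrite ler_sqr ?nnegrE// hM//.
have := @bmass_diff_ge R _ _ 0 r ((t ^+ 2 * v xp) ^+ 2) df (ltW r0) (sqr_ge0 _).
rewrite (bmass0 mf2) subr0; apply=> x x0 xr.
have f1 := f0 x; have f2 : 0 <= t ^+ 2 * v xp by apply: mulr_ge0; rewrite ?sqr_ge0.
rewrite ler_sqr ?nnegrE// ler_wpM2l ?sqr_ge0// rv//.
  by rewrite eucl_scale ?(ltW t0)// mulr_gt0.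
by rewrite eucl_scale ?(ltW t0)//; apply: le_trans tr; rewrite ler_pM2l.
Qed.

(** This normalisation multiplies the Dirichlet energy and, up to the [ln t] term, the logarithmic
    energy by the same factor [t ^ 4], while the mass becomes [t ^ 2 lam]. *)
Definition dil (t : R) v (x : T2) : R := t ^+ 2 * v (t * x.1, t * x.2).

Lemma bm_dil v lam (t r : R) : 0 < t -> prof v lam -> bm (dil t v) r = t ^+ 2 * bm v (t * r).
Proof.
move=> t0 [rv _ dv]; rewrite (bmass_dilate _ _ t0 (rdec_measurable rv) dv); congr (_ * _).
by field; rewrite gt_eqF.
Qed.

Lemma prof_dil v lam (t : R) : 0 < t -> prof v lam -> prof (dil t v) (t ^+ 2 * lam).
Proof.
move=> t0 pv; have := prof_dilate (sqr_ge0 t) t0 pv.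
by rewrite (_ : (t ^+ 2) ^+ 2 / t ^+ 2 = t ^+ 2)//; field; rewrite gt_eqF.
Qed.

(* The profiles dil t v concentrate as t grows; the first t for which the mass of dil t v dominates
   that of u on every disc produces either equality (t = 1), a point of contact, or a strictly smaller supremum. *)
Section first_contact.
Variables (u v : T2 -> R) (lam M : R).
Hypotheses (lam0 : 0 < lam) (pu : prof u lam) (pv : prof v lam)
  (hM : forall x, 0 < eucl x -> u x <= M).

Let good (t : R) := 1 <= t /\ forall r, 0 < r -> bm u r <= bm (dil t v) r.

(** The second term of [t] makes the dilated profile exceed [M] near the origin; the third makes its
    mass, from the radius where the first argument stops, exceed the total mass of [u]. *)
Lemma good_ex : exists t, good t.
Proof.
have [rv v0 dv] := pv; have [_ u0 du] := pu; have [mv2 _ vl] := dv.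
have [xp [xp0 vp]] : exists xp : T2, 0 < eucl xp /\ 0 < v xp.
  apply: contrapT => h.
  have z x : 0 < eucl x -> v x = 0.
    move=> x0; apply/eqP; rewrite eq_le v0 andbT leNgt; apply/negP => vx; apply: h.
    by exists x.
  have : (\int[L]_x (v x ^+ 2)%:E = \int[L]_x (cst 0 x))%E.
    apply: ae_eq_integral => //.
    - by mf.
    - by apply: ae_mono (@ae_eucl_gt0 R) => x /z -> _; rewrite expr0n.
  by rewrite integral0 vl => -[] h0; move: lam0; rewrite h0 ltxx.
have M0 : 0 <= M by apply: le_trans (u0 xp) (hM xp0).
have mP : 0 < bm v (eucl xp).
  have := @bmass_diff_ge R _ _ 0 (eucl xp) (v xp ^+ 2) dv (ltW xp0) (sqr_ge0 _).
  rewrite (bmass0 mv2) subr0 => /(_ _)/lt_le_trans; apply.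
    by rewrite mulr_gt0 ?exprn_gt0// area_gt0.
  by move=> x x0 xx; rewrite ler_sqr ?nnegrE// rv.
pose t := 1 + M / v xp + lam / bm v (eucl xp).
have q1 : 0 <= M / v xp by rewrite divr_ge0// ltW.
have q2 : 0 <= lam / bm v (eucl xp) by rewrite divr_ge0 ?ltW.
have t1 : 1 <= t by rewrite /t; lra.
have t0 : 0 < t := lt_le_trans ltr01 t1.
have tt : t <= t ^+ 2 by rewrite expr2 ler_peMl// ltW.
exists t; split=> // r r0; have [h|h] := leP (t * r) (eucl xp).
  have hMt : M <= t ^+ 2 * v xp.
    by rewrite -ler_pdivrMr//; apply: le_trans tt; rewrite /t; lra.
  have [a1 a2] := bmass_near0 pu pv hM t0 xp0 hMt r0 h.
  apply: le_trans a1 _; apply: le_trans _ a2; apply: ler_wpM2r; first by rewrite ltW// area_gt0.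
  by rewrite ler_sqr ?nnegrE// (le_trans M0).
apply: le_trans (bmass_le r du) _; rewrite (bm_dil r t0 pv).
apply: (@le_trans _ _ (t ^+ 2 * bm v (eucl xp))).
  by rewrite -ler_pdivrMr//; apply: le_trans tt; rewrite /t; lra.
by rewrite ler_wpM2l ?sqr_ge0// (bmass_mono dv)// ltW.
Qed.

Let tp := inf [set t | good t].

Lemma tp_ge1 : 1 <= tp.
Proof.
apply: lb_le_inf; first by have [t ht] := good_ex; exists t.
by move=> t [].
Qed.

(** The condition is closed: for a good [t] slightly above [tp], doubling bounds the disc mass of
    [dil t v] by [(t / tp) ^ 4] times that of [dil tp v]. *)
Lemma tp_good : good tp.
Proof.
have t1 := tp_ge1; split=> // r r0; have t0 : 0 < tp := lt_le_trans ltr01 t1.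
have [_ _ dv] := pv.
rewrite (bm_dil r t0 pv); set m := bm v (tp * r).
have m0 : 0 <= m by apply: bmass_ge0 => x; exact: sqr_ge0.
apply/ler_addgt0Pr => e e0.
(* The constant 15 is the sum 4 + 6 + 4 + 1 of binomial coefficients in [(1 + d) ^ 4], each power of
   [d] being at most [d]. *)
pose d := Num.min 1 (e / (15 * (tp ^+ 2 * m) + 1)).
have D0 : 0 < 15 * (tp ^+ 2 * m) + 1 by rewrite ltr_wpDl// mulr_ge0// mulr_ge0// sqr_ge0.
have d0 : 0 < d by rewrite lt_min ltr01 divr_gt0.
have d1 : d <= 1 by rewrite ge_min lexx.
have d2 : d * (15 * (tp ^+ 2 * m) + 1) <= e by rewrite -ler_pdivlMr// ge_min lexx orbT.
have hi : has_inf [set t | good t].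
  by split; [have [t ht] := good_ex; exists t|exists 1 => t []].
have td0 : 0 < tp * d by rewrite mulr_gt0.
have [t gt tt] := inf_adherent td0 hi.
have tpt : tp <= t by apply: ge_inf => //; exists 1 => ? [].
have [_ /(_ r r0)] := gt; rewrite (bm_dil r (lt_le_trans t0 tpt) pv) => h.
have k1 : 1 <= t / tp by rewrite ler_pdivlMr// mul1r.
have := prof_doubling pv k1 (mulr_gt0 t0 r0); rewrite mulrA divfK ?gt_eqF// -/m => h2.
have k2 : t / tp <= 1 + d by rewrite ler_pdivrMr//; move: tt; rewrite -/tp; lra.
pose k := t / tp; have tE : t = k * tp by rewrite /k divfK// gt_eqF.
apply: le_trans h _; apply: (@le_trans _ _ (k ^+ 4 * (tp ^+ 2 * m))).
  have -> : k ^+ 4 * (tp ^+ 2 * m) = t ^+ 2 * (k ^+ 2 * m) by rewrite tE; ring.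
  by rewrite ler_wpM2l ?sqr_ge0.
have k4 : k ^+ 4 <= 1 + 15 * d.
  apply: (@le_trans _ _ ((1 + d) ^+ 4)).
    by rewrite lerXn2r// ?nnegrE ?addr_ge0// ?(ltW d0)// (le_trans ler01).
  have -> : (1 + d) ^+ 4 = 1 + 4 * d + 6 * (d * d) + 4 * (d * d * d) + d * d * d * d by ring.
  have dd : d * d <= d by rewrite ler_piMr// ltW.
  have ddd : d * d * d <= d by apply: le_trans dd; rewrite ler_piMr// mulr_ge0// ltW.
  have dddd : d * d * d * d <= d by apply: le_trans ddd; rewrite ler_piMr// !mulr_ge0// ltW.
  lra.
have Z : 0 <= tp ^+ 2 * m by rewrite mulr_ge0// sqr_ge0.
have := ler_wpM2r Z k4; move: d2; lra.
Qed.

(** Without contact the domination is strict and [tp] could be lowered: near the origin because the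
    dilated profile exceeds [M] there, on a compact range of radii because of a uniform gap, and far
    out because its mass exceeds the total mass of [u]. *)
Lemma first_contact (x1 : T2) : 1 < tp -> 0 < eucl x1 -> M < tp ^+ 2 * v x1 ->
  exists2 r0, 0 < r0 & bm u r0 = bm (dil tp v) r0.
Proof.
move=> t1 x10 hx1; have [_ gt] := tp_good; have t0 : 0 < tp := lt_trans ltr01 t1.
apply: contrapT => hn.
have lt r : 0 < r -> bm u r < bm (dil tp v) r.
  move=> r0; rewrite lt_neqAle gt// andbT; apply/eqP => e; apply: hn; exists r => //.
have [_ u0 du] := pu; have [_ v0 dv] := pv.
have M0 : 0 <= M by apply: le_trans (u0 x1) (hM x10).
have vx0 : 0 < v x1.
  by have := le_lt_trans M0 hx1; rewrite pmulr_rgt0// exprn_gt0.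
pose r1 := eucl x1 / tp; have r10 : 0 < r1 by rewrite divr_gt0.
(* Every parameter at least [ta > 1] is good far out: [S] is chosen such that [ta ^ 2] times the
   mass of [v] in the disc of radius [S] is already at least [lam]. *)
pose ta := (1 + tp) / 2; have ta1 : 1 < ta by rewrite /ta; lra.
have tat : ta < tp by rewrite /ta; lra.
have ea : 0 < lam * (1 - ta ^- 2).
  by rewrite mulr_gt0// subr_gt0 invf_lt1 ?exprn_gt0 ?(lt_trans ltr01)// expr_gt1// (ltW (lt_trans ltr01 ta1)).
have [S S0 hS] := dens_bmass_lim dv ea.
pose R0 := Num.max S r1.
have rR : r1 <= R0 by rewrite le_max lexx orbT.
have [eta eta0 gap] := prof_gap pu (prof_dil t0 pv) r10 rR lt.
pose g := tp ^+ 2 * v x1 - M; have g0 : 0 < g by rewrite subr_gt0.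
have A0 : 0 < 4 * tp ^+ 2 * lam by rewrite !mulr_gt0// exprn_gt0.
have B0 : 0 < 2 * (tp ^+ 2 * v x1) by rewrite !mulr_gt0// exprn_gt0.
(* The first three terms serve, in this order, the gap [eta] on the middle range, the excess over
   [M] near the origin, and [ta <= t']. *)
pose d := Num.min (eta / (4 * tp ^+ 2 * lam)) (Num.min (g / (2 * (tp ^+ 2 * v x1))) (Num.min ((tp - ta) / tp) 2^-1)).
have d0 : 0 < d by rewrite !lt_min !divr_gt0//= ?subr_gt0.
have : d <= d by []; rewrite {2}/d !le_min => /and4P[d1 d2 d3 d4].
rewrite ler_pdivlMr// in d1; rewrite ler_pdivlMr// in d2; rewrite ler_pdivlMr// in d3.
pose t' := tp * (1 - d).
have t'p : t' < tp by rewrite /t' gtr_pMr// gtrBl.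
have t'a : ta <= t' by rewrite /t'; lra.
have t'1 : 1 <= t' by rewrite (le_trans (ltW ta1)).
have t'0 : 0 < t' := lt_le_trans ltr01 t'1.
suff gt' : good t'.
  have : tp <= t' by apply: ge_inf => //; exists 1 => ? [].
  by rewrite leNgt t'p.
split=> // r r0; have [rr1|rr1] := leP r r1.
  have hMt : M <= t' ^+ 2 * v x1.
    have -> : t' ^+ 2 * v x1 = (tp ^+ 2 * v x1) - d * (2 * (tp ^+ 2 * v x1)) + d ^+ 2 * (tp ^+ 2 * v x1) by rewrite /t'; ring.
    have : 0 <= d ^+ 2 * (tp ^+ 2 * v x1) by rewrite !mulr_ge0 ?sqr_ge0// ltW.
    by move: d2; rewrite /g; lra.
  have tr : t' * r <= eucl x1.
    apply: (@le_trans _ _ (tp * r1)); last by rewrite /r1 mulrC divfK// gt_eqF.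
    by apply: ler_pM => //; exact: ltW.
  have [a1 a2] := bmass_near0 pu pv hM t'0 x10 hMt r0 tr.
  apply: le_trans a1 _; apply: le_trans _ a2; apply: ler_wpM2r; first by rewrite ltW// area_gt0.
  by rewrite ler_sqr ?nnegrE// (le_trans M0).
have [rR0|rR0] := leP r R0; last first.
  apply: le_trans (bmass_le r du) _; rewrite (bm_dil r t'0 pv).
  apply: (@le_trans _ _ (ta ^+ 2 * bm v S)).
    rewrite mulrC -ler_pdivrMr ?exprn_gt0 ?(lt_trans ltr01)//; apply: le_trans (ltW hS); lra.
  apply: ler_pM; rewrite ?sqr_ge0//; first by apply: bmass_ge0 => x; exact: sqr_ge0.
    by rewrite ler_sqr ?nnegrE ?(ltW t'0)// (ltW (lt_trans ltr01 ta1)).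
  apply: (bmass_mono dv); apply: (@le_trans _ _ r); last by rewrite ler_peMl// ltW.
  by apply: le_trans (ltW rR0); rewrite le_max lexx.
have gp := gap r (ltW rr1) rR0.
have k1 : 1 <= tp / t' by rewrite ler_pdivlMr// mul1r ltW.
have := prof_doubling pv k1 (mulr_gt0 t'0 r0); rewrite mulrA divfK ?gt_eqF// => h2.
rewrite (bm_dil r t'0 pv); move: gp; rewrite (bm_dil r t0 pv) => gp.
set m := bm v (tp * r) in h2 gp *; set m' := bm v (t' * r) in h2 *.
have ml : m <= lam := bmass_le _ dv.
have m0 : 0 <= m by apply: bmass_ge0 => x; exact: sqr_ge0.
have h3 : (1 - d) ^+ 2 * m <= m'.
  have := ler_wpM2l (sqr_ge0 (t' / tp)) h2.
  have -> : (t' / tp) ^+ 2 * ((tp / t') ^+ 2 * m') = m' by field; rewrite !gt_eqF.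
  by rewrite (_ : t' / tp = 1 - d)// /t' mulrC mulKf// gt_eqF.
have h4 : tp ^+ 2 * ((1 - d) ^+ 4 * m) <= t' ^+ 2 * m'.
  have -> : tp ^+ 2 * ((1 - d) ^+ 4 * m) = t' ^+ 2 * ((1 - d) ^+ 2 * m) by rewrite /t'; ring.
  by rewrite ler_wpM2l// sqr_ge0.
apply: le_trans _ h4.
have h5 : 1 - 4 * d <= (1 - d) ^+ 4.
  have -> : (1 - d) ^+ 4 = 1 - 4 * d + d ^+ 2 * ((d - 2) ^+ 2 + 2) by ring.
  by rewrite lerDl mulr_ge0 ?sqr_ge0// addr_ge0// sqr_ge0.
have h6 := ler_wpM2r m0 h5; have h7 := ler_wpM2l (sqr_ge0 tp) h6.
have h8 : d * (4 * tp ^+ 2 * m) <= eta.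
  by apply: le_trans d1; rewrite ler_wpM2l ?(ltW d0)// ler_wpM2l// mulr_ge0// sqr_ge0.
by move: gp h7 h8; clear; lra.
Qed.

End first_contact.

Lemma rmin_prof c e lam u : rmin c e lam u -> prof u lam.
Proof. by move=> [[u0 [s1 [s2 [wx _]]]] ru]; split=> //; exact: WX_dens wx. Qed.

Lemma is_min_Elog c e lam u v s1 s2 t1 t2 : 0 < c -> minprob c e lam ->
  is_min c e lam u s1 s2 -> is_min c e lam v t1 t2 -> Elog u = Elog v.
Proof.
move=> c0 hmin hu hv; have vu := virial (ltW c0) hmin hu; have vv := virial (ltW c0) hmin hv.
have [_ eu] := hu; have [_ ev] := hv.
by apply: (mulfI (lt0r_neq0 c0)); lra.
Qed.

(** At a point of contact the dominated mass grows at least as fast from inside and at most as fast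
    towards outside. Hence the value [k] of [dil t v] on the circle separates inner from outer
    values of both profiles, as the exchange requires. The function with [dil t v] inside and [u]
    outside has mass [lam] and turns out to be a minimiser, with disc masses above those of [u]. *)
Lemma contact_paste c e lam u v (t r0 : R) : 0 < c -> 0 < lam -> minprob c e lam -> rmin c e lam u -> rmin c e lam v ->
  0 < t -> (forall r, 0 < r -> bm u r <= bm (dil t v) r) -> 0 < r0 -> bm u r0 = bm (dil t v) r0 ->
  {ae mu, forall r : R1, 0 < r -> r < r0 -> bm u r = bm (dil t v) r}.
Proof.
move=> c0 lam0 hmin hu hv t0 dom r0p ct.
have pu := rmin_prof hu; have pv := rmin_prof hv; have pf := prof_dil t0 pv.
have [ru u0 du] := pu; have [rf f0 df] := pf; have [rv _ _] := pv.
pose x0 : T2 := (r0, 0).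
have ex0 : eucl x0 = r0 by rewrite /eucl /= expr0n/= addr0 sqrtr_sqr gtr0_norm.
pose k := dil t v x0; have k0 : 0 <= k := f0 x0.
have hin x : 0 < eucl x -> eucl x < r0 -> k <= u x /\ k <= dil t v x.
  move=> xp xr; split; last by apply: rf; rewrite ?ex0 ?ltW.
  have a0 := area_gt0 (ltW xp) xr.
  rewrite -ler_sqr ?nnegrE// -(ler_pM2r a0).
  have l := @prof_lower R _ _ _ _ x0 pf (ltW xp) (ltW xr); rewrite ex0 in l.
  apply: le_trans (l (lexx _)) _; apply: le_trans (prof_upper pu (ltW xr) xp (lexx _)).
  by rewrite ct lerD2l lerN2 dom.
have hout x : r0 < eucl x -> u x <= k /\ dil t v x <= k.
  move=> xr; split; last by apply: rf; rewrite ?ex0// ltW.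
  have a0 := area_gt0 (ltW r0p) xr.
  rewrite -ler_sqr ?nnegrE// -(ler_pM2r a0).
  apply: le_trans (prof_lower pu (ltW r0p) (ltW xr) (lexx _)) _.
  have l := @prof_upper R _ _ r0 (eucl x) x0 pf (ltW xr); rewrite ex0 in l.
  apply: le_trans _ (l r0p (lexx _)).
  by rewrite ct lerD2r dom// (lt_trans r0p xr).
have [[_ [p1 [p2 mu1]]] _] := hu; have [[_ [q1 [q2 mu2]]] _] := hv.
have [wu eu] := mu1; have [wv ev] := mu2.
have wf := WX_scale (t ^+ 2) wv t0; have Ef := Elog_scale (t ^+ 2) wv t0.
rewrite (_ : (t ^+ 2) ^+ 2 / t ^+ 2 * lam = t ^+ 2 * lam) in wf; last by field; rewrite gt_eqF.
have [a1 [a2 [b1 [b2 [wa wb s E]]]]] := paste_energy r0p ru rf hin hout wu wf ct.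
have ea := minprob_scale t0 hmin wa; have eb := hmin _ _ _ wb.
have t4 : 0 < t ^+ 4 by rewrite exprn_gt0.
have ea' : t ^+ 4 * (e - c * ln t * lam ^+ 2) <= a1 + a2 + c * Elog (paste r0 u (dil t v)).
  by rewrite mulrC -ler_pdivlMr//; move: ea; rewrite -/(dil t v); lra.
have EF : Elog (dil t v) = t ^+ 4 * (Elog v - ln t * lam ^+ 2).
  by rewrite /dil Ef; congr (_ * _); field; rewrite gt_eqF.
(* The totals before and after the exchange are compared with the two lower bounds, at mass [lam]
   for one pasted function and at mass [t ^ 2 lam] for the other; since [u] and [dil t v] attain
   them, so does each pasted function. *)
have mb : is_min c e lam (paste r0 (dil t v) u) b1 b2.
  split=> //; apply/eqP; rewrite eq_le eb andbT.
  have Ec : c * Elog (paste r0 u (dil t v)) + c * Elog (paste r0 (dil t v) u) = c * Elog u + c * Elog (dil t v).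
    by rewrite -!mulrDr; congr (_ * _); exact: E.
  move: Ec; rewrite EF => Ec.
  have T2E : t ^+ 2 ^+ 2 = t ^+ 4 by ring.
  rewrite T2E in s; rewrite -ev in ea'.
  by move: s Ec ea' eu; clear; lra.
have EE := is_min_Elog c0 hmin mu1 mb.
have rotp c' s' x : c' ^+ 2 + s' ^+ 2 = 1 -> paste r0 (dil t v) u (plane_rot c' s' x) = paste r0 (dil t v) u x.
  by move=> cs; rewrite /paste eucl_rot// !rdec_rot.
rewrite (Elog_Imax wu) in EE; last by move=> ? ? ?; exact: rdec_rot.
rewrite (Elog_Imax wb rotp) in EE.
have [_ nu _ _ _] := wu; have [_ nb _ _ _] := wb.
have mu_ := rdec_measurable ru; have mf_ := rdec_measurable rf.
have bp r := bmass_paste r df du mf_ mu_ (esym ct).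
have J : Imax (fun x => u x ^+ 2) <= Imax (fun x => paste r0 (dil t v) u x ^+ 2) by rewrite EE.
have dm r : 0 < r -> bm u r <= bm (paste r0 (dil t v) u) r.
  by move=> r_; rewrite bp; case: ifP => // _; exact: dom.
apply: filterS (bmass_eq_of_Imax (WX_logdens wu) (WX_logdens wb) nu nb dm J) => r h r_ rr.
by rewrite h// bp (ltW rr).
Qed.

(** In the case of contact, equal disc masses on arbitrarily small discs are incompatible with
    [bmass_near0]: per unit of area one mass is at most [M ^ 2], the other at least a strictly
    larger number. *)
Lemma rmin_dichotomy c e lam u v M : 0 < c -> 0 < lam -> minprob c e lam -> rmin c e lam u -> rmin c e lam v ->
  (forall x, 0 < eucl x -> u x <= M) ->
  {ae L, forall x, u x = v x} \/ exists2 t, 1 < t & forall x, 0 < eucl x -> t ^+ 2 * v x <= M.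
Proof.
move=> c0 lam0 hmin hu hv hM; have pu := rmin_prof hu; have pv := rmin_prof hv.
pose tp := inf [set t | 1 <= t /\ forall r, 0 < r -> bm u r <= bm (dil t v) r].
have [_ gt] : 1 <= tp /\ forall r, 0 < r -> bm u r <= bm (dil tp v) r := tp_good lam0 pu pv hM.
have := tp_ge1 lam0 pu pv hM; rewrite -/tp le_eqVlt => /orP[/eqP t1|t1]; [left|].
  have dm r : 0 < r -> bm u r <= bm v r.
    by move=> r0; have := gt r r0; rewrite -t1 (bm_dil r ltr01 pv) expr1n !mul1r.
  have [[_ [p1 [p2 mu1]]] ru] := hu; have [[_ [q1 [q2 mu2]]] rv] := hv.
  have EE := is_min_Elog c0 hmin mu1 mu2; have [wu _] := mu1; have [wv _] := mu2.
  rewrite (Elog_Imax wu) in EE; last by move=> ? ? ?; exact: rdec_rot.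
  rewrite (Elog_Imax wv) in EE; last by move=> ? ? ?; exact: rdec_rot.
  have [_ nu _ _ _] := wu; have [_ nv _ _ _] := wv.
  apply: (prof_eq_of_bmass pu pv).
  by apply: bmass_eq_of_Imax (WX_logdens wu) (WX_logdens wv) nu nv dm _; rewrite EE.
right; exists tp => // x1 x10; rewrite leNgt; apply/negP => hx1.
have t0 : 0 < tp := lt_trans ltr01 t1.
have [r0 r0p ct] := first_contact lam0 pu pv hM t1 x10 hx1.
have h := contact_paste c0 lam0 hmin hu hv t0 gt r0p ct.
have m0 : 0 < Num.min r0 (eucl x1 / tp) by rewrite lt_min r0p divr_gt0.
have [r [r_ rm hr]] := ae_itv_ex h m0; move: rm; rewrite lt_min => /andP[rr0 rx].
have tr : tp * r <= eucl x1 by rewrite mulrC -ler_pdivlMr// ltW.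
have [a1 a2] := bmass_near0 pu pv hM t0 x10 (ltW hx1) r_ tr.
have [_ u0 _] := pu; have M0 : 0 <= M by apply: le_trans (u0 x1) (hM _ x10).
have A := area_gt0 (lexx 0) r_.
have := le_trans a2 (le_trans _ a1); rewrite -/(dil tp v) -hr// => /(_ (lexx _)).
by rewrite ler_pM2r// leNgt ltr_sqr ?nnegrE ?hx1// (le_trans M0 (ltW hx1)).
Qed.

(** The dichotomy is applied with the exact supremum [s] of [u]. If it fails to give equality it
    bounds [v] by [s / t ^ 2], and with exchanged roles it bounds [u] by an even smaller number,
    which forces [s = 0]. *)
Lemma rmin_unique c e lam u v M : 0 < c -> 0 < lam -> minprob c e lam -> rmin c e lam u -> rmin c e lam v ->
  (forall x, 0 < eucl x -> u x <= M) -> {ae L, forall x, u x = v x}.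
Proof.
move=> c0 lam0 hmin hu hv hM; have [[u0 _] _] := hu; have [[v0 _] _] := hv.
pose A := [set m | forall x, 0 < eucl x -> u x <= m].
pose x0 : T2 := (1, 0).
have ex0 : 0 < eucl x0 by rewrite /eucl /= expr0n/= addr0 sqrtr_sqr normr1.
have A0 m : A m -> 0 <= m by move=> h; apply: le_trans (u0 x0) (h _ ex0).
have hA : has_inf A by split; [exists M|exists 0 => m /A0].
pose s := inf A.
have hs x : 0 < eucl x -> u x <= s by move=> xp; apply: lb_le_inf; [case: hA|move=> m /(_ _ xp)].
have s0 : 0 <= s := A0 _ hs.
have [//|[t t1 ht]] := rmin_dichotomy c0 lam0 hmin hu hv hs.
have t0 : 0 < t := lt_trans ltr01 t1.
have hv' x : 0 < eucl x -> v x <= s / t ^+ 2 by move=> xp; rewrite ler_pdivlMr ?exprn_gt0// mulrC ht.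
have [h|[t' t'1 ht']] := rmin_dichotomy c0 lam0 hmin hv hu hv'.
  by apply: ae_mono h => x ->.
have t'0 : 0 < t' := lt_trans ltr01 t'1.
have tt : 1 < t ^+ 2 by rewrite expr_gt1// ltW.
have tt' : 1 < t' ^+ 2 by rewrite expr_gt1// ltW.
have ss : s <= s / t ^+ 2.
  apply: ge_inf; first by case: hA.
  move=> x xp; apply: le_trans _ (ht' x xp).
  by rewrite ler_peMl// ltW.
have sz : s = 0.
  by move: ss; rewrite ler_pdivlMr ?exprn_gt0// => h; apply/eqP; rewrite eq_le s0 andbT; nra.
apply: ae_mono (@ae_eucl_gt0 R) => x xp.
have e1 : u x = 0 by apply/eqP; rewrite eq_le u0 andbT -sz hs.
have e2 : v x = 0 by apply/eqP; rewrite eq_le v0 andbT; have := hv' x xp; rewrite sz mul0r.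
by rewrite e1 e2.
Qed.

End uniqueness.

(** * The phase *)

Section phase.
Variable R : realType.
Local Notation mu := (@lebesgue_measure R).
Local Notation L := (@leb2 R).
Local Notation R1 := (measurableTypeR R).
Local Notation T2 := (R1 * R1)%type.
Implicit Types (f g w u : T2 -> R).

(** * Functions whose quotients on a disc are negligible *)

Section disc_constant.
Variables (f : T2 -> R) (rad : R).
Hypotheses (mf0 : measurable_fun setT f) (rad0 : 0 < rad).

Definition both (x y : T2) : R := if (eucl x <= rad) && (eucl y <= rad) then 1 else 0.

(** The squared increment, restricted to pairs with both ends in the disc, so that nothing is
    required of [f] outside it. *)
Definition osc (t : T2) : \bar R := (\int[L]_x (both x (x + t)%R * (f (x + t)%R - f x)%R ^+ 2)%:E)%E.

Lemma measurable_osc t : measurable_fun setT (fun x : T2 => both x (x + t) * (f (x + t) - f x) ^+ 2).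
Proof.
have [ms _] := mpres_shift t; have me := @measurable_eucl R.
have m1 : measurable_fun setT (fun x : T2 => f (x + t)) by exact: (measurableT_comp mf0 ms).
have m2 : measurable_fun setT (fun x : T2 => eucl (x + t) : R) by exact: (measurableT_comp me ms).
by rewrite /both; mf.
Qed.

Lemma both_ge0 x y : 0 <= both x y.
Proof. by rewrite /both; case: ifP. Qed.

Lemma osc_ge0 t : (0 <= osc t)%E.
Proof. by apply: integral_ge0 => x _; rewrite lee_fin mulr_ge0 ?sqr_ge0// both_ge0. Qed.

(** A double step is split at its midpoint, which lies in the disc by convexity. *)
Lemma osc_double t : (osc (t + t)%R <= 4%:E * osc t)%E.
Proof.
pose G (x : T2) : R := both x (x + t) * (f (x + t) - f x) ^+ 2.
have mG : measurable_fun setT G := measurable_osc t.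
have G0 x : 0 <= G x by rewrite mulr_ge0 ?sqr_ge0// both_ge0.
have [ms hs] := mpres_shift t.
have mG2 : measurable_fun setT (fun x : T2 => G (x + t)) by exact: (measurableT_comp mG ms).
have -> : (4%:E * osc t = \int[L]_x (2 * G x + 2 * G (x + t)%R)%:E)%E.
  rewrite ge0_integral_EFinD; [|by mf|by mf|by move=> x; rewrite mulr_ge0|by move=> x; rewrite mulr_ge0].
  rewrite !ge0_integral_EFinZ//.
  have -> : (\int[L]_x (G (x + t)%R)%:E = osc t)%E.
    by apply: (hs (fun x => (G x)%:E)) => [|x]; [mf|rewrite lee_fin].
  have -> : (\int[L]_x (G x)%:E = osc t)%E by [].
  by rewrite -ge0_muleDl ?lee_fin// -EFinD; congr (_%:E * _)%E; ring.
apply: ge0_le_integral => //.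
- by move=> x _; rewrite lee_fin mulr_ge0 ?sqr_ge0// both_ge0.
- by apply/measurable_EFinP; exact: measurable_osc.
- by mf.
move=> x _; rewrite lee_fin /G.
have E : x + t + t = x + (t + t) by rewrite addrA.
rewrite E {1}/both; case: ifP => [/andP[h1 h2]|_]; last first.
  by rewrite mul0r addr_ge0// mulr_ge0// mulr_ge0 ?sqr_ge0// both_ge0.
have h3 : eucl (x + t) <= rad.
  have := eucl_triangle x (x + (t + t)).
  have -> : x + (x + (t + t)) = (2 * (x + t).1, 2 * (x + t).2) by rewrite !addrpE /=; congr (_, _); ring.
  by rewrite eucl_scale//; lra.
rewrite /both h1 h2 h3 /= !mul1r.
have := sqr_ge0 ((f (x + (t + t)) - f (x + t)) - (f (x + t) - f x)); lra.
Qed.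

Hypothesis small : forall d e, 0 < e -> exists2 t, 0 < t & forall h, 0 < h -> h < t ->
  (osc (axv d h) <= (e * h ^+ 2)%:E)%E.

Lemma axvD d (a b : R) : axv d a + axv d b = axv d (a + b).
Proof. by rewrite /axv; case: d; rewrite addrpE /= ?addr0. Qed.

(** Halving [k] times costs [4 ^ k], exactly compensated by the quadratic smallness at step
    [h / 2 ^ k]; the remaining factor is arbitrary. *)
Lemma osc0 d h : 0 < h -> osc (axv d h) = 0%E.
Proof.
move=> h0; apply/eqP; rewrite eq_le osc_ge0 andbT; apply/lee_addgt0Pr => e e0; rewrite add0e.
have h2 : 0 < h ^+ 2 by rewrite exprn_gt0.
have [t t0 ht] := small d (divr_gt0 e0 h2).
have key k : (osc (axv d h) <= (4 ^+ k)%:E * osc (axv d (h / 2 ^+ k)))%E.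
  elim: k => [|k IH]; first by rewrite !expr0 divr1 mul1e.
  apply: le_trans IH _; rewrite exprSr EFinM -muleA lee_wpmul2l ?lee_fin ?exprn_ge0//.
  have -> : axv d (h / 2 ^+ k) = axv d (h / 2 ^+ k.+1) + axv d (h / 2 ^+ k.+1).
    by rewrite axvD; congr axv; rewrite exprS; field; rewrite expf_neq0.
  exact: osc_double.
pose k := (Num.trunc (h / t)).+1.
have hk : h / 2 ^+ k < t.
  rewrite ltr_pdivrMr ?exprn_gt0// mulrC -ltr_pdivrMr//.
  apply: lt_le_trans (Num.Theory.truncnS_gt _) _.
  by rewrite -natrX ler_nat ltnW// ltn_expl.
have hk0 : 0 < h / 2 ^+ k by rewrite divr_gt0// exprn_gt0.
apply: le_trans (key k) _; apply: le_trans (lee_wpmul2l _ (ht _ hk0 hk)) _.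
  by rewrite lee_fin exprn_ge0.
rewrite -EFinM lee_fin.
have -> : (4 : R) ^+ k = 2 ^+ k * 2 ^+ k by rewrite -exprMn; congr (_ ^+ _); ring.
have k2 : (2 : R) ^+ k != 0 by rewrite expf_neq0.
have hn : h != 0 by rewrite gt_eqF.
by rewrite le_eqVlt; apply/orP; left; apply/eqP; field; rewrite ?k2 ?hn.
Qed.

Lemma axis_inv d h : {ae L, forall x, eucl x <= rad -> eucl (x + axv d h) <= rad -> f (x + axv d h) = f x}.
Proof.
have pos k : 0 < k -> {ae L, forall x, eucl x <= rad -> eucl (x + axv d k) <= rad -> f (x + axv d k) = f x}.
  move=> k0; have := osc0 d k0; rewrite /osc => o.
  have mE : measurable_fun setT (fun x : T2 => (both x (x + axv d k) * (f (x + axv d k) - f x) ^+ 2)%:E).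
    by apply/measurable_EFinP; exact: measurable_osc.
  have h0 : (\int[L]_x `|(both x (x + axv d k)%R * (f (x + axv d k)%R - f x)%R ^+ 2)%:E| = 0)%E.
    rewrite -[RHS]o; apply: eq_integral => x _.
    by rewrite gee0_abs// lee_fin mulr_ge0 ?sqr_ge0// both_ge0.
  have /(ae_eq_integral_abs L measurableT mE) := h0.
  apply: ae_mono => x /(_ I) [] /eqP; rewrite mulf_eq0 => /orP[/eqP + h1 h2|].
    by rewrite /both h1 h2/= => /eqP; rewrite oner_eq0.
  by rewrite sqrf_eq0 subr_eq0 => /eqP.
have [h0|h0|->] := ltgtP h 0; [|exact: pos|].
  have hN : 0 < - h by rewrite oppr_gt0.
  have := ae_mpres (mpres_shift (axv d h)) (pos _ hN); apply: ae_mono => x.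
  have -> : x + axv d h + axv d (- h) = x.
    by rewrite -addrA axvD subrr /axv; case: (d); rewrite addr0.
  by move=> + h1 h2 => /(_ h2 h1) ->.
apply: aeW => x _ _; congr f.
by rewrite /axv; case: (d); rewrite addr0.
Qed.

(** The step is made along the axes in one of two orders. The squared norms of the two corners add
    up to those of the two ends, so at least one corner lies in the disc. *)
Lemma disc_inv (t : T2) : {ae L, forall x, eucl x <= rad -> eucl (x + t) <= rad -> f (x + t) = f x}.
Proof.
have E1 x : x + t = x + axv false t.1 + axv true t.2.
  by rewrite /axv !addrpE /= !addr0.
have E2 x : x + t = x + axv true t.2 + axv false t.1.
  by rewrite /axv !addrpE /= !addr0.
have a1 := axis_inv false t.1; have a2 := ae_mpres (mpres_shift (axv false t.1)) (axis_inv true t.2).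
have b1 := axis_inv true t.2; have b2 := ae_mpres (mpres_shift (axv true t.2)) (axis_inv false t.1).
have a := ae_mono2 (fun x p q => conj p q) a1 a2; have b := ae_mono2 (fun x p q => conj p q) b1 b2.
apply: ae_mono2 a b => x [p1 p2] [q1 q2] hx hy.
have [h|h] := leP (eucl (x + axv false t.1)) rad.
  by rewrite E1 p2 ?p1// -E1.
have h' : eucl (x + axv true t.2) <= rad.
  move: hx hy; rewrite !le_eucl ?(ltW rad0)//.
  move: h; rewrite ltNge le_eucl ?(ltW rad0)// -ltNge.
  by rewrite /axv !addrpE /= !addr0; lra.
by rewrite E2 q2 ?q1// -E2.
Qed.

Lemma disc_const : exists C, {ae L, forall x, eucl x <= rad -> f x = C}.
Proof.
pose P (x y : T2) := ((eucl x <= rad) && (eucl y <= rad)) ==> ((f y <= f x) && (f x <= f y)).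
have me := @measurable_eucl R.
have mP : measurable_fun setT (fun z : T2 * T2 => P z.1 z.2).
  rewrite (_ : (fun z => P z.1 z.2) = (fun z : T2 * T2 => ~~ ((eucl z.1 <= rad) && (eucl z.2 <= rad)) || ((f z.2 <= f z.1) && (f z.1 <= f z.2)))).
    by mf.
  by apply/funext => z; rewrite /P implybE.
have h : {ae L, forall x, {ae L, forall y, P x y}}.
  apply: ae_pair => // t; apply: ae_mono (disc_inv t) => x hx.
  by apply/implyP => /andP[h1 h2]; rewrite hx// lexx.
have [x [hx xr]] : exists x, {ae L, forall y, P x y} /\ eucl x <= rad.
  apply: contrapT => N; apply: (@annulus_nonnull R 0 rad (lexx 0) rad0).
  by apply: ae_mono h => x hx /andP[_ xr]; apply: N; exists x; rewrite ltW.
exists (f x); apply: ae_mono hx => y /implyP hy yr.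
by apply/eqP; rewrite eq_le; apply: hy; rewrite xr.
Qed.

End disc_constant.

(** The increment of a planar vector splits into the increment of its length and that of its
    direction. Where a length is 0 the direction is undefined, but the product [U U'] removes the
    term. *)
Lemma modulus_diff (a b a' b' U U' : R) : 0 <= U -> 0 <= U' -> a ^+ 2 + b ^+ 2 = U ^+ 2 -> a' ^+ 2 + b' ^+ 2 = U' ^+ 2 ->
  (a' - a) ^+ 2 + (b' - b) ^+ 2 = (U' - U) ^+ 2 + U * U' * ((a' / U' - a / U) ^+ 2 + (b' / U' - b / U) ^+ 2).
Proof.
move=> U0 U'0 h h'.
have z (p q : R) : p ^+ 2 + q ^+ 2 = 0 -> p = 0 /\ q = 0.
  move=> /eqP; rewrite paddr_eq0 ?sqr_ge0// !sqrf_eq0 => /andP[/eqP -> /eqP ->].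
  by [].
have [e|n] := eqVneq U 0.
  by move: h; rewrite e expr0n/= => /z[-> ->]; rewrite !subr0 mul0r mul0r addr0.
have [e|n'] := eqVneq U' 0.
  by move: h'; rewrite e expr0n/= => /z[-> ->]; rewrite !sub0r !sqrrN mulr0 mul0r addr0.
have -> : U * U' * ((a' / U' - a / U) ^+ 2 + (b' / U' - b / U) ^+ 2) =
  (a' ^+ 2 + b' ^+ 2) * (U / U') + (a ^+ 2 + b ^+ 2) * (U' / U) - 2 * (a * a' + b * b') by field; rewrite n n'.
have -> : (a' - a) ^+ 2 + (b' - b) ^+ 2 = (a' ^+ 2 + b' ^+ 2) + (a ^+ 2 + b ^+ 2) - 2 * (a * a' + b * b') by ring.
by rewrite h h'; field; rewrite n n'.
Qed.

Lemma angle_ex (P Q : R) : P ^+ 2 + Q ^+ 2 = 1 -> exists theta, cos theta = P /\ sin theta = Q.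
Proof.
move=> h; have P1 : -1 <= P <= 1.
  by have q0 := sqr_ge0 Q; apply/andP; split; nra.
have S : sin (acos P) = `|Q|.
  by rewrite sin_acos// -sqrtr_sqr; congr Num.sqrt; lra.
have [q|q] := leP 0 Q.
  by exists (acos P); rewrite acosK ?in_itv//= S ger0_norm.
by exists (- acos P); rewrite cosN sinN acosK ?in_itv//= S ltr0_norm// opprK.
Qed.

(* Since |F| = U and F has no more Dirichlet energy than U, the difference quotients of the
   direction F / U carry no energy. *)
Lemma phase_const (a b U : T2 -> R) s1 s2 t1 t2 p1 p2 : rdec U -> (forall x, 0 <= U x) ->
  L2 L a -> L2 L b -> L2 L U -> {ae L, forall x, a x ^+ 2 + b x ^+ 2 = U x ^+ 2} ->
  is_dir false a s1 -> is_dir true a s2 -> is_dir false b t1 -> is_dir true b t2 ->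
  is_dir false U p1 -> is_dir true U p2 -> s1 + t1 <= p1 -> s2 + t2 <= p2 ->
  forall rad xr, 0 < rad -> eucl xr = rad -> 0 < U xr ->
  exists P Q, {ae L, forall x, eucl x <= rad -> a x = P * U x /\ b x = Q * U x}.
Proof.
move=> rU U0 la lb lU E da1 da2 db1 db2 dU1 dU2 h1 h2 rad xr rad0 xrE Ur.
have [ma _] := la; have [mb _] := lb; have [mU _] := lU; have mi := @measurable_invr R.
have mp : measurable_fun setT (fun x => a x / U x).
  exact: (measurable_funM ma (measurableT_comp mi mU)).
have mq : measurable_fun setT (fun x => b x / U x).
  exact: (measurable_funM mb (measurableT_comp mi mU)).
pose m := U xr.
have Um x : 0 < eucl x -> eucl x <= rad -> m <= U x by move=> x0 xr'; apply: rU => //; rewrite xrE.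
have key d e : 0 < e -> exists2 t, 0 < t & forall h, 0 < h -> h < t ->
    (osc (fun x => a x / U x)%R rad (axv d h) + osc (fun x => b x / U x)%R rad (axv d h) <= (e * h ^+ 2)%:E)%E.
  move=> e0; have m2 : 0 < m ^+ 2 by rewrite exprn_gt0.
  have [sa [sb [p [da db [dU hs]]]]] : exists sa sb p, [/\ is_dir d a sa, is_dir d b sb & is_dir d U p /\ sa + sb <= p].
    by case: d; [exists s2, t2, p2|exists s1, t1, p1].
  have [_ ga _] := da; have [_ gb _] := db; have [_ _ /(_ _ (mulr_gt0 e0 m2)) [t t0 gU]] := dU.
  exists t => // h h0 ht.
  pose W x := U x * U (x + axv d h) * ((a (x + axv d h) / U (x + axv d h) - a x / U x) ^+ 2 +
    (b (x + axv d h) / U (x + axv d h) - b x / U x) ^+ 2).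
  have [ms _] := mpres_shift (axv d h).
  have sh f : measurable_fun setT f -> measurable_fun setT (fun x : T2 => f (x + axv d h)).
    by move=> mf; exact: (measurableT_comp mf ms).
  have s_a := sh _ ma; have s_b := sh _ mb; have s_U := sh _ mU; have s_p := sh _ mp; have s_q := sh _ mq.
  have mW : measurable_fun setT W by rewrite /W; mf.
  have W0 x : 0 <= W x.
    by apply: mulr_ge0; [exact: mulr_ge0|apply: addr_ge0; exact: sqr_ge0].
  have mdU : measurable_fun setT (diffq (axv d h) U) by rewrite /diffq; mf.
  have mda : measurable_fun setT (diffq (axv d h) a) by rewrite /diffq; mf.
  have mdb : measurable_fun setT (diffq (axv d h) b) by rewrite /diffq; mf.
  have EW : (N2 L (diffq (axv d h) a) + N2 L (diffq (axv d h) b) = N2 L (diffq (axv d h) U) + \int[L]_x (W x)%:E)%E.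
    rewrite /N2 -!ge0_integral_EFinD//; try by move=> x; exact: sqr_ge0.
    - apply: ae_eq_integral => //; [by mf|by mf|].
      apply: ae_mono2 E (ae_mpres (mpres_shift (axv d h)) E) => x e1 e2 _.
      by congr (_%:E); rewrite /diffq; exact: modulus_diff.
    - by mf.
    - by mf.
    - by mf.
  (* On the disc both lengths are at least [m], the value of the decreasing [U] on its boundary
     circle. *)
  have LW : ((m ^+ 2)%:E * (osc (fun x => a x / U x)%R rad (axv d h) + osc (fun x => b x / U x)%R rad (axv d h)) <= \int[L]_x (W x)%:E)%E.
    have o1 := measurable_osc rad mp (axv d h); have o2 := measurable_osc rad mq (axv d h).
    have b0 x y := both_ge0 rad x y.
    rewrite /osc -ge0_integral_EFinD//; [|by move=> x; rewrite mulr_ge0 ?sqr_ge0|by move=> x; rewrite mulr_ge0 ?sqr_ge0].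
    rewrite -ge0_integral_EFinZ ?sqr_ge0//; first last.
    - by move=> x; apply: addr_ge0; apply: mulr_ge0; rewrite ?sqr_ge0.
    - by mf.
    apply: ae_ge0_le_integral => //.
    - by move=> x _; rewrite lee_fin; apply: mulr_ge0; rewrite ?sqr_ge0//; apply: addr_ge0; apply: mulr_ge0; rewrite ?sqr_ge0.
    - by mf.
    - by move=> x _; rewrite lee_fin.
    - by mf.
    apply: ae_mono2 (@ae_eucl_gt0 R) (ae_mpres (mpres_shift (axv d h)) (@ae_eucl_gt0 R)) => x x0 y0 _.
    rewrite lee_fin -mulrDr /both; case: ifP => [/andP[xr1 yr1]|_]; last by rewrite mul0r mulr0.
    rewrite mul1r /W; apply: ler_wpM2r; first by apply: addr_ge0; exact: sqr_ge0.
    by rewrite expr2; apply: ler_pM; rewrite ?Um// ltW.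
  (* The quotients of [a] and [b] together are at most [p h ^ 2], those of [U] at least
     [(p - e m ^ 2) h ^ 2] for small [h]; the energy [W] of the direction is confined to the
     difference. *)
  have a1 := ga _ h0; have b1 := gb _ h0; have u1 := gU _ h0 ht.
  have fW : (\int[L]_x (W x)%:E <= (e * m ^+ 2 * h ^+ 2)%:E)%E.
    have l1 : (((p - e * m ^+ 2) * h ^+ 2)%:E + \int[L]_x (W x)%:E <= (sa * h ^+ 2)%:E + (sb * h ^+ 2)%:E)%E.
      by apply: le_trans (leeD a1 b1); rewrite EW leeD2r.
    have := ler_wpM2r (sqr_ge0 h) hs.
    move: l1; case: (\int[L]_x (W x)%:E)%E => [r| |]; rewrite -?EFinD ?lee_fin ?leNye//.
    by clear; lra.
  rewrite -(@lee_pmul2l _ (m ^+ 2)%:E) ?lte_fin//; apply: le_trans LW _; apply: le_trans fW _.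
  by rewrite -EFinM lee_fin [leRHS]mulrCA mulrA.
have [P hP] : exists C, {ae L, forall x, eucl x <= rad -> a x / U x = C}.
  apply: (disc_const mp rad0) => d e e0; have [t t0 ht] := key d e e0; exists t => // h h0 hh.
  by apply: le_trans (ht _ h0 hh); rewrite leeDl// osc_ge0.
have [Q hQ] : exists C, {ae L, forall x, eucl x <= rad -> b x / U x = C}.
  apply: (disc_const mq rad0) => d e e0; have [t t0 ht] := key d e e0; exists t => // h h0 hh.
  by apply: le_trans (ht _ h0 hh); rewrite leeDr// osc_ge0.
exists P, Q; have A := ae_mono2 (fun x p q => conj p q) hP hQ.
apply: ae_mono2 A (@ae_eucl_gt0 R) => x [p q] x0 xr'.
have Ux : U x != 0 by rewrite gt_eqF// (lt_le_trans Ur)// Um.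
by rewrite -p// -q// !divfK.
Qed.

(** Discs on which [U] is positive are nested, so their constant phases agree with the one found on
    a first disc. Where [U] vanishes nothing is to be shown. *)
Lemma phase_global (a b U : T2 -> R) s1 s2 t1 t2 p1 p2 : rdec U -> (forall x, 0 <= U x) ->
  L2 L a -> L2 L b -> L2 L U -> {ae L, forall x, a x ^+ 2 + b x ^+ 2 = U x ^+ 2} ->
  is_dir false a s1 -> is_dir true a s2 -> is_dir false b t1 -> is_dir true b t2 ->
  is_dir false U p1 -> is_dir true U p2 -> s1 + t1 <= p1 -> s2 + t2 <= p2 ->
  exists theta, {ae L, forall x, a x = cos theta * U x /\ b x = sin theta * U x}.
Proof.
move=> rU U0 la lb lU E da1 da2 db1 db2 dU1 dU2 h1 h2.
have loc := phase_const rU U0 la lb lU E da1 da2 db1 db2 dU1 dU2 h1 h2.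
have z (x : T2) : a x ^+ 2 + b x ^+ 2 = U x ^+ 2 -> U x = 0 -> a x = 0 /\ b x = 0.
  move=> + Ux; rewrite Ux expr0n/= => /eqP; rewrite paddr_eq0 ?sqr_ge0// !sqrf_eq0.
  by move=> /andP[/eqP -> /eqP ->].
have [[xr [xr0 Ur]]|N] := pselect (exists x : T2, 0 < eucl x /\ 0 < U x); last first.
  exists 0; apply: ae_mono2 E (@ae_eucl_gt0 R) => x e x0.
  have Ux : U x = 0 by apply/eqP; rewrite eq_le U0 andbT leNgt; apply/negP => Ux; apply: N; exists x.
  by have [-> ->] := z x e Ux; rewrite Ux !mulr0.
have [P [Q hPQ]] := loc _ _ xr0 erefl Ur.
have uniq x (P' Q' : R) : 0 < U x -> a x = P * U x /\ b x = Q * U x -> a x = P' * U x /\ b x = Q' * U x -> P' = P /\ Q' = Q.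
  move=> Ux [-> ->] [e1 e2]; have Un : U x != 0 by rewrite gt_eqF.
  by split; apply: (mulIf Un).
have ex_pt (S : T2 -> Prop) : {ae L, forall x, S x} -> exists x, [/\ 0 < eucl x, eucl x < eucl xr & S x].
  move=> hS; apply: contrapT => N; apply: (@annulus_nonnull R 0 (eucl xr) (lexx 0) xr0).
  by apply: ae_mono hS => x Sx /andP[x1 x2]; apply: N; exists x.
have [theta [ct st]] : exists theta, cos theta = P /\ sin theta = Q.
  apply: angle_ex.
  have [x [x0 xlt [e pq]]] := ex_pt _ (ae_mono2 (fun x p q => conj p q) E hPQ).
  have Ux : 0 < U x := lt_le_trans Ur (rU _ _ x0 (ltW xlt)).
  have [pa pb] := pq (ltW xlt).
  apply: (@mulIf _ (U x ^+ 2)); first by rewrite expf_neq0// gt_eqF.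
  by rewrite mul1r -[RHS]e pa pb; ring.
have all (y : T2) : 0 < eucl y -> 0 < U y -> {ae L, forall x, eucl x <= eucl y -> a x = P * U x /\ b x = Q * U x}.
  move=> y0 Uy; have [yx|xy] := leP (eucl y) (eucl xr).
    by apply: ae_mono hPQ => x hx xy; apply: hx; exact: le_trans yx.
  have [P' [Q' hPQ']] := loc _ _ y0 erefl Uy.
  have [x [x0 xlt [k1 k2]]] := ex_pt _ (ae_mono2 (fun x p q => conj p q) hPQ hPQ').
  have Ux : 0 < U x := lt_le_trans Ur (rU _ _ x0 (ltW xlt)).
  have [eP eQ] := uniq x P' Q' Ux (k1 (ltW xlt)) (k2 (ltW (lt_trans xlt xy))).
  by move: hPQ'; rewrite eP eQ.
exists theta; rewrite ct st.
(* Each disc has its own null set, so only the countably many discs of rational radius are used;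
   [unpickle] enumerates the rationals, with radius 0 as default. *)
pose rd (n : nat) : T2 := (if unpickle n is Some q then ratr (q : rat) else 0, 0).
have cnt : {ae L, forall x, forall n, 0 < eucl (rd n) -> 0 < U (rd n) -> eucl x <= eucl (rd n) ->
    a x = P * U x /\ b x = Q * U x}.
  apply: ae_foralln => n.
  have [r0|r0] := ltP 0 (eucl (rd n)); last by apply: aeW.
  have [u0|u0] := ltP 0 (U (rd n)); last by apply: aeW.
  by apply: ae_mono (all _ r0 u0) => x hx _ _; exact: hx.
(* If [U] is positive up to and including some circle and zero beyond, points of that circle lie in
   no strictly larger admissible disc; that one circle is a null set. *)
have rim : {ae L, forall x, 0 < eucl x -> 0 < U x -> exists y, eucl x < eucl y /\ 0 < U y}.
  have [[x1 [x10 Ux1 hx1]]|N] := pselect (exists x1, [/\ 0 < eucl x1, 0 < U x1 & forall y, eucl x1 < eucl y -> U y <= 0]).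
    apply: ae_mono (ae_eucl_neq (eucl x1)) => x xn x0 Ux.
    exists x1; split=> //; rewrite lt_neqAle xn/= leNgt; apply/negP => /hx1.
    by rewrite leNgt Ux.
  apply: aeW => x x0 Ux; apply: contrapT => h; apply: N; exists x; split=> // y xy.
  by rewrite leNgt; apply/negP => Uy; apply: h; exists y.
have A := ae_mono2 (fun x p q => conj p q) cnt rim.
have B := ae_mono2 (fun x p q => conj p q) E (@ae_eucl_gt0 R).
apply: ae_mono2 A B => x [hc hr] [e x0].
have [Ux|Ux] := leP (U x) 0.
  have Uz : U x = 0 by apply/eqP; rewrite eq_le Ux U0.
  by have [-> ->] := z x e Uz; rewrite Uz !mulr0.
have [y [xy Uy]] := hr x0 Ux.
have [q] := rat_in_itvoo xy; rewrite in_itv/= => /andP[q1 q2].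
have Eq : eucl (rd (pickle q)) = ratr q.
  by rewrite /rd pickleK /eucl /= expr0n/= addr0 sqrtr_sqr ger0_norm// ltW// (lt_trans x0).
have q0 : 0 < eucl (rd (pickle q)) by rewrite Eq (lt_trans x0).
apply: (hc (pickle q) q0); last by rewrite Eq ltW.
by apply: lt_le_trans Uy _; apply: rU => //; rewrite Eq ltW.
Qed.

End phase.

Theorem theorem3p3 (R : realType) (gamma : R) (hgamma : 0 < gamma)
  (lam : R) (hlam : 0 < lam) (ustar : R * R -> R)
  (hX : inX (fun x => ((ustar x)%:C)%C))
  (hsym : sym_decreasing ustar)
  (hN : mass (fun x => ((ustar x)%:C)%C) = lam%:E)
  (hE : energy gamma (fun x => ((ustar x)%:C)%C) = e0 gamma lam)
  (v : R * R -> R[i]) (hvX : inX v) (hvN : mass v = lam%:E)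
  (hvE : energy gamma v = e0 gamma lam) :
  exists (theta : R) (x0 : R * R),
    {ae @leb2 R, forall x, v x = ((cos theta +i* sin theta) * (ustar (x - x0))%:C)%C}.
Proof.
pose c := gamma / (4 * pi).
have c0 : 0 < c by rewrite divr_gt0// mulr_gt0// pi_gt0.
have [s1 [s2 wx]] := WX_of_inX hX hN; have [_ _ Eu] := energy_WX gamma wx.
pose e := s1 + s2 + c * Elog ustar.
(* Real functions are admissible in the complex problem, so the infimum [e0], attained by [ustar],
   bounds their energies. *)
have hmin : minprob c e lam.
  move=> w t1 t2 hw; have [hx hm he] := energy_WX gamma hw.
  rewrite -lee_fin -he -[(e)%:E]Eu hE; apply: ereal_inf_lbound.
  by exists (fun x => ((w x)%:C)%C).
have ru : rdec ustar by move=> x y _; exact: hsym.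
have [lu _ _ _ _] := wx.
have u0 x : 0 <= ustar x.
  have [x0|x0] := leP (eucl x) 0; last exact: rdec_ge0.
  have e10 : eucl ((1, 0) : R * R) = 1 by rewrite /eucl /= expr0n/= addr0 expr1n sqrtr1.
  apply: (@le_trans _ _ (ustar (1, 0))); first by apply: (rdec_ge0 ru lu); rewrite e10.
  by apply: hsym; rewrite e10 (le_trans x0).
have hu : rmin c e lam ustar by split=> //; split=> //; exists s1, s2.
(* The monotonicity hypothesis includes the origin, so [ustar 0] is the finite bound that the
   uniqueness of radial minimisers starts from. *)
have ub x : 0 < eucl x -> ustar x <= ustar 0.
  by move=> x0; apply: hsym; rewrite {1}/eucl /= expr0n addr0 sqrtr0 eucl_ge0.
have [a1 [a2 [b1 [b2 [lR lI ld Ev [da1 da2 db1 db2]]]]]] := energy_complex gamma hvX hvN.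
have [p1 [p2 [ww q1 q2]]] := WX_modulus hvX hvN lR lI da1 da2 db1 db2.
pose w x := Num.sqrt (cabs2 (v x)).
have w2 x : w x ^+ 2 = cabs2 (v x) by rewrite sqr_sqrtr// addr_ge0 ?sqr_ge0.
have Ew : Elog w = Ilog (fun x => cabs2 (v x)) (fun x => cabs2 (v x)).
  by rewrite /Elog; congr Ilog; apply/funext => x; exact: w2.
have ev : a1 + a2 + b1 + b2 + c * Elog w = e.
  by move: Ev; rewrite hvE -hE Eu Ew => -[].
have ew := hmin _ _ _ ww.
have hw : nnmin c e lam w.
  split; first by move=> x; exact: sqrtr_ge0.
  by exists p1, p2; split=> //; move: ev ew; rewrite -/w; lra.
(* The energies of [v] and of its modulus [w] are both [e] with the same logarithmic part, so the
   inequalities [q1] and [q2] in the two directions are equalities. *)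
have P1 : a1 + b1 <= p1 by move: ev ew; rewrite -/w; lra.
have P2 : a2 + b2 <= p2 by move: ev ew; rewrite -/w; lra.
have [u [x0 [hru wu]]] := nnmin_radial c0 hlam hmin hw.
have uu := rmin_unique c0 hlam hmin hu hru ub.
have mu_ := rdec_measurable ru.
have wus : {ae @leb2 R, forall x, w (x + x0) = ustar x}.
  by apply: ae_mono2 wu uu => x -> ->.
have [_ _ dU1 dU2 _] := WX_ae mu_ wus (WX_shift x0 ww).
have [mR _] := lR; have [mI _] := lI; have ms := mpres_shift x0.
have E : {ae @leb2 R, forall x, Rep v (x + x0) ^+ 2 + Imp v (x + x0) ^+ 2 = ustar x ^+ 2}.
  by apply: ae_mono wus => x <-; rewrite w2.
have [theta h] := phase_global ru u0 (L2_mpres ms lR) (L2_mpres ms lI) lu E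
  (is_dir_shift x0 da1 mR) (is_dir_shift x0 da2 mR) (is_dir_shift x0 db1 mI) (is_dir_shift x0 db2 mI)
  dU1 dU2 P1 P2.
exists theta, x0; apply: ae_mono (ae_mpres (mpres_shift (- x0)) h) => x.
rewrite subrK /Rep /Imp => -[h1 h2]; apply/eqP; rewrite eq_complex /= h1 h2.
by rewrite !mulr0 subr0 add0r !eqxx.
Qed.
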